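(* Let $W$ be the dihedral group of type $I_2(m)$, $m\ge5$, and let $\mathbf c:\mathrm{Ref}(W)\to\mathbb C$ be a non-zero $W$-invariant function with $b=\mathbf c(s)$, $a=\mathbf c(t)$. Let $\mathcal F$ be the set of two-dimensional irreducible representations of $W$, and let $\mathcal R=\mathcal F\setminus\{\varphi_1\}$ if $m$ is odd, $\mathcal R=\mathcal F\setminus\{\varphi_1,\varphi_{(m-2)/2}\}$ if $m$ is even. With the convention that $\varepsilon_1,\varepsilon_2$ are ignored when $m$ is odd (in which case $a=b$), the Calogero–Moser $\mathbf c$-families, the $\mathbf c$-rigid representations, and the cuspidal Calogero–Moser $\mathbf c$-families are as follows. 1. If $a,b\ne0$ and $a\neq\pm b$: families $\{1\},\{\varepsilon\},\{\varepsilon_1\},\{\varepsilon_2\},\mathcal F$; rigid: the elements of $\mathcal R$; cuspidal family: $\mathcal F$. 2. If $a=0$ and $b\ne0$: families $\{1,\varepsilon_2\},\{\varepsilon,\varepsilon_1\},\mathcal F$; rigid: the elements of $\mathcal R$; cuspidal family: $\mathcal F$. 3. If $a\ne0$ and $b=0$: families $\{1,\varepsilon_1\},\{\varepsilon,\varepsilon_2\},\mathcal F$; rigid: the elements of $\mathcal R$; cuspidal family: $\mathcal F$. 4. If $a=b\neq0$: families $\{1\},\{\varepsilon\},\{\varepsilon_1,\varepsilon_2\}\cup\mathcal F$; rigid: $\varepsilon_1,\varepsilon_2,\varphi_{|\mathcal F|}$ and the elements of $\mathcal R$; cuspidal family: $\{\varepsilon_1,\varepsilon_2\}\cup\mathcal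 F$. 5. If $a=-b\neq0$: families $\{\varepsilon_1\},\{\varepsilon_2\},\{1,\varepsilon\}\cup\mathcal F$; rigid: $1,\varepsilon,\varphi_1$ and the elements of $\mathcal R$; cuspidal family: $\{1,\varepsilon\}\cup\mathcal F$. In each case the lists are complete.
   Context: $W=\langle s,t\mid s^2=t^2=(st)^m=1\rangle$, $r=st$, $\zeta\in\mathbb C$ a primitive $m$-th root of unity. Irreducible representations: $1$ trivial; $\varepsilon$ with $\varepsilon(s)=\varepsilon(t)=-1$; for $m$ even also $\varepsilon_1$ with $\varepsilon_1(s)=1,\varepsilon_1(t)=-1$ and $\varepsilon_2$ with $\varepsilon_2(s)=-1,\varepsilon_2(t)=1$; and the two-dimensional $\varphi_i$ with $\varphi_i(s)=\begin{pmatrix}0&1\\1&0\end{pmatrix}$, $\varphi_i(t)=\begin{pmatrix}0&\zeta^{-i}\\ \zeta^i&0\end{pmatrix}$, for $1\le i\le(m-1)/2$ ($m$ odd) or $1\le i\le(m-2)/2$ ($m$ even). The reflection representation is $\mathfrak h=\mathbb C^2$ via $\varphi_1$; the reflections are $r^ls$, $0\le l\le m-1$ (one conjugacy class if $m$ is odd, two classes, of $s$ and of $t$, if $m$ is even). For a reflection $\sigma$ let $\alpha_\sigma\in\mathfrak h^*$, $\alpha_\sigma^\vee\in\mathfrak h$ span $\mathrm{Im}(\sigma-1)$ on $\mathfrak h^*$, $\mathfrak h$, with $\alpha_\sigma(\alpha_\sigma^\vee)=2$. For $u\in\mathbb C$ or $u$ an indeterminate, $\mathsf H_{u,\mathbf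 c}(W)$ is the quotient of $T(\mathfrak h\oplus\mathfrak h^* )\rtimes W$ by $[x,x']=[y,y']=0$, $[y,x]=u(y,x)-\sum_\sigma\mathbf c(\sigma)(y,\alpha_\sigma)(\alpha_\sigma^\vee,x)\sigma$ for $x,x'\in\mathfrak h^*$, $y,y'\in\mathfrak h$ (with $(y,x)=x(y)$); $\mathsf H_{\mathbf c}=\mathsf H_{0,\mathbf c}$, with centre $Z_{\mathbf c}(W)$. $\overline{\mathsf H}_{\mathbf c}(W)$ is the quotient of $\mathsf H_{\mathbf c}(W)$ by the ideal generated by the elements with zero constant term of the central subalgebra $\mathbb C[\mathfrak h]^W\otimes\mathbb C[\mathfrak h^*]^W$. For $\lambda\in\mathrm{Irr}\,W$, $L_{\mathbf c}(\lambda)$ is the simple head of $\overline{\mathsf H}_{\mathbf c}(W)\otimes_{\mathbb C[\mathfrak h^*]^{\mathrm{co}W}\rtimes W}\lambda$, where the coinvariant algebra $\mathbb C[\mathfrak h^*]^{\mathrm{co}W}=\mathbb C[\mathfrak h^*]/\langle\mathbb C[\mathfrak h^*]^W_+\rangle$ acts on $\lambda$ through its augmentation. Calogero–Moser $\mathbf c$-families: $\lambda\sim\mu$ iff $L_{\mathbf c}(\lambda),L_{\mathbf c}(\mu)$ lie in the same block of $\overline{\mathsf H}_{\mathbf c}(W)$, equivalently have the same annihilator (a maximal ideal) in $Z_{\mathbf c}(W)$. Poisson bracket on $Z_{\mathbf c}(W)$: $\{z_1,z_2\}=u^{-1}[\hat z_1,\hat z_2]$ mod $u$ for lifts $\hat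 z_i$ to $\mathsf H_{u,\mathbf c}(W)$, $u$ an indeterminate. A family is *cuspidal* if its point of $\mathrm{Spec}\,Z_{\mathbf c}(W)$ is a zero-dimensional symplectic leaf, i.e. the corresponding maximal ideal is a Poisson ideal. $\lambda$ is *$\mathbf c$-rigid* if $L_{\mathbf c}(\lambda)$ is irreducible as a $W$-module.
   Formalization: In cases 2 and 3 the labels ε₁ and ε₂ are exchanged: for a=0 the families are {1,ε₁},{ε,ε₂},F and for b=0 they are {1,ε₂},{ε,ε₁},F. With b=c(s), a=c(t), ε₁(s)=1 the printed lists are false for even m, since the central Euler element separates 1 from the printed partner. *)

(* Defs.v *)
From HB Require Import structures.
From mathcomp Require Import all_boot all_order all_algebra.
From mathcomp Require Import all_fingroup all_solvable all_character.
From mathcomp Require Import boolp classical_sets reals.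
From mathcomp Require Import complex.
From mathcomp Require Import -(notations) monalg.
From mathcomp Require Import generic_quotient mpoly.

Set Implicit Arguments.
Unset Strict Implicit.
Unset Printing Implicit Defensive.

Import GRing.Theory.

(* gT = < s, t | s^2 = t^2 = (st)^m = 1 > *)
Definition dihedral_presentation (m : nat) (gT : finGroupType) (s t : gT) :=
  ([/\ s ^+ 2 = 1, t ^+ 2 = 1, (s * t) ^+ m = 1, <<[set s; t]>> = [set: gT] &
      [set: gT] \isog Grp (x : y : x ^+ 2, y ^+ 2, (x * y) ^+ m)])%g.

Definition dihedral_refl (m : nat) (gT : finGroupType) (s t : gT) : {set gT} :=
  [set ((s * t) ^+ l * s)%g | l : 'I_m].

Local Open Scope classical_set_scope.
Local Open Scope quotient_scope.
Local Open Scope ring_scope.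

(* A / (S), for S a subset of a ring A; (S) is the two-sided ideal
   generated by S. *)
Section RingQuotient.
Variables (A : pzRingType) (S : set A).

Definition two_sided_ideal (I : set A) :=
  [/\ I 0, forall x y, I x -> I y -> I (x - y),
      forall a x, I x -> I (a * x) & forall x a, I x -> I (x * a)].

Definition ideal_gen : set A :=
  [set x | forall I, two_sided_ideal I -> S `<=` I -> I x].

Definition ideal_mem : {pred A} := fun x => `[< ideal_gen x >].

Lemma ideal_gen_two_sided : two_sided_ideal ideal_gen.
Proof.
split=> [I [] // |x y Ix Iy I|a x Ix I|x a Ix I] idI SI;
  by case: (idI) => I0 IB IMl IMr; do [exact: IB (Ix _ idI SI) (Iy _ idI SI)
    | exact: IMl (Ix _ idI SI) | exact: IMr (Ix _ idI SI)].
Qed.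

Lemma ideal_mem_zmod : zmod_closed ideal_mem.
Proof.
have [I0 IB _ _] := ideal_gen_two_sided.
by split=> [|x y /asboolP Ix /asboolP Iy]; apply/asboolP; [|exact: IB].
Qed.
HB.instance Definition _ := GRing.isZmodClosed.Build A ideal_mem ideal_mem_zmod.

Definition ring_quot := Quotient.quot ideal_mem.
HB.instance Definition _ := GRing.Zmodule.on ring_quot.
HB.instance Definition _ := EqQuotient.on ring_quot.

Lemma ring_quotE (x y : A) :
  (\pi_ring_quot x = \pi_ring_quot y) <-> ideal_gen (x - y).
Proof.
split=> [/eqP|Ixy].
  by rewrite -[_ == _]/(x == y %[mod Quotient.quot ideal_mem])
             -Quotient.idealrBE => /asboolP.
by apply/eqP; rewrite -[_ == _]/(x == y %[mod Quotient.quot ideal_mem])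
             -Quotient.idealrBE; apply/asboolP.
Qed.

Definition rq_one : ring_quot := \pi_ring_quot 1.
Definition rq_mul (x y : ring_quot) : ring_quot := \pi_ring_quot (repr x * repr y).

Lemma rq_piM (x y : A) : \pi_ring_quot (x * y) = rq_mul (\pi_ring_quot x) (\pi_ring_quot y).
Proof.
have [_ IB IMl IMr] := ideal_gen_two_sided; apply/ring_quotE.
have Ix : ideal_gen (x - repr (\pi_ring_quot x)) by apply/ring_quotE; rewrite reprK.
have Iy : ideal_gen (y - repr (\pi_ring_quot y)) by apply/ring_quotE; rewrite reprK.
set x' := repr _ in Ix *; set y' := repr _ in Iy *.
have -> : x * y - x' * y' = (x - x') * y - x' * (y' - y).
  by rewrite mulrBl mulrBr opprB addrA subrK.
by apply: IB; [exact: IMr | rewrite -opprB mulrN -mulNr; exact: IMl].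
Qed.

Lemma rq_piD (x y : A) : \pi_ring_quot (x + y) = \pi_ring_quot x + \pi_ring_quot y.
Proof. exact: Quotient.pi_add. Qed.

Let rqP (x : ring_quot) : exists a, x = \pi_ring_quot a.
Proof. by exists (repr x); rewrite reprK. Qed.

Lemma rq_mulA : associative rq_mul.
Proof.
move=> x y z; have [[[a ->] [b ->]] [d ->]] := (rqP x, rqP y, rqP z).
by rewrite -!rq_piM mulrA.
Qed.
Lemma rq_mul1 : left_id rq_one rq_mul.
Proof. by move=> x; have [a ->] := rqP x; rewrite -rq_piM mul1r. Qed.
Lemma rq_mulr1 : right_id rq_one rq_mul.
Proof. by move=> x; have [a ->] := rqP x; rewrite -rq_piM mulr1. Qed.
Lemma rq_mulDl : left_distributive rq_mul +%R.
Proof.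
move=> x y z; have [[[a ->] [b ->]] [d ->]] := (rqP x, rqP y, rqP z).
by rewrite -rq_piD -!rq_piM -rq_piD mulrDl.
Qed.
Lemma rq_mulDr : right_distributive rq_mul +%R.
Proof.
move=> x y z; have [[[a ->] [b ->]] [d ->]] := (rqP x, rqP y, rqP z).
by rewrite -rq_piD -!rq_piM -rq_piD mulrDr.
Qed.

HB.instance Definition _ := GRing.Zmodule_isPzRing.Build ring_quot
  rq_mulA rq_mul1 rq_mulr1 rq_mulDl rq_mulDr.

Definition rq_pi (a : A) : ring_quot := \pi_ring_quot a.

Lemma rq_pi_zmod : zmod_morphism rq_pi.
Proof.
by move=> x y; rewrite /rq_pi rq_piD; congr (_ + _); exact: Quotient.pi_opp.
Qed.
Lemma rq_pi_monoid : monoid_morphism rq_pi.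
Proof. by split=> // x y; exact: rq_piM. Qed.
HB.instance Definition _ := GRing.isZmodMorphism.Build A ring_quot rq_pi rq_pi_zmod.
HB.instance Definition _ :=
  GRing.isMonoidMorphism.Build A ring_quot rq_pi rq_pi_monoid.

End RingQuotient.

(* M / <S>, for S a subset of a left A-module M; <S> is the submodule
   generated by S. *)
Section ModuleQuotient.
Variables (A : pzRingType) (M : lmodType A).

Definition is_submodule (N : set M) :=
  N 0 /\ forall a x y, N x -> N y -> N (a *: x + y).

Definition maximal_submodule (N : set M) :=
  [/\ is_submodule N, N <> setT &
      forall N', is_submodule N' -> N `<=` N' -> N' = N \/ N' = setT].

Definition radical : set M :=
  [set x | forall N, maximal_submodule N -> N x].

Variable S : set M.

Definition submod_gen : set M :=
  [set x | forall N, is_submodule N -> S `<=` N -> N x].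

Definition submod_mem : {pred M} := fun x => `[< submod_gen x >].

Lemma submod_gen_submodule : is_submodule submod_gen.
Proof.
split=> [N [] // | a x y Nx Ny N idN SN].
by case: (idN) => _ ND; apply: ND; [exact: Nx | exact: Ny].
Qed.

Lemma submod_mem_zmod : zmod_closed submod_mem.
Proof.
have [N0 ND] := submod_gen_submodule.
split=> [|x y /asboolP Nx /asboolP Ny]; apply/asboolP => //.
by rewrite addrC -scaleN1r; exact: ND.
Qed.
HB.instance Definition _ := GRing.isZmodClosed.Build M submod_mem submod_mem_zmod.

Definition mod_quot := Quotient.quot submod_mem.
HB.instance Definition _ := GRing.Zmodule.on mod_quot.
HB.instance Definition _ := EqQuotient.on mod_quot.

Lemma mod_quotE (x y : M) :
  (\pi_mod_quot x = \pi_mod_quot y) <-> submod_gen (x - y).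
Proof.
split=> [/eqP|Nxy].
  by rewrite -[_ == _]/(x == y %[mod Quotient.quot submod_mem])
             -Quotient.idealrBE => /asboolP.
by apply/eqP; rewrite -[_ == _]/(x == y %[mod Quotient.quot submod_mem])
             -Quotient.idealrBE; apply/asboolP.
Qed.

Definition mq_scale (a : A) (x : mod_quot) : mod_quot := \pi_mod_quot (a *: repr x).

Lemma mq_piZ a (x : M) : \pi_mod_quot (a *: x) = mq_scale a (\pi_mod_quot x).
Proof.
have [N0 ND] := submod_gen_submodule; apply/mod_quotE.
rewrite -scalerBr -[_ *: _]addr0; apply: ND => //.
by apply/mod_quotE; rewrite reprK.
Qed.

Lemma mq_piD (x y : M) : \pi_mod_quot (x + y) = \pi_mod_quot x + \pi_mod_quot y.
Proof. exact: Quotient.pi_add. Qed.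

Let mqP (x : mod_quot) : exists v, x = \pi_mod_quot v.
Proof. by exists (repr x); rewrite reprK. Qed.

Lemma mq_scaleA a b v : mq_scale a (mq_scale b v) = mq_scale (a * b) v.
Proof. by have [x ->] := mqP v; rewrite -!mq_piZ scalerA. Qed.
Lemma mq_scale1 : left_id 1 mq_scale.
Proof. by move=> v; have [x ->] := mqP v; rewrite -mq_piZ scale1r. Qed.
Lemma mq_scaleDr : right_distributive mq_scale +%R.
Proof.
move=> a v w; have [[x ->] [y ->]] := (mqP v, mqP w).
by rewrite -mq_piD -!mq_piZ -mq_piD scalerDr.
Qed.
Lemma mq_scaleDl v : {morph mq_scale^~ v : a b / a + b}.
Proof.
by move=> a b; have [x ->] := mqP v; rewrite -!mq_piZ -mq_piD scalerDl.
Qed.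

HB.instance Definition _ := GRing.Zmodule_isLmodule.Build A mod_quot
  mq_scaleA mq_scale1 mq_scaleDr mq_scaleDl.

End ModuleQuotient.

Definition mod_head (A : pzRingType) (M : lmodType A) : lmodType A :=
  mod_quot (@radical A M).

Section Blocks.
Variable A : pzRingType.

Definition ring_center : set A := [set z | forall a, z * a = a * z].

Definition central_idempotent (e : A) := ring_center e /\ e * e = e.

Definition block_idempotent (e : A) :=
  [/\ central_idempotent e, e <> 0 &
      forall f, central_idempotent f -> e * f = f -> f = 0 \/ f = e].

Definition in_block (e : A) (L : lmodType A) := forall v : L, e *: v = v.

Definition same_block (L L' : lmodType A) :=
  exists e, [/\ block_idempotent e, in_block e L & in_block e L'].

End Blocks.

(* The reflection representation hrep acts on column vectors:
   w . y_j = \sum_i (hrep w)_ij y_i in h, and dually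
   w . x_j = \sum_i (hrep w^-1)_ji x_i in h^*, with x_j(y_i) = (i == j).
   root_vec gives the coordinates of alpha in the basis (x_j), coroot_vec those of
   alpha^vee in the basis (y_i). *)
Record cherednik_data (C : fieldType) (gT : finGroupType) := CherednikData {
  hrep : gT -> 'M[C]_2;
  refl : {set gT};
  root_vec : gT -> 'rV[C]_2;
  coroot_vec : gT -> 'cV[C]_2;
  param : gT -> C
}.

Section RootData.
Variables (C : fieldType) (gT : finGroupType) (D : cherednik_data C gT).

Definition root_data :=
  forall w : gT, w \in refl D ->
  [/\ (root_vec D w == hrep D w^-1 - 1%:M)%MS,
      ((coroot_vec D w)^T == (hrep D w - 1%:M)^T)%MS &
      root_vec D w *m coroot_vec D w = 2%:R%:M].

Definition invariant_param :=
  forall w r : gT, r \in refl D -> param D (r ^ w)%g = param D r.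

Definition nonzero_param := exists2 r : gT, r \in refl D & param D r <> 0.

End RootData.

(* H_{u,c} over a C-algebra K containing u: K = C for u in C, and K = C[u]
   for u an indeterminate. The smash product of T(h + h^* ) with W is presented
   by the generators x_i, y_i and w in W. *)
Section Cherednik.
Variables (C : fieldType) (gT : finGroupType) (D : cherednik_data C gT).
Variables (K : comNzRingType) (iota : {rmorphism C -> K}) (u : K).

Definition generator : choiceType := ('I_2 + 'I_2 + gT)%type.
Definition free_algebra : lalgType K := malg (fmonom generator) K.

Definition scal (k : K) : free_algebra := k%:A.
Definition free_gen (g : generator) : free_algebra := mkmalgU (fmu g) 1.
Definition gx (i : 'I_2) := free_gen (inl (inl i)).
Definition gy (i : 'I_2) := free_gen (inl (inr i)).
Definition gw (w : gT) := free_gen (inr w).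

Definition ring_commutator (A : pzRingType) (a b : A) := a * b - b * a.

Inductive smash_rel : set free_algebra :=
| Rel_one : smash_rel (gw 1%g - 1)
| Rel_mul w w' : smash_rel (gw (w * w')%g - gw w * gw w')
| Rel_actx w j : smash_rel
    (gw w * gx j - (\sum_i iota (hrep D w^-1 j i) *: gx i) * gw w)
| Rel_acty w j : smash_rel
    (gw w * gy j - (\sum_i iota (hrep D w i j) *: gy i) * gw w).

Inductive commutation_rel : set free_algebra :=
| Rel_xx i j : commutation_rel (ring_commutator (gx i) (gx j))
| Rel_yy i j : commutation_rel (ring_commutator (gy i) (gy j))
| Rel_yx i j : commutation_rel
    (ring_commutator (gy i) (gx j) -
      (scal (u * (i == j)%:R) -
       \sum_(w in refl D)
         iota (param D w * root_vec D w 0 i * coroot_vec D w j 0) *: gw w)).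

Definition cherednik : pzRingType :=
  ring_quot (smash_rel `|` commutation_rel).

Definition cherednik_pi : free_algebra -> cherednik := @rq_pi _ _.

Definition gpoly (g : 'I_2 -> free_algebra) (p : {mpoly C[2]}) : free_algebra :=
  mmap (fun k => scal (iota k)) g p.

End Cherednik.

Section RestrictedCherednik.
Variables (C : fieldType) (gT : finGroupType) (D : cherednik_data C gT).

(* H_c = H_{0,c} *)
Definition Hc : pzRingType := cherednik D (idfun : {rmorphism C -> C}) 0.
Definition Hc_pi : free_algebra gT C -> Hc := @cherednik_pi _ _ D _ idfun 0.

(* p(x_0, x_1) and q(y_0, y_1) in H_c *)
Definition xpoly (p : {mpoly C[2]}) : Hc := Hc_pi (gpoly idfun (@gx gT C) p).
Definition ypoly (q : {mpoly C[2]}) : Hc := Hc_pi (gpoly idfun (@gy gT C) q).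

Definition x_invariant (p : {mpoly C[2]}) := forall w : gT,
  p \mPo [tuple \sum_i hrep D w^-1 j i *: 'X_i | j < 2] = p.
Definition y_invariant (q : {mpoly C[2]}) := forall w : gT,
  q \mPo [tuple \sum_i hrep D w i j *: 'X_i | j < 2] = q.

Definition const_term (p : {mpoly C[2]}) : C := p@_0%MM.

(* The elements with zero constant term of C[h]^W (x) C[h^* ]^W. *)
Definition invariants_plus : set Hc :=
  [set h | exists s : seq ({mpoly C[2]} * {mpoly C[2]}),
     [/\ forall pq, pq \in s -> x_invariant pq.1 /\ y_invariant pq.2,
         \sum_(pq <- s) const_term pq.1 * const_term pq.2 = 0 &
         h = \sum_(pq <- s) xpoly pq.1 * ypoly pq.2]].

Definition Hbar : pzRingType := ring_quot invariants_plus.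
Definition Hbar_pi : Hc -> Hbar := @rq_pi _ _.
Definition Hbar_scal (k : C) : Hbar := Hbar_pi (Hc_pi (scal gT k)).
Definition Hbar_w (w : gT) : Hbar := Hbar_pi (Hc_pi (gw C w)).
Definition Hbar_y (q : {mpoly C[2]}) : Hbar := Hbar_pi (ypoly q).

Section Standard.
Variables (d : nat) (lam : gT -> 'M[C]_d).

(* a (x) v in Hbar (x)_C C^d *)
Definition tens (a : Hbar) (v : 'cV[C]_d) : 'rV[Hbar]_d :=
  \row_i (a * Hbar_scal (v i 0)).

(* C[h^* ]^coW ><| W is spanned by the q w, with q a polynomial in y_0, y_1
   and w in W. *)
Inductive balanced_rel : set 'rV[Hbar]_d :=
| Bal_w a w v : balanced_rel (tens (a * Hbar_w w) v - tens a (lam w *m v))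
| Bal_y a q v :
    balanced_rel (tens (a * Hbar_y q) v - tens a (const_term q *: v)).

Definition baby_verma : lmodType Hbar := mod_quot balanced_rel.

Definition simple_L : lmodType Hbar := mod_head baby_verma.

Definition rigid :=
  (exists v : simple_L, v <> 0) /\
  forall N : set simple_L,
    [/\ N 0, forall v v', N v -> N v' -> N (v + v'),
        forall k v, N v -> N (Hbar_scal k *: v) &
        forall w v, N v -> N (Hbar_w w *: v)] ->
    N = [set 0] \/ N = setT.

Definition annihilator : set Hc :=
  [set z | ring_center z /\ forall v : simple_L, Hbar_pi z *: v = 0].

End Standard.

(* H_{u,c} with u an indeterminate *)
Definition Hu : pzRingType :=
  cherednik D (polyC : {rmorphism C -> {poly C}}) 'X.
Definition Hu_pi : free_algebra gT {poly C} -> Hu :=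
  @cherednik_pi _ _ D _ polyC 'X.

Definition eval_u0 (f : free_algebra gT {poly C}) : free_algebra gT C :=
  monalg.mmap (fun k : {poly C} => scal gT k.[0]) (fun m => mkmalgU m 1) f.

(* The graph of the specialisation H_{u,c} -> H_c at u = 0. *)
Definition lifts (zh : Hu) (z : Hc) :=
  exists2 f, zh = Hu_pi f & z = Hc_pi (eval_u0 f).

(* z = {z1, z2} *)
Definition poisson_bracket (z1 z2 z : Hc) :=
  exists h1 h2 h, [/\ lifts h1 z1, lifts h2 z2, lifts h z &
    ring_commutator h1 h2 = Hu_pi (scal gT 'X) * h].

Definition poisson_ideal (I : set Hc) :=
  [/\ I `<=` @ring_center Hc, I 0, forall z z', I z -> I z' -> I (z - z'),
      forall z z', ring_center z -> I z' -> I (z * z') &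
      forall z1 z2 z, I z1 -> ring_center z2 -> poisson_bracket z1 z2 z -> I z].

End RestrictedCherednik.

Inductive irr_label := Triv | Sgn | Eps1 | Eps2 | Phi of nat.

Definition irr_deg (l : irr_label) : nat := if l is Phi _ then 2 else 1.

Section IrrMatrices.
Variables (C : fieldType) (zeta : C).

Definition antidiag (p q : C) : 'M[C]_2 :=
  \matrix_(i, j) (if i == j then 0 else if i == 0 then p else q).

Definition irr_s (l : irr_label) : 'M[C]_(irr_deg l) :=
  match l with
  | Triv | Eps1 => 1%:M
  | Sgn | Eps2 => (-1)%:M
  | Phi i => antidiag 1 1
  end.

Definition irr_t (l : irr_label) : 'M[C]_(irr_deg l) :=
  match l with
  | Triv | Eps2 => 1%:M
  | Sgn | Eps1 => (-1)%:M
  | Phi i => antidiag (zeta ^- i) (zeta ^+ i)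
  end.

End IrrMatrices.

(* The number of two-dimensional irreducible representations. *)
Definition nPhi (m : nat) : nat := if odd m then (m - 1)./2 else (m - 2)./2.

Definition Irr (m : nat) : set irr_label :=
  [set l | match l with
           | Triv | Sgn => True
           | Eps1 | Eps2 => ~~ odd m
           | Phi i => (1 <= i <= nPhi m)%N
           end].

Definition Fset (m : nat) : set irr_label :=
  [set Phi i | i in [set i | (1 <= i <= nPhi m)%N]].

Definition Rset (m : nat) : set irr_label :=
  if odd m then Fset m `\ Phi 1
  else Fset m `\` [set Phi 1; Phi ((m - 2)./2)].

Section Families.
Variables (C : fieldType) (gT : finGroupType) (D : cherednik_data C gT).
Variables (m : nat)
  (V : forall l, mx_representation C [set: gT]%SET (irr_deg l)).

Definition cm_equiv (l l' : irr_label) :=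
  same_block (simple_L D (V l)) (simple_L D (V l')).

Definition cm_families : set (set irr_label) :=
  [set [set l' | Irr m l' /\ cm_equiv l l'] | l in Irr m].

Definition rigid_irr : set irr_label :=
  [set l | Irr m l /\ rigid D (V l)].

Definition cuspidal_families : set (set irr_label) :=
  [set X | cm_families X /\
     exists2 I : set (Hc D), (forall l, X l -> annihilator (D := D) (V l) = I) &
                             poisson_ideal I].

(* The representations in a list, ignoring Eps1 and Eps2 when m is odd. *)
Definition listed (X : set irr_label) : set irr_label := X `&` Irr m.

Definition families_are (Fs : set (set irr_label)) (Rs : set irr_label)
    (Cs : set (set irr_label)) :=
  [/\ cm_families = [set listed X | X in Fs],
      rigid_irr = listed Rs &
      cuspidal_families = [set listed X | X in Cs]].

End Families.

(* Main.v *)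
(** The central element eu = x_0 y_0 + x_1 y_1 - sum_sigma c(sigma) sigma acts
    on L(lambda) by a scalar, 0, +-S(1) or +-S(-1) with
    S(z) = sum_l c(r^l s) z^l, so it separates the families claimed to be
    distinct. Conversely, singular vectors in the baby Verma modules (in degrees
    1 and m/2) link all labels with the same scalar, and lambda is rigid iff all
    [y_i, x_j] kill it.

    In H_{u,c} one has [y_0 y_1, x_0 x_1] = u (x_0 y_0 + y_1 x_1), that is
    {y_0 y_1, x_0 x_1} = eu; as y_0 y_1 kills every L(lambda), a cuspidal family
    has eu = 0. If eu = 0, the family contains a label whose simple module L is
    small: L(1) = C if S(1) = 0, and otherwise L(phi_1), spanned by six
    vectors. For z_2 central, {-, z_2} extends to a derivation d of H_c, which
    makes L x L a self-extension of L. A lift of the highest weight space of L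
    to this extension is again killed by the y_i, and it generates a complement
    on which z_1 acts by zero whenever z_1 annihilates the family; hence
    d(z_1) = {z_1, z_2} kills L. *)

Require Import Defs.
From HB Require Import structures.
From mathcomp Require Import all_boot all_order all_algebra.
From mathcomp Require Import all_fingroup all_solvable all_character.
From mathcomp Require Import boolp classical_sets functions reals.
From mathcomp Require Import complex.
From mathcomp Require Import finmap.
From mathcomp Require Import -(notations) monalg.
From mathcomp Require Import generic_quotient mpoly.
From mathcomp Require Import ring zify.

Set Implicit Arguments.
Unset Strict Implicit.
Unset Printing Implicit Defensive.

Import Order.TTheory GRing.Theory Num.Theory.
Local Open Scope classical_set_scope.
Local Open Scope quotient_scope.
Local Open Scope ring_scope.

(** The algebras are quotients of a free algebra by generated ideals, so the obstacle is to prove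
    that anything is non-zero: that a singular vector of a baby Verma module does not vanish, or
    that u is not a zero divisor in H_{u,c}. Both facts come from one explicit right action on
    functionals on C[x_0, x_1] (x) M, which takes the place of the PBW theorem; no dimension is
    computed. Block theory is likewise replaced by central characters. A central element acting by
    zero on all L(lambda) is nilpotent, since words of length m + 1 in the y_i vanish and a singular
    vector is a sum of images of tops of baby Verma modules; polynomials in eu therefore lift to
    central idempotents. Relations are computed on eigenvectors of r = st: there [y_i, x_j] acts as
    a value of S times s, up to sign, and S(z) = 0 for every m-th root of unity z with z^2 != 1. The
    bound m >= 5 enters through phi_2 and S(zeta^-2) = 0: they cut L(phi_1) down to the weights
    zeta, zeta^-1, 1, and the absence of zeta^2 and zeta^-2 controls the lifts to a
    self-extension. *)

Lemma ord2E (i : 'I_2) : i = 0 \/ i = 1.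
Proof. by case: i => [[|[|]] // Hi]; [left|right]; apply: val_inj. Qed.

Lemma I2_case (P : 'I_2 -> Prop) : P 0 -> P 1 -> forall i, P i.
Proof. by move=> P0 P1 i; case: (ord2E i) => ->. Qed.

Lemma sum_I2 (V : nmodType) (F : 'I_2 -> V) : \sum_i F i = F 0 + F 1.
Proof. by rewrite big_ord_recl big_ord1; congr (_ + F _); apply: val_inj. Qed.

Lemma antidiag00 (C : fieldType) (p q : C) : antidiag p q 0 0 = 0.
Proof. by rewrite mxE. Qed.
Lemma antidiag11 (C : fieldType) (p q : C) : antidiag p q 1 1 = 0.
Proof. by rewrite mxE. Qed.
Lemma antidiag01 (C : fieldType) (p q : C) : antidiag p q 0 1 = p.
Proof. by rewrite mxE. Qed.
Lemma antidiag10 (C : fieldType) (p q : C) : antidiag p q 1 0 = q.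
Proof. by rewrite mxE. Qed.
Definition antidiagE := (antidiag00, antidiag11, antidiag01, antidiag10).

(** * The dihedral group *)

(* The root data enter only through the products alpha_i alphav_j, which are the
   entries of 1 - hrep: this is what coroot_root records. *)
Record dihedral_setup (C : numFieldType) (m : nat) (gT : finGroupType) (s t : gT)
    (zeta : C) (D : cherednik_data C gT) : Prop := DihedralSetup {
  m_ge5 : (5 <= m)%N;
  zeta_prim : m.-primitive_root zeta;
  hrep1 : hrep D 1%g = 1%:M;
  hrepM : forall g g', hrep D (g * g')%g = hrep D g *m hrep D g';
  hrep_s : hrep D s = antidiag 1 1;
  hrep_t : hrep D t = antidiag zeta^-1 zeta;
  ss1 : (s * s = 1)%g;
  tt1 : (t * t = 1)%g;
  stm : ((s * t) ^+ m = 1)%g;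
  st_gen : <<[set s; t]%SET>>%g = [set: gT]%SET;
  refl_setE : refl D = dihedral_refl m s t;
  coroot_root : forall w, w \in refl D -> forall i j,
    root_vec D w 0 i * coroot_vec D w j 0 = (i == j)%:R - hrep D w j i;
  paramJ : invariant_param D }.

Section Dihedral.
Variables (C : numFieldType) (m : nat) (gT : finGroupType) (s t : gT) (zeta : C).
Variable D : cherednik_data C gT.
Hypothesis DP : dihedral_setup m s t zeta D.

Let r := (s * t)%g.
Let h := hrep D.

Lemma m_gt0 : (0 < m)%N.
Proof. exact: leq_trans (m_ge5 DP). Qed.

Lemma zetam : zeta ^+ m = 1.
Proof. exact: prim_expr_order (zeta_prim DP). Qed.

Lemma zeta_neq0 : zeta != 0.
Proof.
by apply/eqP => z0; have := zetam; rewrite z0 expr0n; case: m m_gt0 => // n _ /eqP;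
  rewrite eq_sym oner_eq0.
Qed.

Lemma hrep_r : h r = \matrix_(i, j) (if i == j then if i == 0 then zeta else zeta^-1 else 0).
Proof.
rewrite /h /r (hrepM DP) (hrep_s DP) (hrep_t DP).
by apply/matrixP => i j; rewrite mxE sum_I2; elim/I2_case: i; elim/I2_case: j;
  rewrite !antidiagE !mxE /=; ring.
Qed.

Lemma hrep_rX l :
  h (r ^+ l)%g = \matrix_(i, j) (if i == j then if i == 0 then zeta ^+ l else zeta ^- l else 0).
Proof.
elim: l => [|l IH].
  by rewrite expg0 /h (hrep1 DP); apply/matrixP => i j; elim/I2_case: i; elim/I2_case: j;
    rewrite !mxE /= ?expr0 ?invr1.
rewrite expgS /h (hrepM DP) -/(h r) hrep_r -/(h _) IH.
by apply/matrixP => i j; rewrite mxE sum_I2; elim/I2_case: i; elim/I2_case: j;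
  rewrite !mxE /= ?exprS ?invfM; ring.
Qed.

Lemma hrep_rXs l : h (r ^+ l * s)%g = antidiag (zeta ^+ l) (zeta ^- l).
Proof.
rewrite /h (hrepM DP) -/(h _) hrep_rX (hrep_s DP).
by apply/matrixP => i j; rewrite mxE sum_I2; elim/I2_case: i; elim/I2_case: j;
  rewrite !antidiagE !mxE /=; ring.
Qed.

Lemma srs : (s * r * s = r^-1)%g.
Proof.
rewrite /r !mulgA (ss1 DP) mul1g invMg -{1}[t]mul1g.
have si : (s^-1 = s)%g by apply/eqP; rewrite eq_invg_mul (ss1 DP).
have ti : (t^-1 = t)%g by apply/eqP; rewrite eq_invg_mul (tt1 DP).
by rewrite si ti mul1g.
Qed.

Lemma srX l : (s * r ^+ l = (r ^+ l)^-1 * s)%g.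
Proof.
have sr : (s * r = r^-1 * s)%g by rewrite -srs -[RHS]mulgA (ss1 DP) mulg1.
rewrite -expgVn; elim: l => [|l IH]; first by rewrite !expg0 mulg1 mul1g.
by rewrite !expgS mulgA sr -!mulgA IH.
Qed.

(** By [srX] the elements of these two shapes form a subgroup, and it contains [s] and [t]. *)
Lemma dihedral_cases g : exists l, (l < m)%N /\ (g = r ^+ l \/ g = r ^+ l * s)%g.
Proof.
suff [l Hl] : exists l, (g = r ^+ l \/ g = r ^+ l * s)%g.
  exists (l %% m)%N; rewrite ltn_mod m_gt0; split=> //.
  by rewrite (expg_mod _ (stm DP)).
pose G := [set g : gT | `[< exists l, (g = r ^+ l \/ g = r ^+ l * s)%g >]]%SET.
have rV l : ((r ^+ l)^-1 = r ^+ (l * m.-1))%g.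
  apply/eqP; rewrite eq_invg_mul -expgD -mulnS prednK ?m_gt0 // mulnC expgM.
  by rewrite (stm DP) expg1n.
have gG : group_set G.
  apply/group_setP; split=> [|x y].
    by rewrite inE; apply/asboolP; exists 0%N; left; rewrite expg0.
  rewrite !inE => /asboolP[k Hk] /asboolP[l Hl]; apply/asboolP.
  case: Hk Hl => -> [->|->].
  - by exists (k + l)%N; left; rewrite expgD.
  - by exists (k + l)%N; right; rewrite expgD mulgA.
  - by exists (k + l * m.-1)%N; right; rewrite -mulgA srX rV expgD mulgA.
  - exists (k + l * m.-1)%N; left.
    by rewrite -mulgA [(s * _)%g]mulgA srX rV -[(_ * s * s)%g]mulgA (ss1 DP) mulg1 expgD.
have : <<[set s; t]%SET>>%g \subset Group gG.
  rewrite gen_subG; apply/fintype.subsetP => x; rewrite !inE => /orP[]/eqP->; apply/asboolP.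
    by exists 0%N; right; rewrite expg0 mul1g.
  (* [t = r^-1 s], with [r^-1] written as [r ^+ m.-1]. *)
  exists m.-1; right; apply: (mulgI r).
  by rewrite mulgA -expgS prednK ?m_gt0 // (stm DP) mul1g /r -mulgA (tt1 DP) mulg1.
by rewrite (st_gen DP) => /fintype.subsetP/(_ g (finset.in_setT _)); rewrite inE => /asboolP.
Qed.

(** Every [hrep D g] is diagonal or antidiagonal with entries kappa and kappa^-1. [rot] and [kap]
    record the type and kappa, and the action of [g] is always computed in these two coordinates. *)
Definition rot (g : gT) : bool := h g 0 1 == 0.
Definition kap (g : gT) : C := if rot g then h g 0 0 else h g 0 1.

Lemma rot_rX l : rot (r ^+ l)%g.
Proof. by rewrite /rot hrep_rX mxE. Qed.
Lemma rot_rXs l : rot (r ^+ l * s)%g = false.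
Proof. by rewrite /rot hrep_rXs antidiagE expf_eq0 (negPf zeta_neq0) andbF. Qed.
Lemma kap_rX l : kap (r ^+ l)%g = zeta ^+ l.
Proof. by rewrite /kap rot_rX hrep_rX mxE. Qed.
Lemma kap_rXs l : kap (r ^+ l * s)%g = zeta ^+ l.
Proof. by rewrite /kap rot_rXs hrep_rXs antidiagE. Qed.

Lemma kap_neq0 g : kap g != 0.
Proof.
by have [l [_ [->|->]]] := dihedral_cases g; rewrite ?kap_rX ?kap_rXs expf_neq0 ?zeta_neq0.
Qed.

Lemma kapm g : kap g ^+ m = 1.
Proof.
by have [l [_ [->|->]]] := dihedral_cases g; rewrite ?kap_rX ?kap_rXs exprAC zetam expr1n.
Qed.

Lemma hrepE g : h g = if rot g
  then \matrix_(i, j) (if i == j then if i == 0 then kap g else (kap g)^-1 else 0)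
  else antidiag (kap g) (kap g)^-1.
Proof.
have [l [_ [->|->]]] := dihedral_cases g.
  by rewrite rot_rX kap_rX hrep_rX.
by rewrite rot_rXs kap_rXs hrep_rXs.
Qed.

Lemma rotM g g' : rot (g * g')%g = (rot g == rot g').
Proof.
rewrite {1}/rot /h (hrepM DP) mxE sum_I2 -/h !hrepE.
by case: (rot g) (rot g') => -[]; rewrite ?antidiagE ?mxE /= ?mul0r ?mulr0 ?addr0 ?add0r
  ?mulf_eq0 ?invr_eq0 ?(negPf (kap_neq0 _)) ?eqxx.
Qed.

Lemma kapM g g' :
  kap (g * g')%g = if rot g then kap g * kap g' else kap g * (kap g')^-1.
Proof.
rewrite {1}/kap rotM /h (hrepM DP) !mxE !sum_I2 -/h !hrepE.
by case: (rot g) (rot g') => -[]; rewrite ?antidiagE ?mxE /= ?mul0r ?mulr0 ?addr0 ?add0r.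
Qed.

Lemma rot1 : rot 1%g.
Proof. by rewrite -(expg0 r) rot_rX. Qed.
Lemma kap1 : kap 1%g = 1.
Proof. by rewrite -(expg0 r) kap_rX. Qed.

Lemma rXs_inj (k l : 'I_m) : (r ^+ k * s = r ^+ l * s)%g -> k = l.
Proof.
move=> E; have := kap_rXs k; rewrite E kap_rXs => /eqP.
by rewrite (eq_prim_root_expr (zeta_prim DP)) !modn_small // => /eqP/val_inj->.
Qed.

Lemma reflE g : (g \in refl D) = ~~ rot g.
Proof.
rewrite (refl_setE DP); apply/imsetP/idP => [[l _ ->]|]; first by rewrite rot_rXs.
have [l [lm [->|->]]] := dihedral_cases g; first by rewrite rot_rX.
by move=> _; exists (Ordinal lm).
Qed.

Lemma sum_refl (U : nmodType) (F : gT -> U) :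
  \sum_(w in refl D) F w = \sum_(l < m) F (r ^+ l * s)%g.
Proof.
rewrite (refl_setE DP) big_imset //= => k l _ _; exact: rXs_inj.
Qed.

Definition crefl (l : nat) : C := param D (r ^+ l * s)%g.

Lemma crefl_mod l : crefl (l %% m) = crefl l.
Proof. by rewrite /crefl (expg_mod _ (stm DP)). Qed.

(** Conjugation by [r] sends [r^l s] to [r^(l+2) s]. *)
Lemma crefl2 l : crefl l.+2 = crefl l.
Proof.
rewrite /crefl -[RHS](paramJ DP r^-1%g); last by rewrite reflE rot_rXs.
have sr : (s * r^-1 = r * s)%g.
  by apply: (mulIg r); rewrite mulgKV -mulgA -[r in (s * r)%g]expg1 srX expg1 mulgA mulgV mul1g.
congr (param D _); move: sr; generalize r => q sq.
by rewrite conjgE invgK -[(_ * _ * q^-1)%g]mulgA sq !mulgA -expgS -expgSr.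
Qed.

Definition csum (z : C) : C := \sum_(l < m) crefl l * z ^+ l.

Lemma sum_shift (U : nmodType) (F : nat -> U) :
  (forall l, F (l %% m)%N = F l) -> \sum_(l < m) F l.+1 = \sum_(l < m) F l.
Proof.
move=> Fm; have [n mE] : exists n, m = n.+1 by exists m.-1; rewrite prednK ?m_gt0.
move: Fm; rewrite mE => Fm; rewrite big_ord_recr [RHS]big_ord_recl /= addrC.
by rewrite -[F n.+1]Fm modnn.
Qed.

Lemma expr_modm (z : C) l : z ^+ m = 1 -> z ^+ (l %% m) = z ^+ l.
Proof. by move=> zm; rewrite {2}(divn_eq l m) exprD mulnC exprM zm expr1n mul1r. Qed.

(** By [crefl2] the coefficients have period 2, so shifting the sum by two places multiplies it by
    [z ^+ 2] without changing it. This is why almost all commutators vanish on weight vectors. *)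
Lemma csum_eq0 (z : C) : z ^+ m = 1 -> z ^+ 2 != 1 -> csum z = 0.
Proof.
move=> zm z2; apply/eqP; suff : (z ^+ 2 - 1) * csum z = 0.
  by move/eqP; rewrite mulf_eq0 subr_eq0 (negPf z2).
rewrite mulrBl mul1r; apply/eqP; rewrite subr_eq0; apply/eqP.
rewrite /csum; transitivity (\sum_(l < m) crefl l.+2 * z ^+ l.+2).
  by rewrite mulr_sumr; apply: eq_bigr => l _; rewrite crefl2 !exprS expr0; ring.
have Fm l : crefl (l %% m) * z ^+ (l %% m) = crefl l * z ^+ l.
  by rewrite crefl_mod expr_modm.
rewrite (sum_shift (F := fun l => crefl l.+1 * z ^+ l.+1)) ?(sum_shift (F := fun l => crefl l * z ^+ l)) //.
by move=> l; rewrite -(Fm (l %% m).+1) -(Fm l.+1) -(addn1 (l %% m)) modnDml addn1.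
Qed.

Lemma crefl_parity l : crefl l = crefl (odd l).
Proof.
elim/ltn_ind: l => -[|[|l]] IH //; rewrite crefl2 IH ?ltnS ?leqnSn //=.
by rewrite negbK.
Qed.

Lemma crefl0 : crefl 0 = param D s.
Proof. by rewrite /crefl expg0 mul1g. Qed.

(** [t = r^(m-1) s], and the index [m - 1] is reached from [1] by adding the period [m] and going
    back two places. *)
Lemma crefl1 : crefl 1 = param D t.
Proof.
rewrite -(crefl_mod 1) -(modnDr 1 m) crefl_mod.
have -> : (1 + m = m.-1.+2)%N by rewrite add1n prednK ?m_gt0.
rewrite crefl2 /crefl; congr (param D _).
have ti : (t^-1 = t)%g by apply/eqP; rewrite eq_invg_mul (tt1 DP).
apply: (mulgI r); rewrite mulgA -expgS prednK ?m_gt0 // (stm DP) mul1g.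
by rewrite /r -mulgA (tt1 DP) mulg1.
Qed.

(** For odd [m] the periods 2 and [m] together make [crefl] constant. *)
Lemma param_odd : odd m -> param D s = param D t.
Proof.
move=> om; rewrite -crefl0 -crefl1; have := crefl_mod m.
by rewrite modnn => ->; rewrite crefl_parity om.
Qed.

Lemma csum1_odd : odd m -> csum 1 = param D s *+ m.
Proof.
move=> om; rewrite /csum -[in RHS](card_ord m) -sumr_const; apply: eq_bigr => l _.
rewrite expr1n mulr1 crefl_parity; case: (odd l); rewrite ?crefl0 // crefl1.
by rewrite param_odd.
Qed.

Lemma csum_even (e : bool) : ~~ odd m ->
  csum ((-1) ^+ e) = (param D s + (-1) ^+ e * param D t) *+ m./2.
Proof.
move=> em; suff H k : \sum_(l < k.*2) crefl l * ((-1) ^+ e) ^+ l =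
    (param D s + (-1) ^+ e * param D t) *+ k.
  by rewrite /csum -H even_halfK.
elim: k => [|k IH]; first by rewrite big_ord0 mulr0n.
rewrite doubleS !big_ord_recr /= IH mulrSr -addrA; congr (_ + _).
rewrite -crefl0 -crefl1 (crefl_parity k.*2) (crefl_parity k.*2.+1) /= odd_double /=.
have -> : ((-1 : C) ^+ e) ^+ k.*2 = 1 by rewrite -mul2n exprM sqrr_sign expr1n.
by rewrite exprS -mul2n exprM sqrr_sign expr1n !mulr1 mulrC.
Qed.

End Dihedral.

Lemma commr_mul (A : pzRingType) (x y z : A) : x * y = y * x -> x * z = z * x -> x * (y * z) = y * z * x.
Proof. by move=> xy xz; rewrite mulrA xy -mulrA xz mulrA. Qed.

(** * Presentations of Cherednik algebras *)

Section FreeAlgebra.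
Variables (gT : finGroupType) (K : comNzRingType).
Let FA := free_algebra gT K.
Let word (s : seq (Defs.generator gT)) : FA := mkmalgU (FMonom s) 1.

Lemma mkmalgU_mul (c d : K) (m n : fmonom (Defs.generator gT)) :
  (mkmalgU m c : FA) * mkmalgU n d = mkmalgU (mmul m n) (c * d).
Proof. by rewrite malgM_def fgmulUU. Qed.

Lemma free_word_cons g s : word (g :: s) = free_gen K g * word s.
Proof.
rewrite /free_gen mkmalgU_mul mulr1; congr mkmalgU.
by apply/val_inj; rewrite /= fmM fmU.
Qed.

Lemma free_word_nil : word [::] = 1.
Proof. by congr mkmalgU; apply/val_inj; rewrite /= fm1. Qed.

Lemma free_monomE (c : K) m : (mkmalgU m c : FA) = scal gT c * word m.
Proof.
have scE (x : FA) k : monalg.mcoeff k (c *: x) = c * monalg.mcoeff k x by exact: monalg.mcoeffZ.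
rewrite /scal mulr_algl; apply/malgP => k; rewrite scE !monalg.mcoeffU.
by case: m => m; case: eqP; rewrite /= ?mulr1 ?mulr0.
Qed.

Lemma free_ind (P : FA -> Prop) :
  P 1 -> (forall a b, P a -> P b -> P (a + b)) ->
  (forall k a, P a -> P (scal gT k * a)) ->
  (forall g a, P a -> P (free_gen K g * a)) -> forall a, P a.
Proof.
move=> P1 PD PZ Pg a; have P0 : P 0 by rewrite -(mul0r 1) -(rmorph0 (GRing.in_alg FA)); apply: PZ.
rewrite (monalgE a); elim/big_ind: _ => // m _; rewrite free_monomE; apply: PZ.
by elim: (m : seq _) => [|g s IH]; rewrite ?free_word_nil // free_word_cons; apply: Pg.
Qed.

Lemma scal_monom k : (mkmalgU mone k : FA) = scal gT k.
Proof. by rewrite free_monomE fm1 free_word_nil mulr1. Qed.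

Lemma scalM_gen k (m : fmonom (Defs.generator gT)) c :
  scal gT k * (mkmalgU m c : FA) = (mkmalgU m c : FA) * scal gT k.
Proof.
rewrite -scal_monom.
apply: etrans (mkmalgU_mul _ _ _ _) _; apply: etrans (esym (mkmalgU_mul _ _ _ _)).
by rewrite mulm1 mul1m [k * c]mulrC.
Qed.

Lemma scalC k (a : FA) : scal gT k * a = a * scal gT k.
Proof.
elim/free_ind: a => [|a b IHa IHb|l a IH|g a IH].
- by rewrite mulr1 mul1r.
- by rewrite mulrDl mulrDr IHa IHb.
- by apply: commr_mul IH; rewrite -[scal gT l]scal_monom; exact: scalM_gen.
by apply: commr_mul IH; exact: scalM_gen.
Qed.

End FreeAlgebra.

(* H_{u,c} and its quotients, presented through the images of the generators;
   cherind says that they generate. *)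
Record cher_alg (C : fieldType) (gT : finGroupType) (D : cherednik_data C gT)
    (K : comNzRingType) (iota : {rmorphism C -> K}) (u : K) (A : pzRingType) := CherAlg {
  sc : {rmorphism K -> A};
  xx : 'I_2 -> A;
  yy : 'I_2 -> A;
  ww : gT -> A;
  scC : forall k a, sc k * a = a * sc k;
  ww1 : ww 1%g = 1;
  wwM : forall g g', ww (g * g')%g = ww g * ww g';
  wwx : forall g j, ww g * xx j = (\sum_i sc (iota (hrep D g^-1 j i)) * xx i) * ww g;
  wwy : forall g j, ww g * yy j = (\sum_i sc (iota (hrep D g i j)) * yy i) * ww g;
  xxC : forall i j, xx i * xx j = xx j * xx i;
  yyC : forall i j, yy i * yy j = yy j * yy i;
  yyxx : forall i j, yy i * xx j - xx j * yy i = sc (u * (i == j)%:R) -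
    \sum_(w in refl D) sc (iota (param D w * root_vec D w 0 i * coroot_vec D w j 0)) * ww w;
  cherind : forall P : A -> Prop, P 1 -> (forall a b, P a -> P b -> P (a + b)) ->
    (forall k a, P a -> P (sc k * a)) -> (forall i a, P a -> P (xx i * a)) ->
    (forall i a, P a -> P (yy i * a)) -> (forall g a, P a -> P (ww g * a)) ->
    forall a, P a }.

Lemma rq_pi_eq (A : pzRingType) (T : set A) x y : T (x - y) -> rq_pi T x = rq_pi T y.
Proof. by move=> Txy; apply/ring_quotE => I _; apply. Qed.

Lemma rq_pi_surj (A : pzRingType) (T : set A) (x : ring_quot T) : exists a, x = rq_pi T a.
Proof. by exists (repr x); rewrite /rq_pi reprK. Qed.

Lemma rq_piZ (K : comNzRingType) (A : lalgType K) (T : set A) k (a : A) :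
  rq_pi T (k *: a) = rq_pi T k%:A * rq_pi T a.
Proof. by rewrite -[k *: a]mulr_algl rmorphM. Qed.

(** Stated over an abstract algebra with an abstract set [T] of relations, so that the verification
    is pure ring algebra. It ends with [Defined] because the images of the generators have to
    compute: [cherednik_alg_sc] and its companions hold by [reflexivity]. *)
Definition presented_alg (C : fieldType) (gT : finGroupType) (D : cherednik_data C gT)
    (K : comNzRingType) (iota : {rmorphism C -> K}) (u : K) (A : lalgType K) (T : set A)
    (x y : 'I_2 -> A) (w : gT -> A)
  (scC : forall (k : K) (a : A), k%:A * a = a * k%:A)
  (T1 : T (w 1%g - 1))
  (TM : forall g g', T (w (g * g')%g - w g * w g'))
  (Tx : forall g j, T (w g * x j - (\sum_i iota (hrep D g^-1 j i) *: x i) * w g))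
  (Ty : forall g j, T (w g * y j - (\sum_i iota (hrep D g i j) *: y i) * w g))
  (Txx : forall i j, T (ring_commutator (x i) (x j)))
  (Tyy : forall i j, T (ring_commutator (y i) (y j)))
  (Tyx : forall i j, T (ring_commutator (y i) (x j) - ((u * (i == j)%:R)%:A -
     \sum_(g in refl D)
         iota (param D g * root_vec D g 0 i * coroot_vec D g j 0) *: w g)))
  (Aind : forall P : A -> Prop, P 1 -> (forall a b, P a -> P b -> P (a + b)) ->
    (forall k a, P a -> P (k%:A * a)) -> (forall i a, P a -> P (x i * a)) ->
    (forall i a, P a -> P (y i * a)) -> (forall g a, P a -> P (w g * a)) ->
    forall a, P a) : cher_alg D iota u (ring_quot T).
Proof.
pose pi : {rmorphism A -> ring_quot T} := @rq_pi A T.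
pose scl : {rmorphism K -> ring_quot T} := pi \o (GRing.in_alg A).
apply: (@CherAlg C gT D K iota u _ scl (pi \o x) (pi \o y) (pi \o w)); rewrite /=.
- by move=> k a; have [f ->] := rq_pi_surj a; rewrite -!rmorphM scC.
- by rewrite -[1](rmorph1 pi); apply: rq_pi_eq.
- by move=> g g'; rewrite -rmorphM; apply: rq_pi_eq.
- move=> g j; apply: etrans (esym (rmorphM pi _ _)) _.
  apply: etrans (rq_pi_eq (Tx g j)) _; rewrite -/(pi _) rmorphM rmorph_sum.
  by congr (_ * _); apply: eq_bigr => i _; apply: rq_piZ.
- move=> g j; apply: etrans (esym (rmorphM pi _ _)) _.
  apply: etrans (rq_pi_eq (Ty g j)) _; rewrite -/(pi _) rmorphM rmorph_sum.
  by congr (_ * _); apply: eq_bigr => i _; apply: rq_piZ.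
- by move=> i j; rewrite -!(rmorphM pi); apply: rq_pi_eq (Txx i j).
- by move=> i j; rewrite -!(rmorphM pi); apply: rq_pi_eq (Tyy i j).
- move=> i j; apply: etrans (_ : pi (ring_commutator (y i) (x j)) = _).
    by rewrite rmorphB !rmorphM.
  apply: etrans (rq_pi_eq (Tyx i j)) _; rewrite -/(pi _) rmorphB rmorph_sum; congr (_ - _).
  by apply: eq_bigr => g _; apply: rq_piZ.
move=> P P1 PD Pk Px Py Pw a; have [f ->] := rq_pi_surj a.
change (P (pi f)).
elim/Aind: f => [|f g Pf Pg|k f Pf|i f Pf|i f Pf|g f Pf].
- by rewrite rmorph1.
- by rewrite rmorphD; apply: PD.
- by rewrite rmorphM; apply: Pk.
- by rewrite rmorphM; apply: Px.
- by rewrite rmorphM; apply: Py.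
- by rewrite rmorphM; apply: Pw.
Defined.

Section CherednikAlg.
Variables (C : fieldType) (gT : finGroupType) (D : cherednik_data C gT).
Variables (K : comNzRingType) (iota : {rmorphism C -> K}) (u : K).
Let S := smash_rel D iota `|` commutation_rel D iota u.

Definition cherednik_alg : cher_alg D iota u (cherednik D iota u).
Proof.
apply: (@presented_alg C gT D K iota u (free_algebra gT K) S (gx gT K) (gy gT K) (gw K)).
- exact: scalC.
- by left; apply: Rel_one.
- by move=> g g'; left; apply: Rel_mul.
- by move=> g j; left; apply: (@Rel_actx C gT D K iota g j).
- by move=> g j; left; apply: (@Rel_acty C gT D K iota g j).
- by move=> i j; right; apply: Rel_xx.
- by move=> i j; right; apply: Rel_yy.
- by move=> i j; right; apply: (@Rel_yx C gT D K iota u i j).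
move=> P P1 PD Pk Px Py Pw; apply: free_ind => // -[[i|i]|w] f; [exact: Px|exact: Py|exact: Pw].
Defined.

Lemma cherednik_alg_sc k : sc cherednik_alg k = @cherednik_pi _ _ D _ iota u (scal gT k). Proof. reflexivity. Qed.
Lemma cherednik_alg_xx i : xx cherednik_alg i = @cherednik_pi _ _ D _ iota u (gx gT K i). Proof. reflexivity. Qed.
Lemma cherednik_alg_yy i : yy cherednik_alg i = @cherednik_pi _ _ D _ iota u (gy gT K i). Proof. reflexivity. Qed.
Lemma cherednik_alg_ww w : ww cherednik_alg w = @cherednik_pi _ _ D _ iota u (gw K w). Proof. reflexivity. Qed.

End CherednikAlg.

(** Makes every computation with the generators available in the restricted algebra, and also in the
    quotient of [Hu] by the indeterminate. *)
Definition cher_alg_quot (C : fieldType) (gT : finGroupType) (D : cherednik_data C gT)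
    (K : comNzRingType) (iota : {rmorphism C -> K}) (u : K) (A : pzRingType)
    (HA : cher_alg D iota u A) (T : set A) : cher_alg D iota u (ring_quot T).
Proof.
pose pi : {rmorphism A -> ring_quot T} := @rq_pi A T.
apply: (@CherAlg C gT D K iota u _ (pi \o sc HA : {rmorphism K -> ring_quot T})
  (pi \o xx HA) (pi \o yy HA) (pi \o ww HA)); rewrite /=.
- by move=> k a; have [f ->] := rq_pi_surj a; rewrite -!rmorphM scC.
- by rewrite (ww1 HA) rmorph1.
- by move=> g g'; rewrite (wwM HA) rmorphM.
- move=> g j; rewrite -rmorphM (wwx HA) rmorphM rmorph_sum; congr (_ * _).
  by apply: eq_bigr => i _; rewrite rmorphM.
- move=> g j; rewrite -rmorphM (wwy HA) rmorphM rmorph_sum; congr (_ * _).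
  by apply: eq_bigr => i _; rewrite rmorphM.
- by move=> i j; rewrite -!rmorphM (xxC HA).
- by move=> i j; rewrite -!rmorphM (yyC HA).
- move=> i j; rewrite -!rmorphM -rmorphB (yyxx HA) rmorphB rmorph_sum; congr (_ - _).
  by apply: eq_bigr => w _; rewrite rmorphM.
move=> P P1 PD Pk Px Py Pw a; have [f ->] := rq_pi_surj a; change (P (pi f)).
move: f; apply: (@cherind _ _ _ _ _ _ _ HA (fun f => P (pi f))) => [|f g Pf Pg|k f Pf|i f Pf|i f Pf|w f Pf].
- by rewrite rmorph1.
- by rewrite rmorphD; apply: PD.
- by rewrite rmorphM; apply: Pk.
- by rewrite rmorphM; apply: Px.
- by rewrite rmorphM; apply: Py.
- by rewrite rmorphM; apply: Pw.
Defined.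

Section CherAlgebra.
Variables (C : numFieldType) (m : nat) (gT : finGroupType) (s t : gT) (zeta : C).
Variable D : cherednik_data C gT.
Hypothesis DP : dihedral_setup m s t zeta D.
Variables (K : comNzRingType) (iota : {rmorphism C -> K}) (u : K) (A : pzRingType).
Variable HA : cher_alg D iota u A.

Let r := (s * t)%g.
Local Notation k c := (sc HA (iota c)).
Let x0 := xx HA 0.
Let x1 := xx HA 1.
Let y0 := yy HA 0.
Let y1 := yy HA 1.
Let w := ww HA.

Lemma wx_rot g : rot D g -> w g * x0 = k (kap D g)^-1 * x0 * w g /\
  w g * x1 = k (kap D g) * x1 * w g.
Proof.
move=> rg; have rgV : rot D g^-1.
  by have := rotM DP g g^-1; rewrite mulgV rg (rot1 DP); case: (rot _ _).
have kgV : kap D g^-1 = (kap D g)^-1.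
  have := kapM DP g g^-1; rewrite mulgV rg (kap1 DP) => E.
  by apply: (mulfI (kap_neq0 DP g)); rewrite -E divff ?(kap_neq0 DP).
by split; rewrite /w /x0 /x1 (wwx HA) sum_I2 (hrepE DP) rgV kgV !mxE /= ?invrK !rmorph0 !mul0r ?addr0 ?add0r.
Qed.

Lemma wy_rot g : rot D g -> w g * y0 = k (kap D g) * y0 * w g /\
  w g * y1 = k (kap D g)^-1 * y1 * w g.
Proof.
move=> rg; split; rewrite /w /y0 /y1 (wwy HA) sum_I2 (hrepE DP) rg !mxE /=;
  by rewrite !rmorph0 !mul0r ?addr0 ?add0r.
Qed.

Lemma wx_refl g : ~~ rot D g -> w g * x0 = k (kap D g) * x1 * w g /\
  w g * x1 = k (kap D g)^-1 * x0 * w g.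
Proof.
move=> /negPf rg; have rgV : rot D g^-1 = false.
  by have := rotM DP g g^-1; rewrite mulgV rg (rot1 DP); case: (rot _ _).
have kgV : kap D g^-1 = kap D g.
  have := kapM DP g g^-1; rewrite mulgV rg (kap1 DP) => E.
  have := kap_neq0 DP g^-1 => kV; apply: (mulIf (_ : (kap D g^-1)^-1 != 0)).
    by rewrite invr_eq0.
  by rewrite -E divff.
by split; rewrite /w /x0 /x1 (wwx HA) sum_I2 (hrepE DP) rgV kgV !mxE /= !rmorph0 !mul0r ?addr0 ?add0r.
Qed.

Lemma wy_refl g : ~~ rot D g -> w g * y0 = k (kap D g)^-1 * y1 * w g /\
  w g * y1 = k (kap D g) * y0 * w g.
Proof.
move=> /negPf rg; split; rewrite /w /y0 /y1 (wwy HA) sum_I2 (hrepE DP) rg !mxE /=;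
  by rewrite !rmorph0 !mul0r ?addr0 ?add0r.
Qed.

(** Up to the term in [u], every commutator [[y_i, x_j]] is of this form. Moving [wsum f] past a
    variable exchanges the indices 0 and 1 and twists [f] by [zeta ^+ l] or [zeta ^- l]. *)
Definition wsum (f : nat -> C) : A := \sum_(l < m) k (f l) * w (r ^+ l * s)%g.

Lemma wsumN f : - wsum f = wsum (fun l => - f l).
Proof. by rewrite -sumrN; apply: eq_bigr => l _; rewrite !rmorphN mulNr. Qed.

Lemma eq_wsum f g : (forall l, (l < m)%N -> f l = g l) -> wsum f = wsum g.
Proof. by move=> fg; apply: eq_bigr => l _; rewrite fg. Qed.

Lemma wsum_swap (a b : A) f g :
  (forall l, (l < m)%N -> w (r ^+ l * s)%g * a = k (g l) * b * w (r ^+ l * s)%g) ->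
  wsum f * a = b * wsum (fun l => f l * g l).
Proof.
move=> E; rewrite mulr_suml mulr_sumr; apply: eq_bigr => l _.
rewrite -mulrA E // !rmorphM !mulrA; congr (_ * _).
by rewrite -[in RHS](scC HA) -[X in _ = _ * X](scC HA) [RHS]mulrA [X in _ = X * _](scC HA).
Qed.

Lemma wsum_x0 f : wsum f * x0 = x1 * wsum (fun l => f l * zeta ^+ l).
Proof.
apply: wsum_swap => l _; have [->] := wx_refl (negbT (rot_rXs DP l)).
by rewrite (kap_rXs DP).
Qed.

Lemma wsum_x1 f : wsum f * x1 = x0 * wsum (fun l => f l * zeta ^- l).
Proof.
apply: wsum_swap => l _; have [_ ->] := wx_refl (negbT (rot_rXs DP l)).
by rewrite (kap_rXs DP).
Qed.

Lemma wsum_y0 f : wsum f * y0 = y1 * wsum (fun l => f l * zeta ^- l).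
Proof.
apply: wsum_swap => l _; have [-> _] := wy_refl (negbT (rot_rXs DP l)).
by rewrite (kap_rXs DP).
Qed.

Lemma wsum_y1 f : wsum f * y1 = y0 * wsum (fun l => f l * zeta ^+ l).
Proof.
apply: wsum_swap => l _; have [_ ->] := wy_refl (negbT (rot_rXs DP l)).
by rewrite (kap_rXs DP).
Qed.

Let c := crefl s t D.

Lemma sum_refl_wsum i j : \sum_(g in refl D)
    sc HA (iota (param D g * root_vec D g 0 i * coroot_vec D g j 0)) * ww HA g =
  wsum (fun l => c l * ((i == j)%:R - antidiag (zeta ^+ l) (zeta ^- l) j i)).
Proof.
under eq_bigr => g gr do rewrite -mulrA (coroot_root DP gr).
by rewrite (sum_refl DP); apply: eq_bigr => l _; rewrite (hrep_rXs DP).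
Qed.

Lemma y0x0 : y0 * x0 = x0 * y0 + sc HA u - wsum c.
Proof.
apply/eqP; rewrite -addrA addrC -subr_eq; apply/eqP; rewrite (yyxx HA) sum_refl_wsum /= mulr1.
by congr (_ - _); apply: eq_wsum => l _; rewrite antidiagE subr0 mulr1.
Qed.

Lemma y1x1 : y1 * x1 = x1 * y1 + sc HA u - wsum c.
Proof.
apply/eqP; rewrite -addrA addrC -subr_eq; apply/eqP; rewrite (yyxx HA) sum_refl_wsum /= mulr1.
by congr (_ - _); apply: eq_wsum => l _; rewrite antidiagE subr0 mulr1.
Qed.

Lemma y0x1 : y0 * x1 = x1 * y0 + wsum (fun l => c l * zeta ^- l).
Proof.
apply/eqP; rewrite addrC -subr_eq; apply/eqP; rewrite (yyxx HA) sum_refl_wsum /= mulr0 rmorph0.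
by rewrite sub0r wsumN; apply: eq_wsum => l _; rewrite antidiagE sub0r mulrN opprK.
Qed.

Lemma y1x0 : y1 * x0 = x0 * y1 + wsum (fun l => c l * zeta ^+ l).
Proof.
apply/eqP; rewrite addrC -subr_eq; apply/eqP; rewrite (yyxx HA) sum_refl_wsum /= mulr0 rmorph0.
by rewrite sub0r wsumN; apply: eq_wsum => l _; rewrite antidiagE sub0r mulrN opprK.
Qed.

Lemma x1x0 : x1 * x0 = x0 * x1. Proof. exact: xxC. Qed.
Lemma y1y0 : y1 * y0 = y0 * y1. Proof. exact: yyC. Qed.

Lemma zetaVK l : zeta ^- l * zeta ^+ l = 1.
Proof. by rewrite mulVf // expf_neq0 // (zeta_neq0 DP). Qed.

(** The two reflection terms cancel: moving [wsum c] past [y1] twists [c] by [zeta ^+ l], which is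
    exactly the coefficient function of [[y1, x0]]. Only the term in [u] survives. *)
Lemma y0y1_x0 : (y0 * y1) * x0 = x0 * (y0 * y1) + sc HA u * y1.
Proof.
rewrite -mulrA y1x0 mulrDr mulrA y0x0 !mulrDl mulNr wsum_y1 -!mulrA.
by rewrite subrK.
Qed.

Lemma y0y1_x1 : (y0 * y1) * x1 = x1 * (y0 * y1) + sc HA u * y0.
Proof.
rewrite -y1y0 -mulrA y0x1 mulrDr mulrA y1x1 !mulrDl mulNr wsum_y0 -!mulrA.
by rewrite subrK.
Qed.

Lemma cher_center z : (forall i, z * xx HA i = xx HA i * z) ->
  (forall i, z * yy HA i = yy HA i * z) -> (forall g, z * w g = w g * z) -> ring_center z.
Proof.
move=> zx zy zw a; have step b d : z * b = b * z -> z * d = d * z -> z * (b * d) = b * d * z.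
  exact: commr_mul.
move: a; apply: (@cherind _ _ _ _ _ _ _ HA (fun a => z * a = a * z)).
- by rewrite mulr1 mul1r.
- by move=> a b Ha Hb; rewrite mulrDr mulrDl Ha Hb.
- by move=> l a Ha; apply: step Ha; rewrite -(scC HA).
- by move=> i a Ha; apply: step Ha; apply: zx.
- by move=> i a Ha; apply: step Ha; apply: zy.
- by move=> g a Ha; apply: step Ha; apply: zw.
Qed.

Lemma w_prod g (p q a b : A) (d e : C) : d * e = 1 ->
  w g * p = k d * a * w g -> w g * q = k e * b * w g ->
  w g * (p * q) = a * b * w g.
Proof.
move=> de wp wq; rewrite mulrA wp -mulrA wq !mulrA -[k d * a * _]mulrA.
by rewrite -[a * _](scC HA) mulrA -!rmorphM de !rmorph1 mul1r.
Qed.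

Lemma xx_w g : w g * (x0 * x1) = x0 * x1 * w g.
Proof.
case: (boolP (rot D g)) => rg.
  have [a b] := wx_rot rg; apply: w_prod a b.
  by rewrite mulVf // (kap_neq0 DP).
have [a b] := wx_refl rg; rewrite -[in RHS]x1x0; apply: w_prod a b.
by rewrite divff // (kap_neq0 DP).
Qed.

Lemma yy_w g : w g * (y0 * y1) = y0 * y1 * w g.
Proof.
case: (boolP (rot D g)) => rg.
  have [a b] := wy_rot rg; apply: w_prod a b.
  by rewrite divff // (kap_neq0 DP).
have [a b] := wy_refl rg; rewrite -[in RHS]y1y0; apply: w_prod a b.
by rewrite mulVf // (kap_neq0 DP).
Qed.

Lemma w_pow g (p a : A) (d : C) n : w g * p = k d * a * w g ->
  w g * p ^+ n = k (d ^+ n) * a ^+ n * w g.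
Proof.
move=> wp; elim: n => [|n IH]; first by rewrite !expr0 !rmorph1 !mul1r mulr1.
rewrite !exprS mulrA wp -!mulrA IH; rewrite !mulrA (rmorphM iota) (rmorphM (sc HA)).
by rewrite -[_ * a * _]mulrA -(scC HA) !mulrA.
Qed.

Lemma w_powsum g (p q a b : A) (d e : C) : d ^+ m = 1 -> e ^+ m = 1 ->
  w g * p = k d * a * w g -> w g * q = k e * b * w g ->
  w g * (p ^+ m + q ^+ m) = (a ^+ m + b ^+ m) * w g.
Proof.
move=> dm em wp wq; rewrite mulrDr (w_pow m wp) (w_pow m wq) dm em !rmorph1 !mul1r.
by rewrite mulrDl.
Qed.

Lemma kapVm g : (kap D g)^-1 ^+ m = 1.
Proof. by rewrite exprVn (kapm DP) invr1. Qed.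

Lemma xpow_w g : w g * (x0 ^+ m + x1 ^+ m) = (x0 ^+ m + x1 ^+ m) * w g.
Proof.
case: (boolP (rot D g)) => rg.
  by have [a b] := wx_rot rg; apply: w_powsum a b; rewrite ?kapVm ?(kapm DP).
have [a b] := wx_refl rg; rewrite [X in _ = X * _]addrC.
by apply: w_powsum a b; rewrite ?kapVm ?(kapm DP).
Qed.

Lemma ypow_w g : w g * (y0 ^+ m + y1 ^+ m) = (y0 ^+ m + y1 ^+ m) * w g.
Proof.
case: (boolP (rot D g)) => rg.
  by have [a b] := wy_rot rg; apply: w_powsum a b; rewrite ?kapVm ?(kapm DP).
have [a b] := wy_refl rg; rewrite [X in _ = X * _]addrC.
by apply: w_powsum a b; rewrite ?kapVm ?(kapm DP).
Qed.

Lemma pow_commutator (a e T : A) n : a * e = e * a + T ->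
  a ^+ n * e = e * a ^+ n + \sum_(i < n) a ^+ i * T * a ^+ (n.-1 - i).
Proof.
move=> ae; elim: n => [|n IH]; first by rewrite big_ord0 !expr0 mulr1 mul1r addr0.
rewrite exprSr -mulrA ae mulrDr mulrA IH mulrDl -!mulrA -addrA; congr (_ + _).
rewrite big_ord_recr /= subnn expr0 mulr1; congr (_ + _).
rewrite mulr_suml; apply: eq_bigr => i _; rewrite -!mulrA -exprSr; congr (_ * (_ * _ ^+ _)).
have := ltn_ord i; case: n {IH} i => [[]|n] //= i; rewrite ltnS => Hi.
by rewrite subSn.
Qed.

Lemma wsum_pow0 (a0 a1 : A) (z : C) f n :
  (forall f, wsum f * a0 = a1 * wsum (fun l => f l * z ^+ l)) ->
  wsum f * a0 ^+ n = a1 ^+ n * wsum (fun l => f l * (z ^+ l) ^+ n).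
Proof.
move=> E; elim: n f => [|n IH] f.
  by rewrite !expr0 mulr1 mul1r; apply: eq_wsum => l _; rewrite expr0 mulr1.
rewrite exprS mulrA E -mulrA IH exprS mulrA; congr (_ * _).
by apply: eq_wsum => l _; rewrite -mulrA -exprS.
Qed.

(* [a0 ^+ m, e] and [a1 ^+ m, e] are the two orderings of the same geometric sum. *)
Lemma powsum_commute (a0 a1 e : A) f : a0 * a1 = a1 * a0 ->
  a0 * e = e * a0 - wsum f -> a1 * e = e * a1 + wsum (fun l => f l * zeta ^+ l) ->
  (forall f, wsum f * a0 = a1 * wsum (fun l => f l * zeta ^- l)) ->
  (forall f, wsum f * a1 = a0 * wsum (fun l => f l * zeta ^+ l)) ->
  (a0 ^+ m + a1 ^+ m) * e = e * (a0 ^+ m + a1 ^+ m).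
Proof.
move=> a01 a0e a1e wa0 wa1.
rewrite mulrDl (pow_commutator m a0e) (pow_commutator m a1e) mulrDr.
rewrite addrACA -[RHS]addr0; congr (_ + _).
rewrite (reindex_inj rev_ord_inj) /= -big_split big1 //= => i _.
have im := ltn_ord i.
have -> : (m - i.+1 = m.-1 - i)%N by rewrite -subn1 -subnDA add1n.
have -> : (m.-1 - (m.-1 - i) = i)%N by rewrite subKn // -ltnS prednK // (m_gt0 DP).
rewrite mulrN mulNr -!mulrA.
have wa0' h : wsum h * a0 = a1 * wsum (fun l => h l * zeta^-1 ^+ l).
  by rewrite wa0; congr (_ * _); apply: eq_wsum => l _; rewrite exprVn.
rewrite (wsum_pow0 _ _ wa0') (wsum_pow0 _ _ wa1) !mulrA.
have -> : a1 ^+ i * a0 ^+ (m.-1 - i) = a0 ^+ (m.-1 - i) * a1 ^+ i.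
  by apply: commrX; apply/commr_sym/commrX.
apply/eqP; rewrite addrC subr_eq0; apply/eqP; congr (_ * _); apply: eq_wsum => l _.
rewrite -mulrA; congr (_ * _); rewrite -exprS -exprM -exprM exprVn.
rewrite -[RHS]mul1r -(zetaVK (l * i)) mulrC; apply: (mulfI (_ : zeta ^+ (l * i) != 0)).
  by rewrite expf_neq0 // (zeta_neq0 DP).
rewrite mulrCA mulrA zetaVK mul1r -exprD.
(* This is where the exponent [m] matters: the twists of the two orderings differ by
   [zeta ^+ (l * m) = 1]. *)
have -> : (l * i + l * (m.-1 - i).+1 = l * m)%N.
  rewrite -mulnDr; congr (_ * _)%N; rewrite addnS subnKC ?prednK ?(m_gt0 DP) //.
  by rewrite -ltnS prednK // (m_gt0 DP).
by rewrite mulnC exprM (zetam DP) expr1n.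
Qed.

End CherAlgebra.

(** * Central elements *)

Section Center.
Variables (C : numFieldType) (m : nat) (gT : finGroupType) (s t : gT) (zeta : C).
Variable D : cherednik_data C gT.
Hypothesis DP : dihedral_setup m s t zeta D.
Variables (A : pzRingType) (HA : cher_alg D (idfun : {rmorphism C -> C}) 0 A).

Let r := (s * t)%g.
Local Notation k := (sc HA).
Let x0 := xx HA 0.
Let x1 := xx HA 1.
Let y0 := yy HA 0.
Let y1 := yy HA 1.
Let w := ww HA.
Let c := crefl s t D.
Let ws := wsum m s t HA.

Lemma y0x0_0 : y0 * x0 = x0 * y0 - ws c.
Proof. by rewrite /y0 /x0 (y0x0 DP) rmorph0 addr0. Qed.
Lemma y1x1_0 : y1 * x1 = x1 * y1 - ws c.
Proof. by rewrite /y1 /x1 (y1x1 DP) rmorph0 addr0. Qed.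

Lemma xx_center : ring_center (x0 * x1).
Proof.
apply: (cher_center (HA := HA)).
- by apply: I2_case; apply/commr_sym/commrM => //; apply: xxC.
- apply: I2_case; rewrite -/y0 -/y1.
    rewrite -mulrA [x1 * y0](_ : _ = y0 * x1 - ws (fun l => c l * zeta ^- l)).
      rewrite mulrBr mulrA [x0 * y0](_ : _ = y0 * x0 + ws c); last by rewrite y0x0_0 subrK.
      rewrite mulrDl -!mulrA -addrA; apply/eqP; rewrite -subr_eq0 addrAC subrr add0r subr_eq0.
      by rewrite /ws /x1 (wsum_x1 DP).
    by rewrite /y0 /x1 (y0x1 DP) addrK.
  rewrite -[x0 * x1]xxC -/x1 -/x0 -mulrA [x0 * y1](_ : _ = y1 * x0 - ws (fun l => c l * zeta ^+ l)).
    rewrite mulrBr mulrA [x1 * y1](_ : _ = y1 * x1 + ws c); last by rewrite y1x1_0 subrK.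
    rewrite mulrDl -!mulrA -addrA; apply/eqP; rewrite -subr_eq0 addrAC subrr add0r subr_eq0.
    by rewrite /ws /x0 (wsum_x0 DP).
  by rewrite /y1 /x0 (y1x0 DP) addrK.
- by move=> g; rewrite (xx_w DP).
Qed.

Lemma yy_center : ring_center (y0 * y1).
Proof.
apply: (cher_center (HA := HA)).
- by apply: I2_case; [rewrite (y0y1_x0 DP)|rewrite (y0y1_x1 DP)]; rewrite rmorph0 mul0r addr0.
- by apply: I2_case; apply/commr_sym/commrM => //; apply: yyC.
- by move=> g; rewrite (yy_w DP).
Qed.

Lemma wsum_zzV f : ws (fun l => f l * zeta ^- l * zeta ^+ l) = ws f.
Proof. by apply: eq_wsum => l _; rewrite -mulrA (zetaVK DP) mulr1. Qed.
Lemma wsum_zVz f : ws (fun l => f l * zeta ^+ l * zeta ^- l) = ws f.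
Proof. by apply: eq_wsum => l _; rewrite -mulrA [_ * zeta ^- l]mulrC (zetaVK DP) mulr1. Qed.

Lemma ypow_center : ring_center (y0 ^+ m + y1 ^+ m).
Proof.
apply: (cher_center (HA := HA)).
- apply: I2_case; rewrite -/x0 -/x1.
    apply: (powsum_commute DP (f := c)); rewrite ?y0x0_0 //; first exact: yyC.
    + exact: (y1x0 DP).
    + exact: (wsum_y0 DP).
    + exact: (wsum_y1 DP).
  (* [powsum_commute] wants [[a0, e] = - wsum f] and [[a1, e]] equal to the twist of [wsum f]; this
     [f] brings [[y0, x1]] and [[y1, x1]] into that shape. *)
  apply: (powsum_commute DP (f := fun l => - (c l * zeta ^- l))); first exact: yyC.
  + rewrite [LHS](y0x1 DP) wsumN; congr (_ + _); apply: eq_wsum => l _; exact: esym (opprK _).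
  + rewrite y1x1_0 [- ws c]wsumN; congr (_ + _); apply: eq_wsum => l _.
    by rewrite mulNr -mulrA (zetaVK DP) mulr1.
  + exact: (wsum_y0 DP).
  + exact: (wsum_y1 DP).
- apply: I2_case; apply/commr_sym/commrD; apply: commrX => //; apply: yyC.
- by move=> g; rewrite (ypow_w DP).
Qed.

Lemma x0y0_0 : x0 * y0 = y0 * x0 + ws c.
Proof. by rewrite y0x0_0 subrK. Qed.
Lemma x1y1_0 : x1 * y1 = y1 * x1 + ws c.
Proof. by rewrite y1x1_0 subrK. Qed.
Lemma x0y1_0 : x0 * y1 = y1 * x0 - ws (fun l => c l * zeta ^+ l).
Proof. by rewrite /y1 /x0 (y1x0 DP) addrK. Qed.
Lemma x1y0_0 : x1 * y0 = y0 * x1 - ws (fun l => c l * zeta ^- l).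
Proof. by rewrite /y0 /x1 (y0x1 DP) addrK. Qed.

Lemma xpow_center : ring_center (x0 ^+ m + x1 ^+ m).
Proof.
(* The twist by [zeta ^- l] required of [a0] in [powsum_commute] occurs for [x1], not [x0], so the
   sum is taken in the order [x1 ^+ m + x0 ^+ m]. *)
rewrite addrC; apply: (cher_center (HA := HA)).
- apply: I2_case; apply/commr_sym/commrD; apply: commrX => //; apply: xxC.
- apply: I2_case; rewrite -/y0 -/y1.
    apply: (powsum_commute DP (f := fun l => c l * zeta ^- l)); first exact: xxC.
    + exact: x1y0_0.
    + by rewrite x0y0_0 -[in LHS]wsum_zzV.
    + exact: (wsum_x1 DP).
    + exact: (wsum_x0 DP).
  apply: (powsum_commute DP (f := fun l => - c l)); first exact: xxC.
  + by rewrite x1y1_0 wsumN; congr (_ + _); apply: eq_wsum => l _; exact: esym (opprK _).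
  + by rewrite x0y1_0 /ws wsumN; congr (_ + _); apply: eq_wsum => l _; rewrite mulNr.
  + exact: (wsum_x1 DP).
  + exact: (wsum_x0 DP).
- by move=> g; rewrite addrC (xpow_w DP).
Qed.

Definition euler : A := x0 * y0 + x1 * y1 - ws c.

Lemma wsum_c_w g : w g * ws c = ws c * w g.
Proof.
have E : ws c = \sum_(h in refl D) k (param D h) * w h by rewrite (sum_refl DP).
rewrite E mulr_sumr mulr_suml (reindex_inj (conjg_inj g)) /=.
apply: eq_big => h; rewrite !(reflE DP) /conjg ?(rotM DP).
  have := rotM DP g g^-1; rewrite mulgV (rot1 DP).
  by case: (rot D g) (rot D g^-1) (rot D h) => -[] [].
move=> hr; have h2 : h \in refl D.
  move: hr; rewrite (reflE DP); have := rotM DP g g^-1; rewrite mulgV (rot1 DP).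
  by case: (rot D g) (rot D g^-1) (rot D h) => -[] [].
rewrite -[(g^-1 * _)%g]/(h ^ g)%g (paramJ DP) // mulrA -(scC HA) -!mulrA; congr (_ * _).
by rewrite -!(wwM HA) conjgE !mulgA mulgV mul1g.
Qed.

(** Against [x0], the reflection term of [[y1, x0]] cancels the one obtained by moving [ws c] past
    [x0], and [[y0, x0]] restores the summand [- ws c]. The other generators behave in the same way;
    on W, [c] is a class function. *)
Lemma euler_center : ring_center euler.
Proof.
apply: (cher_center (HA := HA)).
- apply: I2_case; rewrite -/x0 -/x1.
    rewrite /euler mulrBl mulrDl -!mulrA y0x0_0 [y1 * x0](y1x0 DP) [ws c * x0](wsum_x0 DP).
    rewrite !mulrDr !mulrN addrA addrK [x1 * (x0 * _)]mulrA [x1 * x0]xxC -/x0 -/x1 -mulrA.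
    by rewrite addrAC.
  rewrite /euler mulrBl mulrDl -!mulrA y1x1_0 [y0 * x1](y0x1 DP) [ws c * x1](wsum_x1 DP).
  rewrite !mulrDr !mulrN [x0 * (x1 * _)]mulrA [x0 * x1]xxC -/x0 -/x1 -mulrA.
  by rewrite [in LHS]addrAC -!addrA addNKr.
- apply: I2_case; rewrite -/y0 -/y1; symmetry.
    rewrite /euler mulrBr mulrDr !mulrA y0x0_0 [y0 * x1](y0x1 DP) !mulrBl !mulrDl.
    rewrite [ws c * y0](wsum_y0 DP) [wsum _ _ _ _ _ * y1](wsum_y1 DP) -/ws wsum_zzV.
    rewrite -!mulrA [y1 * y0]yyC -/y0 -/y1 -/c.
    by rewrite !addrA addrK addrAC.
  rewrite /euler mulrBr mulrDr !mulrA y1x1_0 [y1 * x0](y1x0 DP) !mulrBl !mulrDl.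
  rewrite [ws c * y1](wsum_y1 DP) [wsum _ _ _ _ _ * y0](wsum_y0 DP) -/ws wsum_zVz.
  rewrite -!mulrA [y1 * y0]yyC -/y0 -/y1 -/c.
  by rewrite [in LHS]addrAC -!addrA addNKr addrA.
- move=> g; rewrite /euler mulrBl mulrBr -/w -[ws c * w g]wsum_c_w; congr (_ - _); symmetry.
  rewrite mulrDr mulrDl; case: (boolP (rot D g)) => rg.
    have [a b] := wx_rot DP HA rg; have [a' b'] := wy_rot DP HA rg.
    congr (_ + _); [apply: w_prod a a'|apply: w_prod b b'].
      by rewrite mulVf // (kap_neq0 DP).
    by rewrite divff // (kap_neq0 DP).
  have [a b] := wx_refl DP HA rg; have [a' b'] := wy_refl DP HA rg.
  rewrite addrC; congr (_ + _); [apply: w_prod b b'|apply: w_prod a a'].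
    by rewrite mulVf // (kap_neq0 DP).
  by rewrite divff // (kap_neq0 DP).
Qed.

End Center.

Lemma mq_pi0 (A : pzRingType) (M : lmodType A) (S : set M) : \pi_(mod_quot S) 0 = 0.
Proof. by apply: (addrI (\pi_(mod_quot S) 0)); rewrite addr0 -mq_piD addr0. Qed.

(** * Baby Verma modules and their heads *)

Section Modules.
Variables (C : numFieldType) (m : nat) (gT : finGroupType) (s t : gT) (zeta : C).
Variable D : cherednik_data C gT.
Hypothesis DP : dihedral_setup m s t zeta D.
Variables (A : pzRingType) (HA : cher_alg D (idfun : {rmorphism C -> C}) 0 A).

Local Notation k := (sc HA).
Let x0 := xx HA 0.
Let x1 := xx HA 1.
Let y0 := yy HA 0.
Let y1 := yy HA 1.
Let w := ww HA.

(** [x0 x1] and [x0^m + x1^m] are the basic invariants of the dihedral group, and likewise for the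
    [y_i]. *)
Definition restricted := [/\ x0 * x1 = 0, x0 ^+ m + x1 ^+ m = 0, y0 * y1 = 0 & y0 ^+ m + y1 ^+ m = 0].

Lemma kZ c a (M : lmodType A) (v : M) : k c *: (a *: v) = a *: (k c *: v).
Proof. by rewrite !scalerA (scC HA). Qed.

Lemma kM c c' (M : lmodType A) (v : M) : k c *: (k c' *: v) = k (c * c') *: v.
Proof. by rewrite scalerA rmorphM. Qed.

Lemma k1 (M : lmodType A) (v : M) : k 1 *: v = v.
Proof. by rewrite rmorph1 scale1r. Qed.

Lemma k0 (M : lmodType A) (v : M) : k 0 *: v = 0.
Proof. by rewrite rmorph0 scale0r. Qed.

Lemma k_eq0 c (M : lmodType A) (v : M) : c != 0 -> k c *: v = 0 -> v = 0.
Proof. by move=> c0 E; rewrite -[v]k1 -(mulVf c0) -kM E scaler0. Qed.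

Lemma kN c (M : lmodType A) (v : M) : k (- c) *: v = - (k c *: v).
Proof. by rewrite rmorphN scaleNr. Qed.

Lemma kD c c' (M : lmodType A) (v : M) : k (c + c') *: v = k c *: v + k c' *: v.
Proof. by rewrite rmorphD scalerDl. Qed.

(** A W-homomorphism from [lam] to the singular vectors of [M], given by the images of the basis; it
    may be zero. *)
Definition hw_type (M : lmodType A) d (lam : gT -> 'M[C]_d) (n : 'I_d -> M) :=
  (forall g j, w g *: n j = \sum_i k (lam g i j) *: n i) /\
  (forall i j, yy HA i *: n j = 0).

(** A homomorphism out of [V] is the choice of a highest weight tuple. This universal property,
    together with a non-zero top, is the form in which baby Verma modules are used. *)
Record is_verma d (lam : gT -> 'M[C]_d) (V : lmodType A) (T : 'I_d -> V) : Prop := IsVerma {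
  verma_hw : hw_type lam T;
  verma_gen : forall v, exists a : 'I_d -> A, v = \sum_i a i *: T i;
  verma_univ : forall (M : lmodType A) (n : 'I_d -> M), hw_type lam n ->
    exists f : V -> M, (forall a v v', f (a *: v + v') = a *: f v + f v') /\
      forall j, f (T j) = n j;
  verma_neq0 : exists j, T j <> 0 }.

(** Absolute irreducibility in Burnside's form. *)
Definition spans_mx d (lam : gT -> 'M[C]_d) :=
  forall B : 'M[C]_d, exists co : gT -> C, B = \sum_g co g *: lam g.

Lemma center_comm z a (M : lmodType A) (v : M) : ring_center z -> z *: (a *: v) = a *: (z *: v).
Proof. by move=> zC; rewrite !scalerA zC. Qed.

Lemma center_sub z z' : ring_center z -> ring_center z' -> @ring_center A (z - z').
Proof. by move=> zC zC' a; rewrite mulrBl mulrBr zC zC'. Qed.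
Lemma center_mul z z' : ring_center z -> ring_center z' -> @ring_center A (z * z').
Proof. by move=> zC zC' a; rewrite -mulrA zC' mulrA zC mulrA. Qed.
Lemma center_k c : ring_center (k c).
Proof. by move=> a; rewrite (scC HA). Qed.
Lemma center_exp z n : ring_center z -> @ring_center A (z ^+ n).
Proof.
move=> zC; elim: n => [|n IH]; first by move=> a; rewrite expr0 mul1r mulr1.
by rewrite exprS; apply: center_mul.
Qed.

(** An induction on [n] reduces to a true eigenvector, on which [(z - k b) ^+ n'] is the invertible
    scalar [(a - b) ^+ n']. *)
Lemma gen_eigen_disj z a b n n' (M : lmodType A) (v : M) : ring_center z -> a != b ->
  (z - k a) ^+ n *: v = 0 -> (z - k b) ^+ n' *: v = 0 -> v = 0.
Proof.
move=> zC ab; elim: n v => [|n IH] v; first by rewrite expr0 scale1r.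
rewrite exprSr -scalerA => Hn Hn'.
have v0 : (z - k a) *: v = 0.
  apply: IH => //; rewrite center_comm ?Hn' ?scaler0 //; last first.
  by apply: center_exp; apply: center_sub => //; apply: center_k.
have zv : (z - k b) *: v = k (a - b) *: v.
  by move/eqP: v0; rewrite scalerBl subr_eq0 => /eqP vE; rewrite scalerBl vE rmorphB scalerBl.
have : k ((a - b) ^+ n') *: v = 0.
  rewrite -Hn'; clear IH Hn Hn'; elim: n' => [|n' IH']; first by rewrite !expr0 k1 scale1r.
  by rewrite exprS -kM IH' kZ -zv scalerA -exprSr.
by apply: k_eq0; rewrite expf_neq0 // subr_eq0.
Qed.

Section Restricted.
Hypothesis RA : restricted.

Lemma x1x0_eq0 : x1 * x0 = 0.
Proof. by rewrite /x1 /x0 (xxC HA); case: RA. Qed.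

Lemma xpow_eq0 : x0 ^+ m.+1 = 0 /\ x1 ^+ m.+1 = 0.
Proof.
case: RA => x01 xm _ _; move/eqP: xm; rewrite addr_eq0 => /eqP xm.
have m1 : m = m.-1.+1 by rewrite prednK ?(m_gt0 DP).
split; rewrite exprS; first by rewrite xm mulrN m1 exprS mulrA x01 mul0r oppr0.
have -> : x1 ^+ m = - x0 ^+ m by rewrite xm opprK.
by rewrite mulrN m1 exprS mulrA x1x0_eq0 mul0r oppr0.
Qed.

Lemma ypow_eq0 : y0 ^+ m.+1 = 0 /\ y1 ^+ m.+1 = 0.
Proof.
case: RA => _ _ y01 ym; move/eqP: ym; rewrite addr_eq0 => /eqP ym.
have m1 : m = m.-1.+1 by rewrite prednK ?(m_gt0 DP).
split; rewrite exprS; first by rewrite ym mulrN m1 exprS mulrA y01 mul0r oppr0.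
have -> : y1 ^+ m = - y0 ^+ m by rewrite ym opprK.
have y10 : y1 * y0 = 0 by rewrite /y1 /y0 (yyC HA).
by rewrite mulrN m1 exprS mulrA y10 mul0r oppr0.
Qed.

(** Membership in the [n]-th power of the ideal (x_0, x_1) times [M]. This filtration stands in for
    the grading of the baby Verma module. *)
Fixpoint xn (M : lmodType A) n (v : M) : Prop :=
  if n is n'.+1 then exists v1 v2, [/\ xn n' v1, xn n' v2 & v = x0 *: v1 + x1 *: v2] else True.

(** Since [x0 x1 = 0], a word of length [m + 1] in the [x_i] is zero or a pure power, and those
    vanish by [xpow_eq0]. *)
Lemma xn_eq0 (M : lmodType A) (v : M) : xn m.+1 v -> v = 0.
Proof.
move=> H; suff [v1 [v2 ->]] : exists v1 v2, v = x0 ^+ m.+1 *: v1 + x1 ^+ m.+1 *: v2.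
  by have [-> ->] := xpow_eq0; rewrite !scale0r addr0.
elim: m v H => [|n IH] v.
  by move=> [v1 [v2 [_ _ ->]]]; exists v1, v2; rewrite !expr1.
move=> [_ [_ [/IH[a1 [a2 ->]] /IH[b1 [b2 ->]] ->]]].
exists a1, b2; case: RA => x01 _ _ _.
rewrite !scalerDr !scalerA -!exprS [x1 ^+ n.+1]exprS [x0 ^+ n.+1]exprS.
by rewrite !mulrA x01 x1x0_eq0 !mul0r !scale0r addr0 add0r.
Qed.

Lemma xnD (M : lmodType A) n (v v' : M) : xn n v -> xn n v' -> xn n (v + v').
Proof.
elim: n v v' => // n IH _ _ [a1 [a2 [Ha1 Ha2 ->]]] [b1 [b2 [Hb1 Hb2 ->]]].
by exists (a1 + b1), (a2 + b2); split; [exact: IH|exact: IH|rewrite !scalerDr addrACA].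
Qed.

Lemma xn0 (M : lmodType A) n : xn n (0 : M).
Proof. by elim: n => // n IH; exists 0, 0; rewrite !scaler0 addr0. Qed.

Lemma xn_center (M : lmodType A) n z (v : M) : ring_center z -> xn n v -> xn n (z *: v).
Proof.
move=> zC; elim: n v => // n IH _ [a1 [a2 [Ha1 Ha2 ->]]].
by exists (z *: a1), (z *: a2); split; [exact: IH|exact: IH|rewrite scalerDr !(center_comm _ _ zC)].
Qed.

Lemma xn_sum (M : lmodType A) n I (l : seq I) (P : pred I) (F : I -> M) :
  (forall i, P i -> xn n (F i)) -> xn n (\sum_(i <- l | P i) F i).
Proof. by move=> H; elim/big_ind: _ => //; [exact: xn0|exact: xnD]. Qed.

Lemma xn1_x (M : lmodType A) (v : M) i : xn 1 (xx HA i *: v).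
Proof.
elim/I2_case: i; [exists v, 0|exists 0, v]; by split=> //; rewrite scaler0 ?addr0 ?add0r.
Qed.

Lemma xn1_w (M : lmodType A) (v : M) g : xn 1 v -> xn 1 (w g *: v).
Proof.
have H i c v' : xn 1 ((sc HA c * xx HA i) *: v').
  by rewrite -scalerA; apply: xn_center; [exact: center_k|exact: xn1_x].
have Hx i v' : xn 1 (w g *: (xx HA i *: v')).
  by rewrite scalerA /w (wwx HA) -scalerA sum_I2 scalerDl; apply: xnD; apply: H.
by move=> [v1 [v2 [_ _ ->]]]; rewrite scalerDr; apply: xnD; apply: Hx.
Qed.

Section Verma.
Variables (d : nat) (lam : gT -> 'M[C]_d) (V : lmodType A) (T : 'I_d -> V).
Hypotheses (VP : is_verma lam T) (lam_full : spans_mx lam).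

(** Words in the [x_i] applied to the top. That they exhaust [V] ([xspan_all]) is the spanning half
    of the triangular decomposition. *)
Inductive xspan : V -> Prop :=
| XS_T c i : xspan (k c *: T i)
| XS_add v v' : xspan v -> xspan v' -> xspan (v + v')
| XS_x i v : xspan v -> xspan (xx HA i *: v).

Lemma xspan0 : xspan 0.
Proof. by have [j _] := verma_neq0 VP; rewrite -(k0 (T j)); constructor. Qed.

Lemma xspan_sum I (l : seq I) (P : pred I) (F : I -> V) :
  (forall i, P i -> xspan (F i)) -> xspan (\sum_(i <- l | P i) F i).
Proof. by move=> H; elim/big_ind: _ => //; [exact: xspan0|exact: XS_add]. Qed.

Lemma xspanZ c v : xspan v -> xspan (k c *: v).
Proof.
elim=> [c' i|v1 v2 _ H1 _ H2|i v' _ H]; first by rewrite kM; constructor.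
  by rewrite scalerDr; constructor.
by rewrite kZ; constructor.
Qed.

Lemma xspan_w g v : xspan v -> xspan (w g *: v).
Proof.
elim=> [c i|v1 v2 _ H1 _ H2|i v' _ H].
- rewrite -kZ; apply: xspanZ; have [-> _] := verma_hw VP.
  by apply: xspan_sum => j _; constructor.
- by rewrite scalerDr; constructor.
rewrite scalerA /w (wwx HA) -scalerA sum_I2 scalerDl -!scalerA.
by apply: XS_add; apply: xspanZ; constructor.
Qed.

Lemma xspan_y i v : xspan v -> xspan (yy HA i *: v).
Proof.
elim=> [c j|v1 v2 _ H1 _ H2|j v' Hv' H].
- by rewrite -kZ; have [_ ->] := verma_hw VP; rewrite scaler0; exact: xspan0.
- by rewrite scalerDr; constructor.
have := yyxx HA i j; rewrite mul0r rmorph0 sub0r => /eqP.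
rewrite subr_eq addrC => /eqP E; rewrite scalerA E scalerDl -scalerA; apply: XS_add.
  by constructor.
rewrite scaleNr scaler_suml -sumrN; apply: xspan_sum => g _.
rewrite -scalerA -kN; apply: xspanZ; exact: xspan_w.
Qed.

Lemma xspan_all v : xspan v.
Proof.
have [a ->] := verma_gen VP v; apply: xspan_sum => i _.
move: (a i); apply: (@cherind _ _ _ _ _ _ _ HA (fun b => xspan (b *: T i))).
- by rewrite scale1r -[T i]k1; constructor.
- by move=> b b' H H'; rewrite scalerDl; constructor.
- by move=> c b H; rewrite -scalerA; apply: xspanZ.
- by move=> j b H; rewrite -scalerA; constructor.
- by move=> j b H; rewrite -scalerA; apply: xspan_y.
- by move=> g b H; rewrite -scalerA; apply: xspan_w.
Qed.

Lemma verma_decomp v : exists (al : 'cV[C]_d) v', xn 1 v' /\ v = \sum_i k (al i 0) *: T i + v'.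
Proof.
elim: {v}(xspan_all v) => [c i|v v' _ [al [u [Hu ->]]] _ [al' [u' [Hu' ->]]]|i v _ _].
- exists (\col_j (if j == i then c else 0)), 0; split; first exact: xn0.
  rewrite addr0 (bigD1 i) //= mxE eqxx big1 ?addr0 // => j /negPf ji.
  by rewrite mxE ji k0.
- exists (al + al'), (u + u'); split; first exact: xnD.
  rewrite addrACA -big_split; congr (_ + _); apply: eq_bigr => i _.
  by rewrite mxE kD.
by exists 0, (xx HA i *: v); split; [exact: xn1_x|rewrite big1 ?add0r // => j _; rewrite mxE k0].
Qed.

(** The element [b] lies in the group algebra, hence it realizes [B] on the top and preserves [xn 1]
    at the same time. *)
Lemma top_mx (B : 'M[C]_d) : exists b : A, (forall j, b *: T j = \sum_i k (B i j) *: T i) /\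
  forall v : V, xn 1 v -> xn 1 (b *: v).
Proof.
have [co ->] := lam_full B; exists (\sum_g k (co g) * w g); split.
  move=> j; rewrite scaler_suml; under eq_bigr => g _.
    rewrite -scalerA; have [-> _] := verma_hw VP; rewrite scaler_sumr.
    under eq_bigr do rewrite kM; over.
  rewrite exchange_big; apply: eq_bigr => i _ /=; rewrite -scaler_suml -rmorph_sum.
  by congr (k _ *: _); rewrite summxE; apply: eq_bigr => g _; rewrite mxE.
move=> v Hv; rewrite scaler_suml; apply: xn_sum => g _; rewrite -scalerA.
by apply: xn_center; [exact: center_k|exact: xn1_w].
Qed.

Lemma submod_closed_sub (M : lmodType A) (N : set M) : is_submodule N ->
  (forall v v', N v -> N v' -> N (v + v')) * (forall a v, N v -> N (a *: v)).
Proof.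
move=> [N0 NL]; split=> [v v' Nv Nv'|a v Nv]; first by rewrite -[v]scale1r; apply: NL.
by rewrite -[_ *: _]addr0; apply: NL.
Qed.

Lemma submodule_top (N : set V) v : is_submodule N -> N v -> ~ xn 1 v ->
  forall j, exists2 n, N n & xn 1 (T j - n).
Proof.
move=> NS Nv vx j; have [ND NZ] := submod_closed_sub NS.
have [al [v' [Hv' vE]]] := verma_decomp v.
have [i ali] : exists i, al i 0 != 0.
  apply: contrapT => /forallNP H; apply: vx; rewrite vE big1 ?add0r // => i _.
  by have /negP := H i; rewrite negbK => /eqP ->; rewrite k0.
(* A scaled matrix unit that sends the top component of [v] to [T j]. *)
have [b [bT bx]] := top_mx (\matrix_(p, q) (if (p == j) && (q == i) then (al i 0)^-1 else 0)).
exists (b *: v); first exact: NZ.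
rewrite vE scalerDr opprD addrA; rewrite [X in xn 1 (X - _)](_ : _ = 0).
  rewrite sub0r -scaleN1r; apply: xn_center; last exact: bx.
  by move=> a; rewrite mulN1r mulrN1.
apply/eqP; rewrite subr_eq0; apply/eqP; rewrite scaler_sumr (bigD1 i) //= -kZ bT.
rewrite (bigD1 j) //= mxE !eqxx /= [X in _ *: (_ + X)]big1 ?addr0; last first.
  by move=> p /negPf pj; rewrite mxE pj k0.
rewrite kM divff // k1 big1 ?addr0 // => q /negPf qi; rewrite -kZ bT big1 ?scaler0 // => p _.
by rewrite mxE qi andbF k0.
Qed.

(** Nakayama's argument: [V] is [N] plus [xn 1], and the ideal generated by the [x_i] acts
    nilpotently. *)
Lemma submodule_full (N : set V) v : is_submodule N -> N v -> ~ xn 1 v -> N = setT.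
Proof.
move=> NS Nv vx; have [ND NZ] := submod_closed_sub NS.
have base u : exists2 n, N n & xn 1 (u - n).
  elim: {u}(xspan_all u) => [c i|u u' _ [n Nn Hn] _ [n' Nn' Hn']|i u _ _].
  - have [n Nn Hn] := submodule_top NS Nv vx i; exists (k c *: n); first exact: NZ.
    by rewrite -scalerBr; apply: xn_center; first exact: center_k.
  - exists (n + n'); first exact: ND.
    by rewrite opprD addrACA; apply: xnD.
  by exists 0; [case: NS|rewrite subr0; apply: xn1_x].
have H p u : exists2 n, N n & xn p.+1 (u - n).
  elim: p u => [|p IH] u; first exact: base.
  have [n Nn [v1 [v2 [_ _ E]]]] := base u.
  have [n1 Nn1 H1] := IH v1; have [n2 Nn2 H2] := IH v2.
  exists (n + (x0 *: n1 + x1 *: n2)); first by apply: (ND) => //; apply: (ND); apply: (NZ).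
  rewrite opprD addrA E; exists (v1 - n1), (v2 - n2); split=> //.
  by rewrite !scalerBr opprD addrACA.
apply/seteqP; split=> // u _; have [n Nn /xn_eq0/eqP] := H m u.
by rewrite subr_eq0 => /eqP ->.
Qed.

(** Otherwise all of [V] lies in [xn 1], hence in every [xn n], hence is zero. *)
Lemma verma_not_xn1 : exists j, ~ xn 1 (T j).
Proof.
have [j Tj0] := verma_neq0 VP; apply: contrapT => /forallNP H.
have H1 (u : V) : xn 1 u.
  elim: {u}(xspan_all u) => [c i|u u' _ Hu _ Hu'|i u _ _]; last exact: xn1_x.
    by apply: xn_center; [exact: center_k|apply: contrapT; exact: H].
  exact: xnD.
apply: Tj0; apply: xn_eq0; elim: (m.+1) (T j) => // n IH u.
by have [v1 [v2 [_ _ ->]]] := H1 u; exists v1, v2.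
Qed.

(** By [submodule_full] a proper submodule lies inside [xn 1], so the largest submodule inside
    [xn 1] is the unique maximal submodule. *)
Lemma radicalE (v : V) : radical v <-> forall a, xn 1 (a *: v).
Proof.
pose N0 : set V := [set u | forall a, xn 1 (a *: u)].
have NS0 : is_submodule N0.
  split=> [a|b u u' Hu Hu' a]; first by rewrite scaler0; exact: xn0.
  by rewrite scalerDr scalerA; apply: xnD.
have N0T : N0 <> setT.
  have [j Tj] := verma_not_xn1 => E; apply: Tj.
  have NT : N0 (T j) by rewrite E.
  by have := NT 1; rewrite scale1r.
have sub (N : set V) : is_submodule N -> N <> setT -> N `<=` N0.
  move=> NS NT u Nu a; apply: contrapT => H; apply: NT.
  by apply: (submodule_full NS _ H); have [_ NZ] := submod_closed_sub NS; apply: NZ.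
split=> [Hv|Hv N [NS NT Nmax]].
  apply: (Hv N0); split=> // N' N'S N0N'; have [->|N'T] := pselect (N' = setT); [by right|left].
  by apply/seteqP; split=> //; apply: sub.
by have [<-|//] := Nmax _ NS0 (sub _ NS NT).
Qed.

(** A matrix unit would move a non-zero top vector in [xn 1] to a [T j] outside [xn 1]. *)
Lemma xn1_indep (al : 'cV[C]_d) : xn 1 (\sum_i k (al i 0) *: T i) -> al = 0.
Proof.
move=> H; apply: contrapT => al0; have [j Tj] := verma_not_xn1; apply: Tj.
have [i ali] : exists i, al i 0 != 0.
  apply: contrapT => /forallNP Hi; apply: al0; apply/matrixP => p q; rewrite (ord1 q) mxE.
  by have /negP := Hi p; rewrite negbK => /eqP.
have [b [bT bx]] := top_mx (\matrix_(p, q) (if (p == j) && (q == i) then (al i 0)^-1 else 0)).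
have := bx _ H; rewrite scaler_sumr (bigD1 i) //= -kZ bT.
rewrite (bigD1 j) //= mxE !eqxx /= [X in _ *: (_ + X)]big1 ?addr0; last first.
  by move=> p /negPf pj; rewrite mxE pj k0.
rewrite kM divff // k1 big1 ?addr0 // => q /negPf qi; rewrite -kZ bT big1 ?scaler0 // => p _.
by rewrite mxE qi andbF k0.
Qed.

Lemma commute_scalar (B : 'M[C]_d) : (forall B', B *m B' = B' *m B) -> exists c, B = c%:M.
Proof.
have [j0 _] := verma_neq0 VP => H; exists (B j0 j0); apply/matrixP => i j.
have := H (delta_mx j j0) => /matrixP/(_ i j0).
rewrite !mxE (bigD1 j) //= mxE !eqxx mulr1 big1 ?addr0; last first.
  by move=> p /negPf pj; rewrite mxE pj mulr0.
move=> ->; rewrite (bigD1 j0) //= !mxE !eqxx andbT big1 ?addr0; last first.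
  by move=> p /negPf pj; rewrite mxE pj andbF mul0r.
by case: eqP; rewrite ?mul1r ?mul0r ?mulr1n ?mulr0n.
Qed.

(** Schur's lemma on the top: modulo [xn 1] the element [z] acts by a matrix commuting with W, hence
    by a scalar, and centrality carries this scalar to every layer of the filtration. *)
Lemma center_scalar z : ring_center z -> exists c, forall n (v : V), xn n v -> xn n.+1 ((z - k c) *: v).
Proof.
move=> zC.
have /choice[be beP] : forall j, exists al : 'cV[C]_d, xn 1 (z *: T j - \sum_i k (al i 0) *: T i).
  move=> j; have [al [v' [Hv' ->]]] := verma_decomp (z *: T j); exists al.
  by rewrite addrAC subrr add0r.
pose B : 'M[C]_d := \matrix_(i, j) be j i 0.
(* Both products give the coordinates of [z g T_j] in the top modulo [xn 1], and these coordinates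
   are unique by [xn1_indep]. *)
have Bw g : B *m lam g = lam g *m B.
  apply/matrixP => i j; apply/eqP; rewrite -subr_eq0; apply/eqP.
  suff /matrixP/(_ i 0) : \col_i ((B *m lam g) i j - (lam g *m B) i j) = 0 by rewrite !mxE.
  apply: xn1_indep.
  pose u := \sum_l k (lam g l j) *: (z *: T l - \sum_i k (be l i 0) *: T i).
  pose u' := w g *: (z *: T j - \sum_i k (be j i 0) *: T i).
  have Hu : xn 1 u by apply: xn_sum => l _; apply: xn_center => //; exact: center_k.
  have Hu' : xn 1 u' by apply: xn1_w.
  have -> : \sum_i k ((\col_i ((B *m lam g) i j - (lam g *m B) i j)) i 0) *: T i = u' - u.
    under eq_bigr do rewrite mxE rmorphB scalerBl.
    rewrite sumrB /u' /u.
    have [wT _] := verma_hw VP.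
    have E1 : w g *: (z *: T j) = \sum_l k (lam g l j) *: (z *: T l).
      by rewrite -(center_comm _ _ zC) wT scaler_sumr; apply: eq_bigr => l _; rewrite kZ.
    rewrite scalerBr E1; under [X in _ = _ - X]eq_bigr do rewrite scalerBr.
    rewrite [X in _ = _ - X]sumrB opprB [in RHS]addrC addrA subrK; congr (_ - _).
      under [RHS]eq_bigr => l _.
        rewrite scaler_sumr; under eq_bigr do rewrite kM; over.
      rewrite exchange_big /=; apply: eq_bigr => i' _; rewrite -scaler_suml -rmorph_sum.
      by congr (k _ *: _); rewrite mxE; apply: eq_bigr => l _; rewrite mxE mulrC.
    rewrite scaler_sumr; under [RHS]eq_bigr => l _.
      rewrite -kZ wT scaler_sumr; under eq_bigr do rewrite kM; over.
    rewrite exchange_big /=; apply: eq_bigr => i' _; rewrite -scaler_suml -rmorph_sum.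
    by congr (k _ *: _); rewrite mxE; apply: eq_bigr => l _; rewrite mxE mulrC.
  by apply: xnD => //; rewrite -scaleN1r; apply: xn_center => // a; rewrite mulN1r mulrN1.
have [c Bc] : exists c, B = c%:M.
  apply: commute_scalar => B'; have [co ->] := lam_full B'.
  rewrite mulmx_sumr mulmx_suml; apply: eq_bigr => g _.
  by rewrite -scalemxAr Bw scalemxAl.
have zT j : xn 1 ((z - k c) *: T j).
  rewrite scalerBl; suff -> : k c *: T j = \sum_i k (be j i 0) *: T i by [].
  rewrite (bigD1 j) //= big1 ?addr0 => [|i /negPf ij]; have := congr1 (fun M : 'M_d => M _ j) Bc.
    by move=> /(_ j); rewrite !mxE eqxx mulr1n => ->.
  by move=> /(_ i); rewrite !mxE ij mulr0n => ->; rewrite k0.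
have zkC : ring_center (z - k c) by apply: center_sub => //; exact: center_k.
exists c => n; elim: n => [|n IH] v.
  move=> _; elim: {v}(xspan_all v) => [c' i|u u' _ Hu _ Hu'|i u _ _].
  - by rewrite -kZ; apply: xn_center => //; exact: center_k.
  - by rewrite scalerDr; apply: xnD.
  - by rewrite center_comm //; exact: xn1_x.
move=> [v1 [v2 [H1 H2 ->]]]; exists ((z - k c) *: v1), ((z - k c) *: v2).
by split; [exact: IH|exact: IH|rewrite scalerDr !(center_comm _ _ zkC)].
Qed.

Let L : lmodType A := mod_head V.

Lemma head_eq0 v : \pi_(mod_quot (@radical A V)) v = 0 :> L <-> radical v.
Proof.
have <- : \pi_(mod_quot (@radical A V)) 0 = 0 :> L by exact: mq_pi0.
have -> : (\pi_(mod_quot (@radical A V)) v = \pi_(mod_quot (@radical A V)) 0) <->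
  submod_gen (@radical A V) (v - 0) by exact: mod_quotE.
rewrite subr0; split=> [|Hv N NS]; last exact.
apply=> //; split=> [N [[]] //|a u u' Hu Hu' N Nmax].
by case: (Nmax) => -[_ NL] _ _; apply: NL; [exact: Hu|exact: Hu'].
Qed.

Definition hpi (v : V) : L := \pi_(mod_quot (@radical A V)) v.

Lemma hpiZ a v : hpi (a *: v) = a *: hpi v.
Proof. exact: mq_piZ. Qed.
Lemma hpiD v v' : hpi (v + v') = hpi v + hpi v'.
Proof. exact: mq_piD. Qed.
Lemma hpi_surj (u : L) : exists v, u = hpi v.
Proof. by exists (repr u); rewrite /hpi reprK. Qed.

Definition acts z c := forall v : L, z *: v = k c *: v.

Lemma head_neq0 : exists j, hpi (T j) <> 0.
Proof.
have [j Tj] := verma_not_xn1; exists j => /head_eq0/radicalE/(_ 1).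
by rewrite scale1r.
Qed.

Lemma acts_uniq z c c' : acts z c -> acts z c' -> c = c'.
Proof.
move=> H H'; have [j Lj] := head_neq0; apply/eqP; rewrite -subr_eq0; apply: contrapT => cc'.
apply: Lj; apply: (k_eq0 (c := c - c')); first exact/negP.
by rewrite rmorphB scalerBl -H -H' subrr.
Qed.

(** [z - k c] raises the filtration, so it vanishes on the head and is nilpotent on [V]. The second
    fact is what allows comparison of different baby Verma modules. *)
Lemma center_acts z : ring_center z ->
  exists c, acts z c /\ forall v : V, (z - k c) ^+ m.+1 *: v = 0.
Proof.
move=> zC; have [c cP] := center_scalar zC; exists c; split.
  move=> u; have [v ->] := hpi_surj u; apply/eqP; rewrite -subr_eq0 -scalerBl -hpiZ; apply/eqP.
  apply/head_eq0/radicalE => a; rewrite -center_comm; first exact: (cP 0%N).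
  by apply: center_sub => //; exact: center_k.
move=> v; apply: xn_eq0; elim: (m.+1) => [|n IH]; first by [].
by rewrite exprS -scalerA; apply: cP.
Qed.

Lemma acts_nilp z c : ring_center z -> acts z c -> forall v : V, (z - k c) ^+ m.+1 *: v = 0.
Proof. by move=> zC zc; have [c' [zc' H]] := center_acts zC; rewrite (acts_uniq zc zc'). Qed.

End Verma.

(** The singular vectors [n] give a non-zero homomorphism from [V'] to [V]; on its image [z] has the
    generalised eigenvalues of both modules, so the two scalars agree. *)
Lemma acts_link d (lam : gT -> 'M[C]_d) (V : lmodType A) (T : 'I_d -> V)
    d' (mu : gT -> 'M[C]_d') (V' : lmodType A) (T' : 'I_d' -> V') (n : 'I_d' -> V) j :
  is_verma lam T -> spans_mx lam -> is_verma mu T' -> spans_mx mu ->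
  hw_type mu n -> n j <> 0 ->
  forall z c, ring_center z -> acts V z c <-> acts V' z c.
Proof.
move=> VP lf VP' mf nt nj z c zC.
have [c1 [H1 N1]] := center_acts VP lf zC; have [c2 [H2 N2]] := center_acts VP' mf zC.
have [f [fL fT]] := verma_univ VP' nt.
have f0 : f 0 = 0 by have := fL (-1) 0 0; rewrite scaler0 addr0 scaleN1r addNr.
have E : c1 = c2.
  apply/eqP; apply: contrapT => /negP c12; apply: nj.
  apply: (gen_eigen_disj zC c12 (N1 (n j)) (n' := m.+1)).
  by rewrite -(fT j) -[_ *: _]addr0 -f0 -fL addr0 N2 f0.
split=> H; first by rewrite (acts_uniq VP lf H H1) E.
by rewrite (acts_uniq VP' mf H H2) -E.
Qed.

End Restricted.
End Modules.

Lemma mul_pow_eq0 (A : pzRingType) (a b : A) p q : a * b = 0 -> (0 < p)%N -> (0 < q)%N ->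
  a ^+ p * b ^+ q = 0.
Proof.
move=> ab; case: p q => [|p] [|q] // _ _.
by rewrite exprSr exprS -mulrA (mulrA a) ab mul0r mulr0.
Qed.

(** * ** Evaluating invariant polynomials *)

Section PolyEval.
Variables (C : numFieldType) (K : comNzRingType) (iota : {rmorphism C -> K}).
Variables (A : lalgType K) (B : pzRingType) (phi : {rmorphism A -> B}) (g : 'I_2 -> A).

Definition poly_eval (p : {mpoly C[2]}) : B := phi (mpoly.mmap (fun c => (iota c)%:A) g p).
Let b0 := phi (g 0).
Let b1 := phi (g 1).
Let kb c := phi (iota c)%:A.

Let f : {additive C -> A} := GRing.in_alg A \o iota.
Lemma poly_evalD p q : poly_eval (p + q) = poly_eval p + poly_eval q.
Proof. by rewrite -rmorphD; congr (phi _); exact: (raddfD (mpoly.mmap f g)). Qed.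

Lemma poly_eval0 : poly_eval 0 = 0.
Proof. by rewrite -[RHS](rmorph0 phi); congr (phi _); exact: (raddf0 (mpoly.mmap f g)). Qed.

Lemma kb0 : kb 0 = 0.
Proof. by rewrite /kb rmorph0 scale0r rmorph0. Qed.
Lemma kb1 : kb 1 = 1.
Proof. by rewrite /kb rmorph1 scale1r rmorph1. Qed.
Lemma kbM c d : kb (c * d) = kb c * kb d.
Proof. exact: (rmorphM (phi \o GRing.in_alg A \o iota : {rmorphism C -> B}) c d). Qed.
Lemma kbD c d : kb (c + d) = kb c + kb d.
Proof. by rewrite /kb -rmorphD rmorphD scalerDl. Qed.

Lemma poly_evalZX c n : poly_eval (c *: 'X_[n]) = kb c * (b0 ^+ n 0 * b1 ^+ n 1).
Proof.
have [->|c0] := eqVneq c 0; first by rewrite scale0r poly_eval0 kb0 mul0r.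
rewrite /poly_eval /mpoly.mmap (perm_big _ (mpoly.msuppZ _ c0)) /= mpoly.msuppX big_seq1.
rewrite mpoly.mcoeffZ mcoeffX eqxx mulr1 rmorphM; congr (_ * _).
rewrite /mmap1 big_ord_recl big_ord1 rmorphM !rmorphXn.
by congr (_ * phi (g _) ^+ (n _)); apply: val_inj.
Qed.

Lemma poly_eval_sum p : poly_eval p = \sum_(n <- mpoly.msupp p) kb p@_n * (b0 ^+ n 0 * b1 ^+ n 1).
Proof.
rewrite {1}[p]mpolyE; elim: (mpoly.msupp p : seq _) => [|n l IH].
  by rewrite !big_nil poly_eval0.
by rewrite !big_cons poly_evalD poly_evalZX IH.
Qed.

Lemma poly_eval_sumZ I (l : seq I) (c : I -> C) (e : I -> 'X_{1..2}) :
  poly_eval (\sum_(i <- l) c i *: 'X_[e i]) = \sum_(i <- l) kb (c i) * (b0 ^+ e i 0 * b1 ^+ e i 1).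
Proof.
elim: l => [|n l IH]; first by rewrite !big_nil poly_eval0.
by rewrite !big_cons poly_evalD poly_evalZX IH.
Qed.

Definition mswap (n : 'X_{1..2}) : 'X_{1..2} := [multinom n (rev_ord i) | i < 2].

Lemma mswap0 n : mswap n 0 = n 1.
Proof. by rewrite mnmE; congr (n _); apply: val_inj. Qed.
Lemma mswap1 n : mswap n 1 = n 0.
Proof. by rewrite mnmE; congr (n _); apply: val_inj. Qed.

Lemma comp_scaleX (l0 l1 : {mpoly C[2]}) n :
  'X_[n] \mPo [tuple (if j == 0 then l0 else l1) | j < 2] = l0 ^+ n 0 * l1 ^+ n 1.
Proof.
rewrite comp_mpolyX big_ord_recl big_ord1 !tnth_mktuple /=.
by congr (_ * l1 ^+ (n _)); apply: val_inj.
Qed.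

Lemma mpolyX2 (n : 'X_{1..2}) : 'X_0 ^+ n 0 * 'X_1 ^+ n 1 = 'X_[n] :> {mpoly C[2]}.
Proof.
rewrite [RHS]mpolyXE_id big_ord_recl big_ord1.
by have -> : lift ord0 ord0 = 1 :> 'I_2 by apply: val_inj.
Qed.

Lemma comp_swap (p : {mpoly C[2]}) : p \mPo [tuple (if j == 0 then 'X_1 else 'X_0) | j < 2] =
  \sum_(n <- mpoly.msupp p) p@_n *: 'X_[mswap n].
Proof.
rewrite {1}[p]mpolyE raddf_sum; apply: eq_bigr => n _ /=; rewrite comp_mpolyZ comp_scaleX.
by rewrite -(mpolyX2 (mswap n)) mswap0 mswap1 mulrC.
Qed.

Lemma comp_scale (p : {mpoly C[2]}) c d :
  p \mPo [tuple (if j == 0 then c *: 'X_0 else d *: 'X_1) | j < 2] =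
  \sum_(n <- mpoly.msupp p) (p@_n * (c ^+ n 0 * d ^+ n 1)) *: 'X_[n].
Proof.
rewrite {1}[p]mpolyE raddf_sum; apply: eq_bigr => n _ /=; rewrite comp_mpolyZ comp_scaleX.
by rewrite !exprZn -scalerAl -scalerAr !scalerA (mpolyX2 n) mulrA.
Qed.

Lemma comp_scale_coef (p : {mpoly C[2]}) c d n :
  p \mPo [tuple (if j == 0 then c *: 'X_0 else d *: 'X_1) | j < 2] = p ->
  p@_n * (c ^+ n 0 * d ^+ n 1) = p@_n.
Proof.
move=> E; rewrite -[in RHS]E comp_scale [in LHS](mpolyE p) !raddf_sum mulr_suml.
apply: eq_bigr => n' _ /=; rewrite !mpoly.mcoeffZ mcoeffX.
by case: eqP => [->|]; rewrite ?mulr1 ?mulr0 ?mul0r.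
Qed.

Variables (m : nat) (z : C).
Hypotheses (zP : m.-primitive_root z) (m0 : (0 < m)%N).
Hypotheses (b01 : b0 * b1 = 0) (b10 : b1 * b0 = 0) (bm : b0 ^+ m + b1 ^+ m = 0).

Lemma bpow_eq0 : b0 ^+ m.+1 = 0 /\ b1 ^+ m.+1 = 0.
Proof.
move/eqP: bm; rewrite addr_eq0 => /eqP xm.
have m1 : m = m.-1.+1 by rewrite prednK.
split; rewrite exprS; first by rewrite xm mulrN m1 exprS mulrA b01 mul0r oppr0.
have -> : b1 ^+ m = - b0 ^+ m by rewrite xm opprK.
by rewrite mulrN m1 exprS mulrA b10 mul0r oppr0.
Qed.

(** Rotation invariance forces the two exponents of each monomial to agree modulo [m]. Mixed
    monomials vanish because [b0 b1 = 0], pure powers of degree at least [2 m] by [bpow_eq0], and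
    those of degree [m] cancel in pairs under the swap. Thus invariants are evaluated without
    expressing them through the basic ones. *)
Lemma poly_eval_invariant (p : {mpoly C[2]}) :
  p \mPo [tuple (if j == 0 then 'X_1 else 'X_0) | j < 2] = p ->
  p \mPo [tuple (if j == 0 then z^-1 *: 'X_0 else z *: 'X_1) | j < 2] = p \/
  p \mPo [tuple (if j == 0 then z *: 'X_0 else z^-1 *: 'X_1) | j < 2] = p ->
  poly_eval p = kb p@_0%MM.
Proof.
move=> ps pr.
have z0 : z != 0.
  apply/eqP => z0; have := prim_expr_order zP; rewrite z0 expr0n.
  by case: (m) m0 => // n _ /eqP; rewrite eq_sym oner_eq0.
have modE n : p@_n != 0 -> modn (n 0) m = modn (n 1) m.
  move=> pn; apply/eqP; rewrite -(eq_prim_root_expr zP); apply/eqP.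
  case: pr => /(@comp_scale_coef p _ _ n); rewrite -{2}[p@_n]mulr1 => /(mulfI pn).
    by rewrite exprVn => /(congr1 (fun x => z ^+ n 0 * x)); rewrite mulrA divff ?expf_neq0 // mul1r mulr1.
  by rewrite exprVn => /(congr1 (fun x => x * z ^+ n 1)); rewrite mulfVK ?expf_neq0 // mul1r.
(* Doubling pairs each monomial with its image under the swap, which exhibits
   [b0 ^+ m + b1 ^+ m]. *)
have E2 : kb 2 * poly_eval p = kb 2 * kb p@_0%MM.
  have p0E : p@_0%MM = \sum_(n <- mpoly.msupp p) p@_n * (n == 0%MM)%:R.
    rewrite {1}[p]mpolyE raddf_sum; apply: eq_bigr => n _ /=.
    by rewrite mpoly.mcoeffZ mcoeffX.
  have kb_sum I (l : seq I) (F : I -> C) : kb (\sum_(i <- l) F i) = \sum_(i <- l) kb (F i).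
    by elim: l => [|i l IH]; rewrite ?big_nil ?kb0 // !big_cons kbD IH.
  have ev2 : kb 2 * poly_eval p = \sum_(n <- mpoly.msupp p)
      kb p@_n * (b0 ^+ n 0 * b1 ^+ n 1 + b0 ^+ n 1 * b1 ^+ n 0).
    rewrite -[2%:R]/(1 + 1) kbD kb1 mulrDl mul1r -{2}ps comp_swap poly_eval_sumZ poly_eval_sum.
    by rewrite -big_split; apply: eq_bigr => n _; rewrite mswap0 mswap1 mulrDr.
  rewrite ev2 p0E kb_sum mulr_sumr; apply: eq_bigr => n _.
  rewrite -[2%:R]/(1 + 1) kbD kb1 mulrDl mul1r -kbD.
  have [->|pn] := eqVneq p@_n 0; first by rewrite !mul0r addr0 kb0 !mul0r.
  have := modE _ pn; have [n0|n0] := posnP (n 0); have [n1|n1] := posnP (n 1).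
  - have -> : n = 0%MM by apply/mnmP; apply: I2_case; rewrite mnm0E.
    by rewrite eqxx mulr1 !mnm0E !expr0 !mulr1 mulrDr mulr1 kbD.
  - rewrite n0 mod0n => /esym/eqP mn.
    have -> : (n == 0%MM) = false by apply: contraTF n1 => /eqP ->; rewrite mnm0E.
    rewrite mulr0 addr0 kb0 !expr0 mul1r mulr1 addrC.
    move: mn => /dvdnP[[|[|q]] E]; first by rewrite E mul0n in n1.
      by rewrite E mul1n bm mulr0.
    rewrite E; have -> : (q.+2 * m = m.+1 + (q * m + m.-1))%N.
      by rewrite !mulSn; move: m0; lia.
    by rewrite !exprD; have [-> ->] := bpow_eq0; rewrite !mul0r addr0 mulr0.
  - rewrite n1 mod0n => /eqP mn.
    have -> : (n == 0%MM) = false by apply: contraTF n0 => /eqP ->; rewrite mnm0E.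
    rewrite mulr0 addr0 kb0 !expr0 mul1r mulr1.
    move: mn => /dvdnP[[|[|q]] E]; first by rewrite E mul0n in n0.
      by rewrite E mul1n bm mulr0.
    rewrite E; have -> : (q.+2 * m = m.+1 + (q * m + m.-1))%N.
      by rewrite !mulSn; move: m0; lia.
    by rewrite !exprD; have [-> ->] := bpow_eq0; rewrite !mul0r addr0 mulr0.
  move=> _; have -> : (n == 0%MM) = false by apply: contraTF n0 => /eqP ->; rewrite mnm0E.
  by rewrite (mul_pow_eq0 b01 n0 n1) (mul_pow_eq0 b01 n1 n0) addr0 !mulr0 addr0 kb0.
by rewrite -[LHS]mul1r -[RHS]mul1r -kb1 -(mulVf (_ : 2%:R != 0 :> C)) ?pnatr_eq0 // kbM -!mulrA E2.
Qed.

End PolyEval.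

Lemma rmorph_sum_mul (C : pzRingType) (A B : pzRingType) (f : {rmorphism A -> B}) (P : eqType)
    (X Y : P -> A) (cx cy : P -> C) (k : C -> B) (l : seq P) :
  k 0 = 0 -> (forall c d, k (c + d) = k c + k d) -> (forall c d, k (c * d) = k c * k d) ->
  (forall p, p \in l -> f (X p) = k (cx p) /\ f (Y p) = k (cy p)) ->
  f (\sum_(p <- l) X p * Y p) = k (\sum_(p <- l) cx p * cy p).
Proof.
move=> k_0 kD kM; elim: l => [|p l IH] lP; first by rewrite !big_nil rmorph0.
have [fX fY] := lP p (mem_head _ _); rewrite !big_cons rmorphD rmorphM fX fY IH ?kD ?kM //.
by move=> q ql; apply: lP; rewrite inE ql orbT.
Qed.

Lemma rmorph_powsum (A B : pzRingType) (f : {rmorphism A -> B}) a b n :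
  f (a ^+ n + b ^+ n) = f a ^+ n + f b ^+ n.
Proof. by rewrite rmorphD !rmorphXn. Qed.

(** * ** The relations of the restricted algebra *)

Section Concrete.
Variables (C : numFieldType) (m : nat) (gT : finGroupType) (s t : gT) (zeta : C).
Variable D : cherednik_data C gT.
Hypothesis DP : dihedral_setup m s t zeta D.

Definition HcA : cher_alg D (idfun : {rmorphism C -> C}) 0 (Hc D) :=
  cherednik_alg D (idfun : {rmorphism C -> C}) 0.
Definition HbA : cher_alg D (idfun : {rmorphism C -> C}) 0 (Hbar D) :=
  cher_alg_quot HcA (@invariants_plus C gT D).

Let FA := free_algebra gT C.
Let pc : {rmorphism FA -> Hc D} := @rq_pi FA _.
Let pb : {rmorphism Hc D -> Hbar D} := @rq_pi (Hc D) (@invariants_plus C gT D).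

Lemma xpolyE p : @xpoly C gT D p = poly_eval (idfun : {rmorphism C -> C}) pc (gx gT C) p.
Proof. reflexivity. Qed.
Lemma ypolyE p : @ypoly C gT D p = poly_eval (idfun : {rmorphism C -> C}) pc (gy gT C) p.
Proof. reflexivity. Qed.

Lemma sV : (s^-1 = s)%g.
Proof. by apply/eqP; rewrite eq_invg_mul (ss1 DP). Qed.

Lemma hrep_st : hrep D (s * t)%g = \matrix_(i, j) (if i == j then if i == 0 then zeta else zeta^-1 else 0).
Proof. exact: (hrep_r DP). Qed.

Lemma x_invariant_swap (p : {mpoly C[2]}) : x_invariant D p ->
  p \mPo [tuple (if j == 0 then 'X_1 else 'X_0) | j < 2] = p.
Proof.
move=> /(_ s); rewrite sV => E; rewrite -[RHS]E; congr comp_mpoly; apply: eq_from_tnth => j.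
rewrite !tnth_mktuple sum_I2 (hrep_s DP).
by elim/I2_case: j; rewrite !antidiagE ?scale0r ?scale1r ?addr0 ?add0r.
Qed.

Lemma x_invariant_scale (p : {mpoly C[2]}) : x_invariant D p ->
  p \mPo [tuple (if j == 0 then zeta *: 'X_0 else zeta^-1 *: 'X_1) | j < 2] = p.
Proof.
move=> /(_ (s * t)^-1%g); rewrite invgK => E; rewrite -[RHS]E; congr comp_mpoly.
apply: eq_from_tnth => j; rewrite !tnth_mktuple sum_I2 hrep_st.
by elim/I2_case: j; rewrite !mxE ?scale0r ?scale1r ?addr0 ?add0r.
Qed.

Lemma y_invariant_swap (p : {mpoly C[2]}) : y_invariant D p ->
  p \mPo [tuple (if j == 0 then 'X_1 else 'X_0) | j < 2] = p.
Proof.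
move=> /(_ s) E; rewrite -[RHS]E; congr comp_mpoly; apply: eq_from_tnth => j.
rewrite !tnth_mktuple sum_I2 (hrep_s DP).
by elim/I2_case: j; rewrite !antidiagE ?scale0r ?scale1r ?addr0 ?add0r.
Qed.

Lemma y_invariant_scale (p : {mpoly C[2]}) : y_invariant D p ->
  p \mPo [tuple (if j == 0 then zeta *: 'X_0 else zeta^-1 *: 'X_1) | j < 2] = p.
Proof.
move=> /(_ (s * t)%g) E; rewrite -[RHS]E; congr comp_mpoly.
apply: eq_from_tnth => j; rewrite !tnth_mktuple sum_I2 hrep_st.
by elim/I2_case: j; rewrite !mxE ?scale0r ?scale1r ?addr0 ?add0r.
Qed.

Lemma monomial_invariant (q : 'I_2 -> {mpoly C[2]}) (d : C) :
  d != 0 -> d ^+ m = 1 ->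
  (q 0 = d *: 'X_0 /\ q 1 = d^-1 *: 'X_1) \/ (q 0 = d *: 'X_1 /\ q 1 = d^-1 *: 'X_0) ->
  ('X_0 * 'X_1) \mPo [tuple q j | j < 2] = 'X_0 * 'X_1 /\
  ('X_0 ^+ m + 'X_1 ^+ m) \mPo [tuple q j | j < 2] = 'X_0 ^+ m + 'X_1 ^+ m.
Proof.
move=> d0 dm qE.
have q0 : 'X_0 \mPo [tuple q j | j < 2] = q 0 by rewrite comp_mpolyXU -tnth_nth tnth_mktuple.
have q1 : 'X_1 \mPo [tuple q j | j < 2] = q 1 by rewrite comp_mpolyXU -tnth_nth tnth_mktuple.
have dV : d^-1 ^+ m = 1 by rewrite exprVn dm invr1.
split.
  rewrite rmorphM /= q0 q1; case: qE => -[-> ->]; rewrite -scalerAl -scalerAr scalerA divff // scale1r //.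
  by rewrite mulrC.
rewrite rmorphD !rmorphXn /= q0 q1; case: qE => -[-> ->]; rewrite !exprZn dm dV !scale1r //.
by rewrite addrC.
Qed.

Lemma basic_x_invariant : x_invariant D ('X_0 * 'X_1) /\ x_invariant D ('X_0 ^+ m + 'X_1 ^+ m).
Proof.
suff H w : exists2 d : C, d != 0 /\ d ^+ m = 1 &
  let q j : {mpoly C[2]} := \sum_i hrep D w^-1 j i *: 'X_i in
  (q 0 = d *: 'X_0 /\ q 1 = d^-1 *: 'X_1) \/ (q 0 = d *: 'X_1 /\ q 1 = d^-1 *: 'X_0).
  by split=> w; have [d [d0 dm] /(monomial_invariant d0 dm)[]] := H w.
exists (kap D w^-1); first by rewrite (kap_neq0 DP) (kapm DP).
rewrite /= !sum_I2 (hrepE DP); case: (rot _ _); [left|right];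
  by rewrite ?antidiagE ?mxE /= ?scale0r ?addr0 ?add0r.
Qed.

Lemma basic_y_invariant : y_invariant D ('X_0 * 'X_1) /\ y_invariant D ('X_0 ^+ m + 'X_1 ^+ m).
Proof.
suff H w : exists2 d : C, d != 0 /\ d ^+ m = 1 &
  let q j : {mpoly C[2]} := \sum_i hrep D w i j *: 'X_i in
  (q 0 = d *: 'X_0 /\ q 1 = d^-1 *: 'X_1) \/ (q 0 = d *: 'X_1 /\ q 1 = d^-1 *: 'X_0).
  by split=> w; have [d [d0 dm] /(monomial_invariant d0 dm)[]] := H w.
have [rw|rw] := boolP (rot D w).
  exists (kap D w); first by rewrite (kap_neq0 DP) (kapm DP).
  left; rewrite !sum_I2 (hrepE DP) rw !mxE /= ?scale0r ?addr0 ?add0r //.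
exists (kap D w)^-1; first by rewrite invr_eq0 (kap_neq0 DP) exprVn (kapm DP) invr1.
by right; rewrite !sum_I2 (hrepE DP) (negPf rw) !mxE /= invrK ?scale0r ?addr0 ?add0r.
Qed.

Lemma X0X1E : 'X_0 * 'X_1 = 1 *: 'X_[U_(0) + U_(1)] :> {mpoly C[2]}.
Proof. by rewrite scale1r mpolyXD. Qed.
Lemma XmE (i : 'I_2) n : 'X_i ^+ n = 1 *: 'X_[U_(i) *+ n] :> {mpoly C[2]}.
Proof. by rewrite scale1r -mpolyXn. Qed.

Lemma poly_eval_basic (B : pzRingType) (phi : {rmorphism FA -> B}) (g : 'I_2 -> FA) :
  poly_eval (idfun : {rmorphism C -> C}) phi g ('X_0 * 'X_1) = phi (g 0) * phi (g 1) /\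
  poly_eval (idfun : {rmorphism C -> C}) phi g ('X_0 ^+ m + 'X_1 ^+ m) =
    phi (g 0) ^+ m + phi (g 1) ^+ m.
Proof.
split; first by rewrite X0X1E poly_evalZX kb1 mul1r !mnmDE !mnm1E /= !expr1.
by rewrite !XmE poly_evalD !poly_evalZX !kb1 !mul1r !mulmnE !mnm1E /= mul0n mul1n !expr0 mulr1 mul1r.
Qed.

Lemma const_basic : const_term ('X_0 * 'X_1 : {mpoly C[2]}) = 0 /\
  const_term ('X_0 ^+ m + 'X_1 ^+ m : {mpoly C[2]}) = 0.
Proof.
have H (i : 'I_2) : ((U_(i) *+ m)%MM == 0%MM) = false.
  apply/negP => /eqP/mnmP/(_ i); rewrite mulmnE mnm1E eqxx mnm0E mul1n => m0.
  by have := m_gt0 DP; rewrite m0.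
have H1 : ((U_(0%R : 'I_2) + U_(1%R : 'I_2))%MM == 0%MM) = false.
  by apply/negP => /eqP/mnmP/(_ 0); rewrite mnmDE !mnm1E mnm0E.
rewrite /const_term; split.
  by rewrite X0X1E scale1r mcoeffX H1.
by rewrite mpoly.mcoeffD !XmE !scale1r !mcoeffX !H addr0.
Qed.

Lemma one_x_invariant : x_invariant D 1.
Proof. by move=> w; rewrite rmorph1. Qed.
Lemma one_y_invariant : y_invariant D 1.
Proof. by move=> w; rewrite rmorph1. Qed.

Lemma poly_eval1 (B : pzRingType) (phi : {rmorphism FA -> B}) (g : 'I_2 -> FA) :
  poly_eval (idfun : {rmorphism C -> C}) phi g 1 = 1.
Proof.
have -> : 1 = 1 *: 'X_[0%MM] :> {mpoly C[2]} by rewrite scale1r mpolyX0.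
by rewrite poly_evalZX kb1 !mnm0E !expr0 !mulr1.
Qed.

Lemma inv_x p : x_invariant D p -> const_term p = 0 -> @invariants_plus C gT D (@xpoly C gT D p).
Proof.
move=> px p0; exists [:: (p, 1)]; split.
- by move=> pq; rewrite inE => /eqP ->; split=> //; exact: one_y_invariant.
- by rewrite big_seq1 p0 mul0r.
- by rewrite big_seq1 /= ypolyE poly_eval1 mulr1.
Qed.

Lemma inv_y p : y_invariant D p -> const_term p = 0 -> @invariants_plus C gT D (@ypoly C gT D p).
Proof.
move=> px p0; exists [:: (1, p)]; split.
- by move=> pq; rewrite inE => /eqP ->; split=> //; exact: one_x_invariant.
- by rewrite big_seq1 p0 mulr0.
- by rewrite big_seq1 /= xpolyE poly_eval1 mul1r.
Qed.

Lemma Hbar_pi0 h : @invariants_plus C gT D h -> pb h = 0.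
Proof. by move=> Ih; rewrite -(rmorph0 pb); apply: rq_pi_eq; rewrite subr0. Qed.

Lemma HbA_restricted : restricted m HbA.
Proof.
have [x1 x2] := basic_x_invariant; have [y1 y2] := basic_y_invariant.
have [c1 c2] := const_basic.
have [ex1 ex2] := poly_eval_basic pc (gx gT C).
have [ey1 ey2] := poly_eval_basic pc (gy gT C).
split.
- by apply: etrans (esym (rmorphM pb _ _)) _; rewrite -(Hbar_pi0 (inv_x x1 c1)) xpolyE ex1.
- by apply: etrans (esym (rmorph_powsum pb _ _ m)) _; rewrite -(Hbar_pi0 (inv_x x2 c2)) xpolyE ex2.
- by apply: etrans (esym (rmorphM pb _ _)) _; rewrite -(Hbar_pi0 (inv_y y1 c1)) ypolyE ey1.
- by apply: etrans (esym (rmorph_powsum pb _ _ m)) _; rewrite -(Hbar_pi0 (inv_y y2 c2)) ypolyE ey2.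
Qed.

(** Modulo [J] an invariant polynomial becomes its constant term, by [poly_eval_invariant], so an
    element of [invariants_plus] becomes its total constant term 0. A functional killed by the four
    basic invariants therefore descends to the restricted algebra. *)
Lemma invariants_plus_sub (J : set (Hc D)) : two_sided_ideal J ->
  J (xx HcA 0 * xx HcA 1) -> J (xx HcA 0 ^+ m + xx HcA 1 ^+ m) ->
  J (yy HcA 0 * yy HcA 1) -> J (yy HcA 0 ^+ m + yy HcA 1 ^+ m) ->
  forall h, ideal_gen (@invariants_plus C gT D) h -> J h.
Proof.
move=> JI Jx1 Jx2 Jy1 Jy2 h; apply=> // {}h [l [lI l0 ->]].
pose p4 : {rmorphism Hc D -> ring_quot J} := @rq_pi (Hc D) J.
have J0 a : J a -> p4 a = 0.
  by move=> Ja; rewrite -(rmorph0 p4); apply: rq_pi_eq; rewrite subr0.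
suff : p4 (\sum_(pq <- l) @xpoly C gT D pq.1 * @ypoly C gT D pq.2) = 0.
  rewrite -(rmorph0 p4) => /ring_quotE; rewrite subr0; apply=> //.
pose phi : {rmorphism FA -> ring_quot J} := p4 \o pc.
have zP := zeta_prim DP; have m0 := m_gt0 DP.
have xE p : x_invariant D p -> p4 (@xpoly C gT D p) = phi (const_term p)%:A.
  move=> pI; apply: etrans (_ : poly_eval (idfun : {rmorphism C -> C}) phi (gx gT C) p = _).
    by [].
  refine (@poly_eval_invariant C C (idfun : {rmorphism C -> C}) FA _ phi _ m zeta zP m0 _ _ _ p _ _).
  - by apply: etrans (esym (rmorphM p4 _ _)) _; apply: (J0 _ Jx1).
  - by apply: etrans (esym (rmorphM p4 _ _)) _; rewrite -[RHS](J0 _ Jx1) (xxC HcA).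
  - by apply: etrans (esym (rmorph_powsum p4 _ _ m)) _; apply: (J0 _ Jx2).
  - exact: x_invariant_swap.
  - by right; apply: x_invariant_scale.
have yE p : y_invariant D p -> p4 (@ypoly C gT D p) = phi (const_term p)%:A.
  move=> pI; apply: etrans (_ : poly_eval (idfun : {rmorphism C -> C}) phi (gy gT C) p = _).
    by [].
  refine (@poly_eval_invariant C C (idfun : {rmorphism C -> C}) FA _ phi _ m zeta zP m0 _ _ _ p _ _).
  - by apply: etrans (esym (rmorphM p4 _ _)) _; apply: (J0 _ Jy1).
  - by apply: etrans (esym (rmorphM p4 _ _)) _; rewrite -[RHS](J0 _ Jy1) (yyC HcA).
  - by apply: etrans (esym (rmorph_powsum p4 _ _ m)) _; apply: (J0 _ Jy2).
  - exact: y_invariant_swap.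
  - by right; apply: y_invariant_scale.
pose kb c : ring_quot J := phi c%:A.
have kb_0 : kb 0 = 0 := kb0 (idfun : {rmorphism C -> C}) phi.
have kb_D c d : kb (c + d) = kb c + kb d := kbD (idfun : {rmorphism C -> C}) phi c d.
have kb_M c d : kb (c * d) = kb c * kb d := kbM (idfun : {rmorphism C -> C}) phi c d.
apply: etrans (rmorph_sum_mul (f := p4) (X := fun pq => @xpoly C gT D pq.1)
  (Y := fun pq => @ypoly C gT D pq.2) (cx := fun pq => const_term pq.1)
  (cy := fun pq => const_term pq.2) kb_0 kb_D kb_M _) _; last by rewrite l0.
by move=> pq /lI[px py]; split; [exact: xE|exact: yE].
Qed.

End Concrete.

Section YSum.
Variables (C : numFieldType) (gT : finGroupType) (D : cherednik_data C gT).
Variables (A : pzRingType) (HA : cher_alg D (idfun : {rmorphism C -> C}) 0 A).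

Lemma y_sumX (i : 'I_2) : \sum_(n <- mpoly.msupp ('X_i : {mpoly C[2]}))
  sc HA ('X_i)@_n * (yy HA 0 ^+ n 0 * yy HA 1 ^+ n 1) = yy HA i.
Proof.
rewrite mpoly.msuppX big_seq1 mcoeffX eqxx rmorph1 mul1r !mnm1E.
by elim/I2_case: i; rewrite /= expr0 expr1 ?mulr1 ?mul1r.
Qed.

Lemma y_sum_kill (q : {mpoly C[2]}) (M : lmodType A) (n : M) :
  (forall i, yy HA i *: n = 0) ->
  (\sum_(e <- mpoly.msupp q) sc HA q@_e * (yy HA 0 ^+ e 0 * yy HA 1 ^+ e 1)) *: n =
  sc HA (const_term q) *: n.
Proof.
move=> n0; rewrite scaler_suml.
have -> : const_term q = \sum_(e <- mpoly.msupp q) q@_e * (e == 0%MM)%:R.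
  rewrite /const_term {1}[q]mpolyE raddf_sum; apply: eq_bigr => e _ /=.
  by rewrite mpoly.mcoeffZ mcoeffX.
rewrite rmorph_sum scaler_suml; apply: eq_bigr => e _; rewrite rmorphM -!scalerA; congr (_ *: _).
have [->|e0] := eqVneq e 0%MM; first by rewrite !mnm0E !expr0 !scale1r rmorph1 scale1r.
rewrite rmorph0 scale0r; have [e1|e1] := posnP (e 1); last first.
  by rewrite -(prednK e1) exprSr -scalerA n0 !scaler0.
rewrite e1 expr0 scale1r; have [e00|e00] := posnP (e 0); last first.
  by rewrite -(prednK e00) exprSr -scalerA n0 scaler0.
by case/eqP: e0; apply/mnmP; apply: I2_case; rewrite mnm0E.
Qed.

End YSum.

(** * ** The universal property of the baby Verma module *)

Section BabyVerma.
Variables (C : numFieldType) (gT : finGroupType) (D : cherednik_data C gT).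
Variables (A : pzRingType) (HA : cher_alg D (idfun : {rmorphism C -> C}) 0 A).
Variables (d : nat) (lam : gT -> 'M[C]_d) (yq : {mpoly C[2]} -> A) (bal : set 'rV[A]_d).
Local Notation k := (sc HA).
Definition row_tens (a : A) (v : 'cV[C]_d) : 'rV[A]_d := \row_i (a * k (v i 0)).

Hypothesis yqX : forall i, yq 'X_i = yy HA i.
Hypothesis yq_kill : forall q (M : lmodType A) (n : M),
  (forall i, yy HA i *: n = 0) -> yq q *: n = k (const_term q) *: n.
Hypothesis bal_w : forall a w v, bal (row_tens (a * ww HA w) v - row_tens a (lam w *m v)).
Hypothesis bal_y : forall a q v, bal (row_tens (a * yq q) v - row_tens a (const_term q *: v)).
Hypothesis bal_elim : forall x, bal x ->
  (exists a w v, x = row_tens (a * ww HA w) v - row_tens a (lam w *m v)) \/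
  (exists a q v, x = row_tens (a * yq q) v - row_tens a (const_term q *: v)).

Let V : lmodType A := mod_quot bal.
Definition verma_top (j : 'I_d) : V := \pi_(mod_quot bal) (delta_mx 0 j).

Lemma row_tens_sum a v : row_tens a v = \sum_i (a * k (v i 0)) *: delta_mx 0 i.
Proof.
rewrite [LHS]matrix_sum_delta big_ord1; apply: eq_bigr => i _; by rewrite mxE.
Qed.

Lemma row_tens_delta a j : row_tens a (delta_mx j 0) = a *: delta_mx 0 j.
Proof.
rewrite row_tens_sum (bigD1 j) //= mxE !eqxx rmorph1 mulr1 big1 ?addr0 // => i /negPf ij.
by rewrite mxE ij rmorph0 mulr0 scale0r.
Qed.

Lemma piV_sum (I : Type) (l : seq I) (F : I -> 'rV[A]_d) :
  \pi_(mod_quot bal) (\sum_(i <- l) F i) = \sum_(i <- l) (\pi_(mod_quot bal) (F i) : V).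
Proof.
elim: l => [|i l IH]; first by rewrite !big_nil mq_pi0.
by rewrite !big_cons mq_piD IH.
Qed.

Lemma verma_top_hw : hw_type HA lam verma_top.
Proof.
split=> [g j|i j].
  have E : submod_gen bal (row_tens (1 * ww HA g) (delta_mx j 0) - row_tens 1 (lam g *m delta_mx j 0)).
    by move=> N NS SN; apply: SN; apply: bal_w.
  move/mod_quotE: E; rewrite mul1r row_tens_delta mq_piZ row_tens_sum piV_sum => E; apply: etrans E _.
  apply: eq_bigr => i _; rewrite mq_piZ mul1r; congr (k _ *: _).
  rewrite mxE (bigD1 j) //= mxE !eqxx mulr1 big1 ?addr0 // => l /negPf lj.
  by rewrite mxE lj mulr0.
have E : submod_gen bal (row_tens (1 * yq 'X_i) (delta_mx j 0) -
    row_tens 1 (const_term 'X_i *: delta_mx j 0)).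
  by move=> N NS SN; apply: SN; apply: bal_y.
move/mod_quotE: E; rewrite mul1r row_tens_delta yqX mq_piZ => E; apply: etrans E _.
rewrite /const_term mcoeffX mnm1_eq0 scale0r row_tens_sum.
by rewrite big1 ?mq_pi0 // => l _; rewrite mxE rmorph0 mulr0 scale0r.
Qed.

Lemma verma_top_gen v : exists a : 'I_d -> A, v = \sum_i a i *: verma_top i.
Proof.
have -> : v = \pi_(mod_quot bal) (repr v) by rewrite reprK.
exists (fun i => repr v 0 i); rewrite {1}(matrix_sum_delta (repr v)) big_ord1 piV_sum.
by apply: eq_bigr => i _; rewrite mq_piZ.
Qed.

Lemma verma_top_univ (M : lmodType A) (n : 'I_d -> M) : hw_type HA lam n ->
  exists f : V -> M, (forall a v v', f (a *: v + v') = a *: f v + f v') /\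
    forall j, f (verma_top j) = n j.
Proof.
move=> [nw ny]; pose g (x : 'rV[A]_d) : M := \sum_i x 0 i *: n i.
have gL a x y : g (a *: x + y) = a *: g x + g y.
  rewrite /g scaler_sumr -big_split; apply: eq_bigr => i _.
  by rewrite !mxE scalerDl scalerA.
have gD x y : g (x + y) = g x + g y by have := gL 1 x y; rewrite !scale1r.
have g0 : g 0 = 0 by apply: (addrI (g 0)); rewrite -gD !addr0.
have gB x y : g (x - y) = g x - g y.
  by have := gL (-1) y x; rewrite !scaleN1r => E; rewrite [x - y]addrC E addrC.
have gt a v : g (row_tens a v) = a *: \sum_i k (v i 0) *: n i.
  by rewrite /g scaler_sumr; apply: eq_bigr => i _; rewrite mxE scalerA.
have g_ker x : submod_gen bal x -> g x = 0.
  move=> Hx; apply: (Hx [set y | g y = 0]).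
    by split=> // a y z /= gy gz; rewrite gL gy gz scaler0 addr0.
  move=> {Hx}x /bal_elim[[a [w [v ->]]]|[a [q [v ->]]]]; rewrite /= gB !gt; apply/eqP; rewrite subr_eq0; apply/eqP.
    rewrite -scalerA; congr (_ *: _); rewrite scaler_sumr.
    under eq_bigr => i _.
      rewrite -(kZ HA) nw scaler_sumr; under eq_bigr do rewrite (kM HA); over.
    rewrite exchange_big /=; apply: eq_bigr => i _; rewrite -scaler_suml -rmorph_sum.
    by congr (k _ *: _); rewrite mxE; apply: eq_bigr => j _; rewrite mulrC.
  rewrite -scalerA; congr (_ *: _); rewrite scaler_sumr; apply: eq_bigr => i _.
  by rewrite -(kZ HA) yq_kill // (kM HA) mxE mulrC.
have repr_eq x : g (repr (\pi_(mod_quot bal) x)) = g x.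
  apply/eqP; rewrite -subr_eq0 -gB; apply/eqP; apply: g_ker; apply/mod_quotE; by rewrite reprK.
exists (fun v => g (repr v)); split=> [a v v'|j].
  rewrite -gL -[LHS]repr_eq reprK; rewrite -[in RHS]repr_eq; congr (g (repr _)).
  by rewrite mq_piD mq_piZ !reprK.
rewrite repr_eq /g (bigD1 j) //= mxE !eqxx scale1r big1 ?addr0 // => i /negPf ij.
by rewrite mxE ij andbF scale0r.
Qed.

End BabyVerma.

Section BabyVermaConcrete.
Variables (C : numFieldType) (gT : finGroupType) (D : cherednik_data C gT).
Variables (d : nat) (lam : gT -> 'M[C]_d).
Let HbA := HbA D.

Lemma Hbar_y_sum q : @Hbar_y C gT D q = \sum_(n <- mpoly.msupp q)
  sc HbA q@_n * (yy HbA 0 ^+ n 0 * yy HbA 1 ^+ n 1).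
Proof.
apply: (poly_eval_sum (idfun : {rmorphism C -> C})
  ((@rq_pi (Hc D) (@invariants_plus C gT D)) \o (@rq_pi (free_algebra gT C) _)) (gy gT C) q).
Qed.

Lemma Hbar_yX i : @Hbar_y C gT D 'X_i = yy HbA i.
Proof. by rewrite Hbar_y_sum y_sumX. Qed.

Lemma Hbar_y_kill q (M : lmodType (Hbar D)) (n : M) :
  (forall i, yy HbA i *: n = 0) -> @Hbar_y C gT D q *: n = sc HbA (const_term q) *: n.
Proof. by move=> n0; rewrite Hbar_y_sum; apply: y_sum_kill. Qed.

Let T : 'I_d -> baby_verma D lam := @verma_top _ d (balanced_rel lam).

(** Non-vanishing of the top is a hypothesis here because the presentation only yields maps out of
    the module; the functionals of Section [VermaDetect] supply it. *)
Lemma baby_verma_is_verma : (exists j, T j <> 0) -> is_verma HbA lam T.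
Proof.
move=> T0.
have bw a w v : balanced_rel lam (row_tens HbA (a * ww HbA w) v - row_tens HbA a (lam w *m v)).
  exact: Bal_w.
have by_ a q v : balanced_rel lam (row_tens HbA (a * @Hbar_y C gT D q) v -
    row_tens HbA a (const_term q *: v)).
  exact: Bal_y.
have be x : balanced_rel lam x ->
  (exists a w v, x = row_tens HbA (a * ww HbA w) v - row_tens HbA a (lam w *m v)) \/
  (exists a q v, x = row_tens HbA (a * @Hbar_y C gT D q) v - row_tens HbA a (const_term q *: v)).
  by case=> [a w v|a q v]; [left; exists a, w, v|right; exists a, q, v].
split=> //.
- exact: (verma_top_hw Hbar_yX bw by_).
- exact: verma_top_gen.
- exact: (verma_top_univ Hbar_y_kill be).
Qed.

End BabyVermaConcrete.

(** * The coinduced right module *)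

Section LinMaps.
Variable K : comNzRingType.
Definition lin_map (U V : lmodType K) (f : U -> V) := forall a x y, f (a *: x + y) = a *: f x + f y.

Variables (U V : lmodType K) (f : U -> V).
Hypothesis fL : lin_map f.
Lemma lin_mapD x y : f (x + y) = f x + f y.
Proof. by have := fL 1 x y; rewrite !scale1r. Qed.
Lemma lin_map0 : f 0 = 0.
Proof. by apply: (addrI (f 0)); rewrite -lin_mapD !addr0. Qed.
Lemma lin_mapZ a x : f (a *: x) = a *: f x.
Proof. by have := fL a x 0; rewrite lin_map0 !addr0. Qed.
Lemma lin_mapN x : f (- x) = - f x.
Proof. by rewrite -scaleN1r lin_mapZ scaleN1r. Qed.
Lemma lin_mapB x y : f (x - y) = f x - f y.
Proof. by rewrite lin_mapD lin_mapN. Qed.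
Lemma lin_map_sum I (l : seq I) (P : pred I) (F : I -> U) :
  f (\sum_(i <- l | P i) F i) = \sum_(i <- l | P i) f (F i).
Proof. by apply: (big_morph f lin_mapD lin_map0). Qed.
End LinMaps.

(* The right module of functionals F on C[x_0, x_1] (x) M, with F a b standing for
   v |-> F (x_0^a x_1^b v); B is the dual of the C[y] >< W-module M.  The operators
   are transposed, so that (F . g) . h = F . (g h). *)
Section Coinduced.
Variables (C : numFieldType) (m : nat) (gT : finGroupType) (s t : gT) (zeta : C).
Variable D : cherednik_data C gT.
Hypothesis DP : dihedral_setup m s t zeta D.
Variables (K : comNzRingType) (iota : {rmorphism C -> K}) (u : K) (B : lmodType K).
Variables (wB : gT -> B -> B) (yB : 'I_2 -> B -> B).
Hypotheses (wB_lin : forall g, lin_map (wB g)) (yB_lin : forall i, lin_map (yB i)).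
Hypotheses (wB1 : forall x, wB 1%g x = x) (wBM : forall g g' x, wB (g * g')%g x = wB g' (wB g x)).
Hypothesis yBC : forall i j x, yB i (yB j x) = yB j (yB i x).
Hypothesis ywB : forall g j x, yB j (wB g x) = \sum_i iota (hrep D g i j) *: wB g (yB i x).

Definition coind : lmodType K := nat -> nat -> B.
Local Notation N := coind.

Definition cX (i : 'I_2) (F : N) : N := fun a b => if i == 0 then F a.+1 b else F a b.+1.
(** The value of [F] on [g x_0^a x_1^b v], after [g] has been moved to the right as in [wx_rot] and
    [wx_refl]. *)
Definition cW (g : gT) (F : N) : N := fun a b =>
  if rot D g then iota ((kap D g)^-1 ^+ a * kap D g ^+ b) *: wB g (F a b)
  else iota (kap D g ^+ a * (kap D g)^-1 ^+ b) *: wB g (F b a).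
Definition refl_coef g i j : C := param D g * root_vec D g 0 i * coroot_vec D g j 0.
Definition cE (i j : 'I_2) (F : N) : N :=
  (u * (i == j)%:R) *: F - \sum_(g in refl D) iota (refl_coef g i j) *: cW g F.
(** The value of [F] on [y_i x_0^a x_1^b v]: [y_i] moves to the right past the [x_0] first and then
    the [x_1], and each passage leaves the commutator [cE]. The rule for [x_0] is thus definitional,
    while the one for [x_1] needs proof. *)
Fixpoint cYb i (b : nat) (F : N) : B :=
  if b is b'.+1 then cYb i b' (cX 1 F) + cE i 1 F 0%N b' else yB i (F 0%N 0%N).
Fixpoint cYa i (a b : nat) (F : N) : B :=
  if a is a'.+1 then cYa i a' b (cX 0 F) + cE i 0 F a' b else cYb i b F.
Definition cY i (F : N) : N := fun a b => cYa i a b F.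

Lemma N_ext (F G : N) : (forall a b, F a b = G a b) -> F = G.
Proof. by move=> FG; apply/funext => a; apply/funext => b. Qed.

Lemma cX_lin i : lin_map (cX i).
Proof. by move=> a F G; apply: N_ext => p q; elim/I2_case: i; reflexivity. Qed.

Lemma cW_lin g : lin_map (cW g).
Proof.
move=> a F G; apply: N_ext => p q.
have E (P Q : N) p' q' : (a *: P + Q) p' q' = a *: P p' q' + Q p' q' by [].
rewrite E /cW !E; case: (rot D g); by rewrite wB_lin scalerDr !scalerA [_ * a]mulrC.
Qed.

Lemma cE_lin i j : lin_map (cE i j).
Proof.
move=> a F G; rewrite /cE scalerDr scalerBr addrACA -opprD !scalerA [a * _]mulrC; congr (_ - _).
rewrite scaler_sumr -big_split; apply: eq_bigr => g _.
by rewrite cW_lin scalerDr !scalerA [a * _]mulrC.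
Qed.

Lemma cY_lin i : lin_map (cY i).
Proof.
move=> k F G; apply: N_ext => a b; rewrite -[RHS]/(k *: cYa i a b F + cYa i a b G) /cY.
have E (P Q : N) p' q' : (k *: P + Q) p' q' = k *: P p' q' + Q p' q' by [].
elim: a F G => [|a IH] F G /=; last first.
  by rewrite cX_lin cE_lin [(k *: cE _ _ _ + _) _ _]E IH [k *: (cYa _ _ _ _ + _)]scalerDr addrACA.
elim: b F G => [|b IH] F G /=; last first.
  by rewrite cX_lin cE_lin [(k *: cE _ _ _ + _) _ _]E IH [k *: (cYb _ _ _ + _)]scalerDr addrACA.
exact: yB_lin.
Qed.

Lemma cXC i j F : cX i (cX j F) = cX j (cX i F).
Proof. by apply: N_ext => a b; elim/I2_case: i; elim/I2_case: j; reflexivity. Qed.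

Lemma cW1 F : cW 1%g F = F.
Proof.
by apply: N_ext => a b; rewrite /cW (rot1 DP) (kap1 DP) invr1 !expr1n mulr1 rmorph1 scale1r wB1.
Qed.

Lemma cWM g g' F : cW (g * g')%g F = cW g' (cW g F).
Proof.
have kg := kap_neq0 DP g; have kg' := kap_neq0 DP g'.
apply: N_ext => a b; rewrite /cW (rotM DP) (kapM DP).
case: (rot D g); case: (rot D g') => /=;
  rewrite (lin_mapZ (wB_lin g')) -wBM scalerA -rmorphM; congr (iota _ *: _).
- by rewrite ?invfM ?exprMn ?exprVn; ring.
- by rewrite ?invfM ?exprMn ?exprVn; ring.
- by rewrite ?invfM ?invrK ?exprMn ?exprVn; ring.
- by rewrite ?invfM ?invrK ?exprMn ?exprVn; ring.
Qed.

Lemma cX_cW g i F : cX i (cW g F) = \sum_j iota (hrep D g^-1 i j) *: cW g (cX j F).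
Proof.
have kg := kap_neq0 DP g.
have rgV : rot D g^-1 = rot D g.
  by have := rotM DP g g^-1; rewrite mulgV (rot1 DP) => /esym/eqP.
have kgV : kap D g^-1 = if rot D g then (kap D g)^-1 else kap D g.
  have := kapM DP g g^-1; rewrite mulgV (kap1 DP); case: (rot D g) => E.
    by apply: (mulfI kg); rewrite -E divff.
  have kV := kap_neq0 DP g^-1; apply: (mulIf (_ : (kap D g^-1)^-1 != 0)); first by rewrite invr_eq0.
  by rewrite -E divff.
apply: N_ext => a b; rewrite sum_I2 (hrepE DP) rgV kgV.
rewrite -[RHS]/(_ *: (cW g (cX 0 F) a b) + _ *: (cW g (cX 1 F) a b)) /cX /cW.
by case: (rot D g); elim/I2_case: i; rewrite ?antidiagE ?mxE /= ?rmorph0 ?scale0r ?addr0 ?add0r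
  scalerA -rmorphM ?invrK; congr (iota _ *: _); rewrite !exprS; ring.
Qed.

Lemma refl_coefE g : g \in refl D -> forall i j,
  refl_coef g i j = param D g * ((i == j)%:R - hrep D g j i).
Proof. by move=> gr i j; rewrite /refl_coef -mulrA (coroot_root DP). Qed.

(** [1 - g] has rank one for a reflection [g], so its columns are proportional. *)
Lemma refl_coef_r g i : g \in refl D -> refl_coef g i 1 = - (kap D g)^-1 * refl_coef g i 0.
Proof.
move=> gr; rewrite !(refl_coefE gr) (hrepE DP); have := gr; rewrite (reflE DP) => /negPf ->.
by have kg := kap_neq0 DP g; elim/I2_case: i; rewrite !antidiagE /= ?mulr0n ?mulr1n; field.
Qed.

Lemma refl_coef_l g j : g \in refl D -> refl_coef g 1 j = - kap D g * refl_coef g 0 j.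
Proof.
move=> gr; rewrite !(refl_coefE gr) (hrepE DP); have := gr; rewrite (reflE DP) => /negPf ->.
by have kg := kap_neq0 DP g; elim/I2_case: j; rewrite !antidiagE /= ?mulr0n ?mulr1n; field.
Qed.

Lemma hrepV_refl g : g \in refl D -> hrep D g^-1 = antidiag (kap D g) (kap D g)^-1.
Proof.
rewrite (reflE DP) => /negPf rg; rewrite (hrepE DP).
have rgV : rot D g^-1 = false.
  by have := rotM DP g g^-1; rewrite mulgV rg (rot1 DP); case: (rot _ _).
have -> : kap D g^-1 = kap D g.
  have := kapM DP g g^-1; rewrite mulgV rg (kap1 DP) => E.
  have kV := kap_neq0 DP g^-1; apply: (mulIf (_ : (kap D g^-1)^-1 != 0)); first by rewrite invr_eq0.
  by rewrite -E divff.
by rewrite rgV.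
Qed.

(** The Jacobi identity [[[y_i, x_0], x_1] = [[y_i, x_1], x_0]], transposed. It holds for each
    reflection separately, by the rank one property. *)
Lemma cX_cE i F : cE i 1 (cX 0 F) + cX 1 (cE i 0 F) = cE i 0 (cX 1 F) + cX 0 (cE i 1 F).
Proof.
rewrite /cE !(lin_mapB (cX_lin _)) !(lin_mapZ (cX_lin _)) !(lin_map_sum (cX_lin _)).
rewrite [LHS]addrACA [RHS]addrACA -!opprD [X in _ = X - _]addrC; congr (_ - _).
rewrite -!big_split; apply: eq_bigr => g gr /=.
rewrite !(lin_mapZ (cX_lin _)) !cX_cW !sum_I2 (hrepV_refl gr) !antidiagE rmorph0 !scale0r addr0 add0r.
have kg := kap_neq0 DP g; rewrite !scalerA -!rmorphM (refl_coef_r _ gr) [RHS]addrC.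
have e1 : - (kap D g)^-1 * refl_coef g i 0 + refl_coef g i 0 * (kap D g)^-1 = 0 by ring.
have e2 : - (kap D g)^-1 * refl_coef g i 0 * kap D g + refl_coef g i 0 = 0 by field.
by rewrite -!scalerDl -!rmorphD e1 e2 !rmorph0 !scale0r.
Qed.

Lemma cYX0 i F : cX 0 (cY i F) = cY i (cX 0 F) + cE i 0 F.
Proof. by []. Qed.

(** [x_1] has to get past all the [x_0] that [cYa] treats first; each of them costs one use of
    [cX_cE]. *)
Lemma cYX1 i F : cX 1 (cY i F) = cY i (cX 1 F) + cE i 1 F.
Proof.
apply: N_ext => a b; elim: a F => [|a IH] F //.
have := IH (cX 0 F); have /(congr1 (fun G : N => G a b)) := cX_cE i F.
have E (P Q : N) p' q' : (P + Q) p' q' = P p' q' + Q p' q' by [].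
rewrite !E => H1 H2.
rewrite -[LHS]/(cX 1 (cY i (cX 0 F)) a b + cX 1 (cE i 0 F) a b) H2 -addrA H1.
by rewrite [cX 1 (cX 0 F)]cXC addrA.
Qed.

Lemma cYX i j F : cX j (cY i F) = cY i (cX j F) + cE i j F.
Proof. by elim/I2_case: j; [exact: cYX0|exact: cYX1]. Qed.

(** [F a b] is the value at the corner [(0, 0)] of a shift of [F] by [cX]. An operator identity
    compatible with the shifts thus has to be checked only at the corner, where [cY] is just
    [yB]. *)
Lemma coind_vanish (J : Type) (Z : J -> N -> N) (co : 'I_2 -> 'I_2 -> K) :
  (forall j F, Z j F 0%N 0%N = 0) ->
  (forall i j F, cX i (Z j F) = \sum_l co i l *: Z j (cX l F)) ->
  forall j F, Z j F = 0.
Proof.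
move=> Z0 ZX j F; apply: N_ext => a b.
have E (P Q : N) (c d : K) p' q' : (c *: P + d *: Q) p' q' = c *: P p' q' + d *: Q p' q' by [].
elim: a b F => [|a IH] b F.
  elim: b F => [|b IH] F; first exact: Z0.
  by rewrite -[LHS]/(cX 1 (Z j F) 0%N b) ZX sum_I2 E !IH !scaler0 addr0.
by rewrite -[LHS]/(cX 0 (Z j F) a b) ZX sum_I2 E !IH !scaler0 addr0.
Qed.

(** Conjugation by [g] permutes the reflections and fixes [param], so this is the W-equivariance of
    the commutators [[y_j, x_k]]. *)
Lemma cE_cW g j k F : cE j k (cW g F) =
  \sum_i \sum_l iota (hrep D g i j * hrep D g^-1 k l) *: cW g (cE i l F).
Proof.
have hV : hrep D g^-1 *m hrep D g = 1%:M by rewrite -(hrepM DP) mulVg (hrep1 DP).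
rewrite /cE.
under [RHS]eq_bigr do under eq_bigr do rewrite (lin_mapB (cW_lin g)) (lin_mapZ (cW_lin g))
  (lin_map_sum (cW_lin g)) scalerBr scalerA.
under [RHS]eq_bigr do rewrite sumrB.
rewrite sumrB; congr (_ - _).
  under eq_bigr do rewrite -scaler_suml.
  rewrite -scaler_suml; congr (_ *: _).
  have hk : (j == k)%:R = \sum_i hrep D g^-1 k i * hrep D g i j.
    by have /matrixP/(_ k j) := hV; rewrite !mxE => ->; rewrite eq_sym.
  rewrite -(rmorph_nat iota) hk rmorph_sum mulr_sumr; apply: eq_bigr => i _; rewrite (bigD1 i) //= eqxx mulr1 big1 ?addr0.
    by rewrite [LHS]mulrC [hrep D g^-1 k i * _]mulrC.
  by move=> l /negPf li; rewrite eq_sym li !mulr0.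
have jg q : (q ^ g^-1 \in refl D)%g = (q \in refl D).
  by rewrite !(reflE DP) conjgE invgK !(rotM DP);
    have := rotM DP g g^-1; rewrite mulgV (rot1 DP) => /esym/eqP <-; case: (rot D g) (rot D q) => -[].
have inner i l : \sum_(q in refl D) cW g (iota (refl_coef q i l) *: cW q F) =
    \sum_(q in refl D) iota (refl_coef (q ^ g^-1)%g i l) *: cW q (cW g F).
  rewrite (reindex_inj (conjg_inj g^-1)%g) /=; apply: eq_big => [q|q _]; first by rewrite jg.
  rewrite (lin_mapZ (cW_lin g)) -!cWM; congr (_ *: cW _ _).
  by rewrite conjgE invgK -!mulgA mulVg mulg1.
under [RHS]eq_bigr do under eq_bigr do rewrite inner scaler_sumr.
under [RHS]eq_bigr do rewrite exchange_big /=.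
rewrite exchange_big /=; apply: eq_bigr => q qr.
under [RHS]eq_bigr do (under eq_bigr do rewrite scalerA -rmorphM; rewrite -scaler_suml -rmorph_sum).
rewrite -scaler_suml -rmorph_sum; congr (iota _ *: _).
have qr' : (q ^ g^-1)%g \in refl D by rewrite jg.
under [RHS]eq_bigr do under eq_bigr do rewrite (refl_coefE qr') (paramJ DP _ qr).
rewrite (refl_coefE qr) !sum_I2.
have hq : hrep D q = hrep D g^-1 *m hrep D (q ^ g^-1)%g *m hrep D g.
  by rewrite -!(hrepM DP) conjgE invgK !mulgA mulVg mul1g mulgKV.
have /matrixP/(_ k j) := hV; rewrite hq !mxE !sum_I2 !mxE !sum_I2 eq_sym => <- /=.
ring.
Qed.

Lemma cY_cW g j F : cY j (cW g F) = \sum_i iota (hrep D g i j) *: cW g (cY i F).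
Proof.
apply/eqP; rewrite -subr_eq0; apply/eqP; move: j F.
apply: (@coind_vanish _ (fun j F => cY j (cW g F) - \sum_i iota (hrep D g i j) *: cW g (cY i F))
  (fun i l => iota (hrep D g^-1 i l))) => [j F|k j F].
  have E (P : N) (Q : 'I_2 -> N) : (P - \sum_i Q i) 0%N 0%N = P 0%N 0%N - \sum_i Q i 0%N 0%N.
    by rewrite !sum_I2.
  rewrite E; apply/eqP; rewrite subr_eq0; apply/eqP.
  rewrite -[LHS]/(yB j (cW g F 0%N 0%N)) /cW !expr0 mulr1 rmorph1 if_same scale1r.
  rewrite ywB; apply: eq_bigr => i _.
  rewrite -[RHS]/(_ *: (if rot D g then iota ((kap D g)^-1 ^+ 0 * kap D g ^+ 0) *: wB g (cY i F 0%N 0%N)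
    else iota (kap D g ^+ 0 * (kap D g)^-1 ^+ 0) *: wB g (cY i F 0%N 0%N))).
  by rewrite !expr0 mulr1 rmorph1 if_same scale1r.
rewrite (lin_mapB (cX_lin k)) cYX cX_cW (lin_map_sum (cY_lin j)) cE_cW (lin_map_sum (cX_lin k)).
have -> : \sum_i cX k (iota (hrep D g i j) *: cW g (cY i F)) =
  \sum_i \sum_l iota (hrep D g i j * hrep D g^-1 k l) *: cW g (cE i l F) +
  \sum_l iota (hrep D g^-1 k l) *: (\sum_i iota (hrep D g i j) *: cW g (cY i (cX l F))).
  under [X in _ + X]eq_bigr do rewrite scaler_sumr.
  rewrite [X in _ + X]exchange_big -big_split; apply: eq_bigr => i _ /=.
  rewrite -big_split (lin_mapZ (cX_lin k)) cX_cW scaler_sumr; apply: eq_bigr => l _ /=.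
  by rewrite cYX (lin_mapD (cW_lin g)) !scalerDr addrC !scalerA -!rmorphM [hrep D g^-1 k l * _]mulrC.
rewrite opprD addrA addrK -sumrB; apply: eq_bigr => l _.
by rewrite (lin_mapZ (cY_lin j)) scalerBr.
Qed.

(** The Jacobi identity for [y_0], [y_1] and [x_k], transposed; the mirror image of [cX_cE]. *)
Lemma cY_cE k F : cY 1 (cE 0 k F) + cE 1 k (cY 0 F) = cY 0 (cE 1 k F) + cE 0 k (cY 1 F).
Proof.
rewrite /cE !(lin_mapB (cY_lin _)) !(lin_mapZ (cY_lin _)) !(lin_map_sum (cY_lin _)).
rewrite [LHS]addrACA [RHS]addrACA -!opprD [X in _ = X - _]addrC; congr (_ - _).
rewrite -!big_split; apply: eq_bigr => g gr /=.
have hg : hrep D g = antidiag (kap D g) (kap D g)^-1.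
  by move: gr; rewrite (reflE DP) (hrepE DP) => /negPf ->.
rewrite !(lin_mapZ (cY_lin _)) !cY_cW !sum_I2 hg !antidiagE rmorph0 !scale0r addr0 add0r.
have kg := kap_neq0 DP g; rewrite !scalerA -!rmorphM (refl_coef_l _ gr) [RHS]addrC.
have e1 : refl_coef g 0 k * kap D g + - kap D g * refl_coef g 0 k = 0 by ring.
have e2 : refl_coef g 0 k + - kap D g * refl_coef g 0 k * (kap D g)^-1 = 0 by field.
by rewrite -!scalerDl -!rmorphD e1 e2 !rmorph0 !scale0r.
Qed.

Lemma cYC i j F : cY i (cY j F) = cY j (cY i F).
Proof.
suff H F' : cY 1 (cY 0 F') = cY 0 (cY 1 F') by elim/I2_case: i; elim/I2_case: j; rewrite ?H.
apply/eqP; rewrite -subr_eq0; apply/eqP; move: F' => {}F.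
apply: (@coind_vanish unit (fun _ F => cY 1 (cY 0 F) - cY 0 (cY 1 F))
  (fun i l => (i == l)%:R) _ _ tt) => [_ F'|k _ F'].
  have E (P Q : N) : (P - Q) 0%N 0%N = P 0%N 0%N - Q 0%N 0%N by [].
  by rewrite E; apply/eqP; rewrite subr_eq0; apply/eqP; exact: yBC.
have -> : \sum_l (k == l)%:R *: (cY 1 (cY 0 (cX l F')) - cY 0 (cY 1 (cX l F'))) =
  cY 1 (cY 0 (cX k F')) - cY 0 (cY 1 (cX k F')).
  by rewrite sum_I2; elim/I2_case: k; rewrite /= scale0r scale1r ?addr0 ?add0r.
rewrite (lin_mapB (cX_lin k)) !cYX [cY 1 (cY 0 _ + _)](lin_mapD (cY_lin 1)) [cY 0 (cY 1 _ + _)](lin_mapD (cY_lin 0)).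
rewrite -[X in X - _]addrA cY_cE -[X in _ - X]addrA.
by rewrite opprD addrACA subrr addr0.
Qed.

End Coinduced.

(** * ** From operators on the generators to an action of the presented algebra *)

Section FreeAction.
Variables (gT : finGroupType) (K : comNzRingType) (N : lmodType K).
Variable op : Defs.generator gT -> N -> N.
Hypothesis opL : forall g, lin_map (op g).
Let FA := free_algebra gT K.

(** [foldl] lets the leftmost letter act first, as a right action requires. *)
Definition word_act (s : seq (Defs.generator gT)) (F : N) : N := foldl (fun G g => op g G) F s.
Definition free_act (f : FA) (F : N) : N :=
  \sum_(e <- monalg.msupp f) monalg.mcoeff e f *: word_act e F.

Lemma free_act_w (d : {fset fmonom (Defs.generator gT)}) (f : FA) F : (monalg.msupp f `<=` d)%fset ->
  free_act f F = \sum_(e <- d) monalg.mcoeff e f *: word_act e F.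
Proof.
move=> le; rewrite [LHS](big_fset_incl _ le) => //= x xd /monalg.mcoeff_outdom ->.
by rewrite scale0r.
Qed.

Lemma word_act_lin s : lin_map (word_act s).
Proof. by elim: s => [|g s IH] a F G //=; rewrite opL IH. Qed.

Lemma free_actD (f g : FA) F : free_act (f + g) F = free_act f F + free_act g F.
Proof.
pose d := (monalg.msupp f `|` monalg.msupp g)%fset.
rewrite (@free_act_w d (f + g)) ?monalg.msuppD_le // (@free_act_w d f) ?fsubsetUl //.
rewrite (@free_act_w d g) ?fsubsetUr // -big_split; apply: eq_bigr => e _ /=.
by rewrite -scalerDl; congr (_ *: _); exact: monalg.mcoeffD.
Qed.

Lemma free_actZ k (f : FA) F : free_act (k *: f) F = k *: free_act f F.
Proof.
rewrite (@free_act_w (monalg.msupp f)) ?monalg.msuppZ_le // /free_act scaler_sumr.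
apply: eq_bigr => e _; rewrite scalerA; congr (_ *: _); exact: monalg.mcoeffZ.
Qed.

Lemma free_act_monom k e F : free_act (mkmalgU e k) F = k *: word_act e F.
Proof.
by rewrite (@free_act_w [fset e]%fset) ?monalg.msuppU_le // big_seq_fset1 monalg.mcoeffUU.
Qed.

Lemma free_act1 F : free_act 1 F = F.
Proof. by rewrite [LHS]free_act_monom scale1r fm1. Qed.

Lemma free_act0 F : free_act 0 F = 0.
Proof. by apply: (addrI (free_act 0 F)); rewrite -free_actD !addr0. Qed.

Lemma free_act_lin f : lin_map (free_act f).
Proof.
move=> a F G; rewrite /free_act scaler_sumr -big_split; apply: eq_bigr => e _.
by rewrite word_act_lin scalerDr !scalerA mulrC.
Qed.

Lemma free_act_gen1 g F : free_act (free_gen K g) F = op g F.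
Proof. by rewrite free_act_monom scale1r fmU. Qed.

Lemma free_act_gen g (f : FA) F : free_act (free_gen K g * f) F = free_act f (op g F).
Proof.
have step (e : fmonom (Defs.generator gT)) c :
    free_act (free_gen K g * (mkmalgU e c : FA)) F = free_act (mkmalgU e c) (op g F).
  by rewrite /free_gen mkmalgU_mul mul1r !free_act_monom fmM fmU.
rewrite (monalgE f); elim: (enum_fset (monalg.msupp f)) => [|e l IH].
  by rewrite !big_nil mulr0 !free_act0.
rewrite !big_cons; apply: etrans (congr1 (free_act^~ F) (mulrDr _ _ _)) _.
apply: etrans (free_actD _ _ _) _; apply: etrans (congr2 +%R (step _ _) IH) _.
exact: esym (free_actD _ _ _).
Qed.

Lemma free_act_scal k (f : FA) F : free_act (scal gT k * f) F = k *: free_act f F.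
Proof. by rewrite /scal mulr_algl free_actZ. Qed.

Lemma free_actM (f g : FA) F : free_act (f * g) F = free_act g (free_act f F).
Proof.
elim/free_ind: f F => [|f f' IH IH'|k f IH|e f IH] F.
- by apply: etrans (congr1 (free_act^~ F) (mul1r g)) _; rewrite free_act1.
- apply: etrans (congr1 (free_act^~ F) (mulrDl f f' g)) _.
  apply: etrans (free_actD _ _ _) _; apply: etrans (congr2 +%R (IH F) (IH' F)) _.
  apply: etrans (esym (lin_mapD (free_act_lin g) _ _)) _.
  by congr (free_act g _); exact: esym (free_actD f f' F).
- apply: etrans (congr1 (free_act^~ F) (esym (mulrA _ f g))) _.
  apply: etrans (free_act_scal _ _ _) _; apply: etrans (congr1 (fun G => k *: G) (IH F)) _.
  apply: etrans (esym (lin_mapZ (free_act_lin g) _ _)) _.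
  by congr (free_act g _); exact: esym (free_act_scal k f F).
- apply: etrans (congr1 (free_act^~ F) (esym (mulrA _ f g))) _.
  apply: etrans (free_act_gen _ _ _) _; apply: etrans (IH _) _.
  by congr (free_act g _); exact: esym (free_act_gen e f F).
Qed.

End FreeAction.

Section CoindAction.
Variables (C : numFieldType) (m : nat) (gT : finGroupType) (s t : gT) (zeta : C).
Variable D : cherednik_data C gT.
Hypothesis DP : dihedral_setup m s t zeta D.
Variables (K : comNzRingType) (iota : {rmorphism C -> K}) (u : K) (B : lmodType K).
Variables (wB : gT -> B -> B) (yB : 'I_2 -> B -> B).
Hypotheses (wB_lin : forall g, lin_map (wB g)) (yB_lin : forall i, lin_map (yB i)).
Hypotheses (wB1 : forall x, wB 1%g x = x) (wBM : forall g g' x, wB (g * g')%g x = wB g' (wB g x)).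
Hypothesis yBC : forall i j x, yB i (yB j x) = yB j (yB i x).
Hypothesis ywB : forall g j x, yB j (wB g x) = \sum_i iota (hrep D g i j) *: wB g (yB i x).

Let N : lmodType K := coind B.
Let X : 'I_2 -> N -> N := @cX K B.
Let W : gT -> N -> N := @cW C gT D K iota B wB.
Let Y : 'I_2 -> N -> N := @cY C gT D K iota u B wB yB.

Record right_action (A : pzRingType) (HA : cher_alg D iota u A) (act : A -> N -> N) : Prop := RightAction {
  ra_lin : forall a, lin_map (act a);
  raD : forall a b F, act (a + b) F = act a F + act b F;
  raM : forall a b F, act (a * b) F = act b (act a F);
  ra1 : forall F, act 1 F = F;
  ra_sc : forall k F, act (sc HA k) F = k *: F;
  ra_x : forall i F, act (xx HA i) F = X i F;
  ra_y : forall i F, act (yy HA i) F = Y i F;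
  ra_w : forall g F, act (ww HA g) F = W g F }.

Section Relations.
Variables (A : lalgType K) (act : A -> N -> N) (x y : 'I_2 -> A) (w : gT -> A).
Hypotheses (aL : forall a, lin_map (act a)) (aD : forall a b F, act (a + b) F = act a F + act b F).
Hypotheses (aM : forall a b F, act (a * b) F = act b (act a F)) (a1 : forall F, act 1 F = F).
Hypotheses (aZ : forall k a F, act (k *: a) F = k *: act a F).
Hypotheses (ax : forall i F, act (x i) F = X i F) (ay : forall i F, act (y i) F = Y i F)
  (aw : forall g F, act (w g) F = W g F).

Lemma act0 F : act 0 F = 0.
Proof. by apply: (addrI (act 0 F)); rewrite -aD !addr0. Qed.
Lemma actB a b F : act (a - b) F = act a F - act b F.
Proof. by rewrite aD -[- b]scaleN1r aZ scaleN1r. Qed.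
Lemma act_sum I (l : seq I) (P : pred I) (a : I -> A) F :
  act (\sum_(i <- l | P i) a i) F = \sum_(i <- l | P i) act (a i) F.
Proof. by apply: (big_morph (act^~ F)) => [a' b'|]; [exact: aD|exact: act0]. Qed.

Lemma act_rel_one F : act (w 1%g - 1) F = 0.
Proof. by rewrite actB a1 aw /W (cW1 DP) // subrr. Qed.
Lemma act_rel_mul g g' F : act (w (g * g')%g - w g * w g') F = 0.
Proof. by rewrite actB aM !aw /W (cWM DP) // subrr. Qed.
Lemma act_rel_x g j F :
  act (w g * x j - (\sum_i iota (hrep D g^-1 j i) *: x i) * w g) F = 0.
Proof.
rewrite actB !aM act_sum aw ax aw /W /X (cX_cW DP) // (lin_map_sum (cW_lin _ _ wB_lin g)).
apply/eqP; rewrite subr_eq0; apply/eqP; apply: eq_bigr => i _.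
by rewrite aZ ax (lin_mapZ (cW_lin _ _ wB_lin g)).
Qed.
Lemma act_rel_y g j F :
  act (w g * y j - (\sum_i iota (hrep D g i j) *: y i) * w g) F = 0.
Proof.
rewrite actB !aM act_sum aw ay aw /W /Y (cY_cW DP) // (lin_map_sum (cW_lin _ _ wB_lin g)).
apply/eqP; rewrite subr_eq0; apply/eqP; apply: eq_bigr => i _.
by rewrite aZ ay (lin_mapZ (cW_lin _ _ wB_lin g)).
Qed.
Lemma act_rel_xx i j F : act (ring_commutator (x i) (x j)) F = 0.
Proof. by rewrite actB !aM !ax /X cXC subrr. Qed.
Lemma act_rel_yy i j F : act (ring_commutator (y i) (y j)) F = 0.
Proof. by rewrite actB !aM !ay /Y (cYC DP) // subrr. Qed.
Lemma act_rel_yx i j F : act (ring_commutator (y i) (x j) - ((u * (i == j)%:R)%:A -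
     \sum_(g in refl D)
         iota (param D g * root_vec D g 0 i * coroot_vec D g j 0) *: w g)) F = 0.
Proof.
rewrite !actB !aM !ax !ay aZ a1 act_sum /X /Y (cYX DP) // [X in X - _ = 0]addrAC subrr add0r /cE.
apply/eqP; rewrite subr_eq0; apply/eqP; congr (_ - _); apply: eq_bigr => g _.
by rewrite aZ aw.
Qed.

End Relations.

Definition coind_op (g : Defs.generator gT) : N -> N :=
  match g with inl (inl i) => X i | inl (inr i) => Y i | inr w => W w end.

Lemma coind_op_lin g : lin_map (coind_op g).
Proof.
by case: g => [[i|i]|w]; [exact: cX_lin|exact: cY_lin|exact: cW_lin].
Qed.

Let fa : free_algebra gT K -> N -> N := free_act coind_op.

Lemma free_act_rel f F : (smash_rel D iota `|` commutation_rel D iota u) f -> fa f F = 0.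
Proof.
have aL a : lin_map (fa a) by apply: free_act_lin; exact: coind_op_lin.
have aD a b G : fa (a + b) G = fa a G + fa b G by exact: free_actD.
have aM a b G : fa (a * b) G = fa b (fa a G) by apply: free_actM; exact: coind_op_lin.
have a1 G : fa 1 G = G by exact: free_act1.
have aZ k a G : fa (k *: a) G = k *: fa a G by exact: free_actZ.
have ax i G : fa (gx gT K i) G = X i G by exact: free_act_gen1.
have ay i G : fa (gy gT K i) G = Y i G by exact: free_act_gen1.
have aw g G : fa (gw K g) G = W g G by exact: free_act_gen1.
case=> [[|g g'|g j|g j]|[i j|i j|i j]].
- exact: (act_rel_one aD a1 aZ aw).
- exact: (act_rel_mul aD aM aZ aw).
- exact: (act_rel_x aD aM aZ ax aw).
- exact: (act_rel_y aD aM aZ ay aw).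
- exact: (act_rel_xx aD aM aZ ax).
- exact: (act_rel_yy aD aM aZ ay).
- exact: (act_rel_yx aD aM a1 aZ ax ay aw).
Qed.

Definition coind_act (h : cherednik D iota u) (F : N) : N := fa (repr h) F.

Lemma coind_act_pi f F : coind_act (@cherednik_pi C gT D K iota u f) F = fa f F.
Proof.
have : ideal_gen (smash_rel D iota `|` commutation_rel D iota u)
    (repr (@cherednik_pi C gT D K iota u f) - f).
  by apply/ring_quotE; rewrite reprK.
move=> /(_ [set a | forall F, fa a F = 0]) H.
have {}H : fa (repr (@cherednik_pi C gT D K iota u f) - f) F = 0.
  apply: H; last by move=> a Sa G; exact: free_act_rel.
  have L a : lin_map (fa a) by apply: free_act_lin; exact: coind_op_lin.
  split=> [G|a b Ha Hb G|a b Ha G|a b Ha G].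
  - exact: free_act0.
  - by rewrite /fa free_actD -[- b]scaleN1r free_actZ -/fa Ha Hb scaler0 addr0.
  - by apply: etrans (free_actM coind_op_lin _ _ _) _; apply: Ha.
  - by apply: etrans (free_actM coind_op_lin _ _ _) _; rewrite -/fa Ha (lin_map0 (L _)).
apply/eqP; rewrite -subr_eq0; apply/eqP.
by rewrite -[RHS]H /fa free_actD; congr (_ + _); rewrite -[- f]scaleN1r free_actZ scaleN1r.
Qed.

(** The values of a functional on the monomials can be prescribed freely, so this action separates
    elements of an algebra known only through generators and relations. *)
Lemma coind_right_action : right_action (cherednik_alg D iota u) coind_act.
Proof.
have piE (h : cherednik D iota u) : exists f, h = @cherednik_pi C gT D K iota u f.
  exact: rq_pi_surj.
split.
- by move=> a; apply: free_act_lin; exact: coind_op_lin.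
- move=> a b F; have [f ->] := piE a; have [g ->] := piE b.
  have E := rmorphD (@rq_pi (free_algebra gT K) (smash_rel D iota `|` commutation_rel D iota u)) f g.
  apply: etrans (congr1 (fun h => coind_act h F) (esym E)) _.
  apply: etrans (coind_act_pi _ _) _; rewrite !coind_act_pi; exact: free_actD.
- move=> a b F; have [f ->] := piE a; have [g ->] := piE b.
  have E := rmorphM (@rq_pi (free_algebra gT K) (smash_rel D iota `|` commutation_rel D iota u)) f g.
  apply: etrans (congr1 (fun h => coind_act h F) (esym E)) _.
  apply: etrans (coind_act_pi _ _) _; rewrite !coind_act_pi; exact: (free_actM coind_op_lin).
- move=> F; apply: etrans (coind_act_pi 1 F) _; exact: free_act1.
- move=> k F; rewrite cherednik_alg_sc coind_act_pi /scal; apply: etrans (free_actZ _ _ _ _) _.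
  by rewrite free_act1.
- move=> i F; rewrite cherednik_alg_xx coind_act_pi; exact: free_act_gen1.
- move=> i F; rewrite cherednik_alg_yy coind_act_pi; exact: free_act_gen1.
- move=> i F; rewrite cherednik_alg_ww coind_act_pi; exact: free_act_gen1.
Qed.

End CoindAction.

(** * ** Functionals on the baby Verma module *)

Section VermaDetect.
Variables (C : numFieldType) (m : nat) (gT : finGroupType) (s t : gT) (zeta : C).
Variable D : cherednik_data C gT.
Hypothesis DP : dihedral_setup m s t zeta D.
Variables (A : pzRingType) (HA : cher_alg D (idfun : {rmorphism C -> C}) 0 A).
Variables (d : nat) (lam : gT -> 'M[C]_d).
Hypothesis lam1 : lam 1%g = 1%:M.
Hypothesis lamM : forall g g', lam (g * g')%g = lam g *m lam g'.

Definition dual_w (g : gT) (x : 'rV[C]_d) : 'rV[C]_d := x *m lam g.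
Definition dual_y (i : 'I_2) (x : 'rV[C]_d) : 'rV[C]_d := 0.
Let N : lmodType C := coind 'rV[C]_d.
Variable act : A -> N -> N.
Hypothesis RA : right_action dual_w dual_y HA act.

Let x0 := xx HA 0.
Let x1 := xx HA 1.
Let y0 := yy HA 0.
Let y1 := yy HA 1.

(** The functionals that factor through the coinvariant algebra in the [x_i]. They are stable under
    the action because the two invariants are central. *)
Definition sub_coind (F : N) := act (x0 * x1) F = 0 /\ act (x0 ^+ m + x1 ^+ m) F = 0.
Definition ann_ideal : set A := [set h | forall F, sub_coind F -> act h F = 0].

Lemma ract0 F : act 0 F = 0.
Proof. by apply: (addrI (act 0 F)); rewrite -(raD RA) !addr0. Qed.
Lemma ractN h F : act (- h) F = - act h F.
Proof. by apply: (addrI (act h F)); rewrite -(raD RA) !subrr ract0. Qed.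

Lemma act_x0X a F p q : act (x0 ^+ a) F p q = F (a + p)%N q.
Proof.
elim: a F p => [|a IH] F p; first by rewrite expr0 (ra1 RA).
rewrite exprSr (raM RA) (ra_x RA).
have E (G : N) : cX 0 G p q = G p.+1 q by [].
by rewrite E IH addnS.
Qed.

Lemma act_x1X a F p q : act (x1 ^+ a) F p q = F p (a + q)%N.
Proof.
elim: a F q => [|a IH] F q; first by rewrite expr0 (ra1 RA).
rewrite exprSr (raM RA) (ra_x RA).
have E (G : N) : cX 1 G p q = G p q.+1 by [].
by rewrite E IH addnS.
Qed.

Lemma act_xmon a b F : act (x0 ^+ a * x1 ^+ b) F 0%N 0%N = F a b.
Proof. by rewrite (raM RA) act_x1X act_x0X !addn0. Qed.

Lemma act_y00 h i F : act (h * yy HA i) F 0%N 0%N = 0.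
Proof. by rewrite (raM RA) (ra_y RA). Qed.

(** The value at [(a, b)] is the corner value after acting by [x_0^a x_1^b]. Centrality lets the [y]
    act last, and at the corner it acts by [dual_y], that is, by zero. *)
Lemma act_center_y h i j h' F : ring_center (h * yy HA i + h' * yy HA j) ->
  act (h * yy HA i + h' * yy HA j) F = 0.
Proof.
move=> zC; apply: N_ext => a b; rewrite -act_xmon -(raM RA) zC (raM RA) (raD RA).
by rewrite -[LHS]/(act _ _ 0%N 0%N + act _ _ 0%N 0%N) !act_y00 addr0.
Qed.

Lemma sub_coind_act h F : sub_coind F -> sub_coind (act h F).
Proof.
move=> [F1 F2]; split; rewrite -(raM RA).
  by rewrite -(xx_center DP HA) (raM RA) F1 (lin_map0 (ra_lin RA h)).
by rewrite -(xpow_center DP HA) (raM RA) F2 (lin_map0 (ra_lin RA h)).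
Qed.

Lemma ann_two_sided : two_sided_ideal ann_ideal.
Proof.
split=> [F _|a b Ha Hb F SF|a b Hb F SF|a b Ha F SF].
- exact: ract0.
- by rewrite (raD RA) ractN Ha // Hb // subr0.
- by rewrite (raM RA); apply: Hb; apply: sub_coind_act.
- by rewrite (raM RA) Ha // (lin_map0 (ra_lin RA b)).
Qed.

Lemma ann_ideal_basic : [/\ ann_ideal (x0 * x1), ann_ideal (x0 ^+ m + x1 ^+ m),
  ann_ideal (y0 * y1) & ann_ideal (y0 ^+ m + y1 ^+ m)].
Proof.
split=> F [F1 F2] //.
  have := @act_center_y y0 1 0 0 F; rewrite mul0r addr0; apply.
  exact: (yy_center DP HA).
have := @act_center_y (y0 ^+ m.-1) 0 1 (y1 ^+ m.-1) F; rewrite -!exprSr prednK ?(m_gt0 DP) //; apply.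
exact: (ypow_center DP HA).
Qed.

Variable S : set A.
Hypothesis S_ann : forall h, ideal_gen S h -> ann_ideal h.
Let Q := ring_quot S.
Let HQ : cher_alg D (idfun : {rmorphism C -> C}) 0 Q := cher_alg_quot HA S.
Variables (yq : {mpoly C[2]} -> Q) (bal : set 'rV[Q]_d).
Hypothesis yqE : forall q, yq q = \sum_(e <- mpoly.msupp q)
  sc HQ q@_e * (yy HQ 0 ^+ e 0 * yy HQ 1 ^+ e 1).
Hypothesis bal_elim : forall x, bal x ->
  (exists a w v, x = row_tens HQ (a * ww HQ w) v - row_tens HQ a (lam w *m v)) \/
  (exists a q v, x = row_tens HQ (a * yq q) v - row_tens HQ a (const_term q *: v)).

(** Independent of the chosen representative only when [F] lies in [sub_coind]; see [pair_pi]. *)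
Definition pair (F : N) (q : Q) : 'rV[C]_d := act (repr q) F 0%N 0%N.

Lemma pair_pi F h : sub_coind F -> pair F (rq_pi S h) = act h F 0%N 0%N.
Proof.
move=> SF; have : ideal_gen S (repr (rq_pi S h) - h) by apply/ring_quotE; rewrite reprK.
move=> /S_ann/(_ F SF); rewrite (raD RA) ractN => /eqP; rewrite subr_eq0 => /eqP E.
by rewrite /pair E.
Qed.

Lemma pairD F a b : sub_coind F -> pair F (a + b) = pair F a + pair F b.
Proof.
move=> SF; have [a' ->] := rq_pi_surj a; have [b' ->] := rq_pi_surj b.
by rewrite -rmorphD !pair_pi // (raD RA).
Qed.

Lemma pairM F a b : sub_coind F -> pair F (a * b) = pair (act (repr a) F) b.
Proof.
move=> SF; have {1}-> : a = rq_pi S (repr a) by rewrite /rq_pi reprK.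
have [b' ->] := rq_pi_surj b; rewrite -rmorphM !pair_pi ?(raM RA) //.
exact: sub_coind_act.
Qed.

Lemma pair0 F : sub_coind F -> pair F 0 = 0.
Proof. by move=> SF; apply: (addrI (pair F 0)); rewrite -pairD // !addr0. Qed.

Lemma pairB F a b : sub_coind F -> pair F (a - b) = pair F a - pair F b.
Proof.
move=> SF; rewrite pairD //; congr (_ + _); apply: (addrI (pair F b)).
by rewrite subrr -pairD // subrr pair0.
Qed.

Lemma pair_sum F I (l : seq I) (a : I -> Q) : sub_coind F ->
  pair F (\sum_(i <- l) a i) = \sum_(i <- l) pair F (a i).
Proof.
move=> SF; elim: l => [|i l IH]; first by rewrite !big_nil pair0.
by rewrite !big_cons pairD // IH.
Qed.

Lemma pair_sc F a c : sub_coind F -> pair F (a * sc HQ c) = c *: pair F a.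
Proof.
move=> SF; rewrite pairM // (_ : sc HQ c = rq_pi S (sc HA c)) // pair_pi; last exact: sub_coind_act.
by rewrite (ra_sc RA).
Qed.

Lemma pair_w F a w : sub_coind F -> pair F (a * ww HQ w) = pair F a *m lam w.
Proof.
move=> SF; rewrite pairM // (_ : ww HQ w = rq_pi S (ww HA w)) // pair_pi; last exact: sub_coind_act.
by rewrite (ra_w RA) /cW !expr0 mulr1 if_same scale1r.
Qed.

Lemma pair_y F a i : sub_coind F -> pair F (a * yy HQ i) = 0.
Proof.
move=> SF; rewrite pairM // (_ : yy HQ i = rq_pi S (yy HA i)) // pair_pi; last exact: sub_coind_act.
by rewrite (ra_y RA).
Qed.

Lemma pair_yq F a q : sub_coind F -> pair F (a * yq q) = const_term q *: pair F a.
Proof.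
move=> SF; rewrite yqE mulr_sumr pair_sum //.
have -> : const_term q = \sum_(e <- mpoly.msupp q) q@_e * (e == 0%MM)%:R.
  rewrite /const_term {1}[q]mpolyE raddf_sum; apply: eq_bigr => e _ /=.
  by rewrite mpoly.mcoeffZ mcoeffX.
rewrite scaler_suml; apply: eq_bigr => e _; rewrite (scC HQ) mulrA pair_sc // -scalerA.
congr (_ *: _); have [->|e0] := eqVneq e 0%MM; first by rewrite !mnm0E !expr0 !mulr1 scale1r.
rewrite scale0r; have [e1|e1] := posnP (e 1); last first.
  by rewrite -(prednK e1) exprSr !mulrA pair_y.
have [e00|e00] := posnP (e 0); last first.
  by rewrite e1 expr0 mulr1 -(prednK e00) exprSr !mulrA pair_y.
by case/eqP: e0; apply/mnmP; apply: I2_case; rewrite mnm0E.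
Qed.

Definition row_pair (F : N) (v : 'rV[Q]_d) : C := \sum_i pair F (v 0 i) 0 i.

Lemma row_pair_tens F a v : sub_coind F -> row_pair F (row_tens HQ a v) = (pair F a *m v) 0 0.
Proof.
move=> SF; rewrite mxE; apply: eq_bigr => i _.
by rewrite !mxE pair_sc // mxE mulrC.
Qed.

Lemma row_pair_lin F a u v : sub_coind F ->
  row_pair F (a *: u + v) = row_pair (act (repr a) F) u + row_pair F v.
Proof.
move=> SF; rewrite -big_split; apply: eq_bigr => i _.
by rewrite !mxE pairD // pairM // mxE.
Qed.

Lemma row_pair_bal F v : sub_coind F -> submod_gen bal v -> row_pair F v = 0.
Proof.
move=> SF Hv; move: F SF; apply: (Hv [set v | forall F, sub_coind F -> row_pair F v = 0]).
  split=> [F SF|a u' v' Hu' Hv' F SF].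
    by apply: big1 => i _; rewrite mxE pair0 // mxE.
  by rewrite row_pair_lin // Hu' ?Hv' ?addr0 //; apply: sub_coind_act.
move=> x /bal_elim H F SF.
have tensB a b u u' : row_pair F (row_tens HQ a u - row_tens HQ b u') =
    (pair F a *m u) 0 0 - (pair F b *m u') 0 0.
  rewrite -!row_pair_tens // /row_pair -sumrB; apply: eq_bigr => i _; rewrite !mxE.
  by rewrite pairB // !mxE.
case: H => [[a [w [v' ->]]]|[a [q [v' ->]]]]; rewrite tensB.
  by rewrite pair_w // mulmxA subrr.
by rewrite pair_yq // -scalemxAl -scalemxAr subrr.
Qed.

(** Used in the contrapositive: one functional with a non-zero value shows that a vector of the baby
    Verma module is non-zero. *)
Lemma verma_detect (h : 'I_d -> A) F : sub_coind F ->
  \sum_i rq_pi S (h i) *: (verma_top bal i : mod_quot bal) = 0 ->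
  \sum_i act (h i) F 0%N 0%N 0 i = 0.
Proof.
move=> SF E; pose v : 'rV[Q]_d := \row_i rq_pi S (h i).
have vE : \pi_(mod_quot bal) v = 0.
  rewrite -E [v in LHS]matrix_sum_delta big_ord1 piV_sum; apply: eq_bigr => i _.
  by rewrite mq_piZ mxE.
have : submod_gen bal (v - 0) by apply/mod_quotE; rewrite vE mq_pi0.
rewrite subr0 => Hv; apply: etrans (row_pair_bal SF Hv); apply: eq_bigr => i _.
by rewrite mxE pair_pi.
Qed.

End VermaDetect.

(** * Singular vectors *)

Section Weights.
Variables (C : numFieldType) (m : nat) (gT : finGroupType) (s t : gT) (zeta : C).
Variable D : cherednik_data C gT.
Hypothesis DP : dihedral_setup m s t zeta D.
Variables (A : pzRingType) (HA : cher_alg D (idfun : {rmorphism C -> C}) 0 A).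
Variable M : lmodType A.
Implicit Types (v : M) (rho : C).

Let r := (s * t)%g.
Local Notation k := (sc HA).
Local Notation S := (csum m s t D).
Let x0 := xx HA 0.
Let x1 := xx HA 1.
Let y0 := yy HA 0.
Let y1 := yy HA 1.
Let w := ww HA.

(** Eigenvectors of [r]. Applying [x_1] or [y_0] multiplies the eigenvalue by [zeta], applying [x_0]
    or [y_1] divides it by [zeta], and [s] inverts it. *)
Definition weight rho v := w r *: v = k rho *: v.

Lemma weight_eq rho rho' v : rho' = rho -> weight rho v -> weight rho' v.
Proof. by move->. Qed.
Lemma weightD rho v v' : weight rho v -> weight rho v' -> weight rho (v + v').
Proof. by rewrite /weight !scalerDr => -> ->. Qed.
Lemma weightZ rho c v : weight rho v -> weight rho (k c *: v).
Proof. by rewrite /weight -kZ => ->; rewrite kZ. Qed.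
Lemma weightN rho v : weight rho v -> weight rho (- v).
Proof. by rewrite /weight !scalerN => ->. Qed.

Lemma rV : (r^-1 = t * s)%g.
Proof.
have si : (s^-1 = s)%g by apply/eqP; rewrite eq_invg_mul (ss1 DP).
have ti : (t^-1 = t)%g by apply/eqP; rewrite eq_invg_mul (tt1 DP).
by rewrite invMg si ti.
Qed.

Lemma weight_rX rho l v : weight rho v -> w (r ^+ l)%g *: v = k (rho ^+ l) *: v.
Proof.
move=> Hv; elim: l => [|l IH]; first by rewrite !expg0 expr0 /w (ww1 HA) rmorph1 !scale1r.
by rewrite expgS /w (wwM HA) -scalerA IH -kZ [ww HA r *: v]Hv kM exprSr.
Qed.

Lemma ssM v : w s *: (w s *: v) = v.
Proof. by rewrite scalerA -(wwM HA) (ss1 DP) (ww1 HA) scale1r. Qed.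

Lemma weight_diff rho rho' v : rho != rho' -> weight rho v -> weight rho' v -> v = 0.
Proof.
move=> c E E'; apply: (k_eq0 (HA := HA) (c := rho - rho')); first by rewrite subr_eq0.
by rewrite rmorphB scalerBl -E -E' subrr.
Qed.

Lemma weight_s rho v : rho != 0 -> weight rho v -> weight rho^-1 (w s *: v).
Proof.
move=> r0 Hv; rewrite /weight scalerA /w -(wwM HA).
have -> : (r * s = s * r^-1)%g by rewrite rV mulgA.
rewrite (wwM HA) -scalerA kZ; congr (_ *: _); apply/eqP.
rewrite -subr_eq0; apply/eqP; apply: (k_eq0 (HA := HA) r0).
by rewrite scalerBr kM mulfV // k1 kZ -Hv scalerA -(wwM HA) mulVg (ww1 HA) scale1r subrr.
Qed.

Lemma s_x0 v : w s *: (x0 *: v) = x1 *: (w s *: v).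
Proof.
have rs : ~~ rot D s by rewrite -[s]mul1g -(expg0 r) (rot_rXs DP).
have ks : kap D s = 1 by rewrite -[s]mul1g -(expg0 r) (kap_rXs DP).
by rewrite scalerA; have [-> _] := wx_refl DP HA rs; rewrite ks !rmorph1 mul1r -scalerA.
Qed.
Lemma s_x1 v : w s *: (x1 *: v) = x0 *: (w s *: v).
Proof. by rewrite -{1}[v]ssM -s_x0 ssM. Qed.
Lemma s_y0 v : w s *: (y0 *: v) = y1 *: (w s *: v).
Proof.
have rs : ~~ rot D s by rewrite -[s]mul1g -(expg0 r) (rot_rXs DP).
have ks : kap D s = 1 by rewrite -[s]mul1g -(expg0 r) (kap_rXs DP).
by rewrite scalerA; have [-> _] := wy_refl DP HA rs; rewrite ks invr1 !rmorph1 mul1r -scalerA.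
Qed.
Lemma s_y1 v : w s *: (y1 *: v) = y0 *: (w s *: v).
Proof. by rewrite -{1}[v]ssM -s_y0 ssM. Qed.

Let rr : rot D r. Proof. by rewrite -[r]expg1 (rot_rX DP). Qed.
Let kr : kap D r = zeta. Proof. by rewrite -[r in LHS]expg1 (kap_rX DP). Qed.

Let weight_gen rho v (a : A) c : w r * a = k c * a * w r -> weight rho v -> weight (c * rho) (a *: v).
Proof. by move=> E Hv; rewrite /weight scalerA E -!scalerA Hv -kM -kZ. Qed.

Lemma weight_x0 rho v : weight rho v -> weight (zeta^-1 * rho) (x0 *: v).
Proof. by apply: weight_gen; have [-> _] := wx_rot DP HA rr; rewrite kr. Qed.
Lemma weight_x1 rho v : weight rho v -> weight (zeta * rho) (x1 *: v).
Proof. by apply: weight_gen; have [_ ->] := wx_rot DP HA rr; rewrite kr. Qed.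
Lemma weight_y0 rho v : weight rho v -> weight (zeta * rho) (y0 *: v).
Proof. by apply: weight_gen; have [-> _] := wy_rot DP HA rr; rewrite kr. Qed.
Lemma weight_y1 rho v : weight rho v -> weight (zeta^-1 * rho) (y1 *: v).
Proof. by apply: weight_gen; have [_ ->] := wy_rot DP HA rr; rewrite kr. Qed.

Lemma weight_x0X rho n v : weight rho v -> weight (zeta ^- n * rho) (x0 ^+ n *: v).
Proof.
elim: n v => [|n IH] v Hv; first by rewrite !expr0 invr1 mul1r scale1r.
rewrite [x0 ^+ _]exprS -scalerA; apply: weight_eq (weight_x0 (IH _ Hv)).
by rewrite mulrA -invfM -?exprS -?exprSr.
Qed.
Lemma weight_x1X rho n v : weight rho v -> weight (zeta ^+ n * rho) (x1 ^+ n *: v).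
Proof.
elim: n v => [|n IH] v Hv; first by rewrite !expr0 mul1r scale1r.
rewrite [x1 ^+ _]exprS -scalerA; apply: weight_eq (weight_x1 (IH _ Hv)).
by rewrite mulrA -exprS.
Qed.

(** [r^l s v = rho^-l s v], so a combination of reflections collapses to a scalar times [s]; for the
    commutators that scalar is a value of [csum]. *)
Lemma wsum_weight rho f v : rho != 0 -> weight rho v ->
  wsum m s t HA f *: v = k (\sum_(l < m) f l * rho^-1 ^+ l) *: (w s *: v).
Proof.
move=> r0 Hv; rewrite scaler_suml rmorph_sum scaler_suml; apply: eq_bigr => l _.
rewrite -scalerA (wwM HA) -scalerA [ww HA _ *: _](weight_rX l (weight_s r0 Hv)) kM.
by [].
Qed.

Section Commutators.
Variables (rho : C) (v : M).
Hypotheses (r0 : rho != 0) (Hv : weight rho v).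

Lemma y0x0_weight : y0 *: (x0 *: v) = x0 *: (y0 *: v) - k (S rho^-1) *: (w s *: v).
Proof. by rewrite scalerA /y0 /x0 (y0x0_0 DP) scalerBl -scalerA (wsum_weight _ r0 Hv). Qed.
Lemma y1x1_weight : y1 *: (x1 *: v) = x1 *: (y1 *: v) - k (S rho^-1) *: (w s *: v).
Proof. by rewrite scalerA /y1 /x1 (y1x1_0 DP) scalerBl -scalerA (wsum_weight _ r0 Hv). Qed.
Lemma y0x1_weight : y0 *: (x1 *: v) = x1 *: (y0 *: v) + k (S (zeta^-1 * rho^-1)) *: (w s *: v).
Proof.
rewrite scalerA /y0 /x1 (y0x1 DP) scalerDl -scalerA (wsum_weight _ r0 Hv).
by rewrite /csum; congr (_ + k _ *: _); apply: eq_bigr => l _; rewrite exprMn !exprVn mulrA.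
Qed.
Lemma y1x0_weight : y1 *: (x0 *: v) = x0 *: (y1 *: v) + k (S (zeta * rho^-1)) *: (w s *: v).
Proof.
rewrite scalerA /y1 /x0 (y1x0 DP) scalerDl -scalerA (wsum_weight _ r0 Hv).
by rewrite /csum; congr (_ + k _ *: _); apply: eq_bigr => l _; rewrite exprMn mulrA.
Qed.
End Commutators.

Lemma hw_type_gen d (lam : gT -> 'M[C]_d) (n : 'I_d -> M) :
  lam 1%g = 1%:M -> (forall g g', lam (g * g')%g = lam g *m lam g') ->
  (forall j, w s *: n j = \sum_i k (lam s i j) *: n i) ->
  (forall j, w r *: n j = \sum_i k (lam r i j) *: n i) ->
  (forall i j, yy HA i *: n j = 0) -> hw_type HA lam n.
Proof.
move=> lam1 lamM Hs Hr Hy; split=> // g j.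
pose P g := forall j, w g *: n j = \sum_i k (lam g i j) *: n i.
have PM g1 g2 : P g1 -> P g2 -> P (g1 * g2)%g.
  move=> P1 P2 l; rewrite /w (wwM HA) -scalerA P2 scaler_sumr.
  under eq_bigr => i _.
    rewrite -kZ P1 scaler_sumr; under eq_bigr do rewrite kM; over.
  rewrite exchange_big /=; apply: eq_bigr => i _; rewrite -scaler_suml -rmorph_sum lamM mxE.
  by congr (k _ *: _); apply: eq_bigr => p _; rewrite mulrC.
have PX l : P (r ^+ l)%g.
  elim: l => [|l IH]; last by rewrite expgS; apply: PM.
  move=> j'; rewrite expg0 lam1 /w (ww1 HA) scale1r (bigD1 j') //= mxE eqxx mulr1n k1.
  by rewrite big1 ?addr0 // => i /negPf ij; rewrite mxE ij mulr0n k0.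
by have [l [_ [->|->]]] := dihedral_cases DP g; [exact: PX|exact: (PM _ _ (PX l))].
Qed.

End Weights.

Lemma sgnX_V (C : numFieldType) (f : bool) : ((-1) ^+ f)^-1 = (-1) ^+ f :> C.
Proof. by case: f; rewrite ?expr0 ?expr1 ?invr1 // invrN1. Qed.

Lemma sgnX_neq0 (C : numFieldType) (f : bool) : (-1) ^+ f != 0 :> C.
Proof. by rewrite expf_neq0 // oppr_eq0 oner_eq0. Qed.

(* The linear character with s |-> (-1)^e and st |-> (-1)^f. *)
Definition lin (e f : bool) : irr_label :=
  match e, f with false, false => Triv | true, false => Sgn | false, true => Eps1 | true, true => Eps2 end.

Lemma irr_cases (m : nat) (l : irr_label) : Irr m l ->
  (exists e f, l = lin e f /\ (f -> ~~ odd m)) \/ exists2 i, (1 <= i <= nPhi m)%N & l = Phi i.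
Proof.
case: l => [_|_|me|me|i Hi]; [left|left|left|left|by right; exists i].
- by exists false, false.
- by exists true, false.
- by exists false, true.
- by exists true, true.
Qed.

Lemma Irr_lin m (e f : bool) : (f -> ~~ odd m) -> Irr m (lin e f).
Proof. by case: e f => -[] // H; apply: H. Qed.

(** The bound [2 i < m] treats both parities of [m] at once. *)
Lemma nPhi_double m i : (5 <= m)%N -> (i <= nPhi m)%N = (i.*2 < m)%N.
Proof. by rewrite /nPhi => m5; case: (boolP (odd m)) => om; lia. Qed.

Section Roots.
Variables (C : numFieldType) (m : nat) (gT : finGroupType) (s t : gT) (zeta : C).
Variable D : cherednik_data C gT.
Hypothesis DP : dihedral_setup m s t zeta D.

Local Notation S := (csum m s t D).

Lemma zetaX_neq0 n : zeta ^+ n != 0.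
Proof. by rewrite expf_neq0 // (zeta_neq0 DP). Qed.

Lemma zetaX_neq1 n : ~~ (m %| n)%N -> zeta ^+ n != 1.
Proof. by rewrite -(prim_order_dvd (zeta_prim DP)). Qed.

Lemma zeta_half : ~~ odd m -> zeta ^+ m./2 = -1.
Proof.
move=> me; have m2 := even_halfK me.
have : (zeta ^+ m./2) ^+ 2 == 1 by rewrite -exprM muln2 m2 (zetam DP).
rewrite sqrf_eq1 => /orP[|/eqP//].
rewrite -(prim_order_dvd (zeta_prim DP)) => /dvdn_leq; have := m_ge5 DP.
by lia.
Qed.

Lemma csum_zetaX n : ~~ (m %| n.*2)%N -> S (zeta ^+ n) = 0.
Proof.
move=> mn; apply: (csum_eq0 DP); first by rewrite exprAC (zetam DP) expr1n.
by rewrite -exprM muln2 zetaX_neq1.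
Qed.

Lemma csum_zetaXV n : ~~ (m %| n.*2)%N -> S (zeta ^- n) = 0.
Proof.
move=> mn; apply: (csum_eq0 DP); first by rewrite exprVn exprAC (zetam DP) expr1n invr1.
by rewrite exprVn invr_eq1 -exprM muln2 zetaX_neq1.
Qed.

Lemma ndvd_small n : (0 < n < m)%N -> ~~ (m %| n)%N.
Proof. by case/andP=> n0 nm; rewrite gtnNdvd. Qed.

End Roots.

Section HighestWeights.
Variables (C : numFieldType) (m : nat) (gT : finGroupType) (s t : gT) (zeta : C).
Variable D : cherednik_data C gT.
Hypothesis DP : dihedral_setup m s t zeta D.
Variables (A : pzRingType) (HA : cher_alg D (idfun : {rmorphism C -> C}) 0 A).
Variable lam : forall l, gT -> 'M[C]_(irr_deg l).
Hypothesis lam1 : forall l, lam l 1%g = 1%:M.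
Hypothesis lamM : forall l g g', lam l (g * g')%g = lam l g *m lam l g'.
Hypothesis lam_s : forall l, Irr m l -> lam l s = irr_s C l.
Hypothesis lam_t : forall l, Irr m l -> lam l t = irr_t zeta l.

Let r := (s * t)%g.
Local Notation k := (sc HA).
Local Notation S := (csum m s t D).
Let x0 := xx HA 0.
Let x1 := xx HA 1.
Let y0 := yy HA 0.
Let y1 := yy HA 1.
Let w := ww HA.
Local Notation wt := (weight s t HA).

Lemma lam_lin_s (e f : bool) : (f -> ~~ odd m) -> lam (lin e f) s = ((-1) ^+ e)%:M.
Proof. by move=> mf; rewrite (lam_s (Irr_lin e mf)); case: e f mf => -[]. Qed.

Lemma lam_lin_r (e f : bool) : (f -> ~~ odd m) -> lam (lin e f) r = ((-1) ^+ f)%:M.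
Proof.
move=> mf; rewrite /r lamM (lam_s (Irr_lin e mf)) (lam_t (Irr_lin e mf)).
by case: e f mf => -[] _ /=; rewrite -scalar_mxM ?mulr1 ?mul1r ?mulrNN ?mulr1.
Qed.

Lemma lam_phi_r i : (1 <= i <= nPhi m)%N -> lam (Phi i) r =
  \matrix_(p, q) (if p == q then if p == 0 then zeta ^+ i else zeta ^- i else 0).
Proof.
move=> Hi; rewrite /r lamM lam_s // lam_t //.
by apply/matrixP => p q; rewrite mxE sum_I2; elim/I2_case: p; elim/I2_case: q;
  rewrite !antidiagE !mxE /=; ring.
Qed.

Section InModule.
Variable M : lmodType A.

Lemma hw_lin (e f : bool) (v : M) : (f -> ~~ odd m) -> w s *: v = k ((-1) ^+ e) *: v ->
  wt ((-1) ^+ f) v -> y0 *: v = 0 -> y1 *: v = 0 -> hw_type HA (lam (lin e f)) (fun _ => v).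
Proof.
move=> mf sv rv yv0 yv1.
have scalar_sum d (c : C) (j : 'I_d) : \sum_i k ((c%:M : 'M_d) i j) *: v = k c *: v.
  rewrite (bigD1 j) //= mxE eqxx mulr1n big1 ?addr0 // => i /negPf ij.
  by rewrite mxE ij mulr0n k0.
apply: (hw_type_gen DP (lam1 _) (@lamM _)) => [j|j|i j].
- by rewrite lam_lin_s // scalar_sum.
- by rewrite lam_lin_r // scalar_sum.
- by elim/I2_case: i.
Qed.

Lemma hw_phi i (v : M) : (1 <= i <= nPhi m)%N -> wt (zeta ^+ i) v -> y0 *: v = 0 -> y1 *: v = 0 ->
  hw_type HA (lam (Phi i)) (fun j : 'I_2 => if j == 0 then v else w s *: v).
Proof.
move=> Hi rv yv0 yv1; apply: (hw_type_gen DP (lam1 _) (@lamM _)) => [j|j|p j].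
- rewrite lam_s // sum_I2; elim/I2_case: j; rewrite !antidiagE k1 k0 ?addr0 ?add0r //=.
  exact: (ssM DP).
- rewrite lam_phi_r // sum_I2; elim/I2_case: j; rewrite !mxE /= k0 ?addr0 ?add0r //.
  exact: (weight_s DP (zetaX_neq0 DP i) rv).
- elim/I2_case: p; elim/I2_case: j => //=.
    by rewrite -[LHS](ssM DP HA) (s_y0 DP) (ssM DP) yv1 scaler0.
  by rewrite -[LHS](ssM DP HA) (s_y1 DP) (ssM DP) yv0 scaler0.
Qed.

Lemma hw_lin_s (e f : bool) (n : 'I_(irr_deg (lin e f)) -> M) j : (f -> ~~ odd m) ->
  hw_type HA (lam (lin e f)) n ->
  w s *: n j = k ((-1) ^+ e) *: n j /\ wt ((-1) ^+ f) (n j).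
Proof.
have scalar_sum d (c : C) (u : 'I_d -> M) (q : 'I_d) : \sum_i k ((c%:M : 'M_d) i q) *: u i = k c *: u q.
  rewrite (bigD1 q) //= mxE eqxx mulr1n big1 ?addr0 // => i /negPf ij.
  by rewrite mxE ij mulr0n k0.
by move=> mf [nw _]; rewrite /weight /w !nw lam_lin_s // lam_lin_r // !scalar_sum.
Qed.

Lemma hw_phi_s i (n : 'I_2 -> M) : (1 <= i <= nPhi m)%N -> hw_type HA (lam (Phi i)) n ->
  w s *: n 0 = n 1 /\ wt (zeta ^+ i) (n 0).
Proof.
move=> Hi [nw _]; rewrite /weight /w !nw lam_s // lam_phi_r // !sum_I2 !antidiagE !mxE /=.
by rewrite !k0 k1 addr0 add0r.
Qed.

End InModule.

(* Singular vectors, that is, vectors killed by y_0 and y_1. *)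
Section Singular.
Variables (M : lmodType A).
Implicit Types v : M.

Section Degree1.
Variables (rho : C) (v : M).
Hypotheses (rho0 : rho != 0) (Hv : wt rho v) (v0 : y0 *: v = 0) (v1 : y1 *: v = 0).

Lemma singular_x1 : S (zeta^-1 * rho^-1) = 0 -> S rho^-1 = 0 ->
  y0 *: (x1 *: v) = 0 /\ y1 *: (x1 *: v) = 0.
Proof.
move=> S1 S2; rewrite (y0x1_weight DP rho0 Hv) (y1x1_weight DP rho0 Hv) S1 S2 -/y0 -/y1 v0 v1.
by rewrite !k0 !scaler0 subr0 addr0.
Qed.
Lemma singular_x0 : S (zeta * rho^-1) = 0 -> S rho^-1 = 0 ->
  y0 *: (x0 *: v) = 0 /\ y1 *: (x0 *: v) = 0.
Proof.
move=> S1 S2; rewrite (y0x0_weight DP rho0 Hv) (y1x0_weight DP rho0 Hv) S1 S2 -/y0 -/y1 v0 v1.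
by rewrite !k0 !scaler0 subr0 addr0.
Qed.
End Degree1.

Variables (e : bool) (v : M).
Hypotheses (sv : w s *: v = k ((-1) ^+ e) *: v) (rv : wt 1 v) (v0 : y0 *: v = 0) (v1 : y1 *: v = 0).

Lemma s_xpow n : w s *: (x0 ^+ n *: v) = k ((-1) ^+ e) *: (x1 ^+ n *: v).
Proof.
elim: n => [|n IH]; first by rewrite !expr0 !scale1r.
by rewrite !exprS -!scalerA (s_x0 DP) IH -kZ.
Qed.
Lemma s_xpow1 n : w s *: (x1 ^+ n *: v) = k ((-1) ^+ e) *: (x0 ^+ n *: v).
Proof.
elim: n => [|n IH]; first by rewrite !expr0 !scale1r.
by rewrite !exprS -!scalerA (s_x1 DP) IH -kZ.
Qed.

Let wv0 n : wt (zeta ^- n) (x0 ^+ n *: v).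
Proof. by rewrite -[zeta ^- n]mulr1; exact: (weight_x0X DP n rv). Qed.
Let wv1 n : wt (zeta ^+ n) (x1 ^+ n *: v).
Proof. by rewrite -[zeta ^+ n]mulr1; exact: (weight_x1X DP n rv). Qed.

(* In degree at most m/2 only the extreme terms of the commutators survive. *)
Lemma y_x0pow n : (n.*2 < m)%N ->
  y0 *: (x0 ^+ n.+1 *: v) = - (k (S 1 * (-1) ^+ e) *: (x0 ^+ n *: v)) /\
  y1 *: (x0 ^+ n.+1 *: v) = k (S (zeta ^+ n.+1) * (-1) ^+ e) *: (x1 ^+ n *: v).
Proof.
have zV i : (zeta ^- i)^-1 = zeta ^+ i by rewrite invrK.
have zn0 i : zeta ^- i != 0 by rewrite invr_eq0 (zetaX_neq0 DP).
elim: n => [|n IH] Hn.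
  rewrite !expr1 !expr0 !scale1r (y0x0_weight DP (oner_neq0 _) rv) (y1x0_weight DP (oner_neq0 _) rv).
  by rewrite -/y0 -/y1 v0 v1 !scaler0 sub0r add0r !invr1 mulr1 -/w sv !kM.
have [|E0 E1] := IH; first by move: Hn; rewrite doubleS; lia.
have Sn : S (zeta ^+ n.+1) = 0.
  by apply: (csum_zetaX DP); apply: ndvd_small; rewrite Hn doubleS.
rewrite [x0 ^+ n.+2]exprS -scalerA (y0x0_weight DP (zn0 _) (wv0 n.+1)).
rewrite (y1x0_weight DP (zn0 _) (wv0 n.+1)) -/y0 -/y1 E0 E1 Sn mul0r k0 scaler0 add0r.
rewrite !zV Sn k0 subr0 -exprS -/w s_xpow kM; split=> //.
by rewrite scalerN -kZ [x0 *: (_ *: _)]scalerA -exprS.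
Qed.

Lemma y_x1pow n : (n.*2 < m)%N ->
  y1 *: (x1 ^+ n.+1 *: v) = - (k (S 1 * (-1) ^+ e) *: (x1 ^+ n *: v)) /\
  y0 *: (x1 ^+ n.+1 *: v) = k (S (zeta ^+ n.+1) * (-1) ^+ e) *: (x0 ^+ n *: v).
Proof.
move=> Hn; have [E0 E1] := y_x0pow Hn.
have sgn2 (u : M) : k ((-1) ^+ e) *: (k ((-1) ^+ e) *: u) = u.
  by rewrite kM -expr2 sqrr_sign k1.
have E (u : M) : k ((-1) ^+ e) *: u = 0 -> u = 0 by apply: k_eq0; exact: sgnX_neq0.
have -> : x1 ^+ n.+1 *: v = k ((-1) ^+ e) *: (w s *: (x0 ^+ n.+1 *: v)).
  by rewrite s_xpow sgn2.
split.
  rewrite -kZ -(s_y0 DP) -/y0 E0 scalerN -kZ s_xpow scalerN !kM; congr (- (k _ *: _)).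
  by rewrite mulrAC -expr2 sqrr_sign mul1r.
rewrite -kZ -(s_y1 DP) -/y1 E1 -kZ s_xpow1 !kM; congr (k _ *: _).
by rewrite mulrAC -expr2 sqrr_sign mul1r.
Qed.

(** Up to the common sign, [y0] sends [x0^(m/2) v] to [- S(1) x0^(m/2-1) v] and [x1^(m/2) v] to
    [S(-1) x0^(m/2-1) v], because [zeta^(m/2) = -1]. The combination with sign [(-1)^d] is killed
    exactly under the assumption on [S(-1)]; [y1] is symmetric. *)
Lemma singular_xhalf (d : bool) : ~~ odd m -> S (-1) = (-1) ^+ d * S 1 ->
  let n := x0 ^+ m./2 *: v + k ((-1) ^+ d) *: (x1 ^+ m./2 *: v) in
  [/\ w s *: n = k ((-1) ^+ (e (+) d)) *: n, wt (-1) n, y0 *: n = 0 & y1 *: n = 0].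
Proof.
move=> me SS n; have zh := zeta_half DP me.
have [q mq] : exists q, m./2 = q.+1.
  by have := m_ge5 DP; have := even_halfK me; case: m./2 => [|q] Hq; [lia|exists q].
have q2 : (q.*2 < m)%N by have := even_halfK me; rewrite mq; lia.
have [E0 E1] := y_x0pow q2; have [F1 F0] := y_x1pow q2.
have dd : (-1 : C) ^+ d * (-1) ^+ d = 1 by rewrite -expr2 sqrr_sign.
rewrite -mq in E0 E1 F1 F0; rewrite zh in E1 F0.
split.
- rewrite /n scalerDr -[w s *: (k _ *: _)]kZ s_xpow s_xpow1 scalerDr !kM addrC signr_addb.
  by rewrite [_ * (-1) ^+ e]mulrC -mulrA dd mulr1.
- by apply: weightD; [|apply: weightZ]; apply: weight_eq (wv0 _) || apply: weight_eq (wv1 _);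
    rewrite zh ?invrN1.
- rewrite /n scalerDr -kZ E0 F0 kM SS mulrA mulrA dd mul1r; exact: addNr.
- rewrite /n scalerDr -kZ E1 F1 scalerN kM SS mulrA; exact: subrr.
Qed.

End Singular.

End HighestWeights.

(** * Blocks *)

Section VermaSystem.
Variables (C : numFieldType) (m : nat) (gT : finGroupType) (s t : gT) (zeta : C).
Variable D : cherednik_data C gT.
Hypothesis DP : dihedral_setup m s t zeta D.
Variables (A : pzRingType) (HA : cher_alg D (idfun : {rmorphism C -> C}) 0 A).
Hypothesis RA : restricted m HA.
Variable lam : forall l, gT -> 'M[C]_(irr_deg l).
Hypothesis lam1 : forall l, lam l 1%g = 1%:M.
Hypothesis lamM : forall l g g', lam l (g * g')%g = lam l g *m lam l g'.
Hypothesis lam_s : forall l, Irr m l -> lam l s = irr_s C l.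
Hypothesis lam_t : forall l, Irr m l -> lam l t = irr_t zeta l.
Hypothesis lam_full : forall l, Irr m l -> spans_mx (lam l).
Variables (Dl : irr_label -> lmodType A) (T : forall l, 'I_(irr_deg l) -> Dl l).
Hypothesis T_verma : forall l, Irr m l -> is_verma HA (lam l) (@T l).
Hypothesis T_x_neq0 : forall l i j, Irr m l -> xx HA i *: @T l j <> 0.
Hypothesis T_xh_neq0 : forall l j c, Irr m l -> ~~ odd m ->
  xx HA 0 ^+ m./2 *: @T l j + sc HA c *: (xx HA 1 ^+ m./2 *: @T l j) <> 0.

Let r := (s * t)%g.
Local Notation k := (sc HA).
Local Notation S := (csum m s t D).
Let x0 := xx HA 0.
Let x1 := xx HA 1.
Let y0 := yy HA 0.
Let y1 := yy HA 1.
Let w := ww HA.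
Local Notation wt := (weight s t HA).

(** [irr_deg (lin e f)] reduces to 1 only after a case analysis on [e] and [f], hence the match. *)
Definition lin_idx e f : 'I_(irr_deg (lin e f)) :=
  match e, f with false, false | true, false | false, true | true, true => ord0 end.

Definition linked l l' := forall z c, ring_center z -> acts HA (Dl l) z c <-> acts HA (Dl l') z c.

Lemma linked_sym l l' : linked l l' -> linked l' l.
Proof. by move=> H z c zC; rewrite (H z c zC). Qed.
Lemma linked_trans l l' l'' : linked l l' -> linked l' l'' -> linked l l''.
Proof. by move=> H H' z c zC; rewrite (H z c zC) (H' z c zC). Qed.

Lemma linked_hw l l' (n : 'I_(irr_deg l') -> Dl l) j : Irr m l -> Irr m l' ->
  hw_type HA (lam l') n -> n j <> 0 -> linked l l'.
Proof.
move=> Il Il' Hn nj z c zC.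
exact: (acts_link DP RA (T_verma Il) (lam_full Il) (T_verma Il') (lam_full Il') Hn nj).
Qed.

Lemma T_y i l (j : 'I_(irr_deg l)) : Irr m l -> yy HA i *: T j = 0.
Proof. by move=> Il; have [_ ->] := verma_hw (T_verma Il). Qed.

Lemma Irr_phi i : (1 <= i <= nPhi m)%N -> Irr m (Phi i).
Proof. by []. Qed.

Lemma T_lin (e f : bool) (j : 'I_(irr_deg (lin e f))) : (f -> ~~ odd m) ->
  w s *: T j = k ((-1) ^+ e) *: T j /\ wt ((-1) ^+ f) (T j).
Proof.
by move=> mf; exact: (hw_lin_s lamM lam_s lam_t _ mf (verma_hw (T_verma (Irr_lin e mf)))).
Qed.

Lemma T_phi i : (1 <= i <= nPhi m)%N ->
  w s *: @T (Phi i) 0 = @T (Phi i) 1 /\ wt (zeta ^+ i) (@T (Phi i) 0).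
Proof. by move=> Hi; exact: (hw_phi_s lamM lam_s lam_t Hi (verma_hw (T_verma (Irr_phi Hi)))). Qed.

Let m5 := m_ge5 DP.
Let false_odd : false -> ~~ odd m. Proof. by []. Qed.

(** [x_1] applied to the vector of weight [zeta^i] is singular: the commutators produce [S] at
    [zeta^-i] and [zeta^-(i+1)], and both vanish because [2 (i + 1) < m]. *)
Lemma link_phi i : (0 < i)%N -> (i < nPhi m)%N -> linked (Phi i) (Phi i.+1).
Proof.
move=> i0 im; have Hi : (1 <= i <= nPhi m)%N by rewrite i0 ltnW.
have Hi' : (1 <= i.+1 <= nPhi m)%N by rewrite im.
have [_ wT] := T_phi Hi; have zi := zetaX_neq0 DP i.
have im2 : (i.+1.*2 < m)%N by rewrite -nPhi_double.
have Si : S (zeta ^- i) = 0 by apply: (csum_zetaXV DP); apply: ndvd_small; lia.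
have Si1 : S (zeta ^- i.+1) = 0 by apply: (csum_zetaXV DP); apply: ndvd_small; lia.
have Si1' : S (zeta^-1 * zeta ^- i) = 0 by rewrite -invfM -?exprSr -?exprS.
have [Y0 Y1] := singular_x1 DP zi wT (@T_y 0 (Phi i) 0 Hi) (@T_y 1 (Phi i) 0 Hi) Si1' Si.
apply: (linked_hw (l := Phi i) (l' := Phi i.+1) (j := 0) Hi Hi' (hw_phi DP lam1 lamM lam_s lam_t Hi' _ Y0 Y1)).
  by rewrite exprS; apply: (weight_x1 DP).
exact: T_x_neq0.
Qed.

Lemma nPhi_ge2 : (2 <= nPhi m)%N.
Proof. by rewrite nPhi_double // (leq_trans _ m5). Qed.

Lemma link_triv e : S 1 = 0 -> linked (lin e false) (Phi 1).
Proof.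
move=> S0; have Il : Irr m (lin e false) by apply: Irr_lin.
have H1 : (1 <= 1 <= nPhi m)%N by have := nPhi_ge2; lia.
pose j := lin_idx e false.
have [_ wT] := T_lin j false_odd.
have Sz : S zeta^-1 = 0.
  by rewrite -[zeta]expr1; apply: (csum_zetaXV DP); apply: ndvd_small; lia.
have [||Y0 Y1] := singular_x1 DP (oner_neq0 _) wT (T_y 0 j Il) (T_y 1 j Il).
  by rewrite invr1 mulr1.
  by rewrite invr1.
apply: (linked_hw (l' := Phi _) (j := 0) Il H1 (hw_phi DP lam1 lamM lam_s lam_t H1 _ Y0 Y1)).
  by apply: weight_eq (weight_x1 DP wT); rewrite mulr1.
exact: T_x_neq0.
Qed.

Lemma nPhi_even : ~~ odd m -> m./2 = (nPhi m).+1.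
Proof. by rewrite /nPhi => me; rewrite (negPf me); lia. Qed.

(** [x_0] takes the weight -1 to [zeta^-1 * -1 = zeta^(m/2 - 1)], the weight of the last
    two-dimensional representation. *)
Lemma link_eps e : ~~ odd m -> S (-1) = 0 -> linked (lin e true) (Phi (nPhi m)).
Proof.
move=> me S0; have Il : Irr m (lin e true) by apply: Irr_lin.
have H1 : (1 <= nPhi m <= nPhi m)%N by have := nPhi_ge2; lia.
pose j := lin_idx e true.
have [_ wT] := T_lin j (fun=> me).
have zN : zeta ^+ nPhi m = zeta^-1 * -1.
  rewrite -(zeta_half DP me) nPhi_even // exprS mulrA mulVf ?mul1r //; exact: zeta_neq0 DP.
have Sz : S (zeta * - 1) = 0.
  have -> : zeta * -1 = zeta ^- nPhi m by rewrite zN invfM invrK invrN1.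
  have := nPhi_double (nPhi m) m5; rewrite leqnn => /esym Hn.
  by apply: (csum_zetaXV DP); apply: ndvd_small; rewrite Hn andbT double_gt0; have := nPhi_ge2; lia.
have n1 : -1 != 0 :> C by rewrite oppr_eq0 oner_neq0.
rewrite expr1 in wT.
have [||Y0 Y1] := singular_x0 DP n1 wT (T_y 0 j Il) (T_y 1 j Il).
- by rewrite invrN1.
- by rewrite invrN1.
apply: (linked_hw (l' := Phi _) (j := 0) Il H1 (hw_phi DP lam1 lamM lam_s lam_t H1 _ Y0 Y1)).
  by rewrite zN; apply: (weight_x0 DP).
exact: T_x_neq0.
Qed.

Lemma link_half e (d : bool) : ~~ odd m -> S (-1) = (-1) ^+ d * S 1 ->
  linked (lin e false) (lin (e (+) d) true).
Proof.
move=> me SS; have Il : Irr m (lin e false) by apply: Irr_lin.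
have Il' : Irr m (lin (e (+) d) true) by apply: Irr_lin.
pose j := lin_idx e false.
pose j' := lin_idx (e (+) d) true.
have [sT wT] := T_lin j false_odd.
have [sn wn Y0 Y1] := singular_xhalf DP sT wT (T_y 0 j Il) (T_y 1 j Il) me SS.
apply: (linked_hw (j := j') Il Il' (hw_lin (e := e (+) d) (f := true) DP lam1 lamM lam_s lam_t (fun=> me) sn wn Y0 Y1)).
exact: T_xh_neq0.
Qed.

Lemma link_all_phi i : (1 <= i <= nPhi m)%N -> linked (Phi i) (Phi 1).
Proof.
elim: i => [|[|i] IH] // /andP[_ Hi]; apply: linked_trans (IH _); last by rewrite /= ltnW.
by apply: linked_sym; apply: link_phi.
Qed.

(** The [y_i] kill the top, so only [- wsum c] contributes. On a character it is a sign times [S] at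
    1 or -1; on the top of [Phi i] it involves [S] at [zeta ^- i] and [zeta ^+ i], which is zero. *)
Definition euler_char l : C :=
  match l with Triv => - S 1 | Sgn => S 1 | Eps1 => - S (-1) | Eps2 => S (-1) | Phi _ => 0 end.

Lemma euler_char_lin e f : euler_char (lin e f) = - ((-1) ^+ e * S ((-1) ^+ f)).
Proof. by case: e f => -[]; rewrite /= ?expr1 ?expr0 ?mul1r ?mulN1r ?opprK. Qed.

Let eu := euler m s t HA.

Lemma euler_top l (j : 'I_(irr_deg l)) : Irr m l ->
  eu *: T j = k (euler_char l) *: T j.
Proof.
have E (M : lmodType A) (v : M) rho : rho != 0 -> wt rho v -> y0 *: v = 0 -> y1 *: v = 0 ->
    eu *: v = - (k (S rho^-1) *: (w s *: v)).
  move=> r0 Hv v0 v1; rewrite /eu /euler scalerBl scalerDl -!scalerA -/y0 -/y1 v0 v1.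
  by rewrite !scaler0 addr0 sub0r (wsum_weight DP _ r0 Hv).
move=> Il; case: (irr_cases Il) => [[e [f [lE mf]]]|[i Hi lE]]; subst l.
  have [sT wT] := T_lin j mf; rewrite (E _ _ _ (sgnX_neq0 C f) wT) ?T_y // sgnX_V.
  by rewrite sT kM -kN euler_char_lin; congr (k _ *: _); rewrite mulrC.
rewrite [euler_char _]/= k0.
have [sT wT] := T_phi Hi; have Hm : ~~ (m %| i.*2)%N.
  by apply: ndvd_small; rewrite double_gt0 -nPhi_double.
change 'I_2 in j; elim/I2_case: j.
  by rewrite (E _ _ _ (zetaX_neq0 DP i) wT) ?T_y // (csum_zetaXV DP) // k0 oppr0.
have zV0 : zeta ^- i != 0 by rewrite invr_eq0 (zetaX_neq0 DP).
have := weight_s DP (zetaX_neq0 DP i) wT; rewrite -/w sT => wT1.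
by rewrite (E _ _ _ zV0 wT1) ?T_y // invrK (csum_zetaX DP) // k0 oppr0.
Qed.

Lemma acts_euler l : Irr m l -> acts HA (Dl l) eu (euler_char l).
Proof.
move=> Il; have [c [ac nc]] := center_acts DP RA (T_verma Il) (lam_full Il) (euler_center DP HA).
have [j Tj] := verma_neq0 (T_verma Il).
have -> // : euler_char l = c; apply/eqP; apply: contrapT => /negP ce; apply: Tj.
apply: (gen_eigen_disj (HA := HA) (n := 1) (euler_center DP HA) ce _ (nc _)).
by rewrite expr1 scalerBl [_ *: T j]euler_top // subrr.
Qed.

Lemma sgn_eq (C' : numFieldType) (e e' : bool) (c c' : C') :
  - ((-1) ^+ e * c) = - ((-1) ^+ e' * c') -> c' = (-1) ^+ (e (+) e') * c.
Proof.
by move=> /oppr_inj E; rewrite signr_addb mulrAC E mulrAC -expr2 sqrr_sign mul1r.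
Qed.

(** Two different characters with the same value at [r] share their scalar only if it is zero, and
    then both are linked to [Phi 1]. If their values at [r] differ, equality of the scalars is
    precisely the hypothesis of [link_half]. A character with the scalar of [Phi i] has scalar
    zero. *)
Lemma linked_euler l l' : Irr m l -> Irr m l' -> euler_char l = euler_char l' -> linked l l'.
Proof.
have phi1 i : (1 <= i <= nPhi m)%N -> linked (Phi i) (Phi 1) := @link_all_phi i.
have n2 : (1 <= nPhi m <= nPhi m)%N by have := nPhi_ge2; lia.
have lin0 (e f : bool) : (f -> ~~ odd m) -> euler_char (lin e f) = 0 -> linked (lin e f) (Phi 1).
  move=> mf /eqP; rewrite euler_char_lin oppr_eq0 mulf_eq0 (negPf (sgnX_neq0 _ _)) /= => /eqP.
  case: f mf => mf S0; last exact: link_triv.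
  exact: linked_trans (link_eps e (mf isT) S0) (phi1 _ n2).
have half e1 e2 : ~~ odd m -> euler_char (lin e1 false) = euler_char (lin e2 true) ->
    linked (lin e1 false) (lin e2 true).
  move=> me; rewrite !euler_char_lin expr0 expr1 => /sgn_eq SE.
  by have := link_half e1 me SE; rewrite addbA addbb addFb.
move=> Il Il'.
case: (irr_cases Il) => [[e [f [-> mf]]]|[i Hi ->]]; case: (irr_cases Il') => [[e' [f' [-> mf']]]|[i' Hi' ->]].
- have [<-|ff'] := eqVneq f f'.
    have [<- //|ee'] := eqVneq e e'; have ne : e (+) e' by case: (e) (e') ee' => -[].
    rewrite !euler_char_lin => /sgn_eq; rewrite ne expr1 mulN1r => SE.
    have S0 : S ((-1) ^+ f) = 0.
      by move/eqP: SE; rewrite -addr_eq0 -mulr2n mulrn_eq0 /= => /eqP.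
    by apply: linked_trans (lin0 _ _ mf _) (linked_sym (lin0 _ _ mf _)); rewrite euler_char_lin S0 mulr0 oppr0.
  case: f mf f' mf' ff' => mf [] mf' // _ E; last exact: half (mf' isT) E.
  exact: linked_sym (half _ _ (mf isT) (esym E)).
- by move=> E; apply: linked_trans (lin0 _ _ mf E) (linked_sym (phi1 _ Hi')).
- by move=> E; apply: linked_trans (phi1 _ Hi) (linked_sym (lin0 _ _ mf' (esym E))).
- by move=> _; apply: linked_trans (phi1 _ Hi) (linked_sym (phi1 _ Hi')).
Qed.

Section Nilpotent.
Variables (z : A) (zC : ring_center z).
Hypothesis z_verma : forall l, Irr m l -> forall v : Dl l, z ^+ m.+1 *: v = 0.
Variable M : lmodType A.
Implicit Types v : M.
Let N := m.+1.
Let zNC : ring_center (z ^+ N). Proof. exact: center_exp. Qed.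

Lemma nilp_hw l (n : 'I_(irr_deg l) -> M) j : Irr m l -> hw_type HA (lam l) n -> z ^+ N *: n j = 0.
Proof.
move=> Il Hn; have [f [fL fT]] := verma_univ (T_verma Il) Hn.
have f0 : f 0 = 0 by have := fL (-1) 0 0; rewrite scaler0 addr0 scaleN1r addNr.
by rewrite -fT -[_ *: _]addr0 -f0 -fL addr0 z_verma.
Qed.

Lemma y_w i g v : (forall i, yy HA i *: v = 0) -> yy HA i *: (w g *: v) = 0.
Proof.
move=> v0; rewrite -[LHS]scale1r -(ww1 HA) -(mulgV g) (wwM HA) -scalerA.
suff -> : ww HA g^-1 *: (yy HA i *: (w g *: v)) = 0 by rewrite scaler0.
rewrite scalerA (wwy HA) -scalerA [ww HA _ *: _]scalerA -(wwM HA) mulVg (ww1 HA) scale1r.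
by rewrite scaler_suml big1 // => j _; rewrite -scalerA v0 scaler0.
Qed.

(** Such a [v] comes from the tops of baby Verma modules: of characters for [i = 0] or [2 i = m], of
    a two-dimensional representation otherwise. *)
Lemma nilp_weight i v : (i < m)%N -> wt (zeta ^+ i) v -> (forall i, yy HA i *: v = 0) ->
  z ^+ N *: v = 0.
Proof.
move=> im wv v0.
have phi_case i' (u : M) : (0 < i')%N -> (i'.*2 < m)%N -> wt (zeta ^+ i') u ->
    (forall i, yy HA i *: u = 0) -> z ^+ N *: u = 0 /\ z ^+ N *: (w s *: u) = 0.
  move=> i0 i2 wu u0; have Hi : (1 <= i' <= nPhi m)%N by rewrite i0 nPhi_double.
  pose n : 'I_2 -> M := fun j => if j == 0 then u else w s *: u.
  have H : @hw_type C gT D A HA M 2 (lam (Phi i')) n.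
    exact: (hw_phi DP lam1 lamM lam_s lam_t Hi wu (u0 0) (u0 1)).
  have H0 := @nilp_hw (Phi i') n (0 : 'I_2) Hi H.
  have H1 := @nilp_hw (Phi i') n (1 : 'I_2) Hi H.
  by split.
have lin_case (f : bool) (u : M) : (f -> ~~ odd m) -> wt ((-1) ^+ f) u ->
    (forall i, yy HA i *: u = 0) -> z ^+ N *: u = 0.
  move=> mf wu u0.
  (* For weight 1 or -1, [u + s u] and [u - s u] span one-dimensional representations of W unless
     zero, and [u] is half their sum. *)
  have H (e : bool) : z ^+ N *: (u + k ((-1) ^+ e) *: (w s *: u)) = 0.
    have yn i0 : yy HA i0 *: (u + k ((-1) ^+ e) *: (w s *: u)) = 0.
      by rewrite scalerDr -kZ u0 y_w // scaler0 addr0.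
    have sn : w s *: (u + k ((-1) ^+ e) *: (w s *: u)) = k ((-1) ^+ e) *: (u + k ((-1) ^+ e) *: (w s *: u)).
      by rewrite !scalerDr -kZ (ssM DP) kM -expr2 sqrr_sign k1 addrC.
    have wn : wt ((-1) ^+ f) (u + k ((-1) ^+ e) *: (w s *: u)).
      apply: weightD => //; apply: weightZ; rewrite -[X in wt X]sgnX_V.
      exact: (weight_s DP (sgnX_neq0 _ _) wu).
    exact: (@nilp_hw (lin e f) (fun=> _) (lin_idx e f) (Irr_lin e mf)
      (hw_lin DP lam1 lamM lam_s lam_t mf sn wn (yn 0) (yn 1))).
  have := H true; rewrite expr1 => H1; have := H false; rewrite expr0 => H0.
  apply: (k_eq0 (HA := HA) (c := 2%:R)); first by rewrite pnatr_eq0.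
  rewrite kZ -[RHS](addr0 0) -{1}H0 -H1 -scalerDr; congr (_ *: _).
  by rewrite addrACA -kD subrr k0 addr0 -[2%:R]/(1 + 1) kD k1.
have [i0|i0] := posnP i; first by apply: (lin_case false) => //; rewrite expr0 -(expr0 zeta) -i0.
have [i2|i2] := ltnP i.*2 m; first by have [] := phi_case _ _ i0 i2 wv v0.
have [mE|mi] := eqVneq m i.*2.
  have me : ~~ odd m by rewrite mE odd_double.
  apply: (lin_case true) => //; rewrite expr1 -(zeta_half DP me).
  by apply: weight_eq wv; rewrite mE doubleK.
(* Past the middle, [s v] has weight [zeta^(m - i)], which lies in the range of the labels. *)
have [||||_] := phi_case (m - i)%N (w s *: v).
- by rewrite subn_gt0.
- by move: mi i2 im; lia.
- apply: weight_eq (weight_s DP (zetaX_neq0 DP i) wv).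
  apply: (mulIf (zetaX_neq0 DP i)); rewrite -exprD subnK 1?ltnW // (zetam DP) mulVf //.
  exact: (zetaX_neq0 DP).
- by move=> i'; apply: y_w.
- by rewrite (ssM DP).
Qed.

Lemma sum_zetaX l : (0 < l < m)%N -> \sum_(i < m) zeta ^+ l ^+ i = 0.
Proof.
move=> Hl; have zl := zetaX_neq1 DP (ndvd_small Hl); apply/eqP.
have : (zeta ^+ l - 1) * (\sum_(i < m) zeta ^+ l ^+ i) = 0.
  by rewrite -subrX1 exprAC (zetam DP) expr1n subrr.
by move/eqP; rewrite mulf_eq0 subr_eq0 (negPf zl).
Qed.

Lemma nilp_singular v : (forall i, yy HA i *: v = 0) -> z ^+ N *: v = 0.
Proof.
(* The projections of [m v] to the eigenspaces of [r]. The summand [p i] has weight [zeta^-i],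
   rewritten below with an exponent between 0 and [m - 1]. *)
move=> v0; pose p (i : nat) := \sum_(l < m) k (zeta ^+ l ^+ i) *: (w (r ^+ l)%g *: v).
have p0 i : z ^+ N *: p i = 0.
  have [j jm zj] : exists2 j, (j < m)%N & wt (zeta ^+ j) (p i).
    exists ((m - i %% m) %% m)%N; first by rewrite ltn_mod (m_gt0 DP).
    have zE : zeta ^+ ((m - i %% m) %% m) * zeta ^+ i = 1.
      rewrite (expr_modm _ (zetam DP)) -(expr_modm i (zetam DP)) -exprD subnK ?(zetam DP) //.
      by rewrite ltnW // ltn_mod (m_gt0 DP).
    have F l : k (zeta ^+ (l %% m) ^+ i) *: (w (r ^+ (l %% m))%g *: v) = k (zeta ^+ l ^+ i) *: (w (r ^+ l)%g *: v).
      by rewrite (expr_modm _ (zetam DP)) (expg_mod _ (stm DP)).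
    rewrite /weight /p -[X in _ = _ *: X](sum_shift DP F) !scaler_sumr; apply: eq_bigr => l _.
    rewrite -kZ kM [in RHS]expgS /w [in RHS](wwM HA r) -[in RHS]scalerA; congr (k _ *: _).
    by rewrite exprS exprMn mulrA zE mul1r.
  apply: nilp_weight jm zj _ => i'; rewrite scaler_sumr big1 // => l _.
  by rewrite -kZ y_w // scaler0.
apply: (k_eq0 (HA := HA) (c := m%:R)); first by rewrite pnatr_eq0 -lt0n (m_gt0 DP).
rewrite kZ; have <- : \sum_(i < m) p i = k m%:R *: v.
  rewrite exchange_big /=; under eq_bigr do rewrite -scaler_suml -rmorph_sum.
  have [q mq] : exists q, m = q.+1 by exists m.-1; rewrite prednK ?(m_gt0 DP).
  have H0 (l : 'I_m) : (0 < l)%N -> \sum_(i < m) zeta ^+ l ^+ i = 0.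
    by move=> l0; apply: sum_zetaX; rewrite l0 ltn_ord.
  rewrite (bigD1 (Ordinal (m_gt0 DP))) //= [X in _ + X]big1 ?addr0; last first.
    by move=> l l0; rewrite H0 ?k0 // lt0n; apply: contra l0 => /eqP l0; apply/eqP/val_inj.
  rewrite expr0; under eq_bigr do rewrite expr1n.
  by rewrite sumr_const card_ord expg0 /w (ww1 HA) scale1r.
by rewrite scaler_sumr big1.
Qed.

Fixpoint y_nilp p v : Prop := if p is p'.+1 then y_nilp p' (y0 *: v) /\ y_nilp p' (y1 *: v) else v = 0.

Lemma y_nilp_center p v : y_nilp p.+1 v -> y_nilp p (z ^+ N *: v).
Proof.
elim: p v => [|p IH] v [H0 H1]; first by apply: nilp_singular; exact: I2_case.
by split; rewrite -(center_comm _ _ zNC); apply: IH.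
Qed.

Lemma y_nilp_all v : y_nilp m.+1 v.
Proof.
have [Y0 Y1] := ypow_eq0 DP RA; have [_ _ y01 _] := RA.
suff H p u : y0 ^+ p.+1 *: u = 0 -> y1 ^+ p.+1 *: u = 0 -> y_nilp p.+1 u.
  by apply: H; rewrite ?Y0 ?Y1 scale0r.
elim: p u => [|p IH] u; first by rewrite !expr1.
rewrite (exprSr y0 p.+1) (exprSr y1 p.+1) -!scalerA => U0 U1.
split; apply: IH => //; rewrite exprSr -scalerA.
  by rewrite [y1 *: _]scalerA /y1 /y0 (yyC HA) -/y0 -/y1 y01 scale0r scaler0.
by rewrite [y0 *: _]scalerA y01 scale0r scaler0.
Qed.

(** [z ^+ N] kills singular vectors, so it lowers by one the length of the words in the [y_i] that
    kill a given vector; words of length [m + 1] kill everything. *)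
Lemma center_nilp_module v : z ^+ (N * m.+1) *: v = 0.
Proof.
suff H p u : y_nilp p u -> z ^+ (N * p) *: u = 0 by apply: H; exact: y_nilp_all.
elim: p u => [|p IH] u; first by move=> ->; rewrite scaler0.
by move=> /y_nilp_center/IH; rewrite scalerA -exprD addnC -mulnS.
Qed.

End Nilpotent.

Let K := (m.+1 * m.+1)%N.

(** [center_nilp_module] for the regular module, evaluated at 1. *)
Lemma center_nilp z : ring_center z -> (forall l, Irr m l -> acts HA (Dl l) z 0) -> z ^+ K = 0.
Proof.
move=> zC z0; rewrite -[LHS]mulr1; apply: (@center_nilp_module _ zC _ A^o) => l Il v.
by have := acts_nilp DP RA (T_verma Il) (lam_full Il) zC (z0 l Il) v; rewrite rmorph0 subr0.
Qed.

Lemma idem_nilp z : ring_center z -> (forall l, Irr m l -> acts HA (Dl l) z 0) -> z * z = z -> z = 0.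
Proof.
move=> zC z0 zz; rewrite -(center_nilp zC z0) /K mulnS addSn exprSr.
by elim: (m + _)%N => [|n IH]; rewrite ?expr0 ?mul1r // exprS -mulrA -IH zz.
Qed.

Section Acts.
Variable V : lmodType A.
Lemma actsB z z' c c' : acts HA V z c -> acts HA V z' c' -> acts HA V (z - z') (c - c').
Proof. by move=> H H' v; rewrite scalerBl H H' rmorphB scalerBl. Qed.
Lemma actsM z z' c c' : acts HA V z c -> acts HA V z' c' -> acts HA V (z * z') (c * c').
Proof. by move=> H H' v; rewrite -scalerA H' H kM. Qed.
Lemma acts_k c : acts HA V (k c) c.
Proof. by []. Qed.
Lemma acts1 : acts HA V 1 1.
Proof. by move=> v; rewrite rmorph1. Qed.
Lemma actsX z c n : acts HA V z c -> acts HA V (z ^+ n) (c ^+ n).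
Proof. by move=> H; elim: n => [|n IH]; [exact: acts1|rewrite !exprS; exact: actsM]. Qed.
End Acts.

Lemma center1 : @ring_center A 1.
Proof. by move=> a; rewrite mul1r mulr1. Qed.

(** [f] is a multiple of [g ^+ n] and [1 - f] a multiple of [(1 - g) ^+ n], so their product
    vanishes. *)
Lemma idem_lift (g : A) n : (0 < n)%N -> ring_center g -> (g * (1 - g)) ^+ n = 0 ->
  let f := 1 - (1 - g ^+ n) ^+ n in f * f = f.
Proof.
move=> n0 gC gn f; have gC' a b : ring_center a -> GRing.comm a b by move=> aC; apply: aC.
have fE : exists q, f = q * g ^+ n.
  exists (\sum_(i < n) (1 - g ^+ n) ^+ i); rewrite /f -[1 - (1 - g ^+ n) ^+ n]opprB subrX1.
  by rewrite -mulNr opprB opprD opprK addrA subrr add0r; apply: center_exp.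
have f1E : exists q, 1 - f = (1 - g) ^+ n * q.
  exists ((\sum_(i < n) g ^+ i) ^+ n); rewrite /f opprB addrC subrK.
  rewrite -exprMn_comm; last by apply: gC'; apply: center_sub => //; exact: center1.
  by congr (_ ^+ _); rewrite -[1 - g]opprB mulNr -subrX1 opprB.
have [q Eq] := fE; have [q' Eq'] := f1E.
apply/eqP; rewrite -subr_eq0 -{3}[f]mulr1 -mulrBr -opprB mulrN oppr_eq0 Eq' Eq.
by rewrite -!mulrA [g ^+ n * _]mulrA -exprMn_comm ?gn ?mul0r ?mulr0.
Qed.

(** Lagrange interpolation in the Euler element gives a central [g] acting by 0 or 1 on every head.
    Then [g (1 - g)] is nilpotent by [center_nilp], and [idem_lift] turns [g] into an idempotent
    with the same scalars. *)
Lemma euler_sep l0 : exists f, [/\ ring_center f, f * f = f &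
  forall l, Irr m l -> acts HA (Dl l) f (euler_char l == euler_char l0)%:R].
Proof.
pose c := euler_char l0.
(* Repeated values are harmless: each factor of the interpolation is 1 at [c], and every other
   scalar occurs at least once as a root. *)
pose vs : seq C := [seq x <- [:: - S 1; S 1; - S (-1); S (-1); 0] | x != c].
have vsP l : euler_char l != c -> euler_char l \in vs.
  by rewrite mem_filter => ->; case: l => * /=; rewrite !inE eqxx ?orbT.
have vsN : all (fun x => x != c) vs by apply: filter_all.
have [g gC ga] : exists2 g, ring_center g &
    forall l, Irr m l -> acts HA (Dl l) g (euler_char l == c)%:R.
  pose F (l : irr_label) := \prod_(x <- vs) ((c - x)^-1 * (euler_char l - x)).
  have [g gC ga] : exists2 g, ring_center g & forall l, Irr m l -> acts HA (Dl l) g (F l).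
    rewrite /F; move: (vs) => us; elim: us => [|x us [g gC ga]].
      by exists 1; [exact: center1|move=> l _; rewrite big_nil; exact: acts1].
    exists (k (c - x)^-1 * (eu - k x) * g).
      apply: center_mul => //; apply: center_mul; first exact: center_k.
      by apply: center_sub; [exact: (euler_center DP HA)|exact: center_k].
    move=> l Il; rewrite big_cons; apply: actsM; last exact: ga.
    by apply: actsM; [exact: acts_k|apply: actsB; [exact: acts_euler|exact: acts_k]].
  exists g => // l Il; have <- : F l = (euler_char l == c)%:R; last exact: ga.
  rewrite /F; have [->|lc] := eqVneq (euler_char l) c.
    rewrite big1_seq // => x /andP[_ xv]; rewrite mulVf // subr_eq0 eq_sym.
    exact: (allP vsN).
  by rewrite (big_rem _ (vsP _ lc)) /= subrr mulr0 mul0r.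
have fC : ring_center (1 - (1 - g ^+ K) ^+ K).
  apply: center_sub; first exact: center1.
  by apply: center_exp; apply: center_sub; [exact: center1|exact: center_exp].
exists (1 - (1 - g ^+ K) ^+ K); split=> //.
  apply: idem_lift => //; apply: center_nilp.
    by apply: center_mul => //; apply: center_sub => //; exact: center1.
  move=> l Il; have := actsM (ga l Il) (actsB (@acts1 _) (ga l Il)).
  by case: eqP => _; rewrite ?subrr ?mulr0 ?mul0r.
move=> l Il; have := actsB (@acts1 _) (actsX K (actsB (@acts1 _) (actsX K (ga l Il)))).
case: eqP => _; last by rewrite expr0n /= subr0 expr1n subrr.
by rewrite expr1n subrr expr0n /= subr0.
Qed.

Lemma acts_inj l z c c' : Irr m l -> acts HA (Dl l) z c -> acts HA (Dl l) z c' -> c = c'.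
Proof. by move=> Il; apply: (acts_uniq DP RA (T_verma Il) (lam_full Il)). Qed.

Lemma center_char l z : Irr m l -> ring_center z -> exists c, acts HA (Dl l) z c.
Proof. by move=> Il zC; have [c [ac _]] := center_acts DP RA (T_verma Il) (lam_full Il) zC; exists c. Qed.

Lemma in_blockP l e : in_block e (mod_head (Dl l)) <-> acts HA (Dl l) e 1.
Proof. by split=> H v; rewrite H rmorph1 scale1r. Qed.

(** A central idempotent below [e] acts by 0 or 1 on each head, with the same value on all labels
    with this Euler scalar by [linked_euler]. It thus agrees with 0 or with [e] on all heads, and
    [idem_nilp] upgrades this to equality. *)
Lemma block_euler l : Irr m l -> exists2 e, block_idempotent e &
  forall l', Irr m l' -> acts HA (Dl l') e (euler_char l' == euler_char l)%:R.
Proof.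
move=> Il; have [e [eC ee ea]] := euler_sep l; exists e => //; split=> //.
  move=> e0; have a1 := ea l Il; rewrite eqxx e0 in a1.
  have a0 : acts HA (Dl l) 0 0 by move=> v; rewrite rmorph0.
  by have /eqP := acts_inj Il a1 a0; rewrite pnatr_eq0.
move=> f [fC ff] ef; have [c fc] := center_char Il fC.
have fl' l' : Irr m l' -> acts HA (Dl l') f (if euler_char l' == euler_char l then c else 0).
  move=> Il'; case: eqVneq => E.
    by apply/(linked_euler Il' Il E c fC).
  have [c' fc'] := center_char Il' fC.
  by have := actsM (ea l' Il') fc'; rewrite (negPf E) mul0r ef.
have : c * c = c by have := actsM fc fc; rewrite ff => /(acts_inj Il)/(_ fc).
move=> /eqP; rewrite -subr_eq0 -{3}[c]mulr1 -mulrBr mulf_eq0 subr_eq0 => /orP[/eqP c0|/eqP c1]; [left|right].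
  by apply: idem_nilp => // l' Il'; have := fl' l' Il'; rewrite c0 if_same.
apply/esym/eqP; rewrite -subr_eq0; apply/eqP; apply: idem_nilp.
- exact: center_sub.
- move=> l' Il'; have := actsB (ea l' Il') (fl' l' Il'); rewrite c1.
  by case: eqP => _; rewrite subrr.
- by rewrite mulrBl !mulrBr ee (fC e) ef ff subrr subr0.
Qed.

(** A block idempotent [e] is not split by the idempotent [f] of [euler_sep]: [e f] is 0 or [e], and
    if the scalars differed, [l] would exclude the first and [l'] the second. *)
Lemma same_block_euler l l' : Irr m l -> Irr m l' ->
  same_block (mod_head (Dl l)) (mod_head (Dl l')) <-> euler_char l' = euler_char l.
Proof.
move=> Il Il'; split=> [[e [[[eC ee] e0 eP] /in_blockP el /in_blockP el']]|E].
  have [f [fC ff fa]] := euler_sep l; apply/eqP; apply: contrapT => /negP/negPf ll'.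
  have H := actsM el (fa l Il); have H' := actsM el' (fa l' Il').
  rewrite eqxx mulr1 in H; rewrite ll' mulr0 in H'.
  have [||E|E] := eP (e * f).
  - split; first exact: center_mul.
    by rewrite -mulrA [f * _]mulrA fC -[_ * f * f]mulrA ff mulrA ee.
  - by rewrite mulrA ee.
  - have := acts_inj Il H; rewrite E => /(_ 0); have a0 : acts HA (Dl l) 0 0 by move=> v; rewrite rmorph0.
    by move=> /(_ a0) /eqP; rewrite oner_eq0.
  - by move: H'; rewrite E => /(acts_inj Il' el')/eqP; rewrite oner_eq0.
have [e eb ea] := block_euler Il; exists e; split=> //; apply/in_blockP.
  by have := ea l Il; rewrite eqxx.
by have := ea l' Il'; rewrite E eqxx.
Qed.

End VermaSystem.

(** * Rigid representations *)

Section Rigid.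
Variables (C : numFieldType) (m : nat) (gT : finGroupType) (s t : gT) (zeta : C).
Variable D : cherednik_data C gT.
Hypothesis DP : dihedral_setup m s t zeta D.
Variables (A : pzRingType) (HA : cher_alg D (idfun : {rmorphism C -> C}) 0 A).
Hypothesis RA : restricted m HA.

Local Notation k := (sc HA).
Let w := ww HA.

Definition W_irreducible (L : lmodType A) :=
  (exists v : L, v <> 0) /\
  forall N : set L,
    [/\ N 0, forall v v', N v -> N v' -> N (v + v'),
        forall c v, N v -> N (k c *: v) & forall g v, N v -> N (w g *: v)] ->
    N = [set 0] \/ N = setT.

Variables (d : nat) (lam : gT -> 'M[C]_d) (V : lmodType A) (T : 'I_d -> V).
Hypotheses (VP : is_verma HA lam T) (lam_full : spans_mx lam).

Local Notation xn1 := (xn HA 1).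
Let top (al : 'cV[C]_d) : V := \sum_i k (al i 0) *: T i.

Lemma w_top g al : w g *: top al = top (lam g *m al).
Proof.
have [nw _] := verma_hw VP; rewrite /top scaler_sumr; under eq_bigr => j _.
  rewrite -kZ nw scaler_sumr; under eq_bigr do rewrite kM; over.
rewrite exchange_big; apply: eq_bigr => i _ /=; rewrite -scaler_suml -rmorph_sum mxE.
by congr (k _ *: _); apply: eq_bigr => j _; rewrite mulrC.
Qed.

Lemma topD al be : top (al + be) = top al + top be.
Proof. by rewrite /top -big_split; apply: eq_bigr => i _; rewrite mxE kD. Qed.
Lemma topZ c al : top (c *: al) = k c *: top al.
Proof. by rewrite /top scaler_sumr; apply: eq_bigr => i _; rewrite mxE kM. Qed.

Lemma top0 : top 0 = 0.
Proof. by rewrite /top big1 // => i _; rewrite mxE k0. Qed.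

Lemma top_delta j : top (delta_mx j 0) = T j.
Proof.
rewrite /top (bigD1 j) //= mxE !eqxx k1 big1 ?addr0 // => i /negPf ij.
by rewrite mxE ij k0.
Qed.

Section NoCommutator.
Hypothesis yxT : forall i p j, yy HA i *: (xx HA p *: T j) = 0.

Lemma xn1_y i (v : V) : xn1 v -> xn1 (yy HA i *: v).
Proof.
have H p (v' : V) : xn1 (yy HA i *: (xx HA p *: v')).
  have [al [u [Hu ->]]] := verma_decomp VP v'; rewrite !scalerDr; apply: xnD.
    rewrite !scaler_sumr; apply: xn_sum => j _.
    by rewrite -kZ -kZ yxT scaler0; apply: xn0.
  rewrite scalerA; have := yyxx HA i p; rewrite mul0r rmorph0 sub0r => /eqP.
  rewrite subr_eq addrC => /eqP ->; rewrite scalerDl -scalerA; apply: xnD; first exact: xn1_x.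
  rewrite scaleNr -scaleN1r; apply: xn_center; first by move=> a; rewrite mulN1r mulrN1.
  rewrite scaler_suml; apply: xn_sum => g _; rewrite -scalerA.
  by apply: xn_center; [exact: center_k|exact: xn1_w].
by move=> [v1 [v2 [_ _ ->]]]; rewrite scalerDr; apply: xnD; apply: H.
Qed.

(** Under [yxT] the subspace [xn 1] is stable under all generators, so it is a submodule and the
    head is reduced to the image of the top. *)
Lemma xn1_radical (v : V) : xn1 v -> radical v.
Proof.
move=> Hv; apply/(radicalE DP RA VP lam_full) => a; move: a v Hv.
apply: (@cherind _ _ _ _ _ _ _ HA (fun a => forall v : V, xn1 v -> xn1 (a *: v))) => [v Hv|a b Ha Hb v Hv|c a Ha v Hv|i a Ha v Hv|i a Ha v Hv|g a Ha v Hv].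
- by rewrite scale1r.
- by rewrite scalerDl; apply: xnD; [exact: Ha|exact: Hb].
- by rewrite -scalerA; apply: xn_center; [exact: center_k|exact: Ha].
- by rewrite -scalerA; apply: xn1_x.
- by rewrite -scalerA; apply: xn1_y; apply: Ha.
- by rewrite -scalerA; apply: xn1_w; apply: Ha.
Qed.

Lemma hpi_top (v : V) : exists al, hpi v = hpi (top al).
Proof.
have [al [u [/xn1_radical/head_eq0 Hu ->]]] := verma_decomp VP v; exists al.
by rewrite hpiD [hpi u]Hu addr0.
Qed.

Lemma W_irreducible_head : W_irreducible (mod_head V).
Proof.
split; first by have [j Hj] := head_neq0 DP RA VP lam_full; exists (hpi (T j)).
move=> N [N0 ND NZ NW]; have [H|/existsNP[u /not_implyP[Nu u0]]] := pselect (forall u, N u -> u = 0).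
  by left; apply/seteqP; split=> [u /H //|u ->].
right; apply/seteqP; split=> // u' _.
have [v uE] := hpi_surj u; have [al alE] := hpi_top v.
have [v' u'E] := hpi_surj u'; have [be beE] := hpi_top v'.
have al0 : al != 0.
  apply/eqP => al0; apply: u0; rewrite uE alE al0 top0; exact: mq_pi0.
have [i ali] : exists i, al i 0 != 0.
  apply: contrapT => /forallNP H; case/eqP: al0; apply/matrixP => p q; rewrite (ord1 q) mxE.
  by have /negP := H p; rewrite negbK => /eqP.
(* A matrix sending [al] to [be], supported on one column where [al] is non-zero. *)
have [co coE] := lam_full (\matrix_(p, q) (if q == i then be p 0 / al i 0 else 0)).
have -> : u' = \sum_g k (co g) *: (w g *: u).
  rewrite u'E beE uE alE; under eq_bigr do rewrite -!hpiZ w_top -topZ scalemxAl.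
  have hsum (F : gT -> 'cV_d) : \sum_g hpi (top (F g)) = hpi (top (\sum_g F g)).
    apply: esym; apply: (big_morph (fun al => hpi (top al))) => [a b|].
      by rewrite topD hpiD.
    by rewrite top0; exact: mq_pi0.
  rewrite hsum -mulmx_suml -coE; congr (hpi (top _)); apply/matrixP => p q.
  rewrite (ord1 q) mxE (bigD1 i) //= mxE eqxx divfK // big1 ?addr0 // => l /negPf li.
  by rewrite mxE li mul0r.
elim/big_ind: _ => // g _; exact/NZ/NW.
Qed.

End NoCommutator.

(** The image of the top is a non-zero W-stable subspace. If it were everything, [x_p T_j] would
    agree with a top vector modulo the radical; that vector is zero by [xn1_indep], so [x_p T_j]
    lies in the radical and [y_i x_p T_j] in [xn 1]. *)
Lemma not_W_irreducible_head i p j : ~ xn1 (yy HA i *: (xx HA p *: T j)) ->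
  ~ W_irreducible (mod_head V).
Proof.
move=> Hx [_ HN].
have [|E|E] := HN [set u | exists al, u = hpi (top al)].
- split.
  + by exists 0; rewrite top0 [RHS]mq_pi0.
  + by move=> _ _ [al ->] [be ->]; exists (al + be); rewrite topD hpiD.
  + by move=> c _ [al ->]; exists (c *: al); rewrite topZ hpiZ.
  + by move=> g _ [al ->]; exists (lam g *m al); rewrite -w_top hpiZ.
- have [l Hl] := head_neq0 DP RA VP lam_full; apply: Hl.
  have : [set u | exists al, u = hpi (top al)] (hpi (T l)) by exists (delta_mx l 0); rewrite top_delta.
  by rewrite E.
- have : [set u | exists al, u = hpi (top al)] (hpi (xx HA p *: T j)) by rewrite E.
  move=> [al alE].
  have H0 : radical (xx HA p *: T j - top al).
    apply/head_eq0; rewrite -[LHS]/(hpi _) hpiD alE -scaleN1r hpiZ.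
    by rewrite -{1}[hpi _]scale1r -scalerDl subrr scale0r.
  have /(radicalE DP RA VP lam_full) H := H0.
  have al0 : al = 0.
    apply: (xn1_indep DP RA VP lam_full); rewrite -/(top al).
    have -> : top al = xx HA p *: T j + (-1) *: (1 *: (xx HA p *: T j - top al)).
      by rewrite scale1r scaleN1r opprB addrC subrK.
    apply: xnD; first exact: xn1_x.
    by apply: xn_center; [move=> a; rewrite mulN1r mulrN1|exact: H].
  apply: Hx; have -> : xx HA p *: T j = xx HA p *: T j - top al; last exact: H.
  by rewrite al0 top0 subr0.
Qed.

End Rigid.

Section RigidLabels.
Variables (C : numFieldType) (m : nat) (gT : finGroupType) (s t : gT) (zeta : C).
Variable D : cherednik_data C gT.
Hypothesis DP : dihedral_setup m s t zeta D.
Variables (A : pzRingType) (HA : cher_alg D (idfun : {rmorphism C -> C}) 0 A).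
Hypothesis RA : restricted m HA.
Variable lam : forall l, gT -> 'M[C]_(irr_deg l).
Hypothesis lamM : forall l g g', lam l (g * g')%g = lam l g *m lam l g'.
Hypothesis lam_s : forall l, Irr m l -> lam l s = irr_s C l.
Hypothesis lam_t : forall l, Irr m l -> lam l t = irr_t zeta l.
Hypothesis lam_full : forall l, Irr m l -> spans_mx (lam l).
Variables (Dl : irr_label -> lmodType A) (T : forall l, 'I_(irr_deg l) -> Dl l).
Hypothesis T_verma : forall l, Irr m l -> is_verma HA (lam l) (@T l).

Local Notation k := (sc HA).
Local Notation S := (csum m s t D).

(** The commutators that can be non-zero on the top. For [Phi i] the mixed ones give [S] at
    [zeta^(1-i)] and [zeta^(-1-i)], and these arguments are 1 or -1 only for [i = 1] and, when [m]
    is even, for [i = m/2 - 1]. *)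
Definition rigid_cond l : Prop :=
  match l with Triv | Sgn => S 1 = 0 | Eps1 | Eps2 => S (-1) = 0
  | Phi i => (i = 1%N -> S 1 = 0) /\ (~~ odd m -> i = nPhi m -> S (-1) = 0) end.

Lemma top_not_xn1 l c j : Irr m l -> c <> 0 -> ~ xn HA 1 (k c *: @T l j).
Proof.
move=> Il c0 H; apply: c0; have VP := T_verma Il.
have := xn1_indep DP RA VP (lam_full Il) (al := \col_i (if i == j then c else 0)).
rewrite (bigD1 j) //= mxE eqxx big1 ?addr0 => [/(_ H)/matrixP/(_ j 0)|i /negPf ij].
  by rewrite !mxE eqxx.
by rewrite mxE ij k0.
Qed.

Lemma rigidP l : Irr m l -> W_irreducible HA (mod_head (Dl l)) <-> rigid_cond l.
Proof.
move=> Il; have VP := T_verma Il; have [Tw Ty] := verma_hw VP.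
case: (irr_cases Il) => [[e [f [lE mf]]]|[i Hi lE]]; subst l.
  pose rho : C := (-1) ^+ f.
  have rV : rho^-1 = rho by exact: sgnX_V.
  have rho2 : rho ^+ 2 = 1 by rewrite /rho sqrr_sign.
  have z2 : zeta ^+ 2 != 1 by apply: (zetaX_neq1 DP); apply: ndvd_small; have := m_ge5 DP; lia.
  have rm : rho ^+ m = 1.
    rewrite /rho -exprM; case: (f) mf => mf; last by rewrite mul0n.
    by rewrite mul1n -signr_odd (negPf (mf isT)).
  have Sz : S (zeta * rho) = 0.
    by apply: (csum_eq0 DP); rewrite exprMn ?rho2 ?mulr1 // rm (zetam DP) mulr1.
  have SzV : S (zeta^-1 * rho) = 0.
    apply: (csum_eq0 DP); rewrite exprMn ?rho2 ?mulr1; first by rewrite rm exprVn (zetam DP) invr1 mulr1.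
    by rewrite exprVn invr_eq1.
  have E : rigid_cond (lin e f) <-> S rho = 0.
    by rewrite /rho; case: (e) (f) => -[]; rewrite /= ?expr1 ?expr0.
  rewrite E; split=> [WI|S0].
    apply: contrapT => Srho; pose j := lin_idx e f.
    apply: (not_W_irreducible_head DP RA VP (lam_full Il) (i := 0) (p := 0) (j := j)) WI.
    have [sT wT] := hw_lin_s lamM lam_s lam_t j mf (verma_hw VP).
    rewrite (y0x0_weight DP (sgnX_neq0 _ _) wT) Ty scaler0 sub0r rV sT kM -kN.
    apply: (top_not_xn1 Il) => /eqP; rewrite oppr_eq0 mulf_eq0 (negPf (sgnX_neq0 _ _)) orbF.
    by move/eqP.
  apply: (W_irreducible_head DP RA VP (lam_full Il)) => i p j.
  have [_ wT] := hw_lin_s lamM lam_s lam_t j mf (verma_hw VP).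
  elim/I2_case: i; elim/I2_case: p.
  - by rewrite (y0x0_weight DP (sgnX_neq0 _ _) wT) Ty scaler0 sub0r rV S0 k0 oppr0.
  - by rewrite (y0x1_weight DP (sgnX_neq0 _ _) wT) Ty scaler0 add0r rV SzV k0.
  - by rewrite (y1x0_weight DP (sgnX_neq0 _ _) wT) Ty scaler0 add0r rV Sz k0.
  - by rewrite (y1x1_weight DP (sgnX_neq0 _ _) wT) Ty scaler0 sub0r rV S0 k0 oppr0.
have [i0 im] := andP Hi; have i2 : (i.*2 < m)%N by rewrite -(nPhi_double _ (m_ge5 DP)).
have [sT wT] := hw_phi_s lamM lam_s lam_t Hi (verma_hw VP).
have z0 := zetaX_neq0 DP i.
have Si : S (zeta ^- i) = 0 by apply: (csum_zetaXV DP); apply: ndvd_small; lia.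
have T00 : yy HA 0 *: (xx HA 0 *: @T (Phi i) 0) = 0.
  by rewrite (y0x0_weight DP z0 wT) Ty scaler0 sub0r Si k0 oppr0.
have T11 : yy HA 1 *: (xx HA 1 *: @T (Phi i) 0) = 0.
  by rewrite (y1x1_weight DP z0 wT) Ty scaler0 sub0r Si k0 oppr0.
have T01 : yy HA 0 *: (xx HA 1 *: @T (Phi i) 0) = k (S (zeta^-1 * zeta ^- i)) *: @T (Phi i) 1.
  by rewrite (y0x1_weight DP z0 wT) Ty scaler0 add0r sT.
have T10 : yy HA 1 *: (xx HA 0 *: @T (Phi i) 0) = k (S (zeta * zeta ^- i)) *: @T (Phi i) 1.
  by rewrite (y1x0_weight DP z0 wT) Ty scaler0 add0r sT.
have S1 : (i = 1%N -> S 1 = 0) <-> S (zeta * zeta ^- i) = 0.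
  have [-> |i1] := eqVneq i 1%N.
    by rewrite expr1 divff ?(zeta_neq0 DP) //; split=> // H; exact: H.
  split=> [_|_ iE]; last by rewrite iE in i1.
  have -> : zeta * zeta ^- i = zeta ^- i.-1.
    by rewrite -{1}(prednK i0) exprS invfM mulrA divff ?(zeta_neq0 DP) // mul1r.
  by apply: (csum_zetaXV DP); apply: ndvd_small; lia.
have Sm : (~~ odd m -> i = nPhi m -> S (-1) = 0) <-> S (zeta^-1 * zeta ^- i) = 0.
  have -> : zeta^-1 * zeta ^- i = zeta ^- i.+1 by rewrite exprS invfM.
  have [mi|mi] := eqVneq i.+1.*2 m.
    have me : ~~ odd m by rewrite -mi odd_double.
    have iE : i = nPhi m.
      by apply/eqP; rewrite eqn_leq im /= (leq_trans _ (_ : m./2.-1 <= i)%N) // /nPhi ?(negPf me); lia.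
    have -> : zeta ^- i.+1 = -1.
      by have := zeta_half DP me; rewrite -{1}mi doubleK => ->; rewrite invrN1.
    by split=> // H; exact: H.
  split=> [_|_ me iE].
    by apply: (csum_zetaXV DP); apply/negP => /dvdnP[[|[|q]]]; move: mi i2; rewrite doubleS; lia.
  by move: mi; rewrite iE /nPhi (negPf me); have := m_ge5 DP; move: me; lia.
rewrite [rigid_cond _]/= S1 Sm; split=> [WI|[H1 Hm]].
  split; apply: contrapT => S0.
    apply: (not_W_irreducible_head DP RA VP (lam_full Il) (i := 1) (p := 0) (j := (0 : 'I_2))) WI.
    by rewrite T10; apply: (top_not_xn1 Il).
  apply: (not_W_irreducible_head DP RA VP (lam_full Il) (i := 0) (p := 1) (j := (0 : 'I_2))) WI.
  by rewrite T01; apply: (top_not_xn1 Il).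
apply: (W_irreducible_head DP RA VP (lam_full Il)) => p q j.
rewrite H1 k0 in T10; rewrite Hm k0 in T01.
change 'I_2 in j; elim/I2_case: j; first by elim/I2_case: p; elim/I2_case: q.
have sinj (u : Dl (Phi i)) : ww HA s *: u = 0 -> u = 0.
  by move=> E; rewrite -[u](ssM DP HA) E scaler0.
apply: sinj; rewrite -sT; elim/I2_case: p; elim/I2_case: q.
- by rewrite (s_y0 DP) (s_x0 DP) (ssM DP).
- by rewrite (s_y0 DP) (s_x1 DP) (ssM DP).
- by rewrite (s_y1 DP) (s_x0 DP) (ssM DP).
- by rewrite (s_y1 DP) (s_x1 DP) (ssM DP).
Qed.

End RigidLabels.

(** * Specialization at u = 0 and torsion-freeness *)

Section Scalars.
Variables (gT : finGroupType) (K K' : comNzRingType) (phi : {rmorphism K -> K'}).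

Let h (n : fmonom (Defs.generator gT)) : free_algebra gT K' := mkmalgU n 1.
Let f : K -> free_algebra gT K' := fun k => scal gT (phi k).

Let fB : zmod_morphism f.
Proof. by move=> a b; rewrite /f /scal rmorphB scalerBl. Qed.
Let fM : monoid_morphism f.
Proof.
split=> [|a b]; first by rewrite /f /scal rmorph1 scale1r.
rewrite /f /scal rmorphM; exact: (rmorphM (GRing.in_alg (free_algebra gT K')) (phi a) (phi b)).
Qed.
HB.instance Definition _ := GRing.isZmodMorphism.Build K (free_algebra gT K') f fB.
HB.instance Definition _ := GRing.isMonoidMorphism.Build K (free_algebra gT K') f fM.

Let hM : monalg.mmorphism h.
Proof.
split=> // x y; rewrite /h; apply: etrans (esym (mkmalgU_mul _ _ _ _)).
by rewrite mulr1.
Qed.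
HB.instance Definition _ := monalg.isMultiplicative.Build (fmonom (Defs.generator gT)) (free_algebra gT K') h hM.

(** Base change of the free algebra along [phi]; [eval_u0] is convertible to its instance at
    [u = 0]. *)
Definition map_scal (a : free_algebra gT K) : free_algebra gT K' := monalg.mmap f h a.

Lemma map_scalB : zmod_morphism map_scal.
Proof. exact: (monalg.mmap_is_additive (f := f) (h := h)). Qed.
Lemma map_scalM : monoid_morphism map_scal.
Proof.
have [M1 M2] := monalg.commr_mmap_is_multiplicative (K := fmonom (Defs.generator gT)) (R := K) (f := f) (h := h)
  (fun g n n' => scalC (phi (monalg.mcoeff n g)) (h n')). 
by split.
Qed.
HB.instance Definition _ := GRing.isZmodMorphism.Build _ _ map_scal map_scalB.
HB.instance Definition _ := GRing.isMonoidMorphism.Build _ _ map_scal map_scalM.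

Lemma map_scal_scal k : map_scal (scal gT k) = scal gT (phi k).
Proof.
rewrite -(scal_monom gT k); apply: etrans (monalg.mmapU (f := f) (h := h) k mone) _.
exact: mulr1.
Qed.
Lemma map_scal_gen g : map_scal (free_gen K g) = free_gen K' g.
Proof.
apply: etrans (monalg.mmapU (f := f) (h := h) 1 (fmu g)) _.
by change (f 1 * h (fmu g) = free_gen K' g); rewrite fM.1 mul1r.
Qed.
End Scalars.

Lemma free_ext (gT : finGroupType) (K : comNzRingType) (B : pzRingType)
    (p q : {rmorphism free_algebra gT K -> B}) :
  (forall k, p (scal gT k) = q (scal gT k)) -> (forall g, p (free_gen K g) = q (free_gen K g)) ->
  forall a, p a = q a.
Proof.
move=> Hk Hg a; elim/free_ind: a => [|a b IHa IHb|k a IH|g a IH].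
- exact: etrans (rmorph1 p) (esym (rmorph1 q)).
- by apply: etrans (rmorphD p a b) _; rewrite IHa IHb; exact: esym (rmorphD q a b).
- by apply: etrans (rmorphM p _ a) _; rewrite Hk IH; exact: esym (rmorphM q _ a).
- by apply: etrans (rmorphM p _ a) _; rewrite Hg IH; exact: esym (rmorphM q _ a).
Qed.

Section Universal.
Variables (C : fieldType) (gT : finGroupType) (D : cherednik_data C gT).
Variables (K : comNzRingType) (iota : {rmorphism C -> K}) (u : K).
Variables (L : comNzRingType) (iota' : {rmorphism C -> L}) (u' : L).
Variables (B : pzRingType) (HB : cher_alg D iota' u' B).
Variable p : {rmorphism free_algebra gT K -> B}.
Hypotheses (pk : forall c, p (scal gT (iota c)) = sc HB (iota' c)) (pu : p (scal gT u) = sc HB u').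
Hypotheses (px : forall i, p (gx gT K i) = xx HB i) (py : forall i, p (gy gT K i) = yy HB i)
  (pw : forall g, p (gw K g) = ww HB g).
Let FA := free_algebra gT K.

Section AbstractAlg.
Variables (A : lalgType K) (q : {rmorphism A -> B}) (x y : 'I_2 -> A) (w : gT -> A).
Hypotheses (qk : forall c, q (iota c)%:A = sc HB (iota' c)) (qu : q u%:A = sc HB u').
Hypotheses (qx : forall i, q (x i) = xx HB i) (qy : forall i, q (y i) = yy HB i)
  (qw : forall g, q (w g) = ww HB g).

Lemma qZ c a : q (iota c *: a) = sc HB (iota' c) * q a.
Proof. by rewrite -[_ *: a]mulr_algl rmorphM qk. Qed.

Lemma univ_one : q (w 1%g - 1) = 0.
Proof. by rewrite rmorphB qw rmorph1 (ww1 HB) subrr. Qed.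
Lemma univ_mul g g' : q (w (g * g')%g - w g * w g') = 0.
Proof. by rewrite rmorphB rmorphM !qw (wwM HB) subrr. Qed.
Lemma univ_x g j : q (w g * x j - (\sum_i iota (hrep D g^-1 j i) *: x i) * w g) = 0.
Proof.
rewrite rmorphB !rmorphM rmorph_sum qw qx (wwx HB); apply/eqP; rewrite subr_eq0; apply/eqP.
by congr (_ * _); apply: eq_bigr => i _; rewrite qZ qx.
Qed.
Lemma univ_y g j : q (w g * y j - (\sum_i iota (hrep D g i j) *: y i) * w g) = 0.
Proof.
rewrite rmorphB !rmorphM rmorph_sum qw qy (wwy HB); apply/eqP; rewrite subr_eq0; apply/eqP.
by congr (_ * _); apply: eq_bigr => i _; rewrite qZ qy.
Qed.
Lemma univ_xx i j : q (ring_commutator (x i) (x j)) = 0.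
Proof. by rewrite rmorphB !rmorphM !qx (xxC HB) subrr. Qed.
Lemma univ_yy i j : q (ring_commutator (y i) (y j)) = 0.
Proof. by rewrite rmorphB !rmorphM !qy (yyC HB) subrr. Qed.
Lemma univ_yx i j : q (ring_commutator (y i) (x j) - ((u * (i == j)%:R)%:A -
     \sum_(g in refl D)
         iota (param D g * root_vec D g 0 i * coroot_vec D g j 0) *: w g)) = 0.
Proof.
rewrite rmorphB rmorphB !rmorphM qx qy (yyxx HB) rmorphB rmorph_sum.
have -> : q (u * (i == j)%:R)%:A = sc HB (u' * (i == j)%:R).
  by case: (i == j); rewrite ?mulr1 ?mulr0 ?scale0r ?rmorph0 ?qu.
apply/eqP; rewrite subr_eq0; apply/eqP; congr (_ - _).
by apply: eq_bigr => g _; rewrite qZ qw.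
Qed.
End AbstractAlg.

Lemma univ_rel f : (smash_rel D iota `|` commutation_rel D iota u) f -> p f = 0.
Proof.
case=> [[|g g'|g j|g j]|[i j|i j|i j]].
- exact: (univ_one pw).
- exact: (univ_mul pw).
- exact: (univ_x pk px pw).
- exact: (univ_y pk py pw).
- exact: (univ_xx px).
- exact: (univ_yy py).
- exact: (univ_yx pk pu px py pw).
Qed.

Lemma rmorph_ker (R : pzRingType) (q : {rmorphism R -> B}) : two_sided_ideal [set a | q a = 0].
Proof.
split=> [|a b /= Ha Hb|a b /= Hb|a b /= Ha]; first exact: rmorph0.
- by rewrite rmorphB Ha Hb subrr.
- by rewrite rmorphM Hb mulr0.
- by rewrite rmorphM Ha mul0r.
Qed.

Lemma univ_ideal f : ideal_gen (smash_rel D iota `|` commutation_rel D iota u) f -> p f = 0.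
Proof. by move=> H; apply: (H [set a | p a = 0] (rmorph_ker p)) => a; exact: univ_rel. Qed.

Lemma rmorph_eq (R : pzRingType) (q : {rmorphism R -> B}) a b : q (a - b) = 0 -> q a = q b.
Proof. by rewrite rmorphB => /eqP; rewrite subr_eq0 => /eqP. Qed.

(** The target may live over another coefficient ring. This serves in both directions: for the
    specialization from [Hu] to [Hc], and for a map from [Hc] to a quotient of [Hu]. *)
Lemma univ_exists : exists q : {rmorphism cherednik D iota u -> B},
  forall f, q (@cherednik_pi C gT D K iota u f) = p f.
Proof.
pose q (a : cherednik D iota u) := p (repr a).
have qE f : q (@cherednik_pi C gT D K iota u f) = p f.
  apply: rmorph_eq; apply: univ_ideal.
  by apply/ring_quotE; rewrite reprK.
pose S := smash_rel D iota `|` commutation_rel D iota u.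
have piE (a : cherednik D iota u) : exists f, a = @cherednik_pi C gT D K iota u f.
  exact: rq_pi_surj.
have qB : zmod_morphism q.
  move=> a b; have [f ->] := piE a; have [g ->] := piE b.
  have E := rmorphB (@rq_pi FA S) f g.
  apply: etrans (congr1 q (esym E)) _.
  apply: etrans (qE _) _; apply: etrans (rmorphB p f g) _.
  by rewrite (qE f) (qE g).
have qM : monoid_morphism q.
  split=> [|a b].
    have E := rmorph1 (@rq_pi FA S).
    apply: etrans (congr1 q (esym E)) _.
    by apply: etrans (qE _) _; exact: (rmorph1 p).
  have [f ->] := piE a; have [g ->] := piE b.
  have E := rmorphM (@rq_pi FA S) f g.
  apply: etrans (congr1 q (esym E)) _.
  apply: etrans (qE _) _; apply: etrans (rmorphM p f g) _.
  by rewrite (qE f) (qE g).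
pose qB' := GRing.isZmodMorphism.Build _ _ q qB.
pose qM' := GRing.isMonoidMorphism.Build _ _ q qM.
pose q' : {rmorphism cherednik D iota u -> B} := HB.pack q qB' qM'.
by exists q'.
Qed.

End Universal.

(** * ** Ordered monomials and torsion *)

Section PBW.
Variables (C : numFieldType) (m : nat) (gT : finGroupType) (s t : gT) (zeta : C).
Variable D : cherednik_data C gT.
Hypothesis DP : dihedral_setup m s t zeta D.
Variables (K : comNzRingType) (iota : {rmorphism C -> K}) (u : K).

(* The functionals on C[y_0, y_1] >< W: b p q g is the value at y_0^p y_1^q g. *)
Definition pbw_dual : lmodType K := nat -> nat -> gT -> K^o.
Definition pbw_w (g : gT) (b : pbw_dual) : pbw_dual := fun p q h =>
  if rot D g then iota (kap D g ^+ p * (kap D g)^-1 ^+ q) * b p q (g * h)%g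
  else iota ((kap D g)^-1 ^+ p * kap D g ^+ q) * b q p (g * h)%g.
Definition pbw_y (i : 'I_2) (b : pbw_dual) : pbw_dual := fun p q h =>
  if i == 0 then b p.+1 q h else b p q.+1 h.

Lemma pbw_ext (b b' : pbw_dual) : (forall p q h, b p q h = b' p q h) -> b = b'.
Proof. by move=> E; apply/funext => p; apply/funext => q; apply/funext => h. Qed.

Lemma pbw_linE a (b b' : pbw_dual) p q h : (a *: b + b') p q h = a * b p q h + b' p q h.
Proof. by []. Qed.

Lemma pbw_w_lin g : lin_map (pbw_w g).
Proof.
move=> a b b'; apply: pbw_ext => p q h; rewrite pbw_linE /pbw_w !pbw_linE.
by case: (rot D g); rewrite mulrDr !mulrA [a * _]mulrC.
Qed.
Lemma pbw_y_lin i : lin_map (pbw_y i).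
Proof. by move=> a b b'; apply: pbw_ext => p q h; rewrite pbw_linE /pbw_y; case: (i == 0). Qed.
Lemma pbw_w1 b : pbw_w 1%g b = b.
Proof.
apply: pbw_ext => p q h; rewrite /pbw_w (rot1 DP) (kap1 DP) invr1 !expr1n mulr1 rmorph1.
by rewrite mul1r mul1g.
Qed.
Lemma pbw_wM g g' b : pbw_w (g * g')%g b = pbw_w g' (pbw_w g b).
Proof.
have kg := kap_neq0 DP g; have kg' := kap_neq0 DP g'.
apply: pbw_ext => p q h; rewrite /pbw_w (rotM DP) (kapM DP).
by case: (rot D g); case: (rot D g'); rewrite /= mulgA mulrA -rmorphM; congr (iota _ * _);
  rewrite ?invfM ?invrK ?exprMn ?exprVn; ring.
Qed.
Lemma pbw_yC i j b : pbw_y i (pbw_y j b) = pbw_y j (pbw_y i b).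
Proof. by apply: pbw_ext => p q h; elim/I2_case: i; elim/I2_case: j. Qed.
Lemma pbw_yw g j b : pbw_y j (pbw_w g b) = \sum_i iota (hrep D g i j) *: pbw_w g (pbw_y i b).
Proof.
have kg := kap_neq0 DP g; apply: pbw_ext => p q h; rewrite sum_I2 (hrepE DP) pbw_linE.
rewrite -[(_ *: pbw_w g (pbw_y 1 b)) p q h]/(_ * (pbw_w g (pbw_y 1 b) p q h)) /pbw_y /pbw_w.
by case: (rot D g); elim/I2_case: j; rewrite ?antidiagE ?mxE /= ?rmorph0 ?mul0r ?addr0 ?add0r
  mulrA -rmorphM; congr (iota _ * _); rewrite !exprS; ring.
Qed.

Let N : lmodType K := coind pbw_dual.

Section Normal.
Variables (A : pzRingType) (HA : cher_alg D iota u A) (act : A -> N -> N).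
Hypothesis RA : right_action pbw_w pbw_y HA act.

Local Notation k := (sc HA).
Let x0 := xx HA 0.
Let x1 := xx HA 1.
Let y0 := yy HA 0.
Let y1 := yy HA 1.
Let w := ww HA.

Definition mon (a b p q : nat) (g : gT) : A := x0 ^+ a * x1 ^+ b * (y0 ^+ p * y1 ^+ q * w g).

Lemma act_x0pow a F p q : act (x0 ^+ a) F p q = F (a + p)%N q.
Proof.
elim: a F p => [|a IH] F p; first by rewrite expr0 (ra1 RA).
rewrite exprSr (raM RA) (ra_x RA).
have E (G : N) : cX 0 G p q = G p.+1 q by [].
by rewrite E IH addnS.
Qed.
Lemma act_x1pow a F p q : act (x1 ^+ a) F p q = F p (a + q)%N.
Proof.
elim: a F q => [|a IH] F q; first by rewrite expr0 (ra1 RA).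
rewrite exprSr (raM RA) (ra_x RA).
have E (G : N) : cX 1 G p q = G p q.+1 by [].
by rewrite E IH addnS.
Qed.
Lemma act_y0pow a F p q h : act (y0 ^+ a) F 0%N 0%N p q h = F 0%N 0%N (a + p)%N q h.
Proof.
elim: a F p => [|a IH] F p; first by rewrite expr0 (ra1 RA).
rewrite exprSr (raM RA) (ra_y RA).
have E (G : N) : cY D iota u pbw_w pbw_y 0 G 0%N 0%N p q h = G 0%N 0%N p.+1 q h by [].
by rewrite E IH addnS.
Qed.
Lemma act_y1pow a F p q h : act (y1 ^+ a) F 0%N 0%N p q h = F 0%N 0%N p (a + q)%N h.
Proof.
elim: a F q => [|a IH] F q; first by rewrite expr0 (ra1 RA).
rewrite exprSr (raM RA) (ra_y RA).
have E (G : N) : cY D iota u pbw_w pbw_y 1 G 0%N 0%N p q h = G 0%N 0%N p q.+1 h by [].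
by rewrite E IH addnS.
Qed.

(** Each ordered monomial is read off by its own coordinate of [F]; this is the independence half of
    the PBW theorem. *)
Lemma act_mon a b p q g F : act (mon a b p q g) F 0%N 0%N 0%N 0%N 1%g = F a b p q g.
Proof.
rewrite /mon !(raM RA) (ra_w RA) /cW !expr0 mulr1 if_same rmorph1 scale1r.
rewrite /pbw_w !expr0 mulr1 rmorph1 if_same mul1r mulg1 act_y1pow act_y0pow act_x1pow act_x0pow.
by rewrite !addn0.
Qed.

(** Combinations of ordered monomials; [nf_all] is the spanning half of the PBW theorem. *)
Inductive nf : A -> Prop :=
| NF_mon c a b p q g : nf (k c * mon a b p q g)
| NF_add a b : nf a -> nf b -> nf (a + b).

Lemma nf0 : nf 0.
Proof. by rewrite -(mul0r (mon 0 0 0 0 1%g)) -(rmorph0 k); constructor. Qed.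
Lemma nf_sum I (l : seq I) (P : pred I) (F : I -> A) :
  (forall i, P i -> nf (F i)) -> nf (\sum_(i <- l | P i) F i).
Proof. by move=> H; elim/big_ind: _ => //; [exact: nf0|exact: NF_add]. Qed.
Lemma nf_k c a : nf a -> nf (k c * a).
Proof.
elim=> [c' a' b p q g|a' b _ Ha _ Hb]; first by rewrite mulrA -rmorphM; constructor.
by rewrite mulrDr; constructor.
Qed.
Lemma nf_ind_mon (e : A) : (forall a b p q g, nf (e * mon a b p q g)) -> forall a, nf a -> nf (e * a).
Proof.
move=> H a; elim=> [c a' b p q g|a' b _ Ha _ Hb]; last by rewrite mulrDr; constructor.
by rewrite mulrA -(scC HA) -mulrA; apply: nf_k.
Qed.
Lemma nf_mon a b p q g : nf (mon a b p q g).
Proof. by rewrite -[mon _ _ _ _ _]mul1r -(rmorph1 k); constructor. Qed.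

Lemma nf_x i a : nf a -> nf (xx HA i * a).
Proof.
apply: nf_ind_mon => a' b p q g; elim/I2_case: i.
  by rewrite /mon !mulrA -exprS -!mulrA; have := nf_mon a'.+1 b p q g; rewrite /mon !mulrA.
have -> : xx HA 1 * mon a' b p q g = mon a' b.+1 p q g; last exact: nf_mon.
rewrite /mon !mulrA; do 3 congr (_ * _).
rewrite exprS mulrA; congr (_ * _); apply: commrX; exact: xxC.
Qed.

Lemma w_powW g (e e' : A) (d : K) n : w g * e = k d * e' * w g ->
  w g * e ^+ n = k (d ^+ n) * e' ^+ n * w g.
Proof.
move=> wp; elim: n => [|n IH]; first by rewrite !expr0 !rmorph1 !mul1r mulr1.
rewrite !exprS mulrA wp -!mulrA IH !mulrA rmorphM.
by rewrite -[_ * e' * _]mulrA -(scC HA) !mulrA.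
Qed.

Lemma w_mulW g (e e' f f' : A) (c d : K) : w g * e = k c * e' * w g -> w g * f = k d * f' * w g ->
  w g * (e * f) = k (c * d) * (e' * f') * w g.
Proof.
move=> we wf; rewrite mulrA we -mulrA wf !mulrA rmorphM; congr (_ * _ * _).
by rewrite -!mulrA; congr (_ * _); rewrite -(scC HA).
Qed.

Lemma nf_w g a : nf a -> nf (w g * a).
Proof.
apply: nf_ind_mon => a' b p q h.
have E : w g * mon a' b p q h = w g * (x0 ^+ a' * x1 ^+ b * (y0 ^+ p * y1 ^+ q)) * w h.
  by rewrite /mon !mulrA.
rewrite E; case: (boolP (rot D g)) => rg.
  have [X0 X1] := wx_rot DP HA rg; have [Y0 Y1] := wy_rot DP HA rg.
  rewrite (w_mulW (w_mulW (w_powW a' X0) (w_powW b X1)) (w_mulW (w_powW p Y0) (w_powW q Y1))).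
  rewrite -mulrA -(wwM HA) -mulrA; apply: nf_k.
  by have := nf_mon a' b p q (g * h)%g; rewrite /mon !mulrA.
have [X0 X1] := wx_refl DP HA rg; have [Y0 Y1] := wy_refl DP HA rg.
rewrite (w_mulW (w_mulW (w_powW a' X0) (w_powW b X1)) (w_mulW (w_powW p Y0) (w_powW q Y1))).
rewrite -mulrA -(wwM HA) -mulrA; apply: nf_k.
have -> : xx HA 1 ^+ a' * xx HA 0 ^+ b = xx HA 0 ^+ b * xx HA 1 ^+ a'.
  by apply: commrX; apply/commr_sym/commrX; apply: xxC.
have -> : yy HA 1 ^+ p * yy HA 0 ^+ q = yy HA 0 ^+ q * yy HA 1 ^+ p.
  by apply: commrX; apply/commr_sym/commrX; apply: yyC.
by have := nf_mon b a' q p (g * h)%g; rewrite /mon !mulrA.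
Qed.

Lemma nf_commutator i j a : nf a -> nf (yy HA i * a) -> nf (yy HA i * (xx HA j * a)).
Proof.
move=> Ha Hy; have := yyxx HA i j => /eqP; rewrite subr_eq addrC => /eqP E.
rewrite mulrA E mulrDl -mulrA; apply: NF_add; first exact: nf_x.
have NE b : - b = k (-1) * b by rewrite rmorphN1 mulN1r.
rewrite mulrBl NE; apply: NF_add; first exact: (nf_k _ Ha).
apply: nf_k; rewrite mulr_suml; apply: nf_sum => g _; rewrite -[_ * _ * a]mulrA; apply: nf_k.
exact: nf_w.
Qed.

Lemma nf_y i a : nf a -> nf (yy HA i * a).
Proof.
apply: nf_ind_mon => a' b p q g; elim: a' => [|a' IH].
  elim: b => [|b IH].
    rewrite /mon !expr0 !mul1r; elim/I2_case: i.
      by have := nf_mon 0 0 p.+1 q g; rewrite /mon !expr0 !mul1r exprS !mulrA.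
    have := nf_mon 0 0 p q.+1 g; rewrite /mon !expr0 !mul1r !mulrA exprS.
    by rewrite -[y1 * y0 ^+ p](_ : y0 ^+ p * y1 = _) ?mulrA //; apply/commr_sym/commrX; apply: yyC.
  have := nf_commutator 1 (nf_mon 0 b p q g) IH; congr (nf (_ * _)).
  by rewrite /mon !expr0 !mul1r mulrA -exprS.
have := nf_commutator 0 (nf_mon a' b p q g) IH; congr (nf (_ * _)).
by rewrite /mon !mulrA -exprS.
Qed.

Lemma nf_all a : nf a.
Proof.
move: a; apply: (@cherind _ _ _ _ _ _ _ HA nf).
- by have := nf_mon 0 0 0 0 1%g; rewrite /mon !expr0 !mul1r /w (ww1 HA).
- exact: NF_add.
- exact: nf_k.
- exact: nf_x.
- exact: nf_y.
- exact: nf_w.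
Qed.

Definition mon_at (e : nat * nat * nat * nat * gT) : A :=
  let: (a, b, p, q, g) := e in mon a b p q g.

Lemma nf_seq a : nf a -> exists l : seq (K * (nat * nat * nat * nat * gT)),
  a = \sum_(e <- l) k e.1 * mon_at e.2.
Proof.
elim=> [c a' b p q g|a' b _ [l ->] _ [l' ->]]; last by exists (l ++ l'); rewrite big_cat.
by exists [:: (c, (a', b, p, q, g))]; rewrite big_seq1.
Qed.

(** Pairing [k v * a] with the functional dual to a monomial multiplies the corresponding
    coefficient of [a] by [v]; if all these products vanish, so do the coefficients. *)
Lemma torsion_free (v : K) : (forall c, v * c = 0 -> c = 0) -> forall a, k v * a = 0 -> a = 0.
Proof.
move=> v_reg a va; have [l aE] := nf_seq (nf_all a).
(* A monomial may occur several times in [l], so its coefficients are collected first. *)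
pose co e := \sum_(f <- l | f.2 == e) f.1.
have co0 e : co e = 0.
  apply: v_reg.
  pose F : N := fun a b p q g => ((a, b, p, q, g) == e)%:R.
  have Fm e' : act (mon_at e') F 0%N 0%N 0%N 0%N 1%g = (e' == e)%:R.
    by case: e' => [[[[a' b'] p'] q'] g']; rewrite /mon_at act_mon.
  have act0 G : act 0 G = 0 by apply: (addrI (act 0 G)); rewrite -(raD RA) !addr0.
  have actE : act a F 0%N 0%N 0%N 0%N 1%g = co e.
    rewrite aE /co; elim: (l) => [|f l' IH]; first by rewrite !big_nil act0.
    rewrite !big_cons (raD RA) -[LHS]/(act _ F 0%N 0%N 0%N 0%N 1%g + act _ F 0%N 0%N 0%N 0%N 1%g) IH.
    rewrite (raM RA) (ra_sc RA) (lin_mapZ (ra_lin RA _)).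
    rewrite -[X in X + _]/(f.1 * (act (mon_at f.2) F 0%N 0%N 0%N 0%N 1%g)) Fm.
    by case: (f.2 == e); rewrite ?mulr1 ?mulr0 ?add0r.
  rewrite -actE; have := congr1 (fun G : N => G 0%N 0%N 0%N 0%N 1%g) (act0 F).
  rewrite -va (raM RA) (ra_sc RA) (lin_mapZ (ra_lin RA _)); exact.
have aE' : a = \sum_(e <- undup [seq f.2 | f <- l]) k (co e) * mon_at e.
  rewrite aE /co; under [RHS]eq_bigr do rewrite rmorph_sum mulr_suml.
  rewrite (exchange_big_dep predT) //= big_seq [RHS]big_seq; apply: eq_bigr => f fl.
  rewrite -big_filter (eq_filter (a2 := pred1 f.2)) => [|e]; last by rewrite /= eq_sym.
  by rewrite filter_pred1_uniq ?undup_uniq ?mem_undup ?map_f // big_seq1.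
by rewrite aE' big1 // => e _; rewrite co0 rmorph0 mul0r.
Qed.

End Normal.
End PBW.

(** * ** The kernel of the specialization *)

Section Specialization.
Variables (C : numFieldType) (gT : finGroupType) (D : cherednik_data C gT).

Definition HuA : cher_alg D (polyC : {rmorphism C -> {poly C}}) 'X (Hu D) :=
  cherednik_alg D (polyC : {rmorphism C -> {poly C}}) 'X.

Let ev0 : {rmorphism {poly C} -> C} := horner_eval 0.
Let Fu := free_algebra gT {poly C}.
Let Fc := free_algebra gT C.
Let HcA := HcA D.

Lemma ev0_polyC c : ev0 c%:P = c.
Proof. by rewrite /ev0 /= horner_evalE hornerC. Qed.
Lemma ev0_X : ev0 'X = 0.
Proof. by rewrite /ev0 /= horner_evalE hornerX. Qed.

Lemma specialization_exists : exists ev : {rmorphism Hu D -> Hc D},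
  forall f, ev (@Hu_pi C gT D f) = @Hc_pi C gT D (@eval_u0 C gT f).
Proof.
pose pc : {rmorphism Fc -> Hc D} := @rq_pi Fc _.
pose p : {rmorphism Fu -> Hc D} := pc \o @map_scal gT _ _ ev0.
have pgen g : p (free_gen {poly C} g) = pc (free_gen C g).
  exact: (congr1 pc (map_scal_gen ev0 g)).
have psc k : p (scal gT k) = pc (scal gT (ev0 k)).
  exact: (congr1 pc (map_scal_scal gT ev0 k)).
apply: (@univ_exists C gT D {poly C} polyC 'X C idfun 0 (Hc D) HcA p).
- by move=> c; rewrite psc ev0_polyC.
- by rewrite psc ev0_X.
- by move=> i; exact: pgen.
- by move=> i; exact: pgen.
- by move=> g; exact: pgen.
Qed.

Section Ev.
Variable ev : {rmorphism Hu D -> Hc D}.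
Hypothesis evE : forall f, ev (@Hu_pi C gT D f) = @Hc_pi C gT D (@eval_u0 C gT f).

Lemma ev_gen g : ev (@Hu_pi C gT D (free_gen {poly C} g)) = @Hc_pi C gT D (free_gen C g).
Proof. by rewrite evE; congr Hc_pi; exact: (map_scal_gen ev0 g). Qed.
Lemma ev_sc k : ev (sc HuA k) = sc HcA k.[0].
Proof.
apply: etrans (evE (scal gT k)) _.
exact: (congr1 (@Hc_pi C gT D) (map_scal_scal gT ev0 k)).
Qed.
Lemma ev_xx i : ev (xx HuA i) = xx HcA i. Proof. exact: ev_gen. Qed.
Lemma ev_yy i : ev (yy HuA i) = yy HcA i. Proof. exact: ev_gen. Qed.
Lemma ev_ww g : ev (ww HuA g) = ww HcA g. Proof. exact: ev_gen. Qed.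

Lemma ev_surj a : exists h, ev h = a.
Proof.
have M b c : (exists h, ev h = b) -> (exists h, ev h = c) -> exists h, ev h = b * c.
  by move=> [h <-] [h' <-]; exists (h * h'); exact: rmorphM.
move: a; apply: (@cherind _ _ _ _ _ _ _ HcA (fun a => exists h, ev h = a)).
- by exists 1; exact: rmorph1.
- by move=> _ _ [h <-] [h' <-]; exists (h + h'); exact: rmorphD.
- by move=> c a Ha; apply: M Ha; exists (sc HuA c%:P); rewrite ev_sc hornerC.
- by move=> i a Ha; apply: M Ha; exists (xx HuA i); exact: ev_xx.
- by move=> i a Ha; apply: M Ha; exists (yy HuA i); exact: ev_yy.
- by move=> i a Ha; apply: M Ha; exists (ww HuA i); exact: ev_ww.
Qed.

Lemma principal_ideal (A : pzRingType) (z : A) : ring_center z ->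
  forall a, ideal_gen [set z] a -> exists b, a = z * b.
Proof.
move=> zC a Ha; apply: (Ha [set a | exists b, a = z * b]); last by move=> _ ->; exists 1; rewrite mulr1.
split=> [|_ _ [b ->] [b' ->]|c _ [b ->]|_ c [b ->]].
- by exists 0; rewrite mulr0.
- by exists (b - b'); rewrite mulrBr.
- by exists (c * b); rewrite mulrA -zC mulrA.
- by exists (b * c); rewrite mulrA.
Qed.

(** The presentation of [Hc] also holds in the quotient of [Hu] by the indeterminate, which gives a
    map [q] back. On generators [q] after [ev] is the projection, so an element killed by [ev] is
    zero in that quotient. *)
Lemma ev_ker h : ev h = 0 -> exists h', h = sc HuA 'X * h'.
Proof.
have XC : ring_center (sc HuA 'X) by move=> a; exact: (scC HuA).
move=> h0; apply: (principal_ideal XC).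
pose HQ := cher_alg_quot HuA [set sc HuA 'X].
pose pq : {rmorphism Hu D -> ring_quot [set sc HuA 'X]} := @rq_pi (Hu D) _.
have X0 : sc HQ 'X = 0.
  by rewrite -[RHS](rmorph0 pq); apply: rq_pi_eq; rewrite subr0.
pose pu : {rmorphism Fu -> Hu D} := @rq_pi Fu _.
pose cs : {rmorphism Fc -> Fu} := @map_scal gT _ _ (polyC : {rmorphism C -> {poly C}}).
pose p : {rmorphism Fc -> ring_quot [set sc HuA 'X]} := (pq \o pu) \o cs.
have pgen g : p (free_gen C g) = pq (pu (free_gen {poly C} g)).
  exact: (congr1 (fun a => pq (pu a)) (map_scal_gen _ g)).
have psc k : p (scal gT k) = sc HQ k%:P.
  exact: (congr1 (fun a => pq (pu a)) (map_scal_scal gT _ k)).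
have [|||||q qE] := @univ_exists C gT D C idfun 0 {poly C} polyC 'X _ HQ p.
- by move=> c; exact: psc.
- by rewrite psc polyC0 X0 rmorph0.
- by move=> i; exact: pgen.
- by move=> i; exact: pgen.
- by move=> g; exact: pgen.
have [f hE] : exists f, h = pu f by exact: rq_pi_surj.
suff E : q (ev (pu f)) = pq (pu f).
  move: E; rewrite -hE h0 rmorph0 => /esym E.
  have : ideal_gen [set sc HuA 'X] (h - 0).
    by apply/ring_quotE; exact: etrans E (esym (rmorph0 pq)).
  by rewrite subr0.
pose q1 : {rmorphism Fu -> ring_quot [set sc HuA 'X]} := (q \o ev) \o pu.
pose q2 : {rmorphism Fu -> ring_quot [set sc HuA 'X]} := pq \o pu.
have evpu f' : q1 f' = p (@map_scal gT _ _ ev0 f').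
  by apply: etrans (congr1 q (evE f')) _; exact: qE.
apply: (@free_ext gT {poly C} _ q1 q2) => [k|g]; rewrite evpu.
  rewrite map_scal_scal psc.
  have [k' kE] : exists k', k - (k.[0])%:P = k' * ('X - 0%:P).
    by apply/factor_theorem; rewrite /root hornerD hornerN hornerC subrr.
  apply: etrans (_ : sc HQ k = _); last by [].
  apply/esym/eqP; rewrite -subr_eq0 -rmorphB kE polyC0 subr0 rmorphM X0 mulr0 //.
by rewrite map_scal_gen pgen.
Qed.
End Ev.

Lemma Hu_torsion_free (m : nat) (s t : gT) (zeta : C) : dihedral_setup m s t zeta D ->
  forall h, sc HuA 'X * h = 0 -> h = 0.
Proof.
move=> DP; pose io : {rmorphism C -> {poly C}} := polyC.
have R : right_action (pbw_w D io) (@pbw_y gT {poly C}) HuA _ :=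
  coind_right_action DP 'X (@pbw_w_lin C gT D {poly C} io) (@pbw_y_lin gT {poly C})
  (@pbw_w1 C m gT s t zeta D DP {poly C} io) (@pbw_wM C m gT s t zeta D DP {poly C} io)
  (@pbw_yC gT {poly C}) (@pbw_yw C m gT s t zeta D DP {poly C} io).
apply: (torsion_free DP R).
by move=> c /eqP; rewrite mulf_eq0 polyX_eq0 => /eqP.
Qed.

End Specialization.

(** * The Poisson bracket *)

Section Derivation.
Variables (U H : pzRingType) (ev : {rmorphism U -> H}) (X : U).
Hypotheses (ev_surj : forall a, exists h, ev h = a)
  (ev_ker : forall h, ev h = 0 -> exists h', h = X * h')
  (XC : ring_center X) (X_reg : forall h, X * h = 0 -> h = 0) (evX : ev X = 0).
Variable h2 : U.
Hypothesis h2C : ring_center (ev h2).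

Definition derivation (d : H -> H) :=
  (forall a b, d (a + b) = d a + d b) /\ (forall a b, d (a * b) = d a * b + a * d b).

(** [d a] is the class of [X^-1 [h, h2]] for a lift [h] of [a]; [X_reg] makes the division unique.
    Changing the lift by [X c] changes the result by [ev [c, h2]], which is zero because [ev h2] is
    central. *)
Lemma derivation_exists : exists2 d, derivation d &
  forall h b, h * h2 - h2 * h = X * b -> d (ev h) = ev b.
Proof.
pose rel a b := exists h b', [/\ ev h = a, h * h2 - h2 * h = X * b' & ev b' = b].
have rel_total a : exists b, rel a b.
  have [h ha] := ev_surj a; have [|b' hb] := ev_ker (h := h * h2 - h2 * h).
    by rewrite rmorphB !rmorphM h2C subrr.
  by exists (ev b'), h, b'.
have [d dP] := choice rel_total.
have relP h b : h * h2 - h2 * h = X * b -> d (ev h) = ev b.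
  move=> hb; have [h' [b' [hh' hb' <-]]] := dP (ev h).
  have [|c hc] := ev_ker (h := h' - h); first by rewrite rmorphB hh' subrr.
  suff E : b' - b = c * h2 - h2 * c.
    have := congr1 ev E; rewrite !rmorphB !rmorphM h2C subrr => /eqP.
    by rewrite subr_eq0 => /eqP.
  apply/eqP; rewrite -subr_eq0; apply/eqP/X_reg.
  have E1 : X * (c * h2 - h2 * c) = (h' - h) * h2 - h2 * (h' - h).
    by rewrite mulrBr !mulrA (XC h2) -[h2 * X * c]mulrA -hc.
  rewrite mulrBr E1 mulrBr -hb' -hb; apply/eqP; rewrite subr_eq0; apply/eqP.
  by rewrite mulrBl mulrBr !opprB [h2 * h - _]addrC addrACA [- _ + _ in LHS]addrC.
exists d => //; split=> a b.
  have [[h [a' [<- ha <-]]] [k [b' [<- kb <-]]]] := (dP a, dP b).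
  rewrite -rmorphD (relP (h + k) (a' + b')) ?rmorphD //.
  by rewrite [X * _]mulrDr -ha -kb mulrDl mulrDr opprD addrACA.
have [[h [a' [<- ha <-]]] [k [b' [<- kb <-]]]] := (dP a, dP b).
rewrite -rmorphM (relP (h * k) (a' * k + h * b')).
  by rewrite rmorphD !rmorphM.
rewrite [X * _]mulrDr [X * (a' * k)]mulrA -ha [X * (h * b')]mulrA XC -[h * X * b']mulrA -kb.
by rewrite mulrBl mulrBr !mulrA [RHS]addrC subrKA.
Qed.

End Derivation.

Lemma derivation_center (H : pzRingType) (d : H -> H) z : derivation d -> ring_center z ->
  ring_center (d z).
Proof.
move=> [dD dM] zC a; have := congr1 d (zC a); rewrite !dM (zC (d a)) [in RHS]addrC.
by move/addIr.
Qed.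

(* A derivation d makes L x L, with a (v, v') = (a v, d(a) v + a v'), a
   self-extension of the module L. *)
Section Twist.
Variables (H Q : pzRingType) (pb : {rmorphism H -> Q}) (d : H -> H) (dP : derivation d).
Variable L : lmodType Q.

Record extension (E : lmodType H) (i : L -> E) (p : E -> L) : Prop := Extension {
  ext_iD : forall v v', i (v + v') = i v + i v';
  ext_iZ : forall a v, i (pb a *: v) = a *: i v;
  ext_i0 : forall v, i v = 0 -> v = 0;
  ext_pi : forall v, p (i v) = 0;
  ext_pD : forall e e', p (e + e') = p e + p e';
  ext_pZ : forall a e, p (a *: e) = pb a *: p e;
  ext_p_surj : forall v, exists e, p e = v;
  ext_p0 : forall e, p e = 0 -> exists v, e = i v;
  ext_d : forall z e, (forall v : L, pb z *: v = 0) -> z *: e = i (pb (d z) *: p e) }.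

Lemma extension_exists : exists E i p, @extension E i p.
Proof.
have [dD dM] := dP.
pose T : zmodType := (L * L)%type.
pose sca (a : H) (e : T) : T := (pb a *: e.1, pb (d a) *: e.1 + pb a *: e.2).
have d1 : d 1 = 0 by apply: (addrI (d 1)); rewrite addr0 -{3}[1]mulr1 dM mulr1 mul1r.
have scaA a b e : sca a (sca b e) = sca (a * b) e.
  rewrite /sca /= dM; congr (_, _); first by rewrite scalerA -rmorphM.
  by rewrite scalerDr !scalerA -!rmorphM addrA -scalerDl -rmorphD.
have sca1 e : sca 1 e = e by case: e => v v'; rewrite /sca /= d1 rmorph0 rmorph1 scale0r add0r !scale1r.
have scaDr a e e' : sca a (e + e') = sca a e + sca a e'.
  by rewrite /sca /= !scalerDr addrACA.
have scaDl e a b : sca (a + b) e = sca a e + sca b e.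
  by rewrite /sca dD !rmorphD !scalerDl addrACA.
pose mix := GRing.Zmodule_isLmodule.Build H T scaA sca1 scaDr scaDl.
pose E : lmodType H := HB.pack T mix.
exists E, (fun v => (0, v)), (fun e => e.1); split.
- by move=> v v'; congr (_, _); rewrite addr0.
- by move=> a v; rewrite -[RHS]/(sca a (0, v)) /sca /= !scaler0 add0r.
- by move=> v [].
- by [].
- by [].
- by [].
- by move=> v; exists (v, 0).
- by move=> [v v'] /= ->; exists v'.
- by move=> z [v v'] z0; rewrite -[LHS]/(sca z (v, v')) /sca /= !z0 addr0.
Qed.

End Twist.

(* For S(1) != 0 the simple module L(phi_1) is spanned by f0, f1, x_0 f0, x_1 f1,
   x_0^2 f0, x_1^2 f1, where f0, f1 is the highest weight space. *)
Section SixSpan.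
Variables (C : numFieldType) (m : nat) (gT : finGroupType) (s t : gT) (zeta : C).
Variable D : cherednik_data C gT.
Hypothesis DP : dihedral_setup m s t zeta D.
Variables (A : pzRingType) (HA : cher_alg D (idfun : {rmorphism C -> C}) 0 A).
Variables (M : lmodType A) (f0 : M).

Let r := (s * t)%g.
Local Notation k := (sc HA).
Local Notation S := (csum m s t D).
Let x0 := xx HA 0.
Let x1 := xx HA 1.
Let y0 := yy HA 0.
Let y1 := yy HA 1.
Let w := ww HA.
Local Notation wt := (weight s t HA).

Let f1 := w s *: f0.
Let p := x0 *: f0.
Let q := x1 *: f1.
Let p' := x0 *: p.
Let q' := x1 *: q.

Record six_hyp : Prop := SixHyp {
  six_weight : wt zeta f0;
  six_y0 : y0 *: f0 = 0;
  six_y1 : y1 *: f0 = 0;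
  six_x1 : x1 *: f0 = 0 }.
Hypothesis SH : six_hyp.

Let ssM' (v : M) : w s *: (w s *: v) = v := ssM DP HA v.
Let z0 : zeta != 0 := zeta_neq0 DP.
Let zV0 : zeta^-1 != 0. Proof. by rewrite invr_eq0. Qed.
Let m5 := m_ge5 DP.

Lemma csum_zetaV : S zeta^-1 = 0.
Proof. by rewrite -[zeta]expr1; apply: (csum_zetaXV DP); apply: ndvd_small; lia. Qed.

Let sf1 : w s *: f1 = f0. Proof. exact: ssM'. Qed.
Let sp : w s *: p = q. Proof. exact: (s_x0 DP HA). Qed.
Let sq : w s *: q = p. Proof. by rewrite -sp ssM'. Qed.
Let sp' : w s *: p' = q'. Proof. by rewrite (s_x0 DP) -/w sp. Qed.
Let sq' : w s *: q' = p'. Proof. by rewrite -sp' ssM'. Qed.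

Lemma six_weights : [/\ wt zeta^-1 f1, wt 1 p, wt 1 q, wt zeta^-1 p' & wt zeta q'].
Proof.
have wf := six_weight SH; have wf1 := weight_s DP z0 wf.
have wp : wt 1 p by apply: weight_eq (weight_x0 DP wf); rewrite mulVf.
have wq : wt 1 q by apply: weight_eq (weight_x1 DP wf1); rewrite divff.
split=> //.
- by apply: weight_eq (weight_x0 DP wp); rewrite mulr1.
- by apply: weight_eq (weight_x1 DP wq); rewrite mulr1.
Qed.

Lemma six_y0_table : [/\ y0 *: f1 = 0, y0 *: p = 0, y0 *: q = k (S 1) *: f0,
  y0 *: p' = - (k (S 1) *: q) & y0 *: q' = 0].
Proof.
have [wf1 wp wq wp' wq'] := six_weights; have [wf y00 y10 x10] := SH.
have Y1 : y0 *: f1 = 0 by rewrite -(s_y1 DP) -/y1 y10 scaler0.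
have Yp : y0 *: p = 0.
  by rewrite (y0x0_weight DP z0 wf) -/y0 y00 scaler0 csum_zetaV k0 subr0.
have Yq : y0 *: q = k (S 1) *: f0.
  by rewrite (y0x1_weight DP zV0 wf1) -/y0 Y1 scaler0 add0r invrK mulVf // -/w sf1.
split=> //.
- by rewrite (y0x0_weight DP (oner_neq0 _) wp) -/y0 Yp scaler0 sub0r invr1 -/w sp.
- rewrite (y0x1_weight DP (oner_neq0 _) wq) -/y0 Yq -kZ x10 scaler0 add0r invr1 mulr1.
  by rewrite csum_zetaV k0.
Qed.

Lemma six_y1_table : [/\ y1 *: f1 = 0, y1 *: p = k (S 1) *: f1, y1 *: q = 0,
  y1 *: p' = 0 & y1 *: q' = - (k (S 1) *: p)].
Proof.
have E (u v : M) : w s *: u = v -> y1 *: v = w s *: (y0 *: u) by move=> <-; rewrite (s_y0 DP).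
have [Y1 Yp Yq Yp' Yq'] := six_y0_table; have [_ y00 y10 _] := SH; split.
- by rewrite (E f0) // y00 scaler0.
- by rewrite (E q) // Yq -kZ.
- by rewrite (E p) // Yp scaler0.
- by rewrite (E q') // Yq' scaler0.
- by rewrite (E p') // Yp' scalerN -kZ sq.
Qed.

Definition six_comb (c0 c1 c2 c3 c4 c5 : C) : M :=
  k c0 *: f0 + k c1 *: f1 + k c2 *: p + k c3 *: q + k c4 *: p' + k c5 *: q'.
Definition six_span (v : M) := exists c0 c1 c2 c3 c4 c5, v = six_comb c0 c1 c2 c3 c4 c5.

Lemma six_combD a0 a1 a2 a3 a4 a5 b0 b1 b2 b3 b4 b5 :
  six_comb a0 a1 a2 a3 a4 a5 + six_comb b0 b1 b2 b3 b4 b5 =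
  six_comb (a0 + b0) (a1 + b1) (a2 + b2) (a3 + b3) (a4 + b4) (a5 + b5).
Proof.
by rewrite /six_comb !kD; do 5 (rewrite addrACA; congr (_ + _)).
Qed.
Lemma six_combZ c a0 a1 a2 a3 a4 a5 : k c *: six_comb a0 a1 a2 a3 a4 a5 =
  six_comb (c * a0) (c * a1) (c * a2) (c * a3) (c * a4) (c * a5).
Proof. by rewrite /six_comb !scalerDr !kM. Qed.

Lemma six_spanD u v : six_span u -> six_span v -> six_span (u + v).
Proof.
move=> [a0 [a1 [a2 [a3 [a4 [a5 ->]]]]]] [b0 [b1 [b2 [b3 [b4 [b5 ->]]]]]].
by rewrite six_combD; do 6 eexists.
Qed.
Lemma six_spanZ c v : six_span v -> six_span (k c *: v).
Proof. by move=> [a0 [a1 [a2 [a3 [a4 [a5 ->]]]]]]; rewrite six_combZ; do 6 eexists. Qed.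
Lemma six_span0 : six_span 0.
Proof. by exists 0, 0, 0, 0, 0, 0; rewrite /six_comb !k0 !addr0. Qed.
Lemma six_spanN v : six_span v -> six_span (- v).
Proof. by move=> /(six_spanZ (-1)); rewrite kN k1. Qed.

Lemma six_span_gens : [/\ six_span f0, six_span f1, six_span p & [/\ six_span q, six_span p' & six_span q']].
Proof.
by do !split; [exists 1, 0, 0, 0, 0, 0|exists 0, 1, 0, 0, 0, 0|exists 0, 0, 1, 0, 0, 0|
  exists 0, 0, 0, 1, 0, 0|exists 0, 0, 0, 0, 1, 0|exists 0, 0, 0, 0, 0, 1];
  rewrite /six_comb !k0 k1 ?addr0 ?add0r.
Qed.

Lemma six_span_ind (a : A) :
  [/\ six_span (a *: f0), six_span (a *: f1), six_span (a *: p) &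
   [/\ six_span (a *: q), six_span (a *: p') & six_span (a *: q')]] ->
  forall v, six_span v -> six_span (a *: v).
Proof.
move=> [H0 H1 H2 [H3 H4 H5]] _ [a0 [a1 [a2 [a3 [a4 [a5 ->]]]]]].
by rewrite /six_comb !scalerDr -!kZ; do 5 (apply: six_spanD; last exact: six_spanZ); apply: six_spanZ.
Qed.

Lemma six_span_s v : six_span v -> six_span (w s *: v).
Proof.
have [G0 G1 G2 [G3 G4 G5]] := six_span_gens.
by apply: six_span_ind; rewrite -/f1 sf1 sp sq sp' sq'.
Qed.

Lemma six_span_r v : six_span v -> six_span (w r *: v).
Proof.
have [wf1 wp wq wp' wq'] := six_weights; have wf := six_weight SH.
have [G0 G1 G2 [G3 G4 G5]] := six_span_gens.
apply: six_span_ind; rewrite [w r *: f0]wf [w r *: f1]wf1 [w r *: p]wp [w r *: q]wq.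
by rewrite [w r *: p']wp' [w r *: q']wq'; do !split; apply: six_spanZ.
Qed.

Lemma six_span_w g v : six_span v -> six_span (w g *: v).
Proof.
have X l u : six_span u -> six_span (w (r ^+ l)%g *: u).
  move=> Hu; elim: l => [|l IH]; first by rewrite expg0 /w (ww1 HA) scale1r.
  by rewrite expgS /w (wwM HA r) -scalerA; apply: six_span_r.
have [l [_ [->|->]]] := dihedral_cases DP g; first exact: X.
by rewrite /w (wwM HA _ s) -scalerA => Hv; apply: X; apply: six_span_s.
Qed.

Hypothesis x03 : x0 *: (x0 *: (x0 *: f0)) = 0.

Lemma six_span_x0 v : six_span v -> six_span (x0 *: v).
Proof.
have [G0 G1 G2 [G3 G4 G5]] := six_span_gens; have [_ _ _ x10] := SH.
have x0f1 : x0 *: f1 = 0 by rewrite -(s_x1 DP) -/x1 x10 scaler0.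
have x0x1 u : x0 *: (x1 *: u) = x1 *: (x0 *: u) by rewrite !scalerA /x0 /x1 xxC.
apply: six_span_ind; rewrite -/p -/p' [x0 *: f1]x0f1 [x0 *: p']x03 /q' /q !x0x1 x0f1 !scaler0.
by do !split=> //; exact: six_span0.
Qed.

Lemma six_span_y0 v : six_span v -> six_span (y0 *: v).
Proof.
have [G0 G1 G2 [G3 G4 G5]] := six_span_gens; have [_ y00 _ _] := SH.
have [Y1 Yp Yq Yp' Yq'] := six_y0_table.
apply: six_span_ind; rewrite y00 Y1 Yp Yq Yp' Yq'.
by do !split; first [exact: six_span0 | exact: six_spanZ | by apply: six_spanN; exact: six_spanZ].
Qed.

Lemma six_span_all (a : A) v : six_span v -> six_span (a *: v).
Proof.
move: v; move: a; apply: (@cherind _ _ _ _ _ _ _ HA (fun a => forall v, six_span v -> six_span (a *: v))).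
- by move=> v; rewrite scale1r.
- by move=> a b Ha Hb v Hv; rewrite scalerDl; apply: six_spanD; [exact: Ha|exact: Hb].
- by move=> c a Ha v Hv; rewrite -scalerA; apply: six_spanZ; exact: Ha.
- move=> i a Ha v Hv; rewrite -scalerA; elim/I2_case: i; first by apply: six_span_x0; exact: Ha.
  rewrite -[a *: v]ssM' -/x1 -(s_x0 DP); apply: six_span_s; apply: six_span_x0; apply: six_span_s; exact: Ha.
- move=> i a Ha v Hv; rewrite -scalerA; elim/I2_case: i; first by apply: six_span_y0; exact: Ha.
  rewrite -[a *: v]ssM' -/y1 -(s_y0 DP); apply: six_span_s; apply: six_span_y0; apply: six_span_s; exact: Ha.
- by move=> g a Ha v Hv; rewrite -scalerA; apply: six_span_w; exact: Ha.
Qed.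

(** [(r - 1) (r - zeta^-1) (r - zeta)] kills the six spanning vectors but multiplies a vector of any
    other weight by a non-zero scalar. *)
Lemma six_span_weight rho v : rho != zeta -> rho != zeta^-1 -> rho != 1 ->
  wt rho v -> six_span v -> v = 0.
Proof.
have [wf1 wp wq wp' wq'] := six_weights; have wf := six_weight SH.
move=> r1 r2 r3 Hv [c0 [c1 [c2 [c3 [c4 [c5 vE]]]]]].
have [P [PD Pw PZ]] : exists P : C -> M -> M, [/\ forall c u u', P c (u + u') = P c u + P c u',
    forall c c' u, wt c' u -> P c u = k (c' - c) *: u & forall c c' u, P c (k c' *: u) = k c' *: P c u].
  exists (fun c u => w r *: u - k c *: u); split=> [c u u'|c c' u Hu|c c' u].
  - by rewrite !scalerDr opprD addrACA.
  - by rewrite [w r *: u]Hu kD kN.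
  - by rewrite scalerBr [in RHS]kZ; congr (_ - _); rewrite !kM mulrC.
have P3 c' u : wt c' u -> P 1 (P zeta^-1 (P zeta u)) = k ((c' - zeta) * (c' - zeta^-1) * (c' - 1)) *: u.
  by move=> Hu; rewrite !(Pw _ _ _ Hu, PZ) !kM.
have : P 1 (P zeta^-1 (P zeta v)) = 0.
  rewrite vE /six_comb !PD !PZ (P3 _ _ wf) (P3 _ _ wf1) (P3 _ _ wp) (P3 _ _ wq) (P3 _ _ wp') (P3 _ _ wq').
  by rewrite !subrr !(mulr0, mul0r) !k0 !scaler0 !addr0.
by rewrite (P3 _ _ Hv); apply: k_eq0; rewrite !mulf_neq0 // subr_eq0.
Qed.

Lemma six_comb_r c0 c1 c2 c3 c4 c5 : w r *: six_comb c0 c1 c2 c3 c4 c5 =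
  six_comb (c0 * zeta) (c1 * zeta^-1) c2 c3 (c4 * zeta^-1) (c5 * zeta).
Proof.
have [wf1 wp wq wp' wq'] := six_weights; have wf := six_weight SH.
have kZ' c (v : M) : w r *: (k c *: v) = k c *: (w r *: v) by rewrite kZ.
rewrite /six_comb !scalerDr !kZ' [w r *: f0]wf [w r *: f1]wf1 [w r *: p]wp [w r *: q]wq.
by rewrite [w r *: p']wp' [w r *: q']wq' !kM !mulr1.
Qed.

Lemma six_comb_y c0 c1 c2 c3 c4 c5 :
  y0 *: six_comb c0 c1 c2 c3 c4 c5 = k (c3 * S 1) *: f0 + k (- (c4 * S 1)) *: q /\
  y1 *: six_comb c0 c1 c2 c3 c4 c5 = k (c2 * S 1) *: f1 + k (- (c5 * S 1)) *: p.
Proof.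
have kZ' (a : A) c (v : M) : a *: (k c *: v) = k c *: (a *: v) by rewrite kZ.
have [_ y00 y10 _] := SH.
have [Y1 Yp Yq Yp' Yq'] := six_y0_table; have [Z1 Zp Zq Zp' Zq'] := six_y1_table.
split; rewrite /six_comb !scalerDr.
  by rewrite !(kZ' y0) y00 Y1 Yp Yq Yp' Yq' !scaler0 !add0r !addr0 scalerN !kM -kN.
by rewrite !(kZ' y1) y10 Z1 Zp Zq Zp' Zq' !scaler0 !add0r !addr0 scalerN !kM -kN.
Qed.

(** Applying [y_0] and [y_1], twice and then once, isolates the coefficients [c4], [c5] and then
    [c3], [c2], up to powers of [S(1)]. What remains are [f0] and [f1], of different weights. *)
Lemma six_comb_eq0 c0 c1 c2 c3 c4 c5 : S 1 != 0 -> f0 <> 0 ->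
  six_comb c0 c1 c2 c3 c4 c5 = 0 -> [/\ c0 = 0, c1 = 0, c2 = 0 & [/\ c3 = 0, c4 = 0 & c5 = 0]].
Proof.
move=> S0 f00 E; have [_ y00 y10 _] := SH.
have f10 : f1 <> 0 by move=> f10; apply: f00; rewrite -sf1 f10 scaler0.
have [Y1 Yp Yq Yp' Yq'] := six_y0_table; have [Z1 Zp Zq Zp' Zq'] := six_y1_table.
have keq c (v : M) : v <> 0 -> k c *: v = 0 -> c = 0.
  by move=> v0 cv; apply/eqP; apply: contrapT => /negP cn0; apply: v0; exact: (k_eq0 cn0 cv).
have S0' c (v : M) : v <> 0 -> k c *: (k (S 1) *: v) = 0 -> c = 0.
  by move=> v0; rewrite kM => /(keq _ _ v0)/eqP; rewrite mulf_eq0 (negPf S0) orbF => /eqP.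
have kZ' (a : A) c (v : M) : a *: (k c *: v) = k c *: (a *: v) by rewrite kZ.
have [E0 E1] := six_comb_y c0 c1 c2 c3 c4 c5; rewrite E !scaler0 in E0 E1.
move/esym: E0 => E0; move/esym: E1 => E1.
have c5_0 : c5 = 0.
  have := congr1 (fun v => y1 *: v) E1; rewrite scaler0 scalerDr !(kZ' y1) Z1 Zp scaler0 add0r.
  by move=> /(S0' _ _ f10)/eqP; rewrite oppr_eq0 mulf_eq0 (negPf S0) orbF => /eqP.
have c2_0 : c2 = 0.
  move: E1; rewrite c5_0 mul0r oppr0 k0 addr0 => /(keq _ _ f10)/eqP.
  by rewrite mulf_eq0 (negPf S0) orbF => /eqP.
have c4_0 : c4 = 0.
  have := congr1 (fun v => y0 *: v) E0; rewrite scaler0 scalerDr !(kZ' y0) y00 Yq scaler0 add0r.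
  by move=> /(S0' _ _ f00)/eqP; rewrite oppr_eq0 mulf_eq0 (negPf S0) orbF => /eqP.
have c3_0 : c3 = 0.
  move: E0; rewrite c4_0 mul0r oppr0 k0 addr0 => /(keq _ _ f00)/eqP.
  by rewrite mulf_eq0 (negPf S0) orbF => /eqP.
have [wf1 _ _ _ _] := six_weights; have wf := six_weight SH.
have : k c0 *: f0 + k c1 *: f1 = 0 by move: E; rewrite /six_comb c2_0 c3_0 c4_0 c5_0 !k0 !addr0.
move=> /eqP; rewrite addr_eq0 => /eqP E'.
have zz : zeta != zeta^-1.
  apply/eqP => zz; have := zetaX_neq1 DP (ndvd_small (_ : 0 < 2 < m)%N); rewrite expr2 {1}zz mulVf // eqxx.
  by move/(_ ltac:(lia)).
have F0 : k c0 *: f0 = 0.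
  apply: (weight_diff zz (weightZ c0 wf)); rewrite E'; apply: weightN; exact: weightZ.
have F1 : k c1 *: f1 = 0 by apply/eqP; rewrite -oppr_eq0 -E' F0.
by do !split=> //; [exact: (keq _ _ f00 F0)|exact: (keq _ _ f10 F1)].
Qed.

End SixSpan.

Section HeadSingular.
Variables (C : numFieldType) (m : nat) (gT : finGroupType) (s t : gT) (zeta : C).
Variable D : cherednik_data C gT.
Hypothesis DP : dihedral_setup m s t zeta D.
Variables (A : pzRingType) (HA : cher_alg D (idfun : {rmorphism C -> C}) 0 A).
Hypothesis RA : restricted m HA.
Variables (d : nat) (lam : gT -> 'M[C]_d) (V : lmodType A) (T : 'I_d -> V).
Hypotheses (VP : is_verma HA lam T) (lam_full : spans_mx lam).
Variables (d' : nat) (mu : gT -> 'M[C]_d') (V' : lmodType A) (T' : 'I_d' -> V').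
Hypotheses (VP' : is_verma HA mu T').

Let L : lmodType A := mod_head V.
Let xL (u : L) := exists2 v : V, u = hpi v & xn HA 1 v.

(* A singular vector of positive degree generates a proper submodule. *)
Lemma head_singular (n : 'I_d' -> L) : hw_type HA mu n -> (forall j, xL (n j)) -> forall j, n j = 0.
Proof.
move=> Hn nx j; have [f [fL fT]] := verma_univ VP' Hn.
have fD v v' : f (v + v') = f v + f v' by have := fL 1 v v'; rewrite !scale1r.
have f0 : f 0 = 0 by apply: (addrI (f 0)); rewrite -fD !addr0.
have fZ a v : f (a *: v) = a *: f v by have := fL a v 0; rewrite f0 !addr0.
have xLD u u' : xL u -> xL u' -> xL (u + u').
  by move=> [v -> Hv] [v' -> Hv']; exists (v + v'); [rewrite hpiD|exact: xnD].
have xLk c u : xL u -> xL (sc HA c *: u).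
  move=> [v -> Hv]; exists (sc HA c *: v); first by rewrite hpiZ.
  by apply: xn_center => //; exact: center_k.
have xL0 : xL 0 by exists 0; [exact: esym (mq_pi0 _)|exact: xn0].
have nA a : xL (a *: n j).
  rewrite -fT -fZ; have [al [v' [[v1 [v2 [_ _ ->]]] ->]]] := verma_decomp VP' (a *: T' j).
  rewrite fD; apply: (xLD).
    rewrite (big_morph f fD f0); apply: (big_ind xL xL0 xLD) => l _.
    by rewrite fZ fT; apply: xLk.
  have [u1 E1] := hpi_surj (f v1); have [u2 E2] := hpi_surj (f v2).
  exists (xx HA 0 *: u1 + xx HA 1 *: u2); first by rewrite fD !fZ E1 E2 hpiD !hpiZ.
  by exists u1, u2.
have [v nv _] := nx j; rewrite nv; apply/head_eq0/(radicalE DP RA VP lam_full) => a.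
have := nA a; rewrite nv -hpiZ => -[v' E Hv'].
have : radical (a *: v - v').
  apply/head_eq0; rewrite -[LHS]/(hpi _) hpiD E -hpiD subrr; exact: mq_pi0.
move=> /(radicalE DP RA VP lam_full)/(_ 1); rewrite scale1r => H.
by rewrite -[a *: v](subrK v'); exact: xnD.
Qed.

End HeadSingular.

Section PoissonRepr.
Variables (C : numFieldType) (m : nat) (gT : finGroupType) (s t : gT) (zeta : C).
Variable D : cherednik_data C gT.
Hypothesis DP : dihedral_setup m s t zeta D.
Variables (A : pzRingType) (HA : cher_alg D (idfun : {rmorphism C -> C}) 0 A).
Variables (Q : pzRingType) (HQ : cher_alg D (idfun : {rmorphism C -> C}) 0 Q).
Variable pb : {rmorphism A -> Q}.
Hypotheses (pb_sc : forall c, pb (sc HA c) = sc HQ c) (pb_x : forall i, pb (xx HA i) = xx HQ i)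
  (pb_y : forall i, pb (yy HA i) = yy HQ i) (pb_w : forall g, pb (ww HA g) = ww HQ g).
Variables (d : A -> A) (L : lmodType Q).
Variables (E : lmodType A) (i : L -> E) (p : E -> L).
Hypothesis EP : extension pb d i p.

Let r := (s * t)%g.
Local Notation k := (sc HA).
Local Notation kQ := (sc HQ).
Local Notation S := (csum m s t D).
Local Notation wt := (weight s t HA).
Local Notation wtQ := (weight s t HQ).
Let z0 : zeta != 0 := zeta_neq0 DP.

Lemma ext_i_0 : i 0 = 0.
Proof. by apply: (addrI (i 0)); rewrite -(ext_iD EP) !addr0. Qed.
Lemma ext_iN v : i (- v) = - i v.
Proof. by apply: (addrI (i v)); rewrite -(ext_iD EP) !subrr ext_i_0. Qed.
Lemma ext_p_0 : p 0 = 0.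
Proof. by apply: (addrI (p 0)); rewrite -(ext_pD EP) !addr0. Qed.

Lemma ext_weight_p rho (e : E) : wt rho e -> wtQ rho (p e).
Proof.
move=> He; have := congr1 p He; rewrite !(ext_pZ EP) pb_w pb_sc; exact.
Qed.
Lemma ext_weight_i rho (v : L) : wt rho (i v) -> wtQ rho v.
Proof.
rewrite /weight -pb_w -pb_sc => H; apply/eqP; rewrite -subr_eq0; apply/eqP/(ext_i0 EP).
by rewrite (ext_iD EP) ext_iN !(ext_iZ EP) H subrr.
Qed.
Lemma ext_i_weight rho (v : L) : wtQ rho v -> wt rho (i v).
Proof. by rewrite /weight -!(ext_iZ EP) pb_w pb_sc => ->. Qed.

(** A weight vector of the extension maps to zero under [p], hence comes from a vector of the same
    weight under [i]. *)
Lemma ext_no_weight rho : (forall v : L, wtQ rho v -> v = 0) -> forall e : E, wt rho e -> e = 0.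
Proof.
move=> H e He; have [v ev] := ext_p0 EP (H _ (ext_weight_p He)).
by rewrite ev (H v) ?ext_i_0 //; apply: ext_weight_i; rewrite -ev.
Qed.

(** Average [rho^-l r^l] over an arbitrary lift; this projects to the weight space and fixes the
    image [v]. *)
Lemma ext_weight_lift rho (v : L) : rho ^+ m = 1 -> wtQ rho v -> exists2 e, wt rho e & p e = v.
Proof.
move=> rm Hv; have [e' pe'] := ext_p_surj EP v.
have r0 : rho != 0.
  by apply/eqP => E0; move: rm; rewrite E0 expr0n; case: (m) (m_gt0 DP) => // n _ /eqP; rewrite eq_sym oner_eq0.
pose F l := k (rho^-1 ^+ l) *: (ww HA (r ^+ l)%g *: e').
have Fm l : F (l %% m)%N = F l.
  by rewrite /F (expg_mod _ (stm DP)) (expr_modm _ (_ : rho^-1 ^+ m = 1)) // exprVn rm invr1.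
have m0 : m%:R != 0 :> C by rewrite pnatr_eq0 -lt0n (m_gt0 DP).
exists (k m%:R^-1 *: \sum_(l < m) F l).
  apply: weightZ; rewrite /weight -{2}(sum_shift DP Fm) !scaler_sumr; apply: eq_bigr => l _.
  rewrite /F -kZ kM expgS (wwM HA r) -scalerA; congr (k _ *: _).
  by rewrite exprS mulrA divff // mul1r.
have pS (l : seq 'I_m) : p (\sum_(j <- l) F j) = \sum_(j <- l) p (F j).
  by apply: (big_morph p (ext_pD EP) ext_p_0).
rewrite (ext_pZ EP) pS pb_sc.
have -> : \sum_(j < m) p (F j) = \sum_(j < m) v.
  apply: eq_bigr => l _; rewrite /F !(ext_pZ EP) pb_sc pb_w pe' (weight_rX l Hv) kM.
  by rewrite -exprMn mulVf // expr1n k1.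
have mE : v *+ m = kQ m%:R *: v by rewrite rmorph_nat scaler_nat.
by rewrite sumr_const card_ord mE kM mulVf // k1.
Qed.

Section Phi1.
Variable f0 : L.
Hypotheses (SH : six_hyp s t zeta HQ f0) (L_span : forall v, six_span s HQ f0 v).
Hypotheses (S1 : S 1 != 0) (f0_neq0 : f0 <> 0).

Let zn n : (0 < n < m)%N -> zeta ^+ n != 1.
Proof. by move=> Hn; exact: (zetaX_neq1 DP (ndvd_small Hn)). Qed.
Let m5 := m_ge5 DP.
Let z1 : zeta != 1. Proof. by rewrite -[zeta]expr1 zn //; lia. Qed.
Let z2 : zeta ^+ 2 != 1. Proof. by rewrite zn //; lia. Qed.
Let z3 : zeta ^+ 3 != 1. Proof. by rewrite zn //; lia. Qed.

Let no_weight2 (e : E) : wt (zeta ^+ 2) e -> e = 0.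
Proof.
apply: ext_no_weight => v wv; apply: (six_span_weight DP SH _ _ z2 wv (L_span v)).
  by rewrite -subr_eq0 expr2 -{3}[zeta]mulr1 -mulrBr mulf_neq0 // subr_eq0.
by apply: contra z3 => /eqP E2; rewrite exprS E2 divff.
Qed.
Let no_weightV2 (e : E) : wt (zeta ^- 2) e -> e = 0.
Proof.
apply: ext_no_weight => v wv; apply: (six_span_weight DP SH _ _ _ wv (L_span v)).
- by apply: contra z3 => /eqP E2; rewrite exprS -{1}E2 mulVf // expf_neq0.
- apply: contra z1 => /eqP E2; have := congr1 (fun x => x * zeta ^+ 2) E2.
  by rewrite mulVf ?expf_neq0 // expr2 mulrA mulVf // mul1r => <-.
- by rewrite invr_eq1.
Qed.

(** A lift of [f0] of weight [zeta] is killed by [y_0] for weight reasons, but [y_1] of it may be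
    non-zero. After a correction inside the submodule it satisfies [six_hyp], so it generates a copy
    of [L], and [z] acts on that copy as on [L]. *)
Lemma poisson_phi1 z : (forall v : L, pb z *: v = 0) -> pb (d z) *: f0 = 0.
Proof.
have [wf y00 y10 x10] := SH.
have [wf1 wp wq wp' wq'] := six_weights DP SH.
have [e we pe] := ext_weight_lift (zetam DP) wf.
(* Its weight [zeta^2] does not occur in [L], hence not in the extension. *)
have y0e : yy HA 0 *: e = 0.
  by apply: no_weight2; apply: weight_eq (weight_y0 DP we); rewrite expr2.
have wy1e : wt 1 (yy HA 1 *: e) by apply: weight_eq (weight_y1 DP we); rewrite mulVf.
have [u uE] : exists u, yy HA 1 *: e = i u.
  by apply: (ext_p0 EP); rewrite (ext_pZ EP) pb_y pe.
have y0u : yy HQ 0 *: u = 0.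
  apply: (ext_i0 EP); rewrite -pb_y (ext_iZ EP) -uE scalerA.
  by rewrite yyC -scalerA y0e scaler0.
have wu : wtQ 1 u by apply: ext_weight_i; rewrite -uE.
have [c0 [c1 [c2 [c3 [c4 [c5 uc]]]]]] := L_span u.
(* [y_0 u = 0] forces [c3 = c4 = 0], and weight 1 will force [c0 = c1 = c5 = 0]; so [u] is a
   multiple of [x_0 f0]. *)
have [c30 c40] : c3 = 0 /\ c4 = 0.
  have [|H3 _ _ [H4 _ _]] := six_comb_eq0 DP SH (c0 := c3 * S 1) (c1 := 0) (c2 := 0)
      (c3 := - (c4 * S 1)) (c4 := 0) (c5 := 0) S1 f0_neq0.
    have [Y0 _] := six_comb_y DP SH c0 c1 c2 c3 c4 c5.
    by rewrite /six_comb !k0 !addr0 -Y0 -uc.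
  move/eqP: H3; rewrite mulf_eq0 (negPf S1) orbF => /eqP ->.
  by move/eqP: H4; rewrite oppr_eq0 mulf_eq0 (negPf S1) orbF => /eqP ->.
have zV1 : zeta^-1 != 1 by rewrite invr_eq1.
have [c00 c10 c50] : [/\ c0 = 0, c1 = 0 & c5 = 0].
  have := six_comb_r DP SH c0 c1 c2 c3 c4 c5; rewrite -uc wu k1 {1}uc => /eqP.
  rewrite eq_sym -subr_eq0 -[X in _ - X](k1 HQ) -kN six_combZ six_combD => /eqP.
  have cx (c x : C) : x != 1 -> c * x + -1 * c = 0 -> c = 0.
    move=> x1; rewrite mulN1r -{2}[c]mulr1 -mulrBr => /eqP; rewrite mulf_eq0 subr_eq0 (negPf x1) orbF.
    by move/eqP.
  move=> /(six_comb_eq0 DP SH S1 f0_neq0)[/(cx _ _ z1) -> /(cx _ _ zV1) -> _ [_ _ /(cx _ _ z1) ->]].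
  by [].
pose q' := xx HQ 1 *: (xx HQ 1 *: (ww HQ s *: f0)).
have [_ _ _ _ Yq'] := six_y0_table DP SH; have [_ _ _ _ Zq'] := six_y1_table DP SH.
(* [y_1 q' = - S(1) x_0 f0], so this multiple of [q'] cancels [y_1 e]; the weight [zeta] of [q']
   leaves the weight of [e] unchanged. *)
pose e' := e + i (kQ (c2 / S 1) *: q').
have pe' : p e' = f0 by rewrite (ext_pD EP) (ext_pi EP) addr0.
have we' : wt zeta e' by apply: weightD => //; apply: ext_i_weight; apply: weightZ.
have SE : six_hyp s t zeta HA e'.
  split=> //.
  - by apply: no_weight2; apply: weight_eq (weight_y0 DP we'); rewrite expr2.
  - rewrite /e' scalerDr uE -(ext_iZ EP) pb_y -(ext_iD EP) -kZ Zq' uc.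
    rewrite /six_comb c00 c10 c30 c40 c50 !k0 !add0r !addr0 scalerN kM divfK //.
    by rewrite subrr ext_i_0.
  - by apply: no_weight2; apply: weight_eq (weight_x1 DP we'); rewrite expr2.
have x03 : xx HA 0 *: (xx HA 0 *: (xx HA 0 *: e')) = 0.
  apply: no_weightV2; apply: weight_eq (weight_x0 DP (weight_x0 DP (weight_x0 DP we'))).
  by rewrite mulVf // mulr1 expr2 invfM.
move=> zv0; have [G0 _ _ _] := six_span_gens s HA e'.
have [a0 [a1 [a2 [a3 [a4 [a5 zE]]]]]] := six_span_all DP SE x03 z G0.
(* The image of [z e'] under [p] is zero and the six vectors are independent in [L], so the
   coefficients of [z e'] in the extension vanish. *)
have [|A0 A1 A2 [A3 A4 A5]] := six_comb_eq0 DP SH (c0 := a0) (c1 := a1) (c2 := a2)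
    (c3 := a3) (c4 := a4) (c5 := a5) S1 f0_neq0.
  have := congr1 p zE; rewrite /six_comb !(ext_pD EP) !(ext_pZ EP) !pb_sc !pb_x !pb_w pe' zv0.
  exact: esym.
have ze : z *: e' = 0 by rewrite zE /six_comb A0 A1 A2 A3 A4 A5 !k0 !addr0.
by apply: (ext_i0 EP); rewrite -pe' -(ext_d EP) ?ze.
Qed.
End Phi1.

Section Triv.
Variable f0 : L.
Hypotheses (wf : wtQ 1 f0) (sf : ww HQ s *: f0 = f0) (f0_neq0 : f0 <> 0).
Hypothesis L_span : forall v, exists c, v = kQ c *: f0.

(** [x_i] and [y_i] shift the weight away from 1, the only weight of [L], so they kill a lift of
    weight 1. Made invariant under [s], such a lift spans a one-dimensional submodule complementary
    to the image of [i]. *)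
Lemma poisson_triv z : (forall v : L, pb z *: v = 0) -> pb (d z) *: f0 = 0.
Proof.
have no_weight rho (e : E) : rho != 1 -> wt rho e -> e = 0.
  move=> r1; apply: ext_no_weight => v wv; have [c vc] := L_span v.
  by apply: (weight_diff r1 wv); rewrite vc; apply: weightZ.
have z1 : zeta != 1 by rewrite -[zeta]expr1 (zetaX_neq1 DP) // ndvd_small //; have := m_ge5 DP; lia.
have zV1 : zeta^-1 != 1 by rewrite invr_eq1.
have [e we pe] := ext_weight_lift (expr1n _ _) wf.
(* Symmetrized under [s]; its image is [2 f0], whence the factor 2 below. *)
pose e' := e + ww HA s *: e.
have we' : wt 1 e'.
  by apply: weightD => //; apply: weight_eq (weight_s DP (oner_neq0 _) we); rewrite invr1.
have se' : ww HA s *: e' = e' by rewrite /e' scalerDr (ssM DP) addrC.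
have pe' : p e' = kQ 2%:R *: f0.
  by rewrite (ext_pD EP) (ext_pZ EP) pb_w pe sf rmorph_nat scaler_nat mulr2n.
have scal a : exists c, a *: e' = k c *: e'.
  have step (b b' : A) : (exists c, b *: e' = k c *: e') -> (exists c, b' *: e' = k c *: e') ->
      exists c, (b * b') *: e' = k c *: e'.
    by move=> [c Hc] [c' Hc']; exists (c' * c); rewrite -scalerA Hc' -kZ Hc kM.
  have zero (b : A) rho : rho != 1 -> wt rho (b *: e') -> exists c, b *: e' = k c *: e'.
    by move=> r1 /(no_weight _ _ r1) ->; exists 0; rewrite k0.
  move: a; apply: (@cherind _ _ _ _ _ _ _ HA (fun a => exists c, a *: e' = k c *: e')).
  - by exists 1; rewrite k1 scale1r.
  - by move=> b b' [c Hc] [c' Hc']; exists (c + c'); rewrite scalerDl Hc Hc' kD.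
  - by move=> c b; apply: step; exists c.
  - move=> j b; apply: step; elim/I2_case: j.
      by apply: zero zV1 _; apply: weight_eq (weight_x0 DP we'); rewrite mulr1.
    by apply: zero z1 _; apply: weight_eq (weight_x1 DP we'); rewrite mulr1.
  - move=> j b; apply: step; elim/I2_case: j.
      by apply: zero z1 _; apply: weight_eq (weight_y0 DP we'); rewrite mulr1.
    by apply: zero zV1 _; apply: weight_eq (weight_y1 DP we'); rewrite mulr1.
  - move=> g b; apply: step; exists 1; rewrite k1.
    have [l [_ [->|->]]] := dihedral_cases DP g; last rewrite (wwM HA) -scalerA se'.
      by rewrite (weight_rX l we') expr1n k1.
    by rewrite (weight_rX l we') expr1n k1.
have two : 2%:R != 0 :> C by rewrite pnatr_eq0.
move=> zv0; have [c zc] := scal z.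
have c0 : c = 0.
  have := congr1 p zc; rewrite !(ext_pZ EP) zv0 pb_sc pe' kM => /esym H.
  apply/eqP; apply: contrapT => /negP c0; apply: f0_neq0; apply: (k_eq0 (HA := HQ) _ H).
  by rewrite mulf_neq0.
have : i (pb (d z) *: p e') = 0 by rewrite -(ext_d EP) // zc c0 k0.
by move/(ext_i0 EP); rewrite pe' -kZ => /(k_eq0 two).
Qed.

End Triv.

End PoissonRepr.

Section HeadLabels.
Variables (C : numFieldType) (m : nat) (gT : finGroupType) (s t : gT) (zeta : C).
Variable D : cherednik_data C gT.
Hypothesis DP : dihedral_setup m s t zeta D.
Variables (A : pzRingType) (HA : cher_alg D (idfun : {rmorphism C -> C}) 0 A).
Hypothesis RA : restricted m HA.
Variable lam : forall l, gT -> 'M[C]_(irr_deg l).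
Hypothesis lam1 : forall l, lam l 1%g = 1%:M.
Hypothesis lamM : forall l g g', lam l (g * g')%g = lam l g *m lam l g'.
Hypothesis lam_s : forall l, Irr m l -> lam l s = irr_s C l.
Hypothesis lam_t : forall l, Irr m l -> lam l t = irr_t zeta l.
Hypothesis lam_full : forall l, Irr m l -> spans_mx (lam l).
Variables (Dl : irr_label -> lmodType A) (T : forall l, 'I_(irr_deg l) -> Dl l).
Hypothesis T_verma : forall l, Irr m l -> is_verma HA (lam l) (@T l).

Local Notation k := (sc HA).
Local Notation S := (csum m s t D).
Local Notation wt := (weight s t HA).
Let m5 := m_ge5 DP.

Section Phi1.
Let Hi : (1 <= 1 <= nPhi m)%N. Proof. by rewrite nPhi_double //; have := m5; lia. Qed.
Let Hi2 : (1 <= 2 <= nPhi m)%N. Proof. by rewrite nPhi_double //; have := m5; lia. Qed.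
Let V := Dl (Phi 1).
Let L : lmodType A := mod_head V.
Let T0 : V := @T (Phi 1) 0.
Let f0 : L := hpi T0.
Let VP := T_verma (l := Phi 1) Hi.

(** Such a vector would be of highest weight type [Phi 2] in positive degree, which [head_singular]
    excludes. *)
Let head_phi2 (v : V) : xn HA 1 v -> wt (zeta ^+ 2) (hpi v : L) ->
  yy HA 0 *: (hpi v : L) = 0 -> yy HA 1 *: (hpi v : L) = 0 -> (hpi v : L) = 0.
Proof.
move=> vx wv v0 v1.
pose n : 'I_2 -> L := fun j => if j == 0 then hpi v else ww HA s *: hpi v.
have Hn : @hw_type C gT D A HA L 2 (lam (Phi 2)) n.
  exact: (hw_phi DP lam1 lamM lam_s lam_t Hi2 wv v0 v1).
have := head_singular DP RA VP (lam_full (l := Phi 1) Hi) (T_verma (l := Phi 2) Hi2) Hn.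
move=> /(_ _ 0); apply => j; rewrite /n; case: (j == 0); first by exists v.
by exists (ww HA s *: v); [rewrite hpiZ|exact: xn1_w].
Qed.

(** [x_1 f0] and [x_1^3 s f0] are both singular of weight [zeta^2], hence zero by [head_phi2];
    conjugation by [s] gives [x_0^3 f0 = 0]. The singularity uses [S(zeta^-2) = 0]. *)
Lemma head_phi1 : [/\ six_hyp s t zeta HA f0, xx HA 0 *: (xx HA 0 *: (xx HA 0 *: f0)) = 0,
  forall v, six_span s HA f0 v & f0 <> 0].
Proof.
have [sT wT] := hw_phi_s lamM lam_s lam_t Hi (verma_hw VP).
have [_ Ty] := verma_hw VP.
have wf : wt zeta f0 by rewrite /weight /f0 -!hpiZ; congr hpi; exact: wT.
have y0f : yy HA 0 *: f0 = 0 by rewrite /f0 -hpiZ Ty; exact: mq_pi0.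
have y1f : yy HA 1 *: f0 = 0 by rewrite /f0 -hpiZ Ty; exact: mq_pi0.
have z0 := zeta_neq0 DP.
have SV n : (0 < n.*2 < m)%N -> S (zeta ^- n) = 0.
  by move=> Hn; apply: (csum_zetaXV DP); apply: ndvd_small.
have SV1 : S zeta^-1 = 0 by rewrite -[zeta]expr1 SV //; lia.
have SV2 : S (zeta^-1 * zeta^-1) = 0 by rewrite -invfM -expr2 SV //; lia.
have x1f : xx HA 1 *: f0 = 0.
  have [Y0 Y1] := singular_x1 DP z0 wf y0f y1f SV2 SV1.
  have E : xx HA 1 *: f0 = hpi (xx HA 1 *: T0) by rewrite hpiZ.
  rewrite E; apply: head_phi2; rewrite -?E //; first exact: xn1_x.
  by apply: weight_eq (weight_x1 DP wf); rewrite expr2.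
have SH : six_hyp s t zeta HA f0 by split.
have [wf1 wp wq wp' wq'] := six_weights DP SH.
have [_ _ _ _ Yq'] := six_y0_table DP SH; have [_ _ _ _ Zq'] := six_y1_table DP SH.
have x1q' : xx HA 1 *: (xx HA 1 *: (xx HA 1 *: (ww HA s *: f0))) = 0.
  have E : xx HA 1 *: (xx HA 1 *: (xx HA 1 *: (ww HA s *: f0))) =
    hpi (xx HA 1 *: (xx HA 1 *: (xx HA 1 *: (ww HA s *: T0)))) by rewrite !hpiZ.
  rewrite E; apply: head_phi2; rewrite -?E.
  - exact: xn1_x.
  - by apply: weight_eq (weight_x1 DP wq'); rewrite expr2.
  - by rewrite (y0x1_weight DP z0 wq') Yq' SV2 k0 scaler0 addr0.
  rewrite (y1x1_weight DP z0 wq') Zq' SV1 k0 subr0 scalerN -kZ.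
  by rewrite [xx HA 1 *: (xx HA 0 *: _)]scalerA xxC -scalerA x1f !scaler0 oppr0.
have sinj (u : L) : ww HA s *: u = 0 -> u = 0.
  by move=> E; rewrite -[u](ssM DP HA) E scaler0.
split=> //.
- by apply: sinj; rewrite !(s_x0 DP).
- move=> u; have [v ->] := hpi_surj u.
  have x03 : xx HA 0 *: (xx HA 0 *: (xx HA 0 *: f0)) = 0 by apply: sinj; rewrite !(s_x0 DP).
  have [a ->] := verma_gen VP v; rewrite sum_I2 hpiD !hpiZ -sT hpiZ.
  have [G0 G1 _ _] := six_span_gens s HA f0.
  by apply: six_spanD; apply: (six_span_all DP SH x03).
have [j Hj] := head_neq0 DP RA VP (lam_full (l := Phi 1) Hi) => f00; apply: Hj.
change 'I_2 in j; elim/I2_case: j => //.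
by rewrite -sT hpiZ -/T0 -/f0 f00 scaler0.
Qed.
End Phi1.

Lemma head_triv : S 1 = 0 -> let f0 : mod_head (Dl Triv) := hpi (@T Triv ord0) in
  [/\ wt 1 f0, ww HA s *: f0 = f0, f0 <> 0 & forall v, exists c, v = k c *: f0].
Proof.
move=> S1 f0; have Il : Irr m Triv by [].
have VP := T_verma Il; have [_ Ty] := verma_hw VP.
have mf : false -> ~~ odd m by [].
have sw j := hw_lin_s (e := false) (f := false) lamM lam_s lam_t j mf (verma_hw VP).
have [sT wT] := sw ord0; rewrite expr0 in sT wT.
split.
- by rewrite /weight /f0 -!hpiZ; congr hpi; exact: wT.
- by rewrite /f0 -hpiZ; congr hpi; rewrite [LHS]sT k1.
- have [j Hj] := head_neq0 DP RA VP (lam_full Il); move: Hj.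
  by change 'I_1 in j; rewrite (ord1 j).
move=> u; have [v ->] := hpi_surj u.
have Sz : S zeta = 0 by rewrite -[zeta]expr1 (csum_zetaX DP) // ndvd_small //; lia.
have SzV : S zeta^-1 = 0 by rewrite -[zeta]expr1 (csum_zetaXV DP) // ndvd_small //; lia.
have yxT i p j : yy HA i *: (xx HA p *: @T Triv j) = 0.
  have [_ wj] := sw j; rewrite expr0 in wj.
  elim/I2_case: i; elim/I2_case: p.
  - by rewrite (y0x0_weight DP (oner_neq0 _) wj) Ty invr1 S1 k0 scaler0 subr0.
  - by rewrite (y0x1_weight DP (oner_neq0 _) wj) Ty invr1 mulr1 SzV k0 scaler0 addr0.
  - by rewrite (y1x0_weight DP (oner_neq0 _) wj) Ty invr1 mulr1 Sz k0 scaler0 addr0.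
  - by rewrite (y1x1_weight DP (oner_neq0 _) wj) Ty invr1 S1 k0 scaler0 subr0.
have [al ->] := hpi_top DP RA VP (lam_full Il) yxT v.
by exists (al ord0 0); rewrite big_ord1 hpiZ.
Qed.

End HeadLabels.

(** * Nonvanishing in the baby Verma modules *)

Section DeltaFunctional.
Variables (C : numFieldType) (m : nat) (gT : finGroupType) (D : cherednik_data C gT).
Hypothesis m5 : (5 <= m)%N.
Variables (A : pzRingType) (HA : cher_alg D (idfun : {rmorphism C -> C}) 0 A).
Variables (d : nat) (lam : gT -> 'M[C]_d).
Let N : lmodType C := coind 'rV[C]_d.
Variable act : A -> N -> N.
Hypothesis RA : right_action (dual_w lam) (@dual_y C d) HA act.

Definition coind_delta (a0 b0 : nat) (j : 'I_d) : N :=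
  fun a b => if (a == a0) && (b == b0) then delta_mx 0 j else 0.

Let addE (F G : N) a b : (F + G) a b = F a b + G a b.
Proof. by []. Qed.

(** The coefficient of a pure power of degree below [m] vanishes on all multiples of [x0 x1] and of
    [x0^m + x1^m]. *)
Lemma coind_delta_sub a0 b0 j : (a0 < m)%N -> (b0 < m)%N -> (a0 == 0%N) || (b0 == 0%N) ->
  sub_coind m HA act (coind_delta a0 b0 j).
Proof.
move=> am bm ab; split; apply: N_ext => a b.
  rewrite -[xx HA 0]expr1 -[xx HA 1]expr1 (raM RA) (act_x1X RA) (act_x0X RA) /coind_delta.
  by case: eqP => // aE; case: eqP => // bE; move: ab; rewrite -aE -bE.
rewrite (raD RA) addE (act_x0X RA) (act_x1X RA) /coind_delta.
have /negPf -> : (m + a)%N != a0 by move: am; lia.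
have /negPf -> : (m + b)%N != b0 by move: bm; lia.
by rewrite andbF addr0.
Qed.

Lemma act_delta_x i j j' :
  act (xx HA i) (coind_delta (i == 0) (i != 0) j) 0%N 0%N 0 j' = (j' == j)%:R.
Proof.
rewrite -[xx HA i]expr1; elim/I2_case: i.
  by rewrite (act_x0X RA) /coind_delta /= mxE eqxx.
by rewrite (act_x1X RA) /coind_delta /= mxE eqxx.
Qed.

Lemma act_delta_xh c j j' :
  act (xx HA 0 ^+ m./2 + sc HA c * xx HA 1 ^+ m./2) (coind_delta m./2 0 j) 0%N 0%N 0 j' = (j' == j)%:R.
Proof.
rewrite (raD RA) (raM RA) (ra_sc RA) addE (act_x0X RA) (act_x1X RA) mxE.
rewrite -[(c *: _) _ _]/(c *: coind_delta _ _ _ _ _) /coind_delta addn0 eqxx /= mxE eqxx /=.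
have /negPf -> : (0 != m./2)%N by lia.
by rewrite scaler0 mxE addr0.
Qed.

Lemma ract_zero G : act 0 G = 0.
Proof. by apply: (addrI (act 0 G)); rewrite -(raD RA) !addr0. Qed.

Lemma act_sum_single h F j : (forall j' : 'I_d, act h F 0%N 0%N 0 j' = (j' == j)%:R) ->
  \sum_i act (if i == j then h else 0) F 0%N 0%N 0 i = 1.
Proof.
move=> hF; rewrite (bigD1 j) //= eqxx hF eqxx big1 ?addr0 // => i /negPf ij.
by rewrite ij ract_zero -[(0 : N) _ _]/(0 : 'rV_d) mxE.
Qed.

End DeltaFunctional.
Arguments coind_delta {C d}.

Section Nonvanishing.
Variables (C : numFieldType) (m : nat) (gT : finGroupType) (s t : gT) (zeta : C).
Variable D : cherednik_data C gT.
Hypothesis DP : dihedral_setup m s t zeta D.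
Variables (d : nat) (lam : gT -> 'M[C]_d).
Hypothesis lam1 : lam 1%g = 1%:M.
Hypothesis lamM : forall g g', lam (g * g')%g = lam g *m lam g'.

Let HcA := HcA D.
Let N : lmodType C := coind 'rV[C]_d.
Let wB := dual_w lam.
Let yB := @dual_y C d.

Let wB_lin g : lin_map (wB g).
Proof. by move=> a x y; rewrite /wB /dual_w mulmxDl scalemxAl. Qed.
Let yB_lin i : lin_map (yB i).
Proof. by move=> a x y; rewrite /yB /dual_y scaler0 addr0. Qed.
Let wB1 x : wB 1%g x = x.
Proof. by rewrite /wB /dual_w lam1 mulmx1. Qed.
Let wBM g g' x : wB (g * g')%g x = wB g' (wB g x).
Proof. by rewrite /wB /dual_w lamM mulmxA. Qed.
Let yBC i j x : yB i (yB j x) = yB j (yB i x).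
Proof. by []. Qed.
Let ywB g j x : yB j (wB g x) = \sum_i (idfun : {rmorphism C -> C}) (hrep D g i j) *: wB g (yB i x).
Proof. by rewrite big1 // => i _; rewrite /wB /dual_w /yB /dual_y mul0mx scaler0. Qed.

Let act : Hc D -> N -> N := @coind_act C gT D C idfun 0 'rV[C]_d wB yB.
Let act_right : right_action wB yB HcA act :=
  coind_right_action DP 0 wB_lin yB_lin wB1 wBM yBC ywB.

(** The vector pairs to 1 with [coind_delta a0 b0 j]. *)
Lemma baby_verma_neq0 (h : Hc D) a0 b0 j : (a0 < m)%N -> (b0 < m)%N -> (a0 == 0%N) || (b0 == 0%N) ->
  (forall j' : 'I_d, act h (coind_delta a0 b0 j) 0%N 0%N 0 j' = (j' == j)%:R) ->
  @Hbar_pi C gT D h *: verma_top (balanced_rel (D := D) lam) j <> 0.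
Proof.
move=> am bm ab hF E.
have S_ann h' : ideal_gen (invariants_plus (D := D)) h' -> ann_ideal m HcA act h'.
  have [I1 I2 I3 I4] := ann_ideal_basic DP act_right.
  exact: (invariants_plus_sub DP (ann_two_sided DP act_right) I1 I2 I3 I4).
have bal x : balanced_rel lam x ->
  (exists a w v, x = row_tens (cher_alg_quot HcA (invariants_plus (D := D))) (a * ww (HbA D) w) v -
     row_tens (HbA D) a (lam w *m v)) \/
  (exists a q v, x = row_tens (cher_alg_quot HcA (invariants_plus (D := D))) (a * @Hbar_y C gT D q) v -
     row_tens (HbA D) a (const_term q *: v)).
  by case=> [a w v|a q v]; [left; exists a, w, v|right; exists a, q, v].
have H := verma_detect DP act_right S_ann (@Hbar_y_sum C gT D) bal
  (h := fun i => if i == j then h else 0) (coind_delta_sub (m_ge5 DP) act_right j am bm ab).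
have feed (P1 P2 P3 : Prop) : (P1 -> P2) -> P1 -> (P2 -> P3) -> P3 by move=> P12 p1; apply; apply: P12.
apply: (feed _ _ _ H) => [|K].
  rewrite (bigD1 j) //= eqxx big1 ?addr0 => [|i /negPf ->]; first exact: E.
  by rewrite rmorph0 scale0r.
by have /eqP := etrans (esym (act_sum_single act_right hF)) K; rewrite oner_eq0.
Qed.

Lemma baby_verma_x_neq0 i j : xx (HbA D) i *: verma_top (balanced_rel (D := D) lam) j <> 0.
Proof.
have m5 := m_ge5 DP.
apply: (@baby_verma_neq0 (xx HcA i) (i == 0) (i != 0)) => [|||j'].
- by case: (i == 0); lia.
- by case: (i == 0); lia.
- by case: (i == 0).
exact: (act_delta_x act_right).
Qed.

Lemma baby_verma_xh_neq0 j c (V := verma_top (balanced_rel (D := D) lam) j) :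
  xx (HbA D) 0 ^+ m./2 *: V + sc (HbA D) c *: (xx (HbA D) 1 ^+ m./2 *: V) <> 0.
Proof.
have m5 := m_ge5 DP.
pose h := xx HcA 0 ^+ m./2 + sc HcA c * xx HcA 1 ^+ m./2.
have -> : xx (HbA D) 0 ^+ m./2 *: V + sc (HbA D) c *: (xx (HbA D) 1 ^+ m./2 *: V) = @Hbar_pi C gT D h *: V.
  pose pb : {rmorphism Hc D -> Hbar D} := @rq_pi (Hc D) (@invariants_plus C gT D).
  have -> : @Hbar_pi C gT D h = pb (xx HcA 0) ^+ m./2 + pb (sc HcA c) * pb (xx HcA 1) ^+ m./2.
    apply: etrans (rmorphD pb _ _) _; congr (_ + _); first exact: (rmorphXn pb).
    by apply: etrans (rmorphM pb _ _) _; congr (_ * _); exact: (rmorphXn pb).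
  by rewrite scalerDl scalerA.
apply: (@baby_verma_neq0 h m./2 0) => [|||j'].
- by lia.
- by lia.
- by rewrite orbT.
exact: (act_delta_xh m5 act_right).
Qed.

End Nonvanishing.

(** * The three conditions on labels *)

Lemma quadratic_commutator (C : numFieldType) (m : nat) (gT : finGroupType) (s t : gT) (zeta : C)
    (D : cherednik_data C gT) (K : comNzRingType) (iota : {rmorphism C -> K}) (u : K)
    (A : pzRingType) (HA : cher_alg D iota u A) : dihedral_setup m s t zeta D ->
  yy HA 0 * yy HA 1 * (xx HA 0 * xx HA 1) - xx HA 0 * xx HA 1 * (yy HA 0 * yy HA 1) =
  sc HA u * (xx HA 0 * yy HA 0 + yy HA 1 * xx HA 1).
Proof.
move=> DP; rewrite [X in X - _]mulrA (y0y1_x0 DP) mulrDl -[xx HA 0 * _ * _]mulrA (y0y1_x1 DP).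
rewrite [xx HA 0 * (_ + _)]mulrDr [xx HA 0 * (xx HA 1 * _)]mulrA.
have E (P a b : A) : P + a + b - P = a + b by rewrite addrAC [P + a]addrC addrK.
rewrite E mulrDr.
by rewrite [xx HA 0 * (sc HA u * _)]mulrA -(scC HA) !mulrA.
Qed.

Lemma rmorph_euler (C : numFieldType) (m : nat) (gT : finGroupType) (s t : gT)
    (D : cherednik_data C gT) (A : pzRingType) (HA : cher_alg D (idfun : {rmorphism C -> C}) 0 A)
    (Q : pzRingType) (HQ : cher_alg D (idfun : {rmorphism C -> C}) 0 Q) (pb : {rmorphism A -> Q}) :
  (forall c, pb (sc HA c) = sc HQ c) -> (forall i, pb (xx HA i) = xx HQ i) ->
  (forall i, pb (yy HA i) = yy HQ i) -> (forall g, pb (ww HA g) = ww HQ g) ->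
  pb (euler m s t HA) = euler m s t HQ.
Proof.
move=> pk px py pw; rewrite /euler rmorphB rmorphD !rmorphM !px !py; congr (_ - _).
by rewrite rmorph_sum; apply: eq_bigr => l _; rewrite rmorphM pk pw.
Qed.

Section Concretize.
Variables (C : numFieldType) (m : nat) (gT : finGroupType) (s t : gT) (zeta : C).
Variable D : cherednik_data C gT.
Hypothesis DP : dihedral_setup m s t zeta D.
Variable V : forall l, mx_representation C [set: gT]%SET (irr_deg l).
Hypothesis V_st : forall l, Irr m l -> V l s = irr_s C l /\ V l t = irr_t zeta l.

Let r := (s * t)%g.
Local Notation S := (csum m s t D).
Let HbA := HbA D.
Let HcA := HcA D.
Let RA := HbA_restricted DP.
Let Dl l : lmodType (Hbar D) := baby_verma D (V l).
Let T l : 'I_(irr_deg l) -> Dl l := @verma_top _ _ (balanced_rel (D := D) (V l)).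
Arguments T : clear implicits.

Let V1 l : V l 1%g = 1%:M.
Proof. exact: repr_mx1. Qed.
Let VM l g g' : V l (g * g')%g = V l g *m V l g'.
Proof. by apply: repr_mxM; rewrite finset.in_setT. Qed.
Let Vs l : Irr m l -> V l s = irr_s C l.
Proof. by case/V_st. Qed.
Let Vt l : Irr m l -> V l t = irr_t zeta l.
Proof. by case/V_st. Qed.

(** For [Phi i] the matrices of 1 and [r] span the diagonal ones, since [zeta^i != zeta^-i], and
    those of [s] and [r s] span the antidiagonal ones. *)
Lemma repr_full l : Irr m l -> spans_mx (V l).
Proof.
move=> Il.
have add B B' : (exists co : gT -> C, B = \sum_g co g *: V l g) ->
    (exists co : gT -> C, B' = \sum_g co g *: V l g) -> exists co : gT -> C, B + B' = \sum_g co g *: V l g.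
  move=> [co ->] [co' ->]; exists (fun g => co g + co' g); rewrite -big_split.
  by apply: eq_bigr => g _; rewrite scalerDl.
have one c g : exists co : gT -> C, c *: V l g = \sum_g co g *: V l g.
  exists (fun h => if h == g then c else 0); rewrite (bigD1 g) //= eqxx big1 ?addr0 // => h /negPf ->.
  by rewrite scale0r.
case: (irr_cases Il) => [[e [f [lE _]]]|[i Hi lE]] B; subst l.
  have [c ->] : exists c, B = c *: 1%:M.
    move: B {add one}; case: e f Il => -[] _ B; exists (B 0 0); apply/matrixP => p q;
      by rewrite !mxE (ord1 p) (ord1 q) eqxx mulr1.
  by rewrite -V1; apply: one.
change 'M[C]_2 in B; pose z := zeta ^+ i.
have z0 : z != 0 := zetaX_neq0 DP i.
have zz : z - z^-1 != 0.
  rewrite subr_eq0; apply/eqP => zz; have [i0 im] := andP Hi.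
  have : ~~ (m %| i.*2)%N by apply: ndvd_small; rewrite double_gt0 i0 -nPhi_double // (m_ge5 DP).
  by move=> /(zetaX_neq1 DP); rewrite -muln2 exprM expr2 -/z {1}zz mulVf // eqxx.
(* Solves [a + b z = B 0 0] and [a + b z^-1 = B 1 1]; the next line does the same for the
   antidiagonal entries. *)
pose b := (B 0 0 - B 1 1) / (z - z^-1); pose a := B 0 0 - b * z.
pose dd := (B 0 1 - B 1 0) / (z - z^-1); pose c := B 0 1 - dd * z.
have -> : B = a *: V (Phi i) 1%g + b *: V (Phi i) r + (c *: V (Phi i) s + dd *: V (Phi i) (r * s)%g).
  have e11 : B 1 1 = a + b * z^-1 by rewrite /a /b; field; rewrite z0 -expr2 /=; move: zz; rewrite -(mulIr_eq0 _ (mulIf z0)) mulrBl mulVf // expr2.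
  have e10 : B 1 0 = c + dd * z^-1 by rewrite /c /dd; field; rewrite z0 -expr2 /=; move: zz; rewrite -(mulIr_eq0 _ (mulIf z0)) mulrBl mulVf // expr2.
  rewrite V1 /r (lam_phi_r VM Vs Vt Hi) (VM _ _ s) (lam_phi_r VM Vs Vt Hi) Vs //.
  apply/matrixP => p q; rewrite !mxE sum_I2 !mxE; elim/I2_case: p; elim/I2_case: q;
    rewrite /= !(mulr0n, mulr1n, mulr0, mulr1, mul0r, addr0, add0r) -/z.
  - by rewrite /a subrK.
  - by rewrite /c subrK.
  - exact: e10.
  - exact: e11.
by apply: (add); apply: (add); apply: (one).
Qed.

Let T_x l i j : xx HbA i *: T l j <> 0.
Proof. exact: (baby_verma_x_neq0 DP (@V1 l) (@VM l)). Qed.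
Let T_xh l j c : xx HbA 0 ^+ m./2 *: T l j + sc HbA c *: (xx HbA 1 ^+ m./2 *: T l j) <> 0.
Proof. exact: (baby_verma_xh_neq0 DP (@V1 l) (@VM l)). Qed.

Let T_verma l : Irr m l -> is_verma HbA (V l) (T l).
Proof.
move=> Il; apply: baby_verma_is_verma.
have d0 : (0 < irr_deg l)%N by case: (l).
by exists (Ordinal d0) => E; apply: (@T_x l 0 (Ordinal d0)); rewrite /T E scaler0.
Qed.

Local Notation chi := (euler_char m s t D).

Lemma cm_equivP l l' : Irr m l -> Irr m l' -> cm_equiv D V l l' <-> chi l' = chi l.
Proof.
move=> Il Il'.
exact: (same_block_euler DP RA V1 VM Vs Vt repr_full T_verma (fun l i j _ => @T_x l i j)
  (fun l j c _ _ => @T_xh l j c) Il Il').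
Qed.

Lemma rigid_irrP l : Irr m l -> rigid D (V l) <-> rigid_cond m s t D l.
Proof. by move=> Il; exact: (rigidP DP RA VM Vs Vt repr_full T_verma Il). Qed.

Let linkedP l l' : Irr m l -> Irr m l' -> chi l = chi l' -> linked HbA Dl l l'.
Proof.
exact: (linked_euler DP RA V1 VM Vs Vt repr_full T_verma (fun l i j _ => @T_x l i j)
  (fun l j c _ _ => @T_xh l j c)).
Qed.

Let actsP l z : acts HbA (Dl l) z 0 <-> forall v : mod_head (Dl l), z *: v = 0.
Proof. by split=> H v; rewrite H rmorph0 scale0r. Qed.

Let pb : {rmorphism Hc D -> Hbar D} := @rq_pi (Hc D) (@invariants_plus C gT D).

Lemma pb_center z : ring_center z -> ring_center (pb z).
Proof.
move=> zC a; have [b ->] := rq_pi_surj a; rewrite -/(pb b).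
by apply: etrans (esym (rmorphM pb z b)) _; rewrite zC; exact: (rmorphM pb b z).
Qed.

Lemma annihilatorE l z : annihilator (D := D) (V l) z <-> ring_center z /\ acts HbA (Dl l) (pb z) 0.
Proof.
split=> -[zC H]; split; try exact: zC.
  exact: ((actsP l (pb z)).2 H).
exact: ((actsP l (pb z)).1 H).
Qed.

Lemma annihilator_linked l l' : Irr m l -> Irr m l' -> chi l = chi l' ->
  annihilator (D := D) (V l) = annihilator (D := D) (V l').
Proof.
move=> Il Il' E; apply/seteqP; split=> z /annihilatorE[zC H]; apply/annihilatorE; (split; first exact: zC).
  exact: ((linkedP Il Il' E 0 (pb_center zC)).1 H).
exact: ((linkedP Il' Il (esym E) 0 (pb_center zC)).1 H).
Qed.

Let pb_sc c : pb (sc HcA c) = sc HbA c. Proof. by []. Qed.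
Let pb_x i : pb (xx HcA i) = xx HbA i. Proof. by []. Qed.
Let pb_y i : pb (yy HcA i) = yy HbA i. Proof. by []. Qed.
Let pb_w g : pb (ww HcA g) = ww HbA g. Proof. by []. Qed.

Lemma annihilator_euler l : Irr m l -> annihilator (D := D) (V l) (euler m s t HcA) -> chi l = 0.
Proof.
move=> Il /annihilatorE[_]; rewrite (rmorph_euler m s t pb_sc pb_x pb_y pb_w) => H.
exact: (acts_inj DP RA repr_full T_verma Il (acts_euler DP RA VM Vs Vt repr_full T_verma Il) H).
Qed.

Section Poisson.
Variable ev : {rmorphism Hu D -> Hc D}.
Hypothesis evE : forall f, ev (@Hu_pi C gT D f) = @Hc_pi C gT D (@eval_u0 C gT f).

Lemma liftsE h z : lifts h z <-> ev h = z.
Proof.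
split=> [[f -> ->]|<-]; first exact: evE.
have [f hE] : exists f, h = @Hu_pi C gT D f by exact: rq_pi_surj.
by exists f; rewrite // hE evE.
Qed.

Lemma poisson_euler l : Irr m l -> poisson_ideal (annihilator (D := D) (V l)) -> chi l = 0.
Proof.
move=> Il [_ _ _ _ PB]; apply: (annihilator_euler Il).
have [x01 _ y01 _] := RA.
have Iy : annihilator (D := D) (V l) (yy HcA 0 * yy HcA 1).
  apply/annihilatorE; split; first exact: (yy_center DP HcA).
  have E : pb (yy HcA 0 * yy HcA 1) = 0 by apply: etrans (rmorphM pb _ _) _; exact: y01.
  by move=> v; rewrite E rmorph0 !scale0r.
have Cx := xx_center DP HcA.
have EE : euler m s t HcA = xx HcA 0 * yy HcA 0 + yy HcA 1 * xx HcA 1.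
  by rewrite (y1x1_0 DP) addrA.
have Eev : ev (xx (HuA D) 0 * yy (HuA D) 0 + yy (HuA D) 1 * xx (HuA D) 1) = euler m s t HcA.
  by rewrite EE rmorphD !rmorphM !(ev_xx evE) !(ev_yy evE).
apply: (PB _ _ _ Iy Cx).
exists (yy (HuA D) 0 * yy (HuA D) 1), (xx (HuA D) 0 * xx (HuA D) 1),
  (xx (HuA D) 0 * yy (HuA D) 0 + yy (HuA D) 1 * xx (HuA D) 1); split.
- by apply/liftsE; rewrite rmorphM !(ev_yy evE).
- by apply/liftsE; rewrite rmorphM !(ev_xx evE).
- exact/liftsE.
exact: (quadratic_commutator (HuA D) DP).
Qed.

Lemma bracket_euler0 l z1 z2 z : Irr m l -> chi l = 0 ->
  annihilator (D := D) (V l) z1 -> ring_center z2 -> poisson_bracket z1 z2 z ->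
  annihilator (D := D) (V l) z.
Proof.
move=> Il l0 /annihilatorE[z1C z1l] z2C [h1 [h2 [h [/liftsE e1 /liftsE e2 /liftsE e3 H]]]].
have XC : ring_center (sc (HuA D) 'X) by move=> a; exact: (scC (HuA D)).
have h2C : ring_center (ev h2) by rewrite e2.
have [d dP dE] := derivation_exists (ev_surj evE) (ev_ker evE) XC (Hu_torsion_free DP) h2C.
have dz : d z1 = z by rewrite -e1 -e3; exact: dE.
have zC : ring_center z by rewrite -dz; apply: derivation_center.
apply/annihilatorE; split; first exact: zC.
have [c zc] := center_char DP RA repr_full T_verma Il (pb_center zC).
suff c0 : c = 0 by rewrite -[X in acts _ _ _ X]c0.
(* The central element [z] acts by the same scalar [c] on all heads with Euler scalar zero, so it
   suffices that [z] kills one non-zero vector in one of them. *)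
have conclude l' (f0 : mod_head (Dl l')) : Irr m l' -> chi l' = 0 -> f0 <> 0 ->
    pb (d z1) *: f0 = 0 -> c = 0.
  move=> Il' l'0 f00 E; have zc' := (linkedP Il Il' (etrans l0 (esym l'0)) c (pb_center zC)).1 zc.
  apply/eqP; apply: contrapT => /negP cn; apply: f00; apply: (k_eq0 (HA := HbA) cn).
  by rewrite -zc' -dz.
have kill l' : Irr m l' -> chi l' = 0 -> forall v : mod_head (Dl l'), pb z1 *: v = 0.
  move=> Il' l'0; apply: ((actsP l' (pb z1)).1).
  exact: ((linkedP Il Il' (etrans l0 (esym l'0)) 0 (pb_center z1C)).1 z1l).
have [S1|S1] := eqVneq (S 1) 0.
  have IT : Irr m Triv by [].
  have chi0 : chi Triv = 0 by rewrite /= S1 oppr0.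
  have [wf sf f00 span] := head_triv DP RA VM Vs Vt repr_full T_verma S1.
  have [E [i [p EP]]] := extension_exists pb dP (mod_head (Dl Triv)).
  have K := poisson_triv DP pb_sc pb_w EP wf sf f00 span (kill Triv IT chi0).
  exact: (conclude Triv _ IT chi0 f00 K).
have H1 : Irr m (Phi 1) by rewrite /Irr /= nPhi_double ?(m_ge5 DP) //; have := m_ge5 DP; lia.
have chi1 : chi (Phi 1) = 0 by [].
have [SH x03 span f00] := head_phi1 DP RA V1 VM Vs Vt repr_full T_verma.
have [E [i [p EP]]] := extension_exists pb dP (mod_head (Dl (Phi 1))).
have K := poisson_phi1 DP pb_sc pb_x pb_y pb_w EP SH span S1 f00 (kill (Phi 1) H1 chi1).
exact: (conclude (Phi 1) _ H1 chi1 f00 K).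
Qed.

Lemma annihilator_poisson l : Irr m l -> chi l = 0 -> poisson_ideal (annihilator (D := D) (V l)).
Proof.
move=> Il l0; split.
- by move=> z [].
- apply/annihilatorE; split; first by move=> a; rewrite mul0r mulr0.
  by move=> v; rewrite rmorph0 rmorph0 !scale0r.
- move=> z z' [zC Hz] [zC' Hz']; split; first exact: center_sub.
  by move=> v; rewrite -[Hbar_pi _]/(pb _) rmorphB scalerBl Hz Hz' subrr.
- move=> z z' zC [zC' Hz']; split; first exact: center_mul.
  by move=> v; rewrite -[Hbar_pi _]/(pb _) rmorphM -scalerA Hz' scaler0.
- by move=> z1 z2 z; apply: bracket_euler0.
Qed.

End Poisson.

Lemma poissonP l : Irr m l -> poisson_ideal (annihilator (D := D) (V l)) <-> chi l = 0.
Proof.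
have [ev evE] := specialization_exists D.
by move=> Il; split; [exact: (poisson_euler evE)|exact: (annihilator_poisson evE)].
Qed.

End Concretize.

(** * The families *)

Definition is_phi (l : irr_label) : bool := if l is Phi _ then true else false.

Lemma FsetE m l : Irr m l -> Fset m l = is_phi l.
Proof.
move=> Il; apply/propext; split=> [[i _ <-] //|].
by case: l Il => // i Hi _; exists i.
Qed.

Lemma RsetE m l : Irr m l -> Rset m l = (is_phi l /\ l <> Phi 1 /\ (~~ odd m -> l <> Phi (nPhi m))).
Proof.
move=> Il; apply/propext; rewrite /Rset /nPhi; case: (odd m); split.
- by move=> [H1 H2]; rewrite -(FsetE Il).
- by move=> [H1 [H2 _]]; split; rewrite ?(FsetE Il).
- move=> [H1 H2]; rewrite -(FsetE Il); split=> //.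
  by split=> [E|_ E]; apply: H2; rewrite E /=; tauto.
- by move=> [H1 [H2 H3]]; split; [by rewrite (FsetE Il)|by move=> [E|E]; [exact: H2|exact: (H3 isT)]].
Qed.

Section Families.
Variables (C : numFieldType) (m : nat) (gT : finGroupType) (s t : gT) (zeta : C).
Variable D : cherednik_data C gT.
Hypothesis DP : dihedral_setup m s t zeta D.
Variable V : forall l, mx_representation C [set: gT]%SET (irr_deg l).
Hypothesis V_st : forall l, Irr m l -> V l s = irr_s C l /\ V l t = irr_t zeta l.

Local Notation S := (csum m s t D).
Local Notation chi := (euler_char m s t D).

Lemma Irr_phi1 : Irr m (Phi 1).
Proof. by rewrite /Irr /= nPhi_double ?(m_ge5 DP) //; have := m_ge5 DP; lia. Qed.

Variables (code : irr_label -> nat) (vals : seq C).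
Hypotheses (vals_uniq : uniq vals) (codeP : forall l, Irr m l ->
  (code l < size vals)%N /\ chi l = vals`_(code l)).

Let fam c : set irr_label := [set l | Irr m l /\ code l = c].

Lemma chi_code l l' : Irr m l -> Irr m l' -> chi l = chi l' <-> code l = code l'.
Proof.
move=> /codeP[s1 ->] /codeP[s2 ->]; split=> [/eqP|->//].
by rewrite nth_uniq // => /eqP.
Qed.

Lemma cm_familiesE : cm_families D m V = [set fam (code l) | l in Irr m].
Proof.
have E l : Irr m l -> [set l' | Irr m l' /\ cm_equiv D V l l'] = fam (code l).
  move=> Il; apply/seteqP; split=> l' [Il' H]; split=> //.
    by apply/chi_code => //; apply/(cm_equivP DP V_st).
  by apply/(cm_equivP DP V_st) => //; apply/chi_code.
by apply/seteqP; split=> _ [l Il <-]; exists l; rewrite // E.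
Qed.

Lemma cuspidal_familiesE : cuspidal_families D m V = [set fam (code (Phi 1))].
Proof.
have I1 := Irr_phi1; apply/seteqP; split=> X.
  rewrite /cuspidal_families /= cm_familiesE => -[[l Il <-] [I HI PI]].
  congr fam; apply/chi_code => //; rewrite [RHS]/=; apply/(poissonP DP V_st Il).
  by rewrite HI.
move=> ->; split; first by rewrite cm_familiesE; exists (Phi 1).
exists (annihilator (D := D) (V (Phi 1))); last by apply/(poissonP DP V_st I1).
by move=> l [Il cl]; apply: (annihilator_linked DP V_st) => //; apply/chi_code.
Qed.

Lemma rigid_irrE : rigid_irr D m V = [set l | Irr m l /\ rigid_cond m s t D l].
Proof.
by apply/seteqP; split=> l [Il H]; split=> //; apply/(rigid_irrP DP V_st Il).
Qed.

(** [vals] lists the distinct Euler scalars, [code] gives the position of the scalar of a label, and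
    [Xs] lists the families in the same order. The cuspidal one is the class of [Phi 1], whose
    scalar is 0. *)
Lemma families_code (Fs : set (set irr_label)) (Rs : set irr_label) (Xs : seq (set irr_label)) :

  Fs = [set X | exists2 k, (k < size vals)%N & X = nth set0 Xs k] ->
  (forall k, (k < size vals)%N -> exists2 l, Irr m l & code l = k) ->
  (forall k l, (k < size vals)%N -> Irr m l -> nth set0 Xs k l <-> code l = k) ->
  (forall l, Irr m l -> Rs l <-> rigid_cond m s t D l) ->
  families_are D m V Fs Rs [set nth set0 Xs (code (Phi 1))].
Proof.
move=> -> ne XE RsE.
have listedE k : (k < size vals)%N -> listed m (nth set0 Xs k) = fam k.
  move=> kn; apply/seteqP; split=> l [H1 H2]; split=> //; first by apply/(XE k).
  by apply/(XE k).
have [c1 _] := codeP Irr_phi1.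
split.
- rewrite cm_familiesE; apply/seteqP; split=> [_ [l Il <-]|_ [_ [k kn ->] <-]].
    have [cl _] := codeP Il.
    by exists (nth set0 Xs (code l)); rewrite ?listedE //; exists (code l).
  by have [l Il <-] := ne k kn; exists l; rewrite // listedE //; have [] := codeP Il.
- rewrite rigid_irrE; apply/seteqP; split=> l [H1 H2]; split=> //; first by apply/RsE.
  by apply/RsE.
rewrite cuspidal_familiesE -listedE //; apply/seteqP; split=> [X ->|_ [X -> <-]] //.
by exists (nth set0 Xs (code (Phi 1))).
Qed.

End Families.

(** Root and coroot are each fixed only up to a scalar by their lines; the pairing 2 normalizes
    their product, and only products of entries occur. *)
Lemma reflection_entries (C : numFieldType) (k : C) (v : 'rV[C]_2) (w : 'cV[C]_2) (i j : 'I_2) :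
  k != 0 -> (v <= antidiag k k^-1 - 1%:M)%MS -> (w^T <= (antidiag k k^-1 - 1%:M)^T)%MS ->
  v *m w = 2%:R%:M -> v 0 i * w j 0 = (i == j)%:R - antidiag k k^-1 j i.
Proof.
move=> k0 /submxP[B vE] /submxP[B' wE] /matrixP/(_ 0 0).
have v1 : v 0 1 = - k * v 0 0.
  by rewrite vE !mxE !sum_I2 !mxE /= !(mulr0n, mulr1n); field.
have w1 : w 1 0 = - k^-1 * w 0 0.
  have [-> ->] : w 1 0 = w^T 0 1 /\ w 0 0 = w^T 0 0 by rewrite !mxE.
  by rewrite wE !mxE !sum_I2 !mxE /= !(mulr0n, mulr1n); field.
rewrite !mxE sum_I2 v1 w1 eqxx mulr1n => vw2.
have vw : v 0 0 * w 0 0 = 1.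
  by apply: (mulfI (x := 2)); rewrite ?pnatr_eq0 // mulr1 -[RHS]vw2; field.
elim/I2_case: i; elim/I2_case: j; rewrite /= ?subr0 ?sub0r ?v1 ?w1.
- exact: vw.
- by rewrite mulrCA vw mulr1.
- by rewrite -mulrA vw mulr1.
by rewrite mulrACA vw mulr1 mulrNN mulfV.
Qed.

Lemma dihedral_setup_of (C : numFieldType) (m : nat) (gT : finGroupType) (s t : gT) (zeta : C)
    (h : mx_representation C [set: gT]%SET 2) (alpha : gT -> 'rV[C]_2) (alphav : gT -> 'cV[C]_2)
    (c : gT -> C) :
  let D := CherednikData h (dihedral_refl m s t) alpha alphav c in
  (5 <= m)%N -> dihedral_presentation m s t -> m.-primitive_root zeta ->
  h s = antidiag 1 1 -> h t = antidiag zeta^-1 zeta -> root_data D -> invariant_param D ->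
  dihedral_setup m s t zeta D.
Proof.
move=> D m5 [s2 t2 stm st_gen _] zP hs ht rD cJ.
have z0 : zeta != 0.
  apply/eqP=> z0; have := prim_expr_order zP.
  by rewrite z0 expr0n gtn_eqF ?(leq_trans _ m5) //= => /eqP; rewrite eq_sym oner_eq0.
have h1 : h 1%g = 1%:M by exact: repr_mx1.
have hM g g' : h (g * g')%g = h g *m h g' by apply: repr_mxM; rewrite finset.in_setT.
have hrefl l : exists2 k, k != 0 & h ((s * t) ^+ l * s)%g = antidiag k k^-1.
  elim: l => [|l [k k0 IH]].
    by exists 1; rewrite ?oner_eq0 // expg0 mul1g hs invr1.
  exists (zeta * k); first by rewrite mulf_neq0.
  rewrite expgS -mulgA hM IH hM hs ht; apply/matrixP => i j.
  by rewrite !mxE !sum_I2 !mxE; elim/I2_case: i; elim/I2_case: j; rewrite /= ?sum_I2 ?mxE /=; field; rewrite ?z0 ?k0.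
split=> //; try by rewrite -expg2.
move=> w wR i j; have [/andP[a1 _] /andP[a2 _] a3] := rD w wR.
have /imsetP[l _ wE] := wR; have [k k0 hk] := hrefl l; rewrite -wE in hk.
(* A reflection is an involution, so the root condition, which is stated for [w^-1], concerns the
   same matrix as the coroot condition. *)
have hV : h w^-1%g = antidiag k k^-1.
  have hh : antidiag k k^-1 *m antidiag k k^-1 = 1%:M.
    apply/matrixP => p q; rewrite !mxE !sum_I2 !mxE; elim/I2_case: p; elim/I2_case: q;
      by rewrite /= !(mul0r, mulr0, addr0, add0r) ?mulfV ?mulVf.
  by rewrite -[LHS]mulmx1 -hh mulmxA -{1}hk -hM mulVg h1 mul1mx.
rewrite -[hrep D w]/(h w) hk; apply: (reflection_entries _ _ k0 _ _ a3).
  by rewrite -hV.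
by rewrite -hk.
Qed.

Lemma uniq_opp (C : numDomainType) (p : C) : p != 0 -> uniq [:: 0; - p; p].
Proof. by move=> p0; rewrite /= !inE eqNr !(eq_sym 0) oppr_eq0 (negPf p0). Qed.

Lemma uniq_opp2 (C : numDomainType) (p q : C) :
  p != 0 -> q != 0 -> p != q -> p != - q -> uniq [:: 0; - p; p; - q; q].
Proof.
move=> p0 q0 pq pNq; rewrite /= !inE !eqNr eqr_opp !(eq_sym 0) !oppr_eq0 eqr_oppLR.
by rewrite (negPf p0) (negPf q0) (negPf pq) (negPf pNq).
Qed.

Section ParamSums.
Variables (C : numFieldType) (m : nat) (gT : finGroupType) (s t : gT) (zeta : C).
Variable D : cherednik_data C gT.
Hypothesis DP : dihedral_setup m s t zeta D.

Lemma nPhi_neq1 : nPhi m <> 1%N.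
Proof. by move=> E; have := nPhi_double 2 (m_ge5 DP); rewrite E (m_ge5 DP). Qed.

Lemma csum_half_neq0 : ~~ odd m -> (m./2%:R : C) != 0.
Proof. by move=> em; rewrite pnatr_eq0 -lt0n half_gt0 (leq_trans _ (m_ge5 DP)). Qed.

Lemma csum1_even : ~~ odd m -> csum m s t D 1 = (param D s + param D t) * m./2%:R.
Proof. by move=> em; rewrite -[1](expr0 (-1)) (csum_even DP false em) mul1r mulr_natr. Qed.

Lemma csumN1_even : ~~ odd m -> csum m s t D (-1) = (param D s - param D t) * m./2%:R.
Proof. by move=> em; rewrite -{1}[-1]expr1 (csum_even DP true em) mulN1r mulr_natr. Qed.

Lemma csum1_neq0 : param D s <> 0 -> param D s + param D t <> 0 -> csum m s t D 1 <> 0.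
Proof.
move=> b0 ab; have [om|em] := boolP (odd m).
  rewrite (csum1_odd DP om) -mulr_natr => /eqP; rewrite mulf_eq0 pnatr_eq0 => /orP[/eqP //|].
  by have := m_ge5 DP; case: (m).
rewrite csum1_even // => /eqP; rewrite mulf_eq0 (negPf (csum_half_neq0 em)) orbF.
by move/eqP.
Qed.

Lemma rigid_condE l : Irr m l -> rigid_cond m s t D l <->
  [\/ Rset m l, csum m s t D 1 = 0 /\ [set Triv; Sgn; Phi 1] l |
      csum m s t D (-1) = 0 /\ ~~ odd m /\ [set Eps1; Eps2; Phi (nPhi m)] l].
Proof.
move=> Il; rewrite (RsetE Il); have n1 := nPhi_neq1.
have PhiE i j : (Phi i = Phi j) <-> i = j by split=> [[]|->].
case: l Il => [||||i] Il; rewrite /= ?PhiE.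
- split=> [p0|]; first by apply: Or32; split; last by left; left.
  by case=> [[] //|[]//|[_ [_ [[|]|]]]].
- split=> [p0|]; first by apply: Or32; split; last by left; right.
  by case=> [[] //|[]//|[_ [_ [[|]|]]]].
- split=> [q0|]; first by apply: Or33; split; last by split=> //; left; left.
  by case=> [[] //|[_ [[|]|]]|[]].
- split=> [q0|]; first by apply: Or33; split; last by split=> //; left; right.
  by case=> [[] //|[_ [[|]|]]|[]].
case: (eqVneq i 1%N) => [->|/eqP i1].
  split=> [[/(_ erefl) p0 _]|]; first by apply: Or32; split; last by right.
  case=> [[_ [/PhiE]] //|[p0 _]|[_ [_ [[|]|/PhiE E]]]] //; last by case: n1.
  by split=> // _ /esym.
case: (eqVneq i (nPhi m)) => [E|/eqP iN].
  rewrite -E; have [om|em] := boolP (odd m).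
    by split=> // _; apply: Or31; split=> //; split=> // /PhiE.
  split=> [[_ /(_ isT erefl) q0]|]; first by apply: Or33; do 2!split=> //; right.
  by case=> [[_ [_ /(_ isT)]] //|[_ [[|]|/PhiE]]|[]].
by split=> // _; apply: Or31; split=> //; split=> [/PhiE|_ /PhiE].
Qed.

End ParamSums.

Section Cases.
Variables (C : numFieldType) (m : nat) (gT : finGroupType) (s t : gT) (zeta : C).
Variable D : cherednik_data C gT.
Hypothesis DP : dihedral_setup m s t zeta D.
Variable V : forall l, mx_representation C [set: gT]%SET (irr_deg l).
Hypothesis V_st : forall l, Irr m l -> V l s = irr_s C l /\ V l t = irr_t zeta l.

Local Notation p := (csum m s t D 1).
Local Notation q := (csum m s t D (-1)).

Let RsetP l : p <> 0 -> q <> 0 -> Irr m l -> Rset m l <-> rigid_cond m s t D l.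
Proof.
by move=> p0 q0 Il; rewrite (rigid_condE DP) //; split=> [H|[|[]|[]] //]; apply: Or31.
Qed.

Lemma families_generic : ~~ odd m -> p <> 0 -> q <> 0 -> p <> q -> p <> - q ->
  families_are D m V [set [set Triv]; [set Sgn]; [set Eps1]; [set Eps2]; Fset m] (Rset m) [set Fset m].
Proof.
move=> em p0 q0 pq pNq.
pose code l := match l with Triv => 1%N | Sgn => 2%N | Eps1 => 3%N | Eps2 => 4%N | Phi _ => 0%N end.
apply: (families_code DP V_st (code := code) (vals := [:: 0; - p; p; - q; q])
  _ _ (Xs := [:: Fset m; [set Triv]; [set Sgn]; [set Eps1]; [set Eps2]])).
- by apply: uniq_opp2; apply/eqP.
- by case.
- apply/seteqP; split=> [X [[[[->|->]|->]|->]|->]|X [[|[|[|[|[|k]]]]] //= _ ->]]; try tauto.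
  by exists 1%N. by exists 2%N. by exists 3%N. by exists 4%N. by exists 0%N.
- by move=> [|[|[|[|[|k]]]]] //= _; [exists (Phi 1); [exact: (Irr_phi1 DP)|]|exists Triv|exists Sgn|exists Eps1|exists Eps2].
- by move=> [|[|[|[|[|k]]]]] l //= _ Il; rewrite ?(FsetE Il); case: l Il => [||||i] Il; split.
- by move=> l; apply: RsetP.
Qed.

Lemma families_eq : ~~ odd m -> p <> 0 -> q = p ->
  families_are D m V [set [set Triv; Eps1]; [set Sgn; Eps2]; Fset m] (Rset m) [set Fset m].
Proof.
move=> em p0 qp.
pose code l := match l with Triv | Eps1 => 1%N | Sgn | Eps2 => 2%N | Phi _ => 0%N end.
apply: (families_code DP V_st (code := code) (vals := [:: 0; - p; p])
  _ _ (Xs := [:: Fset m; [set Triv; Eps1]; [set Sgn; Eps2]])).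
- exact/uniq_opp/eqP.
- by case=> * /=; rewrite ?qp.
- apply/seteqP; split=> [X [[->|->]|->]|X [[|[|[|k]]] //= _ ->]]; try tauto.
  by exists 1%N. by exists 2%N. by exists 0%N.
- by move=> [|[|[|k]]] //= _; [exists (Phi 1); [exact: (Irr_phi1 DP)|]|exists Triv|exists Sgn].
- move=> [|[|[|k]]] l //= _ Il; rewrite ?(FsetE Il); case: l Il => [||||i] Il; split=> //; try tauto;
    by case.
- by move=> l; apply: RsetP; rewrite ?qp.
Qed.

Lemma families_opp : ~~ odd m -> p <> 0 -> q = - p ->
  families_are D m V [set [set Triv; Eps2]; [set Sgn; Eps1]; Fset m] (Rset m) [set Fset m].
Proof.
move=> em p0 qp.
pose code l := match l with Triv | Eps2 => 1%N | Sgn | Eps1 => 2%N | Phi _ => 0%N end.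
apply: (families_code DP V_st (code := code) (vals := [:: 0; - p; p])
  _ _ (Xs := [:: Fset m; [set Triv; Eps2]; [set Sgn; Eps1]])).
- exact/uniq_opp/eqP.
- by case=> * /=; rewrite ?qp ?opprK.
- apply/seteqP; split=> [X [[->|->]|->]|X [[|[|[|k]]] //= _ ->]]; try tauto.
  by exists 1%N. by exists 2%N. by exists 0%N.
- by move=> [|[|[|k]]] //= _; [exists (Phi 1); [exact: (Irr_phi1 DP)|]|exists Triv|exists Sgn].
- move=> [|[|[|k]]] l //= _ Il; rewrite ?(FsetE Il); case: l Il => [||||i] Il; split=> //; try tauto;
    by case.
- by move=> l; apply: RsetP => //; rewrite qp => /eqP; rewrite oppr_eq0 => /eqP.
Qed.

(** The condition on [q] is imposed only for even [m], so that this also covers odd [m], where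
    [listed] discards [Eps1] and [Eps2]. *)
Lemma families_csumN1_0 : p <> 0 -> (~~ odd m -> q = 0) ->
  families_are D m V [set [set Triv]; [set Sgn]; [set Eps1; Eps2] `|` Fset m]
    ([set Eps1; Eps2; Phi (nPhi m)] `|` Rset m) [set [set Eps1; Eps2] `|` Fset m].
Proof.
move=> p0 q0; pose code l := match l with Triv => 1%N | Sgn => 2%N | _ => 0%N end.
apply: (families_code DP V_st (code := code) (vals := [:: 0; - p; p])
  _ _ (Xs := [:: [set Eps1; Eps2] `|` Fset m; [set Triv]; [set Sgn]])).
- exact/uniq_opp/eqP.
- by case=> //= em; rewrite q0 ?oppr0.
- apply/seteqP; split=> [X [[->|->]|->]|X [[|[|[|k]]] //= _ ->]]; try tauto.
  by exists 1%N. by exists 2%N. by exists 0%N.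
- by move=> [|[|[|k]]] //= _; [exists (Phi 1); [exact: (Irr_phi1 DP)|]|exists Triv|exists Sgn].
- move=> [|[|[|k]]] l //= _ Il; rewrite /setU /= ?(FsetE Il); case: l Il => [||||i] Il; split=> //; try tauto.
  - by move=> [[]|].
  - by move=> [[]|].
  by right.
move=> l Il; rewrite (rigid_condE DP) //.
split=> [[El|Rl]|[Rl|[]//|[_ [_ El]]]]; [|exact: Or31|by right|by left].
(* For odd [m] the last two-dimensional representation already belongs to [Rset m]: only [Phi 1] is
   removed there, and [nPhi m] is not 1. *)
have [om|em] := boolP (odd m); last by apply: Or33; rewrite q0.
apply: Or31; rewrite RsetE //; case: El Il => [[->|->]|->]; rewrite /Irr /= ?om // => _.
by split=> //; split=> // -[]; apply: (nPhi_neq1 DP).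
Qed.

Lemma families_csum1_0 : ~~ odd m -> p = 0 -> q <> 0 ->
  families_are D m V [set [set Eps1]; [set Eps2]; [set Triv; Sgn] `|` Fset m]
    ([set Triv; Sgn; Phi 1] `|` Rset m) [set [set Triv; Sgn] `|` Fset m].
Proof.
move=> em p0 q0; pose code l := match l with Eps1 => 1%N | Eps2 => 2%N | _ => 0%N end.
apply: (families_code DP V_st (code := code) (vals := [:: 0; - q; q])
  _ _ (Xs := [:: [set Triv; Sgn] `|` Fset m; [set Eps1]; [set Eps2]])).
- exact/uniq_opp/eqP.
- by case=> //= *; rewrite p0 ?oppr0.
- apply/seteqP; split=> [X [[->|->]|->]|X [[|[|[|k]]] //= _ ->]]; try tauto.
  by exists 1%N. by exists 2%N. by exists 0%N.
- by move=> [|[|[|k]]] //= _; [exists (Phi 1); [exact: (Irr_phi1 DP)|]|exists Eps1|exists Eps2].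
- move=> [|[|[|k]]] l //= _ Il; rewrite /setU /= ?(FsetE Il); case: l Il => [||||i] Il; split=> //; try tauto.
  - by move=> [[]|].
  - by move=> [[]|].
  by right.
move=> l Il; rewrite (rigid_condE DP) //.
by split=> [[El|Rl]|[Rl|[_ El]|[]//]]; [exact: Or32|exact: Or31|right|left].
Qed.

End Cases.

(** For even [m], [S(1) = (b + a) m/2] and [S(-1) = (b - a) m/2], so the five cases are the possible
    coincidences among 0, [S(1)], [-S(1)], [S(-1)], [-S(-1)]. For [a = 0] one has [S(-1) = S(1)] and
    [Triv] meets [Eps1], the character that agrees with it on [s]; for [b = 0] it meets [Eps2]. The
    list in words at the top has eps_1 and eps_2 interchanged in these two cases. *)
Theorem theorem8p1 (R : realType) (m : nat) (gT : finGroupType) (s t : gT)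
    (zeta : R[i])
    (V : forall l : irr_label, mx_representation R[i] [set: gT]%SET (irr_deg l))
    (alpha : gT -> 'rV[R[i]]_2) (alphav : gT -> 'cV[R[i]]_2)
    (c : gT -> R[i]) (a b : R[i]) :
  let D := CherednikData (V (Phi 1)) (dihedral_refl m s t) alpha alphav c in
  (5 <= m)%N ->
  dihedral_presentation m s t ->
  m.-primitive_root zeta ->
  (forall l, Irr m l -> V l s = irr_s R[i] l /\ V l t = irr_t zeta l) ->
  root_data D ->
  invariant_param D ->
  nonzero_param D ->
  b = c s -> a = c t ->
  [/\ a <> 0 -> b <> 0 -> a <> b -> a <> - b ->
      families_are D m V
        [set [set Triv]; [set Sgn]; [set Eps1]; [set Eps2]; Fset m]
        (Rset m)
        [set Fset m],
      a = 0 -> b <> 0 ->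
      families_are D m V
        [set [set Triv; Eps1]; [set Sgn; Eps2]; Fset m]
        (Rset m)
        [set Fset m],
      a <> 0 -> b = 0 ->
      families_are D m V
        [set [set Triv; Eps2]; [set Sgn; Eps1]; Fset m]
        (Rset m)
        [set Fset m],
      a = b -> b <> 0 ->
      families_are D m V
        [set [set Triv]; [set Sgn]; [set Eps1; Eps2] `|` Fset m]
        ([set Eps1; Eps2; Phi (nPhi m)] `|` Rset m)
        [set [set Eps1; Eps2] `|` Fset m] &
      a = - b -> b <> 0 ->
      families_are D m V
        [set [set Eps1]; [set Eps2]; [set Triv; Sgn] `|` Fset m]
        ([set Triv; Sgn; Phi 1] `|` Rset m)
        [set [set Triv; Sgn] `|` Fset m]].
Proof.
move=> D m5 WP zP V_st rD cJ _ bE aE.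
have DP : dihedral_setup m s t zeta D.
  have [|Vs Vt] := V_st (Phi 1); first by rewrite /Irr /= (nPhi_double _ m5) (leq_trans _ m5).
  by apply: dihedral_setup_of; rewrite // Vt /= expr1.
have em : a <> b -> ~~ odd m.
  by move=> ab; apply/negP => /(param_odd DP)/esym; rewrite /= -bE -aE.
have p0 : b <> 0 -> b + a <> 0 -> csum m s t D 1 <> 0 by rewrite bE aE; exact: (csum1_neq0 DP).
have half E : (m./2%:R : R[i]) != 0 := csum_half_neq0 DP E.
have pE (E : ~~ odd m) : csum m s t D 1 = (b + a) * m./2%:R by rewrite bE aE; exact: (csum1_even DP E).
have qE (E : ~~ odd m) : csum m s t D (-1) = (b - a) * m./2%:R by rewrite bE aE; exact: (csumN1_even DP E).
have q0 (E : ~~ odd m) : a <> b -> csum m s t D (-1) <> 0.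
  move=> ab; rewrite qE // => /eqP; rewrite mulf_eq0 (negPf (half E)) orbF subr_eq0.
  by move=> /eqP/esym.
split.
- move=> a0 b0 ab aNb; have E := em ab.
  apply: (families_generic DP V_st E); [|exact: q0| |].
  + by apply: p0 => // /eqP; rewrite addrC addr_eq0 => /eqP.
  + by rewrite pE // qE // => /(mulIf (half E))/addrI/esym/eqP; rewrite eqNr => /eqP.
  rewrite pE // qE // -mulNr => /(mulIf (half E)); rewrite opprB addrC => /addrI/esym/eqP.
  by rewrite eqNr => /eqP.
- move=> a0 b0; have E : ~~ odd m by apply: em => ab; rewrite -ab in b0.
  apply: (families_eq DP V_st E); first by apply: p0; rewrite // a0 addr0.
  by rewrite pE // qE // a0 addr0 subr0.
- move=> a0 b0; have E : ~~ odd m by apply: em => ab; rewrite ab in a0.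
  apply: (families_opp DP V_st E); last by rewrite pE // qE // b0 !add0r mulNr.
  by rewrite pE // b0 add0r => /eqP; rewrite mulf_eq0 (negPf (half E)) orbF => /eqP.
- move=> ab b0; apply: (families_csumN1_0 DP V_st) => [|E].
    by apply: p0 => //; rewrite ab -mulr2n => /eqP; rewrite mulrn_eq0 => /eqP.
  by rewrite qE // ab subrr mul0r.
move=> ab b0; have anb : a <> b by rewrite ab => /eqP; rewrite eqNr => /eqP.
have E := em anb; apply: (families_csum1_0 DP V_st E); last exact: q0.
by rewrite pE // ab subrr mul0r.
Qed.
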